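(* Let $\Omega$ be a bounded domain of $\mathbb{R}^d$, let $0<\theta\le1$, and suppose that $1<q\le2_\theta^*$, $q<\infty$, $u_0\in\mathcal{X}_\theta(\Omega)$ and $u_0\not\equiv0$. Let $u=u(x,t)$ be the energy solution to the Cauchy--Dirichlet problem (CD) (see context) with the initial datum $\rho_0=|u_0|^{q-2}u_0$. Then: (i) in case $1<q<2$, there exists a constant $c_1>0$ such that $$c_1(t+1)^{-1/(2-q)}\le\|u(t)\|_{L^q(\Omega)}\le c_1^{-1}(t+1)^{-1/(2-q)}\quad\text{for } t\ge0;$$ (ii) in case $2<q\le2_\theta^*$, there exist constants $t_*>0$ and $c_2>0$ such that $$c_2(t_*-t)_+^{1/(q-2)}\le\|u(t)\|_{L^q(\Omega)}\le c_2^{-1}(t_*-t)_+^{1/(q-2)}\quad\text{for } t\ge0,$$ where $t_*=t_*(u_0)$, called the extinction time of $u$, is uniquely determined by the initial datum $u_0$. Moreover, the estimates in (i) and (ii) also hold true (with possibly different constants $c_1,c_2$ and the same $t_*$) with the norm $\|\cdot\|_{L^q(\Omega)}$ replaced by $\|\cdot\|_{\mathcal{X}_\theta(\Omega)}$. Furthermore, in case $2<q\le2_\theta^*$, the extinction time $t_*$ satisfies $$\frac{q-1}{q-2}\,\frac{\|u_0\|_{L^q(\Omega)}^q}{\|u_0\|_{\mathcal{X}_\theta(\Omega)}^2}\le t_*(u_0)\le\frac{q-1}{q-2}\,C_q^2\,\|u_0\|_{L^q(\Omega)}^{q-2},$$ where $C_q$ is the best constant of the Sobolev--Poincaré inequality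 $\|w\|_{L^q(\Omega)}\le C_q\|w\|_{\mathcal{X}_\theta(\Omega)}$ for all $w\in\mathcal{X}_\theta(\Omega)$.
   Context: Function spaces. For $\theta\in(0,1)$, $[w]_{H^\theta(\mathbb{R}^d)}^2:=\frac12\iint_{\mathbb{R}^d\times\mathbb{R}^d}\frac{|w(x)-w(y)|^2}{|x-y|^{d+2\theta}}\,dx\,dy$, $H^\theta(\mathbb{R}^d):=\{w\in L^2(\mathbb{R}^d):[w]_{H^\theta(\mathbb{R}^d)}<\infty\}$, and $\mathcal{X}_\theta(\Omega):=\{w\in H^\theta(\mathbb{R}^d): w=0 \text{ a.e. on }\mathbb{R}^d\setminus\Omega\}$ with norm $\|w\|_{\mathcal{X}_\theta(\Omega)}:=[w]_{H^\theta(\mathbb{R}^d)}$ and the corresponding inner product $(v,w)_{\mathcal{X}_\theta(\Omega)}=\frac12\iint\frac{(v(x)-v(y))(w(x)-w(y))}{|x-y|^{d+2\theta}}\,dx\,dy$. For $\theta=1$, $\mathcal{X}_1(\Omega):=H^1_0(\Omega)$ with $(v,w)_{\mathcal{X}_1(\Omega)}=\int_\Omega\nabla v\cdot\nabla w\,dx$ and the associated norm. The dual is $\mathcal{X}_\theta(\Omega)^*$, with pairing $\langle\cdot,\cdot\rangle_{\mathcal{X}_\theta(\Omega)}$ and pivot space $L^2(\Omega)$. Functions on $\Omega$ are identified with their zero extensions. $(-\Delta)^\theta:\mathcal{X}_\theta(\Omega)\to\mathcal{X}_\theta(\Omega)^*$ is the Riesz map. $2_\theta^*:=2d/(d-2\theta)$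 if $d>2\theta$, $2_\theta^*:=\infty$ otherwise; $p':=p/(p-1)$; $(a)_+:=\max\{a,0\}$. $C_{\rm weak}(I;X)$ and $C_+(I;X)$ denote weakly continuous and strongly right-continuous $X$-valued functions on $I$. $Q_T:=\Omega\times(0,T)$; $u(t):=u(\cdot,t)$. Problem (CD): $\partial_t(|u|^{q-2}u)+(-\Delta)^\theta u=0$ in $\Omega\times(0,\infty)$, $u=0$ on $(\mathbb{R}^d\setminus\Omega)\times(0,\infty)$ (on $\partial\Omega\times(0,\infty)$ if $\theta=1$), $(|u|^{q-2}u)(\cdot,0)=\rho_0$ in $\Omega$. Weak solution on $[0,T]$, $T<\infty$: a pair $(u,\rho)$ of measurable functions on $\mathbb{R}^d\times(0,T)$ such that (1) for any $\varepsilon\in(0,T)$, $u\in L^2(\varepsilon,T;\mathcal{X}_\theta(\Omega))\cap L^q(Q_T)$, $\rho\in C([0,T];\mathcal{X}_\theta(\Omega)^* )\cap W^{1,2}(\varepsilon,T;\mathcal{X}_\theta(\Omega)^* )\cap L^{q'}(Q_T)$; (2) $\rho=|u|^{q-2}u$ a.e. in $Q_T$ and $\langle\partial_t\rho(t),w\rangle_{\mathcal{X}_\theta(\Omega)}+(u(t),w)_{\mathcal{X}_\theta(\Omega)}=0$ for all $w\in\mathcal{X}_\theta(\Omega)$ and a.e. $t\in(0,T)$; (3) $\rho(t)\to\rho_0$ strongly in $\mathcal{X}_\theta(\Omega)^*$ as $t\to0_+$. A weak solution (on $[0,\infty)$) is a weak solution on $[0,S]$ for all $0<S<\infty$; $\rho$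 is written $|u|^{q-2}u$. Energy solution: for $u_0\in\mathcal{X}_\theta(\Omega)$ (here $q\le2_\theta^*$, so $\mathcal{X}_\theta(\Omega)\hookrightarrow L^q(\Omega)$) and $\rho_0=|u_0|^{q-2}u_0$, (CD) has a unique weak solution $u$; it satisfies $u\in C_{\rm weak}([0,\infty);\mathcal{X}_\theta(\Omega))\cap C_+([0,\infty);\mathcal{X}_\theta(\Omega))\cap C([0,\infty);L^q(\Omega))\cap L^q(\Omega\times(0,\infty))$, $u(0)=u_0$, $|u|^{q-2}u\in C([0,\infty);L^{q'}(\Omega))$, $\partial_t(|u|^{q-2}u)\in C_{\rm weak}([0,\infty);\mathcal{X}_\theta(\Omega)^* )\cap C_+([0,\infty);\mathcal{X}_\theta(\Omega)^* )$, $|u|^{(q-2)/2}u\in W^{1,2}(0,\infty;L^2(\Omega))$; $t\mapsto\|u(t)\|_{L^q(\Omega)}^q$ is absolutely continuous on $[0,\infty)$ with $\frac1{q'}\frac{d}{dt}\|u(t)\|_{L^q(\Omega)}^q+\|u(t)\|_{\mathcal{X}_\theta(\Omega)}^2=0$ for a.e. $t>0$; and $\frac4{qq'}\int_s^t\|\partial_t(|u|^{(q-2)/2}u)(r)\|_{L^2(\Omega)}^2dr+\frac12\|u(t)\|_{\mathcal{X}_\theta(\Omega)}^2\le\frac12\|u(s)\|_{\mathcal{X}_\theta(\Omega)}^2$ for all $0\le s<t<\infty$. It is called the energy solution. *)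

(* Defs.v *)
From HB Require Import structures.
From mathcomp Require Import all_boot all_order all_algebra.
From mathcomp Require Import all_classical all_reals all_analysis.

Set Implicit Arguments.
Unset Strict Implicit.
Unset Printing Implicit Defensive.
Import Order.TTheory GRing.Theory Num.Theory.
Import numFieldNormedType.Exports.

Local Open Scope classical_set_scope.
Local Open Scope ring_scope.

Definition rV_display : measure_display -> measure_display.
Proof. exact. Qed.

Section measurable_rV.
Context {d} {T : sigmaRingType d} (n : nat).

Let coord : 'I_n -> 'rV[T]_n -> T := fun i v => v ord0 i.

Let rV_set0 : g_sigma_preimage coord set0.
Proof. exact: sigma_algebra0. Qed.

Let rV_setC A : g_sigma_preimage coord A -> g_sigma_preimage coord (~` A).
Proof. exact: sigma_algebraC. Qed.

Let rV_bigcup (F : (set 'rV[T]_n)^nat) :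
  (forall i, g_sigma_preimage coord (F i)) ->
  g_sigma_preimage coord (\bigcup_i (F i)).
Proof. exact: sigma_algebra_bigcup. Qed.

HB.instance Definition _ := @isMeasurable.Build (rV_display d)
  'rV[T]_n (g_sigma_preimage coord) rV_set0 rV_setC rV_bigcup.
End measurable_rV.

Section measurable_rV_theory.
Context d1 d2 (T1 : measurableType d1) (T2 : measurableType d2).

Lemma measurable_fun_rVP n (f : T1 -> 'rV[T2]_n) :
  measurable_fun [set: T1] f <->
  forall i, measurable_fun [set: T1] (fun x => f x ord0 i).
Proof.
pose co (i : 'I_n) (v : 'rV[T2]_n) := v ord0 i.
split=> [mf i|mf].
  move=> _ A mA; rewrite setTI.
  have := mf measurableT (co i @^-1` A); rewrite setTI; apply.
  apply: sub_sigma_algebra; rewrite -bigcup_seq/=.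
  by exists i => /=; [rewrite mem_index_enum|exists A => //; rewrite setTI].
move=> _ A mA; rewrite setTI.
suff : preimage_set_system setT f (g_sigma_preimage co) `<=` measurable.
  by apply; exists A => //; rewrite setTI.
rewrite /g_sigma_preimage -g_sigma_preimageE.
apply: smallest_sub; first exact: sigma_algebra_measurable.
move=> _ [B + <-]; rewrite -bigcup_seq/= => -[i _ [C mC <-]].
by rewrite !setTI; have := mf i measurableT C mC; rewrite setTI.
Qed.
End measurable_rV_theory.

Section lebesgue_rV.
Variable R : realType.

Definition rV_cons n (p : measurableTypeR R * 'rV[R]_n) : 'rV[R]_n.+1 :=
  row_mx (const_mx p.1 : 'rV[R]_1) p.2.

Definition rV_head n (v : 'rV[R]_n.+1) : measurableTypeR R * 'rV[R]_n :=
  (v ord0 ord0, \row_i v ord0 (lift ord0 i)).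

Lemma rV_headK n : cancel (@rV_head n) (@rV_cons n).
Proof.
move=> v; apply/rowP => i; rewrite /rV_cons/= mxE.
case: splitP => j /= ij; rewrite mxE.
  by congr (v _ _); apply/val_inj; rewrite /= ij [j]ord1.
by congr (v _ _); apply/val_inj; rewrite /= ij.
Qed.

Lemma rV_consK n : cancel (@rV_cons n) (@rV_head n).
Proof.
case=> x v; congr pair; first by rewrite /rV_cons mxE; case: splitP => // j _; rewrite mxE.
apply/rowP => i; rewrite mxE /rV_cons mxE.
case: splitP => j /= ij; first by have := ltn_ord j; rewrite -ij.
by congr (v _ _); apply/val_inj; move: ij => /= [].
Qed.

Lemma measurable_rV_cons n : measurable_fun [set: _] (@rV_cons n).
Proof.
apply/measurable_fun_rVP => i.
have -> : (fun x => rV_cons x ord0 i) = fun x : measurableTypeR R * 'rV[R]_n =>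
    match @fintype.split 1 n i with inl _ => x.1 | inr j => x.2 ord0 j end.
  by apply/funext => x; rewrite /rV_cons mxE; case: (fintype.split _) => j; rewrite ?mxE.
case: (fintype.split _) => j; first exact: measurable_fst.
have /measurable_fun_rVP := @measurable_snd _ _ (measurableTypeR R) 'rV[R]_n.
exact.
Qed.

Lemma measurable_rV_head n : measurable_fun [set: _] (@rV_head n).
Proof.
have co (i : 'I_n.+1) : measurable_fun [set: 'rV[R]_n.+1] (fun v => v ord0 i).
  by have /measurable_fun_rVP := @measurable_id _ 'rV[R]_n.+1 setT; apply.
apply/measurable_fun_pairP; split; first exact: co.
apply/measurable_fun_rVP => i.
rewrite (_ : (fun x => _) = (fun v : 'rV[R]_n.+1 => v ord0 (lift ord0 i)))//.
by apply/funext => v /=; rewrite mxE.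
Qed.

Section step.
Variables (n : nat) (m : {sigma_finite_measure set 'rV[R]_n -> \bar R}).

Definition lebesgue_rV_step : set 'rV[R]_n.+1 -> \bar R :=
  pushforward (lebesgue_measure \x m)%E (@rV_cons n).

Let step0 : lebesgue_rV_step set0 = 0%E.
Proof. by rewrite /lebesgue_rV_step /pushforward preimage_set0 measure0. Qed.

Let step_ge0 A : (0 <= lebesgue_rV_step A)%E.
Proof. by rewrite /lebesgue_rV_step /pushforward measure_ge0. Qed.

Let step_sigma_additive : semi_sigma_additive lebesgue_rV_step.
Proof.
have mcons A : measurable A -> measurable (@rV_cons n @^-1` A).
  by move=> mA; rewrite -[X in measurable X]setTI; exact: measurable_rV_cons.
move=> F mF tF mUF; rewrite /lebesgue_rV_step /pushforward preimage_bigcup.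
apply: measure_semi_sigma_additive.
- by move=> k; exact: mcons.
- apply/trivIsetP => /= i j _ _ ij; rewrite -preimage_setI.
  by move/trivIsetP : tF => /(_ _ _ _ _ ij) ->//; rewrite preimage_set0.
- by rewrite -preimage_bigcup; exact: mcons.
Qed.

HB.instance Definition _ := isMeasure.Build _ _ _ lebesgue_rV_step
  step0 step_ge0 step_sigma_additive.

Let step_sigma_finite : sigma_finite setT lebesgue_rV_step.
Proof.
have /sigma_finiteP[F [TF ndF Foo]] := sigma_finiteT (@lebesgue_measure R).
have /sigma_finiteP[G [TG ndG Goo]] := sigma_finiteT m.
exists (fun k => @rV_head n @^-1` (F k `*` G k)).
  rewrite -preimage_bigcup (_ : \bigcup_k _ = setT) ?preimage_setT//.
  rewrite -subTset => -[x y] _.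
  have [i _ Fx] : (\bigcup_i F i) x by rewrite -TF.
  have [j _ Gy] : (\bigcup_i G i) y by rewrite -TG.
  exists (maxn i j) => //; split => /=.
  - by move: x Fx; exact/subsetPset/ndF/leq_maxl.
  - by move: y Gy; exact/subsetPset/ndG/leq_maxr.
move=> k; have [mF Fk] := Foo k; have [mG Gk] := Goo k; split.
  rewrite -[X in measurable X]setTI; apply: measurable_rV_head => //.
  exact: measurableX.
rewrite /lebesgue_rV_step /pushforward -comp_preimage.
rewrite (_ : _ \o _ = id) ?preimage_id; last first.
  by apply/funext => x /=; rewrite rV_consK.
by rewrite product_measure1E// lte_mul_pinfty// ge0_fin_numE.
Qed.

HB.instance Definition _ := Measure_isSigmaFinite.Build _ _ _ lebesgue_rV_step
  step_sigma_finite.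
End step.

Fixpoint lebesgue_rV n : {sigma_finite_measure set 'rV[R]_n -> \bar R} :=
  if n is k.+1 then lebesgue_rV_step (lebesgue_rV k) else \d_(0 : 'rV[R]_0).

Lemma lebesgue_rV_box n (A : 'I_n -> set R) :
  (forall i, measurable (A i)) ->
  lebesgue_rV n [set v | forall i, A i (v ord0 i)] =
  \big[mule/1%E]_(i < n) lebesgue_measure (A i).
Proof.
elim: n A => [|n IHn] A mA.
  rewrite big_ord0/= diracE mem_set// => i; by case: i.
have mco m (B : 'I_m -> set R) : (forall i, measurable (B i)) ->
    measurable [set v : 'rV[R]_m | forall i, B i (v ord0 i)].
  move=> mB.
  rewrite (_ : [set v | _] =
    \bigcap_(i in [set: 'I_m]) ((fun v : 'rV[R]_m => v ord0 i) @^-1` B i)).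
    apply: fin_bigcap_measurable => // i _; rewrite -[X in measurable X]setTI.
    have /measurable_fun_rVP/(_ i) := @measurable_id _ 'rV[R]_m setT.
    by apply.
  by apply/seteqP; split=> [v vB i _|v vB i]; [exact: vB|exact: (vB i I)].
rewrite big_ord_recl -IHn//= /lebesgue_rV_step /pushforward.
have mA' := mco _ _ (fun i => mA (lift ord0 i)).
rewrite -product_measure1E//; last exact: mA.
congr (_ _); apply/seteqP; split=> -[x v] /=.
  move=> xvA; split=> [|i].
    by have := xvA ord0; have /(congr1 fst)/= -> := rV_consK (x, v).
  have := xvA (lift ord0 i); have /(congr1 snd)/= := rV_consK (x, v).
  by move=> /rowP/(_ i); rewrite mxE => ->.
move=> [xA vA] i; have [->|[j ->]] : i = ord0 \/ exists j, i = lift ord0 j.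
  by case: (unliftP ord0 i) => [j ->|->]; [right; exists j|left].
- by have /(congr1 fst)/= -> := rV_consK (x, v).
- have /(congr1 snd)/= := rV_consK (x, v).
  by move=> /rowP/(_ j); rewrite mxE => ->; exact: vA.
Qed.

End lebesgue_rV.

Section calculus.
Variables (R : realType) (d : nat).

Definition enorm (x : 'rV[R]_d) : R := Num.sqrt (\sum_i x ord0 i ^+ 2).

Definition pderiv (i : 'I_d) (f : 'rV[R]_d -> R) : 'rV[R]_d -> R :=
  fun x => 'D_(delta_mx ord0 i) f x.

Definition iter_pderiv (s : seq 'I_d) (f : 'rV[R]_d -> R) := foldr pderiv f s.

Definition smooth (f : 'rV[R]_d -> R) := forall s : seq 'I_d,
  continuous (iter_pderiv s f) /\
  forall i x, derivable (iter_pderiv s f) x (delta_mx ord0 i).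

Definition test_fun (Omega : set 'rV[R]_d) (phi : 'rV[R]_d -> R) :=
  let K := closure [set x | phi x != 0] in
  [/\ smooth phi, compact K & K `<=` Omega].

Definition bounded_domain (Omega : set 'rV[R]_d) :=
  [/\ open Omega, connected Omega, Omega !=set0 & bounded_set Omega].

End calculus.

Definition time_test_fun (R : realType) (I : set R) (phi : R -> R) :=
  let K := closure [set t | phi t != 0] in
  [/\ forall n t, derivable (derive1n n phi) t 1, compact K & K `<=` I].

(* A space of real functions, or of functionals: elements are identified when
   their difference has norm 0, and [fnorm] is meaningful on [fmem] only. *)
Record fspace (R : realType) := FSpace {
  fdom : Type;
  fmem : set (fdom -> R);
  fnorm : (fdom -> R) -> R }.
Arguments fmem {R} f _.
Arguments fnorm {R} f _.

Section vector_valued.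
Variable R : realType.
Implicit Types (S : fspace R) (I : set R).

Definition dual S : fspace R := {|
  fdom := fdom S -> R;
  fmem := [set l | (forall a v w, fmem S v -> fmem S w ->
                      l (fun x => a * v x + w x) = a * l v + l w) /\
                   exists C, forall v, fmem S v -> `|l v| <= C * fnorm S v];
  fnorm := fun l => sup [set `|l v| | v in [set v | fmem S v /\ fnorm S v <= 1]]
|}.

Definition strongly_continuous S I (f : R -> fdom S -> R) :=
  (forall t, I t -> fmem S (f t)) /\
  (forall t, I t ->
    fnorm S (f s \- f t) @[s --> within I (nbhs t)] --> (0 : R)).

Definition strongly_right_continuous S I (f : R -> fdom S -> R) :=
  (forall t, I t -> fmem S (f t)) /\
  (forall t, I t ->
    fnorm S (f s \- f t)
      @[s --> within (I `&` [set s | t <= s]) (nbhs t)] --> (0 : R)).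

Definition weakly_continuous S I (f : R -> fdom S -> R) :=
  (forall t, I t -> fmem S (f t)) /\
  (forall l, fmem (dual S) l -> forall t, I t ->
    l (f s) @[s --> within I (nbhs t)] --> l (f t)).

Definition vsimple S (s : R -> fdom S -> R) :=
  exists n (A : 'I_n -> set R) (v : 'I_n -> fdom S -> R),
  [/\ forall i, measurable (A i), forall i, fmem S (v i) &
      forall t x, s t x = \sum_(i < n) \1_(A i) t * v i x].

Definition strongly_measurable S I (f : R -> fdom S -> R) :=
  exists2 s : nat -> R -> fdom S -> R, forall n, vsimple (s n) &
    {ae lebesgue_measure, forall t, I t ->
       fnorm S (s n t \- f t) @[n --> \oo] --> (0 : R)}.

Definition bochner_L2 S I (f : R -> fdom S -> R) :=
  [/\ strongly_measurable I f,
      {ae lebesgue_measure, forall t, I t -> fmem S (f t)} &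
      (\int[lebesgue_measure]_(t in I) (fnorm S (f t) ^+ 2)%:E < +oo)%E].

(* The identity \int phi' f = - \int phi g between Bochner integrals, tested
   against all bounded linear functionals. *)
Definition weak_time_derivative S I (f g : R -> fdom S -> R) :=
  forall phi, time_test_fun I phi -> forall l, fmem (dual S) l ->
    \int[lebesgue_measure]_(t in I) (derive1 phi t * l (f t)) =
    - \int[lebesgue_measure]_(t in I) (phi t * l (g t)).

Definition bochner_W12 S I (f g : R -> fdom S -> R) :=
  [/\ bochner_L2 I f, bochner_L2 I g & weak_time_derivative I f g].

Definition absolutely_continuous I (f : R -> R) :=
  forall e, 0 < e -> exists2 delta, 0 < delta &
    forall n (a b : 'I_n -> R),
      (forall i, [/\ I (a i), I (b i) & a i <= b i]) ->
      trivIset setT (fun i => `]a i, b i[%classic) ->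
      \sum_(i < n) (b i - a i) < delta ->
      \sum_(i < n) `|f (b i) - f (a i)| < e.

End vector_valued.

Section function_spaces.
Variables (R : realType) (d : nat).
Local Notation E := 'rV[R]_d.
Local Notation leb := (lebesgue_rV R d).
Implicit Types (Omega : set E) (theta q : R) (v w : E -> R).

Definition Lq_norme Omega q w : \bar R := 'N[leb]_q%:E[EFin \o (w \_ Omega)].

Definition Lq_norm Omega q w : R := fine (Lq_norme Omega q w).

Definition Lq Omega q : fspace R := {|
  fdom := E;
  fmem := [set w | w \_ Omega \in Lfun leb q%:E];
  fnorm := Lq_norm Omega q |}.

Definition weak_gradient Omega w (g : 'I_d -> E -> R) := forall i,
  fmem (Lq Omega 2) (g i) /\
  forall phi, test_fun Omega phi ->
    \int[leb]_(x in Omega) (w x * pderiv i phi x) =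
    - \int[leb]_(x in Omega) (g i x * phi x).

(* Unique up to equality a.e. in [Omega]; 0 if there is no weak gradient. *)
Definition grad Omega w : 'I_d -> E -> R :=
  xget (fun _ _ => 0) [set g | weak_gradient Omega w g].

Definition H1 Omega : set (E -> R) :=
  [set w | fmem (Lq Omega 2) w /\ exists g, weak_gradient Omega w g].

Definition H1_0 Omega : set (E -> R) :=
  [set w | H1 Omega w /\
    exists phi : nat -> E -> R,
    [/\ forall n, test_fun Omega (phi n),
        Lq_norm Omega 2 (phi n \- w) @[n --> \oo] --> (0 : R) &
        forall i, Lq_norm Omega 2 (pderiv i (phi n) \- grad Omega w i)
          @[n --> \oo] --> (0 : R)]].

(* On the diagonal z.1 = z.2 the integrand is 0 / 0 = 0. *)
Definition gagliardo_integrand theta v w (z : E * E) : R :=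
  (v z.1 - v z.2) * (w z.1 - w z.2) / enorm (z.1 - z.2) `^ (d%:R + 2 * theta).

Definition fractional_sobolev theta : set (E -> R) :=
  [set w | w \in Lfun leb 2%:E /\
    (\int[leb \x leb]_z (gagliardo_integrand theta w w z)%:E < +oo)%E].

Definition Xmem Omega theta : set (E -> R) :=
  [set w | [/\ w \in Lfun leb 2%:E,
      {ae leb, forall x, ~ Omega x -> w x = 0} &
      if theta == 1 then H1_0 Omega w else fractional_sobolev theta w]].

Definition Xinner Omega theta v w : R :=
  if theta == 1
  then \int[leb]_(x in Omega) (\sum_i grad Omega v i x * grad Omega w i x)
  else 2^-1 * \int[(leb \x leb)%E]_z gagliardo_integrand theta v w z.

Definition Xnorm Omega theta w : R := Num.sqrt (Xinner Omega theta w w).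

Definition Xspace Omega theta : fspace R := {|
  fdom := E; fmem := Xmem Omega theta; fnorm := Xnorm Omega theta |}.

Definition critical_exponent theta : \bar R :=
  if 2 * theta < d%:R then (2 * d%:R / (d%:R - 2 * theta))%:E else +oo%E.

Definition sobolev_constant Omega theta q : R :=
  inf [set C | 0 <= C /\ forall w, Xmem Omega theta w ->
    (Lq_norme Omega q w <= (C * Xnorm Omega theta w)%:E)%E].

Definition L2_pairing Omega (r w : E -> R) : R :=
  \int[leb]_(x in Omega) (r x * w x).

End function_spaces.

Section doubly_nonlinear.
Variables (R : realType) (d : nat).
Local Notation E := 'rV[R]_d.
Local Notation leb := (lebesgue_rV R d).
Implicit Types (Omega : set E) (theta q T t : R).

(* [odd_pow (q - 2) a] is |a|^(q-2) a, with value 0 at a = 0 for all q. *)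
Definition odd_pow (r a : R) : R := `|a| `^ r * a.

Definition conj_exp q : R := q / (q - 1).

(* [u t] is the function u(., t). *)
Definition Lq_cylinder Omega (I : set R) q (u : R -> E -> R) :=
  (fun z : E * R => u z.2 z.1) \_ (Omega `*` I)
    \in Lfun (leb \x lebesgue_measure)%E q%:E.

(* [rh] is the curve t |-> rho(t) in the dual space, and [drh] is its time
   derivative. Elements of the dual given by functions are identified with them
   through the pairing of L^2(Omega). *)
Record weak_solution_with Omega theta q T (rho0 : (E -> R) -> R)
    (u rho : R -> E -> R) (rh drh : R -> (E -> R) -> R) : Prop := {
  ws_measurable_u :
    measurable_fun ([set: E] `*` `]0, T[) (fun z : E * R => u z.2 z.1);
  ws_measurable_rho :
    measurable_fun ([set: E] `*` `]0, T[) (fun z : E * R => rho z.2 z.1);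
  ws_u_L2 : forall e, 0 < e < T ->
    bochner_L2 (S := Xspace Omega theta) `]e, T[ u;
  ws_u_Lq : Lq_cylinder Omega `]0, T[ q u;
  ws_rho_rh : {ae lebesgue_measure, forall t, 0 < t < T ->
    forall w, Xmem Omega theta w -> fmem (Lq Omega q) w ->
      rh t w = L2_pairing Omega (rho t) w};
  ws_rho_continuous :
    strongly_continuous (S := dual (Xspace Omega theta)) `[0, T] rh;
  ws_rho_W12 : forall e, 0 < e < T ->
    bochner_W12 (S := dual (Xspace Omega theta)) `]e, T[ rh drh;
  ws_rho_Lq' : Lq_cylinder Omega `]0, T[ (conj_exp q) rho;
  ws_rho_u : {ae (leb \x lebesgue_measure)%E, forall z : E * R,
    (Omega `*` `]0, T[) z -> rho z.2 z.1 = odd_pow (q - 2) (u z.2 z.1)};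
  ws_equation : {ae lebesgue_measure, forall t, 0 < t < T ->
    forall w, Xmem Omega theta w ->
      drh t w + Xinner Omega theta (u t) w = 0};
  ws_initial_dual : fmem (dual (Xspace Omega theta)) rho0;
  ws_initial :
    fnorm (dual (Xspace Omega theta)) (rh t \- rho0) @[t --> 0^'+] --> (0 : R)
}.

Definition weak_solution_on Omega theta q T rho0 u rho :=
  exists rh drh, @weak_solution_with Omega theta q T rho0 u rho rh drh.

Definition weak_solution Omega theta q rho0 u rho :=
  forall T, 0 < T -> weak_solution_on Omega theta q T rho0 u rho.

Record energy_solution Omega theta q (u0 : E -> R) (u : R -> E -> R) : Prop := {
  es_weak_solution : weak_solution Omega theta q
    (L2_pairing Omega (odd_pow (q - 2) \o u0)) u
    (fun t => odd_pow (q - 2) \o u t);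
  es_weakly_continuous :
    weakly_continuous (S := Xspace Omega theta) `[0, +oo[ u;
  es_right_continuous :
    strongly_right_continuous (S := Xspace Omega theta) `[0, +oo[ u;
  es_Lq_continuous : strongly_continuous (S := Lq Omega q) `[0, +oo[ u;
  es_Lq : Lq_cylinder Omega `]0, +oo[ q u;
  es_initial : {ae leb, forall x, u 0 x = u0 x};
  es_rho_continuous : strongly_continuous (S := Lq Omega (conj_exp q))
    `[0, +oo[ (fun t => odd_pow (q - 2) \o u t);
  es_rho_derivative : exists drh : R -> (E -> R) -> R,
    [/\ weak_time_derivative (S := dual (Xspace Omega theta)) `]0, +oo[
          (fun t => L2_pairing Omega (odd_pow (q - 2) \o u t)) drh,
        weakly_continuous (S := dual (Xspace Omega theta)) `[0, +oo[ drh &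
        strongly_right_continuous (S := dual (Xspace Omega theta))
          `[0, +oo[ drh];
  es_absolutely_continuous :
    absolutely_continuous `[0, +oo[ (fun t => Lq_norm Omega q (u t) `^ q);
  es_Lq_identity : {ae lebesgue_measure, forall t, 0 < t ->
    derivable (fun s => Lq_norm Omega q (u s) `^ q) t 1 /\
    (conj_exp q)^-1 * derive1 (fun s => Lq_norm Omega q (u s) `^ q) t
      + Xnorm Omega theta (u t) ^+ 2 = 0};
  es_energy : exists2 dv : R -> E -> R,
    bochner_W12 (S := Lq Omega 2) `]0, +oo[
      (fun t => odd_pow ((q - 2) / 2) \o u t) dv &
    forall s t, 0 <= s -> s < t ->
      4 / (q * conj_exp q) *
        \int[lebesgue_measure]_(r in `[s, t]) (Lq_norm Omega 2 (dv r) ^+ 2)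
      + 2^-1 * Xnorm Omega theta (u t) ^+ 2
      <= 2^-1 * Xnorm Omega theta (u s) ^+ 2
}.

End doubly_nonlinear.

(* Main.v *)
Require Import Defs.
From HB Require Import structures.
From mathcomp Require Import all_boot all_order all_algebra.
From mathcomp Require Import all_classical all_reals all_analysis.
From mathcomp Require Import measurable_realfun ring lra.

Set Implicit Arguments.
Unset Strict Implicit.
Unset Printing Implicit Defensive.
Import Order.TTheory GRing.Theory Num.Theory.
Import numFieldNormedType.Exports.

Local Open Scope classical_set_scope.
Local Open Scope ring_scope.

(** Write [f(t)] for the [q]-th power of the [L^q] norm of [u(t)], [g(t)] for the
    square of its norm in the energy space, [q' = q / (q - 1)], and
    [C] for a constant of the Sobolev-Poincare inequality. The equation tested
    with [u] gives [f' = - q' g], and the energy inequality with the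
    Cauchy-Schwarz inequality gives [(f')^2 <= (q q' / 2) f (- g')]. So the
    Rayleigh quotient [g / f^(2/q)] is nonincreasing, and it is bounded below by
    [C^-2]. Up to constants the Rayleigh quotient is minus the derivative of
    [f^(1 - 2/q) / (1 - 2/q)]; therefore this power of [f] increases linearly
    when [q < 2], which is the algebraic decay, and decreases at a rate between
    two positive constants when [q > 2], until it vanishes at the extinction
    time. The two norms of [u(t)] differ by the square root of the Rayleigh
    quotient, whence the bounds in the energy norm. At [t = 0] the same rates
    bound the extinction time on both sides. Since derivatives are only known
    almost everywhere or weakly, all of this is carried out on increments, by
    [le_of_quadratic_increments]; see [rayleigh_noninc], [slope], [slow_decay],
    [extinction]. The increments of [f] and of its square root are estimated in
    [dissipation] and [sqrt_increment].

    The Sobolev-Poincare inequality, [sobolev_poincare], is proved by one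
    pointwise argument for all exponents. Around a point [x] with
    [|w(x)| = l], in a cube whose volume is a multiple of the measure of the set
    where [|w| > l/2], at least half of the points satisfy [|w| <= l/2]. The
    oscillation over this cube bounds [|w(x)|^q] by the energy density near [x],
    times a factor that the scaling relation between the exponents makes
    independent of [x]. For fractional order the energy density is the inner
    integral of the Gagliardo seminorm; for order one the oscillation is
    integrated along staircase paths, which involve partial derivatives only,
    and the estimate passes from test functions to their limits.

    The extinction time depends on the initial datum only, because two energy
    solutions with the same datum agree ([energy_solution_unique]): the dual norm
    of the difference of the two powers [|u|^(q-2) u] does not increase, since
    the power is monotone. This is again done on increments, by real induction
    in time, from strong right continuity in the energy space. The extinction
    time is the end of the set of times at which the [L^q] norm is positive, so
    it does not depend on the admissible constant [C] either, and the upper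
    bound holds with the best one. *)

(** * Lebesgue measure on row vectors *)

Section rV_measurable.
Context {R : realType}.
Local Notation leb := (lebesgue_rV R).

Lemma measurable_coord n (i : 'I_n) :
  measurable_fun [set: 'rV[R]_n] (fun v : 'rV[R]_n => v ord0 i).
Proof.
by have /measurable_fun_rVP := @measurable_id _ 'rV[R]_n setT; apply.
Qed.

Definition box n (A : 'I_n -> set R) : set 'rV[R]_n :=
  [set v | forall i, A i (v ord0 i)].

Lemma measurable_box n (A : 'I_n -> set R) :
  (forall i, measurable (A i)) -> measurable (box A).
Proof.
move=> mA; rewrite (_ : box A =
  \bigcap_(i in [set: 'I_n]) ((fun v : 'rV[R]_n => v ord0 i) @^-1` A i)).
  apply: fin_bigcap_measurable => // i _; rewrite -[X in measurable X]setTI.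
  exact: measurable_coord.
by apply/seteqP; split=> [v vB i _|v vB i]; [exact: vB|exact: (vB i I)].
Qed.

(** This links the norm topology to the sigma-algebra of the coordinates, and
    reduces local statements to countably many boxes. *)
Lemma open_rational_box n (U : set 'rV[R]_n) (x : 'rV[R]_n) : open U -> U x ->
  exists a b : 'rV[rat]_n,
    box (fun i => `]ratr (a ord0 i), ratr (b ord0 i)[%classic) x /\
    box (fun i => `[ratr (a ord0 i), ratr (b ord0 i)]%classic) `<=` U.
Proof.
move=> oU Ux.
have [e /= e0 eU] : exists2 e : R, 0 < e & ball x e `<=` U.
  by move: (oU) => /(_ _ Ux)/nbhs_ballP[e e0 eU]; exists e.
have : forall i : 'I_n, exists c : rat * rat,
    x ord0 i - e / 2 < ratr c.1 < x ord0 i /\ x ord0 i < ratr c.2 < x ord0 i + e / 2.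
  move=> i; have [r1] : exists r, ratr r \in `]x ord0 i - e / 2, x ord0 i[.
    by apply: rat_in_itvoo; lra.
  have [r2] : exists r, ratr r \in `]x ord0 i, x ord0 i + e / 2[.
    by apply: rat_in_itvoo; lra.
  by rewrite !in_itv/= => h2 h1; exists (r1, r2).
move/choice => [c cP]; exists (\row_i (c i).1), (\row_i (c i).2); split.
  by move=> i /=; rewrite !mxE in_itv/=; have [/andP[_ ->] /andP[-> _]] := cP i.
move=> w wc; apply: eU; split=> // i j; rewrite [i](_ : i = ord0); last exact: ord1.
have := wc j; rewrite /= !mxE in_itv/=; have [/andP[h1 h2] /andP[h3 h4]] := cP j.
move=> /andP[h5 h6]; rewrite /ball/= ltr_norml.
by apply/andP; split; lra.
Qed.

Lemma open_measurable_rV n (U : set 'rV[R]_n) : open U -> measurable U.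
Proof.
move=> oU.
pose B (c : 'rV[rat]_n * 'rV[rat]_n) : set 'rV[R]_n :=
  box (fun i => `]ratr (c.1 ord0 i), ratr (c.2 ord0 i)[%classic).
pose F c := if `[< B c `<=` U >] then B c else set0.
have -> : U = \bigcup_c F c.
  apply/seteqP; split=> [v Uv|v [c _]]; last first.
    by rewrite /F; case: ifPn => // /asboolP; apply.
  have [a [b [vab abU]]] := open_rational_box oU Uv; exists (a, b) => //.
  rewrite /F; case: asboolP => //; case=> w Bw; apply: abU => i.
  by have := Bw i; rewrite /= !in_itv/= => /andP[/ltW -> /ltW ->].
apply: countable_bigcupT_measurable; first exact: countableP.
move=> c; rewrite /F; case: ifP => // _; apply: measurable_box => i.
exact: measurable_itv.
Qed.

Lemma continuous_measurable_rV n (f : 'rV[R]_n -> R) :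
  continuous f -> measurable_fun setT f.
Proof.
move=> cf; apply: (measurability _ (RGenOpens.measurableE R)) => _ [_ [a [b ->]] <-].
rewrite setTI; apply: open_measurable_rV.
by apply: open_comp => [x _|]; [exact: cf|exact: interval_open].
Qed.

(** Tonelli's theorem along the first coordinate, the form in which the
    recursive construction of the Lebesgue measure is used. *)
Lemma ge0_integral_rV_cons n (f : 'rV[R]_n.+1 -> \bar R) :
  measurable_fun setT f -> (forall x, 0 <= f x)%E ->
  (\int[leb n.+1]_x f x =
   \int[lebesgue_measure]_a \int[leb n]_v f (rV_cons (a, v)))%E.
Proof.
move=> mf f0.
rewrite -(@fubini_tonelli1 _ _ _ _ R lebesgue_measure (leb n) (f \o @rV_cons R n))//; last by move=> x; exact: f0.
  by rewrite -[RHS](@ge0_integral_pushforward _ _ _ _ _ (@rV_cons R n) _ _ setT)//; exact: measurable_rV_cons.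
by apply: measurableT_comp => //; exact: measurable_rV_cons.
Qed.

Lemma measurable_rV_consr n (a : R) :
  measurable_fun setT (fun v : 'rV[R]_n => rV_cons (a : measurableTypeR R, v)).
Proof.
apply: (measurableT_comp (@measurable_rV_cons R n)).
exact: measurable_pair1.
Qed.

Lemma measurable_addr_rV n (h : 'rV[R]_n) :
  measurable_fun setT (fun x : 'rV[R]_n => x + h).
Proof.
apply/measurable_fun_rVP => i.
rewrite (_ : (fun x => _) = (fun x : 'rV[R]_n => x ord0 i + h ord0 i)); last first.
  by apply/funext => x; rewrite mxE.
by apply: measurable_funD => //; exact: measurable_coord.
Qed.

Lemma lebesgue_measure_shift (a : R) (A : set R) : measurable A ->
  pushforward lebesgue_measure ((fun x => x + a) : measurableTypeR R -> measurableTypeR R) A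
   = lebesgue_measure A.
Proof.
move=> mA; have ms : measurable_fun setT ((fun x => x + a) : measurableTypeR R -> measurableTypeR R).
  by apply: measurable_funD.
apply/esym/lebesgue_measure_unique => //= _ [[x y]] _ <-.
rewrite /pushforward (_ : _ @^-1` _ = `]x - a, y - a]%classic); last first.
  by apply/seteqP; split=> z /=; rewrite !in_itv/= ltrBlDr lerBrDr.
rewrite !lebesgue_measure_itv/= !lte_fin ltrD2r.
by case: ifP => // _; rewrite -!EFinD; congr (_%:E); lra.
Qed.

Lemma ge0_integral_shift (a : R) (f : measurableTypeR R -> \bar R) :
  measurable_fun setT f -> (forall x, 0 <= f x)%E ->
  (\int[lebesgue_measure]_x f (x + a)%R = \int[lebesgue_measure]_x f x)%E.
Proof.
move=> mf f0.
pose s : measurableTypeR R -> measurableTypeR R := fun x => x + a.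
have ms : measurable_fun setT s by apply: measurable_funD.
transitivity (\int[pushforward lebesgue_measure s]_x f x)%E.
  by rewrite ge0_integral_pushforward.
by apply: eq_measure_integral => A mA _; exact: lebesgue_measure_shift.
Qed.

Lemma rV_consD n (a b : R) (v w : 'rV[R]_n) :
  rV_cons (a : measurableTypeR R, v) + rV_cons (b : measurableTypeR R, w) = rV_cons (a + b : measurableTypeR R, v + w).
Proof.
by apply/rowP => i; rewrite /rV_cons !mxE; case: fintype.split => j; rewrite !mxE.
Qed.

(** Induction on the dimension: the first coordinate is shifted by the
    one-dimensional invariance, the others by the induction hypothesis. *)
Lemma ge0_integral_rV_shift n (h : 'rV[R]_n) (f : 'rV[R]_n -> \bar R) :
  measurable_fun setT f -> (forall x, 0 <= f x)%E ->
  (\int[leb n]_x f (x + h)%R = \int[leb n]_x f x)%E.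
Proof.
elim: n h f => [|n IHn] h f mf f0.
  by apply: eq_integral => x _; congr f; apply/rowP; case.
have mfh : measurable_fun setT (fun x : 'rV[R]_n.+1 => f (x + h)).
  by apply: (measurableT_comp mf); exact: measurable_addr_rV.
rewrite (ge0_integral_rV_cons mfh); last by move=> x; exact: f0.
rewrite (ge0_integral_rV_cons mf f0).
pose h0 := (rV_head h).1; pose h' := (rV_head h).2.
have hE : h = rV_cons (h0, h') by rewrite /h0 /h' -surjective_pairing rV_headK.
have mfc : measurable_fun setT (f \o @rV_cons R n).
  by apply: measurableT_comp => //; exact: measurable_rV_cons.
have mF := @measurable_fun_fubini_tonelli_F _ _ _ _ _ (leb n) _ mfc (fun x => f0 _).
rewrite -[RHS](ge0_integral_shift h0 mF); last by move=> x; apply: integral_ge0 => v _; exact: f0.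
apply: eq_integral => a _.
rewrite -[RHS](IHn h')//; last first.
  by move=> x; exact: f0.
  by apply: measurableT_comp => //; exact: measurable_rV_consr.
by apply: eq_integral => v _; rewrite hE rV_consD.
Qed.

Lemma measurable_ball_box n (x : 'rV[R]_n) (r : R) :
  measurable (box (fun i => `[x ord0 i - r, x ord0 i + r]%classic)).
Proof. by apply: measurable_box => i; exact: measurable_itv. Qed.

Lemma lebesgue_cube n (x : 'rV[R]_n) (r : R) : 0 <= r ->
  leb n (box (fun i => `[x ord0 i - r, x ord0 i + r]%classic)) = ((2 * r) ^+ n)%:E.
Proof.
move=> r0; rewrite lebesgue_rV_box; last by move=> i; exact: measurable_itv.
transitivity (\big[mule/1%E]_(i < n) (2 * r)%:E); last first.
  elim: n {x} => [|n IHn]; first by rewrite big_ord0 expr0.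
  by rewrite big_ord_recl IHn -EFinM exprS.
apply: eq_bigr => i _; rewrite lebesgue_measure_itv/= lte_fin.
case: ifPn => [_|]; first by rewrite -EFinD; congr (_%:E); lra.
by rewrite -leNgt => ?; congr (_%:E); lra.
Qed.

Lemma rV_norm_coord n (x : 'rV[R]_n) i : `|x ord0 i| <= `|x|.
Proof.
rewrite {2}/Num.norm/= mx_normrE.
exact: (le_bigmax_cond 0 (fun ij : 'I_1 * 'I_n => `|x ij.1 ij.2|) (j := (ord0, i))).
Qed.

Lemma bounded_subset_cube n (U : set 'rV[R]_n) : bounded_set U ->
  exists2 r : R, 0 < r & U `<=` box (fun i => `[- r, r]%classic).
Proof.
move=> [M [Mr bM]]; pose r := Num.max M 0 + 1.
have Mr1 : M < r by rewrite /r (le_lt_trans (_ : M <= Num.max M 0))// ?le_max ?lexx// ltrDl.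
exists r; first by rewrite /r ltr_pwDr// le_max lexx orbT.
move=> x /(bM _ Mr1) xr i /=; rewrite in_itv/= -ler_norml.
exact: le_trans (rV_norm_coord _ _) xr.
Qed.

Lemma bounded_finite_measure n (U : set 'rV[R]_n) : measurable U -> bounded_set U ->
  (leb n U < +oo)%E.
Proof.
move=> mU /bounded_subset_cube[r r0 Ur].
have E i : (`[- r, r]%classic : set R) = `[(0 : 'rV[R]_n) ord0 i - r, (0 : 'rV[R]_n) ord0 i + r]%classic.
  by rewrite !mxE !add0r.
rewrite (@le_lt_trans _ _ (((2 * r) ^+ n)%:E))// ?ltry//.
rewrite -(lebesgue_cube 0 (ltW r0)) le_measure// ?inE//.
  exact: measurable_ball_box.
by move=> x /Ur xr i; rewrite -E; exact: xr.
Qed.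

End rV_measurable.

(** * Differential inequalities for the Rayleigh quotient *)

Section partition.
Context {R : realType}.

(** A second-order error disappears in the limit of ever finer uniform
    partitions: the increments of [H] telescope and are multiplied by the
    mesh. It turns increment estimates into monotonicity where derivatives exist
    only almost everywhere. *)
Lemma le_of_quadratic_increments (G H : R -> R) (a b C : R) : a <= b ->
  (forall s t, a <= s -> s < t -> t <= b ->
    G s - G t <= C * (t - s) * (H s - H t)) ->
  G a <= G b.
Proof.
rewrite le_eqVlt => /predU1P[->//|ab] GH.
have step N : N.+1%:R * (G a - G b) <= C * (b - a) * (H a - H b).
  pose h := (b - a) / N.+1%:R.
  have N0 : 0 < N.+1%:R :> R by rewrite ltr0n.
  have h0 : 0 < h by rewrite divr_gt0// subr_gt0.
  pose p (i : nat) := a + i%:R * h.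
  have pN : p N.+1 = b by rewrite /p /h mulrC divfK ?gt_eqF// addrC subrK.
  have p0 : p 0%N = a by rewrite /p mul0r addr0.
  have pS i : p i.+1 = p i + h by rewrite /p -natr1 mulrDl mul1r addrA.
  have tel (F : R -> R) k : \sum_(0 <= i < k) (F (p i) - F (p i.+1)) = F a - F (p k).
    elim: k => [|k IH]; first by rewrite big_geq// p0 subrr.
    by rewrite big_nat_recr//= IH; lra.
  have mono i j : (i <= j)%N -> p i <= p j.
    by move=> ij; rewrite /p lerD2l ler_pM2r// ler_nat.
  rewrite -pN -(tel G) -(tel H).
  have -> : C * (p N.+1 - a) = N.+1%:R * (C * h).
    by rewrite pN /h; field; rewrite addrC natr1 gt_eqF.
  rewrite -mulrA ler_pM2l// mulr_sumr big_nat_cond [leRHS]big_nat_cond.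
  apply: ler_sum => i; rewrite andbT => /andP[_ iN].
  have := GH (p i) (p i.+1); rewrite -[X in X <= p i]p0 -[X in p i.+1 <= X]pN.
  rewrite mono// mono// => /(_ isT).
  rewrite pS ltrDl h0 => /(_ isT isT); rewrite (addrC (p i)) addrK.
  by rewrite addrC.
rewrite leNgt; apply/negP => ba.
have d0 : 0 < G a - G b by rewrite subr_gt0.
have := step (Num.truncn (C * (b - a) * (H a - H b) / (G a - G b))).
rewrite -ler_pdivlMr// leNgt => /negP; apply.
exact: truncnS_gt.
Qed.

Lemma ln_le_sub1 (x : R) : 0 < x -> ln x <= x - 1.
Proof. by move=> x0; have := expR_ge1Dx (ln x); rewrite lnK ?posrE//; lra. Qed.

Lemma powR_bernoulli (e z : R) : 0 < z -> e < 1 -> e != 0 ->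
  (z `^ e - 1) / e <= z - 1.
Proof.
move=> z0 e1 e0; have zE : z = expR (ln z) by rewrite lnK// posrE.
have -> : z `^ e = expR (e * ln z) by rewrite /powR gt_eqF.
rewrite {2}zE; set w := ln z.
move: e0; rewrite neq_lt => /orP[en|ep].
  rewrite ler_ndivrMr//.
  have h1 := expR_ge1Dx (e * w); have h2 := expR_ge1Dx w.
  by nra.
rewrite ler_pdivrMr//.
have -> : expR w = expR (e * w) * expR ((1 - e) * w).
  by rewrite -expRD; congr expR; ring.
have h1 := expR_ge1Dx ((1 - e) * w).
have h2 := expR_ge1Dx (- (e * w)).
have h3 := expR_gt0 (e * w).
have : 1 = expR (e * w) * expR (- (e * w)) by rewrite -expRD subrr expR0.
move: (expR (e * w)) (expR ((1 - e) * w)) (expR (- (e * w))) h1 h2 h3 => E F K h1 h2 h3 EK.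
have a1 : E * (1 + (1 - e) * w) <= E * F by rewrite ler_pM2l.
have a2 : E * (1 - e * w) <= E * K by rewrite ler_pM2l.
rewrite -EK in a2.
have b1 := ler_wpM2l (ltW ep) a1.
have e1' : 0 <= 1 - e by lra.
have b2 := ler_wpM2l e1' a2.
nra.
Qed.

Lemma powR_div (x y r : R) : 0 <= x -> 0 <= y -> (x / y) `^ r = x `^ r / y `^ r.
Proof. by move=> x0 y0; rewrite powRM ?invr_ge0// -powR_inv1// -powRrM mulN1r powRN. Qed.

(** The tangent-line inequality of the concave function [x^e / e]. *)
Lemma powR_concave (e x y : R) : 0 < x -> 0 < y -> e < 1 -> e != 0 ->
  (x `^ e - y `^ e) / e <= y `^ (e - 1) * (x - y).
Proof.
move=> x0 y0 e1 e0; have z0 : 0 < x / y by rewrite divr_gt0.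
have := powR_bernoulli z0 e1 e0.
rewrite -(ler_pM2l (powR_gt0 e y0)).
have -> : y `^ e * (((x / y) `^ e - 1) / e) = (x `^ e - y `^ e) / e.
  rewrite mulrA mulrBr mulr1 -powRM ?(ltW y0)//; last exact: ltW.
  by rewrite mulrCA mulfV ?mulr1// gt_eqF.
suff -> : y `^ (e - 1) * (x - y) = y `^ e * (x / y - 1) by [].
rewrite powRD; last by rewrite (gt_eqF y0) implybT.
rewrite powR_inv1; last exact: ltW.
by field; rewrite gt_eqF.
Qed.

End partition.

Section decay.
Context {R : realType}.
Variables (q C : R) (f g : R -> R).
Hypotheses (q1 : 1 < q) (C0 : 0 < C).
Local Notation qc := (q / (q - 1)).
Hypothesis f_ge0 : forall t : R, 0 <= t -> 0 <= f t.
Hypothesis g_ge0 : forall t : R, 0 <= t -> 0 <= g t.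
Hypothesis g_noninc : forall s t : R, 0 <= s -> s < t -> g t <= g s.
Hypothesis diss_ge : forall s t : R, 0 <= s -> s < t -> qc * g t * (t - s) <= f s - f t.
Hypothesis diss_le : forall s t : R, 0 <= s -> s < t -> f s - f t <= qc * g s * (t - s).
Hypothesis sqrt_lip : forall s t : R, 0 <= s -> s < t ->
  (Num.sqrt (f s) - Num.sqrt (f t)) ^+ 2 <= (t - s) * (q * qc / 8) * (g s - g t).
Hypothesis sobolev : forall t : R, 0 <= t -> f t `^ (2 / q) <= C ^+ 2 * g t.
Hypothesis f0_gt0 : 0 < f 0.

Let q0 : 0 < q. Proof. exact: lt_trans q1. Qed.
Let qc0 : 0 < qc. Proof. by rewrite divr_gt0// subr_gt0. Qed.

Let g_le s t : 0 <= s -> s <= t -> g t <= g s.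
Proof. by move=> s0; rewrite le_eqVlt => /predU1P[->//|]; exact: g_noninc. Qed.

Let f_le s t : 0 <= s -> s <= t -> f t <= f s.
Proof.
move=> s0; rewrite le_eqVlt => /predU1P[->//|st].
rewrite -subr_ge0 (le_trans _ (diss_ge s0 st))// mulr_ge0//; last lra.
by rewrite mulr_ge0 ?(ltW qc0)// g_ge0//; lra.
Qed.

Let g_gt0 t : 0 <= t -> 0 < f t -> 0 < g t.
Proof.
move=> t0 ft0; have := sobolev t0; have := powR_gt0 (2 / q) ft0 => a b.
have : 0 < C ^+ 2 * g t by lra.
by rewrite pmulr_rgt0// exprn_gt0.
Qed.

(** The discrete form of [(f')^2 <= q q' / 2 * f * (- g')]: the increment of
    [f] factors through the one of its square root, and is bounded below by the
    dissipation. *)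
Let fast_dissipation s t : 0 <= s -> s < t ->
  2 * qc / q * g t ^+ 2 * (t - s) <= f s * (g s - g t).
Proof.
move=> s0 st; have t0 : 0 <= t by lra.
have fs := f_ge0 s0; have ft := f_ge0 t0.
have mt := sqrtr_ge0 (f t).
have mle : Num.sqrt (f t) <= Num.sqrt (f s) by rewrite ler_wsqrtr// f_le// ltW.
have fsE : Num.sqrt (f s) ^+ 2 = f s by rewrite sqr_sqrtr.
have ftE : Num.sqrt (f t) ^+ 2 = f t by rewrite sqr_sqrtr.
have lip := sqrt_lip s0 st; have ge := diss_ge s0 st.
have gs := g_ge0 t0.
have h : 0 < t - s by lra.
have A : (f s - f t) ^+ 2 <= 4 * f s * ((t - s) * (q * qc / 8) * (g s - g t)).
  rewrite -{1}fsE -ftE subr_sqr exprMn mulrC ler_pM ?sqr_ge0//.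
  have -> : 4 * f s = (2 * Num.sqrt (f s)) ^+ 2 by rewrite exprMn fsE; ring.
  by rewrite ler_sqr ?nnegrE; lra.
have B : (qc * g t * (t - s)) ^+ 2 <= (f s - f t) ^+ 2.
  have ge0 : 0 <= qc * g t * (t - s) by rewrite mulr_ge0 ?(ltW h)// mulr_ge0// ltW.
  by rewrite ler_sqr ?nnegrE// (le_trans ge0 ge).
have := le_trans B A.
have -> : (qc * g t * (t - s)) ^+ 2 = (q * qc / 2 * (t - s)) * (2 * qc / q * g t ^+ 2 * (t - s)).
  by field; rewrite gt_eqF//= subr_eq0 gt_eqF.
have -> : 4 * f s * ((t - s) * (q * qc / 8) * (g s - g t)) = (q * qc / 2 * (t - s)) * (f s * (g s - g t)).
  by field; rewrite subr_eq0 gt_eqF.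
by rewrite ler_pM2l// mulr_gt0// divr_gt0// mulr_gt0.
Qed.

(** The exponent [2 / q] makes the quotient invariant when [u] is multiplied by
    a constant. *)
Let ray t := g t / f t `^ (2 / q).

(** The logarithm of the Rayleigh quotient decreases up to an error of second
    order in the length of the time interval: [fast_dissipation] bounds the
    decrease of [ln g] below and [diss_le] that of [ln f] above, by the same
    quantity up to replacing a value at [s] by a value at [t]. *)
Lemma rayleigh_noninc a b : 0 <= a -> a <= b -> 0 < f b -> ray b <= ray a.
Proof.
move=> a0 ab fb; have b0 : 0 <= b by lra.
have fpos t : 0 <= t -> t <= b -> 0 < f t by move=> t0 tb; apply: lt_le_trans fb (f_le _ _).
have gpos t : 0 <= t -> t <= b -> 0 < g t by move=> t0 tb; apply: g_gt0 => //; exact: fpos.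
pose L t := ln (g t) - 2 / q * ln (f t).
have rE t : 0 <= t -> t <= b -> ray t = expR (L t).
  move=> t0 tb; rewrite /ray /L expRD expRN lnK ?posrE ?gpos//.
  by rewrite /powR (gt_eqF (fpos _ _ _)).
rewrite !rE// ler_expR -[L b]opprK -[L a]opprK lerN2.
have fa := fpos _ a0 ab; have ga := gpos _ a0 ab; have gb := gpos _ b0 (lexx _).
apply: (@le_of_quadratic_increments _ (fun t => - L t)
  (fun t => 2 * f a * g a * g t + g a ^+ 2 * f t) a b (2 * qc / q / (f b ^+ 2 * g b)) ab).
move=> s t as_ st tb; have s0 : 0 <= s by lra.
have t0 : 0 <= t by lra.
have sb : s <= b by lra.
have fs := fpos _ s0 sb; have gs := gpos _ s0 sb.
have ft := fpos _ t0 tb; have gt := gpos _ t0 tb.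
have l1 : ln (g t) - ln (g s) <= - (g s - g t) / g s.
  rewrite -ln_div ?posrE//; apply: le_trans (ln_le_sub1 (divr_gt0 gt gs)) _.
  by rewrite le_eqVlt; apply/orP; left; apply/eqP; field; rewrite gt_eqF.
have l2 : ln (f s) - ln (f t) <= (f s - f t) / f t.
  rewrite -ln_div ?posrE//; apply: le_trans (ln_le_sub1 (divr_gt0 fs ft)) _.
  by rewrite le_eqVlt; apply/orP; left; apply/eqP; field; rewrite gt_eqF.
have fd := fast_dissipation s0 st.
have dl := diss_le s0 st.
have kp : 0 < 2 * qc / q by rewrite divr_gt0// mulr_gt0.
have l1' : ln (g t) - ln (g s) <= - (2 * qc / q * (t - s) * (g t ^+ 2 / (f s * g s))).
  apply: le_trans l1 _; rewrite mulNr lerN2 ler_pdivlMr//.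
  rewrite -(ler_pM2l fs); apply: le_trans fd.
  by rewrite le_eqVlt; apply/orP; left; apply/eqP; field; rewrite !gt_eqF//= subr_gt0.
have l2' : 2 / q * (ln (f s) - ln (f t)) <= 2 * qc / q * (t - s) * (g s / f t).
  apply: (@le_trans _ _ (2 / q * ((f s - f t) / f t))).
    by rewrite ler_pM2l// divr_gt0.
  have -> : 2 * qc / q * (t - s) * (g s / f t) = 2 / q * ((qc * g s * (t - s)) / f t).
    by field; rewrite !gt_eqF//= subr_gt0.
  by rewrite ler_pM2l ?divr_gt0// ler_pM2r// invr_gt0.
have fsa : f s <= f a by exact: f_le.
have gsa : g s <= g a by exact: g_le.
have fbt : f b <= f t by exact: f_le.
have gbs : g b <= g s by exact: g_le.
have fts : f t <= f s by apply: f_le => //; exact: ltW.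
have gts : g t <= g s by apply: g_le => //; exact: ltW.
have key : g s / f t - g t ^+ 2 / (f s * g s) <=
    (2 * f a * g a * (g s - g t) + g a ^+ 2 * (f s - f t)) / (f b ^+ 2 * g b).
  have -> : g s / f t - g t ^+ 2 / (f s * g s) =
      (f s * (g s - g t) * (g s + g t) + (f s - f t) * g t ^+ 2) / (f s * f t * g s).
    by field; rewrite !gt_eqF.
  apply: ler_pM.
  - by rewrite addr_ge0// !mulr_ge0// ?sqr_ge0//; lra.
  - by rewrite invr_ge0 !mulr_ge0// ltW.
  - apply: lerD.
      rewrite -mulrA [leRHS](_ : _ = f a * ((g s - g t) * (2 * g a))); last by ring.
      by apply: ler_pM => //; rewrite ?mulr_ge0//; try lra; rewrite ler_wpM2l//; lra.
    by rewrite mulrC ler_wpM2r ?subr_ge0// ler_sqr ?nnegrE; lra.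
  - rewrite lef_pV2 ?posrE ?mulr_gt0// expr2 -!mulrA.
    by rewrite ler_pM ?mulr_ge0//; try lra; rewrite ler_pM//; lra.
have := ler_wpM2l (ltW (mulr_gt0 kp (_ : 0 < t - s))) key.
rewrite subr_gt0 => /(_ st) k2.
rewrite /L.
have -> : 2 * qc / q / (f b ^+ 2 * g b) * (t - s) *
    (2 * f a * g a * g s + g a ^+ 2 * f s - (2 * f a * g a * g t + g a ^+ 2 * f t)) =
  2 * qc / q * (t - s) * ((2 * f a * g a * (g s - g t) + g a ^+ 2 * (f s - f t)) / (f b ^+ 2 * g b)).
  by field; rewrite !gt_eqF//= subr_gt0.
by move: l1' l2' k2; rewrite mulrBr mulrBr; lra.
Qed.

Lemma rayleigh_ge t : 0 <= t -> 0 < f t -> (C ^+ 2)^-1 <= ray t.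
Proof.
move=> t0 ft; rewrite /ray ler_pdivlMr ?powR_gt0// ler_pdivrMl ?exprn_gt0//.
exact: sobolev.
Qed.

Let ray0_ge0 : 0 <= ray 0. Proof. by rewrite divr_ge0 ?powR_ge0 ?g_ge0. Qed.

Let ray0_gt0 : 0 < ray 0.
Proof. by rewrite divr_gt0 ?powR_gt0 ?g_gt0. Qed.

Let e := 1 - 2 / q.
Let Y t := f t `^ e / e.

Hypothesis q2 : q != 2.

Let e1 : e < 1. Proof. by rewrite /e ltrBlDr ltrDl divr_gt0. Qed.
Let e0 : e != 0.
Proof.
apply: contra q2 => /eqP e0; have : q * e = 0 by rewrite e0 mulr0.
rewrite /e mulrBr mulrCA mulfV ?(gt_eqF q0)// !mulr1 => /eqP.
by rewrite subr_eq0.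
Qed.

(** The time derivative of [f^e / e] is minus the Rayleigh quotient times the
    conjugate exponent; this is the two-sided estimate it implies. *)
Lemma slope a b : 0 <= a -> a <= b -> 0 < f b ->
  qc * (C ^+ 2)^-1 * (b - a) <= Y a - Y b <= qc * ray 0 * (b - a).
Proof.
move=> a0 ab fb; have b0 : 0 <= b by lra.
have fpos t : 0 <= t -> t <= b -> 0 < f t by move=> t0 tb; apply: lt_le_trans fb (f_le _ _).
have powE t : f t `^ (e - 1) = (f t `^ (2 / q))^-1.
  by rewrite -powRN /e; congr (_ `^ _); lra.
have ratio s t : 0 < f s -> 0 < f t -> f t <= f s ->
    f s `^ (2 / q) / f t `^ (2 / q) <= f s ^+ 2 / f t ^+ 2.
  move=> fs ft fts; rewrite -powR_div ?(ltW fs) ?(ltW ft)// -exprVn -exprMn.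
  rewrite -powR_mulrn ?divr_ge0 ?(ltW fs) ?(ltW ft)//.
  have r1 : 1 <= f s / f t by rewrite ler_pdivlMr ?mul1r.
  have r2 : 2 / q <= 2 by rewrite ler_pdivrMr// ler_pMr// ltW.
  exact: ler_powR r1 _ _ r2.
have f_a := fpos _ a0 ab.
apply/andP; split.
- have := @le_of_quadratic_increments _ (fun t => - Y t - qc * (C ^+ 2)^-1 * t) f a b
    (qc * (C ^+ 2)^-1 * (2 * f a / f b ^+ 2)) ab.
  suff H : forall s t, a <= s -> s < t -> t <= b ->
    - Y s - qc * (C ^+ 2)^-1 * s - (- Y t - qc * (C ^+ 2)^-1 * t) <=
    qc * (C ^+ 2)^-1 * (2 * f a / f b ^+ 2) * (t - s) * (f s - f t) by move/(_ H); lra.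
  move=> s t as_ st tb; have s0 : 0 <= s by lra.
  have t0 : 0 <= t by lra.
  have sb : s <= b by lra.
  have fs := fpos _ s0 sb; have ft := fpos _ t0 tb.
  have fts : f t <= f s by apply: f_le => //; exact: ltW.
  have fsa : f s <= f a by exact: f_le.
  have fbt : f b <= f t by exact: f_le.
  have c1 := powR_concave ft fs e1 e0.
  have c2 : f s `^ (e - 1) * (f s - f t) <= Y s - Y t.
    by rewrite /Y; move: c1; rewrite !mulrBl !mulrBr; lra.
  rewrite powE in c2.
  have c3 := diss_ge s0 st.
  have rt := rayleigh_ge t0 ft.
  have P : 0 < f s `^ (2 / q) by exact: powR_gt0.
  have P' : 0 < f t `^ (2 / q) by exact: powR_gt0.
  have c4 : qc * (t - s) * ((C ^+ 2)^-1 * (f t `^ (2 / q) / f s `^ (2 / q))) <= Y s - Y t.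
    apply: le_trans c2; rewrite [leRHS]mulrC ler_pdivlMr//; apply: le_trans c3.
    have -> : qc * (t - s) * ((C ^+ 2)^-1 * (f t `^ (2 / q) / f s `^ (2 / q))) * f s `^ (2 / q)
       = qc * (t - s) * ((C ^+ 2)^-1 * f t `^ (2 / q)).
      by field; rewrite !gt_eqF//= subr_gt0.
    rewrite [leRHS]mulrAC ler_pM2l; last by apply: mulr_gt0 => //; rewrite subr_gt0.
    by move: rt; rewrite /ray ler_pdivlMr.
  have c5 : 1 - f t `^ (2 / q) / f s `^ (2 / q) <= 2 * f a / f b ^+ 2 * (f s - f t).
    have r1 := ratio _ _ fs ft fts.
    have r2 : f t ^+ 2 / f s ^+ 2 <= f t `^ (2 / q) / f s `^ (2 / q).
      rewrite -lef_pV2 ?posrE ?divr_gt0// ?exprn_gt0//.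
      by rewrite !invf_div.
    have r3 : 1 - f t ^+ 2 / f s ^+ 2 <= 2 * f a / f b ^+ 2 * (f s - f t).
      have -> : 1 - f t ^+ 2 / f s ^+ 2 = ((f s + f t) / f s ^+ 2) * (f s - f t).
        by field; rewrite gt_eqF.
      rewrite ler_wpM2r ?subr_ge0// ler_pM ?invr_ge0 ?sqr_ge0//; try lra.
      by rewrite lef_pV2 ?posrE ?exprn_gt0// ler_sqr ?nnegrE; lra.
    by move: r2 r3; lra.
  have kp : 0 < qc * (t - s) * (C ^+ 2)^-1 by apply: divr_gt0; rewrite ?exprn_gt0//; apply: mulr_gt0 => //; rewrite subr_gt0.
  have := ler_wpM2l (ltW kp) c5.
  by move: c4; rewrite !mulrBr !mulr1 !mulrA; lra.
- have := @le_of_quadratic_increments _ (fun t => Y t + qc * ray 0 * t) f a b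
    (qc * ray 0 * (2 * f a / f b ^+ 2)) ab.
  suff H : forall s t, a <= s -> s < t -> t <= b ->
    Y s + qc * ray 0 * s - (Y t + qc * ray 0 * t) <=
    qc * ray 0 * (2 * f a / f b ^+ 2) * (t - s) * (f s - f t) by move/(_ H); lra.
  move=> s t as_ st tb; have s0 : 0 <= s by lra.
  have t0 : 0 <= t by lra.
  have sb : s <= b by lra.
  have fs := fpos _ s0 sb; have ft := fpos _ t0 tb.
  have fts : f t <= f s by apply: f_le => //; exact: ltW.
  have fsa : f s <= f a by exact: f_le.
  have fbt : f b <= f t by exact: f_le.
  have c1 := powR_concave fs ft e1 e0.
  have c2 : Y s - Y t <= f t `^ (e - 1) * (f s - f t) by rewrite /Y -mulrBl.
  rewrite powE in c2.
  have c3 := diss_le s0 st.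
  have rs := rayleigh_noninc (lexx 0) s0 fs.
  have P : 0 < f s `^ (2 / q) by exact: powR_gt0.
  have P' : 0 < f t `^ (2 / q) by exact: powR_gt0.
  have R0 : 0 <= ray 0 by rewrite divr_ge0 ?powR_ge0 ?g_ge0.
  have c4 : Y s - Y t <= qc * (t - s) * (ray 0 * (f s `^ (2 / q) / f t `^ (2 / q))).
    apply: le_trans c2 _; rewrite mulrC ler_pdivrMr//; apply: le_trans c3 _.
    have -> : qc * (t - s) * (ray 0 * (f s `^ (2 / q) / f t `^ (2 / q))) * f t `^ (2 / q)
       = qc * (t - s) * (ray 0 * f s `^ (2 / q)).
      by field; rewrite !gt_eqF//= subr_gt0.
    rewrite [leLHS]mulrAC ler_pM2l; last by apply: mulr_gt0 => //; rewrite subr_gt0.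
    by move: rs; rewrite {1}/ray ler_pdivrMr.
  have c5 : f s `^ (2 / q) / f t `^ (2 / q) - 1 <= 2 * f a / f b ^+ 2 * (f s - f t).
    have r1 := ratio _ _ fs ft fts.
    have r3 : f s ^+ 2 / f t ^+ 2 - 1 <= 2 * f a / f b ^+ 2 * (f s - f t).
      have -> : f s ^+ 2 / f t ^+ 2 - 1 = ((f s + f t) / f t ^+ 2) * (f s - f t).
        by field; rewrite gt_eqF.
      rewrite ler_wpM2r ?subr_ge0// ler_pM ?invr_ge0 ?sqr_ge0//; try lra.
      by rewrite lef_pV2 ?posrE ?exprn_gt0// ler_sqr ?nnegrE; lra.
    by move: r1 r3; lra.
  have kp : 0 <= qc * (t - s) * ray 0 by apply: mulr_ge0 => //; apply: mulr_ge0; rewrite ?(ltW qc0)// subr_ge0 ltW.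
  have := ler_wpM2l kp c5.
  by move: c4; rewrite !mulrBr !mulr1 !mulrA; lra.
Qed.

Let f_lip s t : 0 <= s -> s <= t -> f s - f t <= qc * g 0 * (t - s).
Proof.
move=> s0; rewrite le_eqVlt => /predU1P[->|st]; first by rewrite !subrr mulr0.
apply: le_trans (diss_le s0 st) _; rewrite ler_wpM2r ?subr_ge0 ?(ltW st)//.
by rewrite ler_wpM2l ?(ltW qc0)// g_le.
Qed.

Let root_as_power t : 0 <= t -> f t `^ q^-1 = (f t `^ e) `^ (e * q)^-1.
Proof. by move=> t0; rewrite -powRrM invfM mulrA mulfV// mul1r. Qed.

(** [sqrt g] and [f ^ (1 / q)] are the two norms of the solution; their ratio is
    the square root of the Rayleigh quotient, which lies between [C ^ -2] and its
    initial value. *)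
Lemma g_bounds t : 0 <= t -> 0 < f t ->
  C^-1 * f t `^ q^-1 <= Num.sqrt (g t) <= Num.sqrt (ray 0) * f t `^ q^-1.
Proof.
move=> t0 ft; have gE : g t = ray t * (f t `^ q^-1) ^+ 2.
  rewrite -powR_mulrn ?powR_ge0// -powRrM (mulrC q^-1) /ray divfK// gt_eqF// powR_gt0//.
have rt := rayleigh_ge t0 ft; have r0 := rayleigh_noninc (lexx 0) t0 ft.
have N0 := powR_ge0 (f t) q^-1.
have rt0 : 0 <= ray t by apply: le_trans rt; rewrite invr_ge0 sqr_ge0.
rewrite gE sqrtrM// sqrtr_sqr ger0_norm// !ler_wpM2r ?ler_wsqrtr// ?andbT.
by rewrite -[C^-1]ger0_norm ?invr_ge0 ?(ltW C0)// -sqrtr_sqr ler_wsqrtr// exprVn.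
Qed.

(** Here [e < 0], so [slope] makes [f ^ e] grow linearly. As the slope is only
    known while [f > 0], a vanishing of [f] has to be excluded first: before its
    first zero [f ^ e] is bounded, hence [f] is bounded below. *)
Lemma slow_decay : q < 2 -> exists A B, [/\ 0 < A, 0 < B &
  forall t, 0 <= t -> 0 < f t /\
   A * (t + 1) `^ (- (2 - q)^-1) <= f t `^ q^-1 <= B * (t + 1) `^ (- (2 - q)^-1)].
Proof.
move=> qlt2.
have en : e < 0 by rewrite subr_lt0 ltr_pdivlMr// mul1r.
pose k1 := - e * (qc * (C ^+ 2)^-1); pose k2 := - e * (qc * ray 0).
have ne : 0 < - e by rewrite oppr_gt0.
have k1p : 0 < k1 by rewrite mulr_gt0// divr_gt0// exprn_gt0.
have k2p : 0 < k2 by rewrite mulr_gt0// mulr_gt0.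
have yb t : 0 <= t -> 0 < f t ->
    f 0 `^ e + k1 * t <= f t `^ e <= f 0 `^ e + k2 * t.
  move=> t0 ft; have /andP[] := slope (lexx 0) t0 ft; rewrite subr0 /Y -mulrBl.
  rewrite ler_ndivlMr// ler_ndivrMr// /k1 /k2 => h1 h2.
  by apply/andP; split; lra.
have fpos t : 0 <= t -> 0 < f t.
  move=> t0; rewrite ltNge; apply/negP => ft.
  pose S := [set s | 0 <= s /\ f s <= 0].
  have infS : has_inf S by split; [exists t|exists 0 => s []].
  pose T := inf S.
  have T0 : 0 <= T by apply: lb_le_inf; [exists t|move=> s []].
  have Tt : T <= t by apply: ge_inf => //; exists 0 => s [].
  have fT s : 0 <= s -> s < T -> 0 < f s.
    move=> s0 sT; rewrite ltNge; apply/negP => fs; move: sT; rewrite ltNge => /negP; apply.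
    by apply: ge_inf; [exists 0 => r []|].
  have fT0 : f T <= 0.
    rewrite leNgt; apply/negP => fT0.
    have d0 : 0 < f T / (qc * g 0 + 1).
      by rewrite divr_gt0// ltr_pwDr// mulr_ge0 ?(ltW qc0)// g_ge0.
    have [s [s0 fs] sT] := inf_adherent d0 infS.
    have Ts : T <= s by apply: ge_inf => //; exists 0 => r [].
    have := f_lip T0 Ts; rewrite leNgt => /negP; apply.
    have sT' : s - T < f T / (qc * g 0 + 1) by rewrite ltrBlDl.
    have D : 0 < qc * g 0 + 1 by rewrite ltr_pwDr// mulr_ge0 ?(ltW qc0)// g_ge0.
    have gg : 0 <= qc * g 0 by rewrite mulr_ge0 ?(ltW qc0)// g_ge0.
    apply: (@lt_le_trans _ _ (f T)); last by lra.
    apply: (@le_lt_trans _ _ ((qc * g 0 + 1) * (s - T))).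
      by rewrite ler_wpM2r// ?subr_ge0//; lra.
    by move: sT'; rewrite ltr_pdivlMr// mulrC.
  (* The upper bound on f ^ e before T keeps f away from 0, against f T = 0. *)
  pose M := f 0 `^ e + k2 * t.
  have M0 : 0 < M by rewrite ltr_pwDl ?powR_gt0// mulr_ge0// ltW.
  pose c := M `^ e^-1.
  have c0 : 0 < c by rewrite powR_gt0.
  have fc s : 0 <= s -> s < T -> c <= f s.
    move=> s0 sT; have fs := fT _ s0 sT; have /andP[_ h] := yb _ s0 fs.
    have h' : f s `^ e <= M by apply: le_trans h _; rewrite /M lerD2l ler_pM2l//; lra.
    have -> : f s = (f s `^ e) `^ e^-1 by rewrite -powRrM mulfV// powRr1// ltW.
    rewrite /c -[e^-1]opprK (powRN M (- e^-1)) (powRN (f s `^ e) (- e^-1)) lef_pV2 ?posrE ?powR_gt0//.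
    by rewrite ge0_ler_powR ?nnegrE ?powR_ge0 ?(ltW M0)// oppr_ge0 invr_le0 ltW.
  have Tp : 0 < T.
    rewrite lt_neqAle T0 andbT; apply/eqP => T00.
    by move: fT0; rewrite -T00 leNgt f0_gt0.
  have gg : 0 <= qc * g 0 by rewrite mulr_ge0 ?(ltW qc0)// g_ge0.
  pose d := Num.min (T / 2) (c / 2 / (qc * g 0 + 1)).
  have D : 0 < qc * g 0 + 1 by lra.
  have d0 : 0 < d by rewrite lt_min !divr_gt0.
  have dT : d <= T / 2 by rewrite ge_min lexx.
  have s0 : 0 <= T - d by lra.
  have sT : T - d < T by lra.
  have := f_lip s0 (ltW sT); have := fc _ s0 sT.
  have : (qc * g 0 + 1) * d <= c / 2.
    by rewrite mulrC -ler_pdivlMr// ge_min lexx orbT.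
  have -> : T - (T - d) = d by lra.
  by rewrite mulrDl mul1r; lra.
have eqE : (e * q)^-1 = - (2 - q)^-1.
  by rewrite -invrN opprB /e mulrBl mul1r divfK// gt_eqF.
pose m1 := Num.min (f 0 `^ e) k1; pose m2 := Num.max (f 0 `^ e) k2.
have m10 : 0 < m1 by rewrite lt_min powR_gt0.
have m20 : 0 < m2 by rewrite lt_max powR_gt0.
exists (m2 `^ (- (2 - q)^-1)), (m1 `^ (- (2 - q)^-1)).
split; [by rewrite powR_gt0|by rewrite powR_gt0|].
move=> t t0; have ft := fpos _ t0; split => //.
have t1 : 0 < t + 1 by lra.
have /andP[h1 h2] := yb _ t0 ft.
have h1' : m1 * (t + 1) <= f t `^ e.
  apply: le_trans h1; rewrite mulrDr mulr1 addrC lerD ?ge_min ?lexx//.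
  by rewrite ler_wpM2r// ge_min lexx orbT.
have h2' : f t `^ e <= m2 * (t + 1).
  apply: le_trans h2 _; rewrite mulrDr mulr1 addrC lerD ?le_max ?lexx//.
  by rewrite ler_wpM2r// le_max lexx orbT.
have p0 : 0 <= (2 - q)^-1 by rewrite invr_ge0; lra.
have [A0 B0] : 0 < m1 * (t + 1) /\ 0 < m2 * (t + 1) by split; exact: mulr_gt0.
rewrite root_as_power// eqE -!powRM ?(ltW t1) ?(ltW m10) ?(ltW m20)// !powRN.
rewrite !lef_pV2 ?posrE ?powR_gt0//.
by rewrite !ge0_ler_powR ?nnegrE ?powR_ge0 ?(ltW A0) ?(ltW B0).
Qed.

(** Here [e > 0], so [slope] makes [f ^ e] decrease linearly, at a rate between
    two positive constants, until it vanishes at the supremum [T] of the times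
    of positivity. The bounds in terms of [T - t] are those of [slope] between
    [t] and times tending to [T]. *)
Lemma extinction : 2 < q -> exists T, [/\ 0 < T,
  forall t, 0 <= t -> (0 < f t) = (t < T),
  forall t, T <= t -> g t = 0 &
  forall t, 0 <= t ->
    (q - 2) / (q - 1) * (C ^+ 2)^-1 * Num.max (T - t) 0 <= f t `^ e
     <= (q - 2) / (q - 1) * ray 0 * Num.max (T - t) 0].
Proof.
move=> qgt2.
have ep : 0 < e by rewrite subr_gt0 ltr_pdivrMr// mul1r.
have kE : (q - 2) / (q - 1) = e * qc.
  by rewrite /e; field; rewrite subr_eq0 !gt_eqF.
rewrite !kE; pose k1 := e * qc * (C ^+ 2)^-1; pose k2 := e * qc * ray 0.
rewrite -/k1 -/k2.
have k1p : 0 < k1 by rewrite mulr_gt0 ?invr_gt0 ?exprn_gt0// mulr_gt0.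
have k2p : 0 < k2 by rewrite mulr_gt0// mulr_gt0.
have yb a b : 0 <= a -> a <= b -> 0 < f b ->
    k1 * (b - a) <= f a `^ e - f b `^ e <= k2 * (b - a).
  move=> a0 ab fb; have /andP[] := slope a0 ab fb; rewrite /Y -mulrBl.
  rewrite ler_pdivlMr// ler_pdivrMr// /k1 /k2 => h1 h2.
  by apply/andP; split; lra.
pose S := [set s | 0 <= s /\ 0 < f s].
have S0 : S 0 by [].
have ubS : has_ubound S.
  exists (f 0 `^ e / k1) => s [s0 fs]; have /andP[h _] := yb _ _ (lexx 0) s0 fs.
  rewrite ler_pdivlMr// mulrC; have := powR_ge0 (f s) e; rewrite subr0 in h; lra.
have supS : has_sup S by split => //; exists 0.
pose T := sup S.
have T0 : 0 <= T by apply: ub_le_sup.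
have gg : 0 <= qc * g 0 by rewrite mulr_ge0 ?(ltW qc0)// g_ge0.
have D : 0 < qc * g 0 + 1 by lra.
have fT : f T = 0.
  apply/eqP; rewrite eq_le f_ge0// andbT leNgt; apply/negP => fT.
  pose d := f T / 2 / (qc * g 0 + 1).
  have d0 : 0 < d by rewrite !divr_gt0.
  have : T + d <= T; last by lra.
  apply: ub_le_sup => //; split; first lra.
  have Td : T <= T + d by lra.
  have := f_lip T0 Td; have -> : T + d - T = d by lra.
  have : (qc * g 0 + 1) * d <= f T / 2 by rewrite mulrC divfK// gt_eqF.
  by rewrite mulrDl mul1r; lra.
have Tp : 0 < T.
  rewrite lt_neqAle T0 andbT; apply/eqP => T00.
  by move: fT; rewrite -T00 => f00; move: f0_gt0; rewrite f00 ltxx.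
have fpos t : 0 <= t -> t < T -> 0 < f t.
  move=> t0 tT; have dT : 0 < T - t by lra.
  have [s [s0 fs] ts] := sup_adherent dT supS.
  by apply: lt_le_trans fs _; apply: f_le => //; rewrite -/T in ts; lra.
have fz t : T <= t -> f t = 0.
  move=> Tt; apply/eqP; rewrite eq_le f_ge0 ?(le_trans T0)// andbT -fT.
  exact: f_le.
have small eps : 0 < eps -> exists2 b, 0 <= b < T & forall c, b <= c -> c < T -> f c <= eps.
  move=> e_0; pose d := Num.min T (eps / (qc * g 0 + 1)).
  have d0 : 0 < d by rewrite lt_min Tp divr_gt0.
  have dT : d <= T by rewrite ge_min lexx.
  exists (T - d); first by apply/andP; split; lra.
  move=> c bc cT; have c0 : 0 <= c by lra.
  have := f_lip c0 (ltW cT); rewrite fT subr0 => /le_trans; apply.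
  apply: (@le_trans _ _ ((qc * g 0 + 1) * d)).
    by apply: ler_pM => //; lra.
  by rewrite mulrC -ler_pdivlMr// ge_min lexx orbT.
exists T; split => //.
- move=> t t0; apply/idP/idP => [ft|]; last exact: fpos.
  by rewrite ltNge; apply/negP => /fz ft0; move: ft; rewrite ft0 ltxx.
- move=> t Tt; have t0 : 0 <= t by lra.
  apply/eqP; rewrite eq_le g_ge0// andbT; apply/ler_addgt0Pr => eps eps0; rewrite add0r.
  pose E := (eps / ray 0) `^ (q / 2).
  have E0 : 0 < E by rewrite powR_gt0// divr_gt0.
  have [b /andP[b0 bT] hb] := small _ E0.
  apply: (@le_trans _ _ (g b)); first by apply: g_le => //; lra.
  have fb := fpos _ b0 bT.
  have := rayleigh_noninc (lexx 0) b0 fb; rewrite {1}/ray ler_pdivrMr ?powR_gt0// => /le_trans; apply.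
  have q20 : 0 <= 2 / q by rewrite divr_ge0// ltW.
  rewrite mulrC -ler_pdivlMr//.
  have EE : E `^ (2 / q) = eps / ray 0.
    have qq : q / 2 * (2 / q) = 1 by field; rewrite gt_eqF.
    by rewrite /E -powRrM qq powRr1// divr_ge0// ltW.
  rewrite -EE; have fE : f b <= E by exact: hb.
  by rewrite ge0_ler_powR ?nnegrE ?(ltW fb) ?(ltW E0).
- move=> t t0; case: (ltP t T) => [tT|Tt]; last first.
    rewrite (max_idPr _) ?subr_le0// !mulr0 fz// powR0 ?lexx//.
  rewrite (max_idPl _) ?subr_ge0 ?(ltW tT)//.
  have ft := fpos _ t0 tT; apply/andP; split.
    apply/ler_addgt0Pr => eps eps0.
    pose b := Num.max t (T - eps / k1).
    have tb : t <= b by rewrite le_max lexx.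
    have b0 : 0 <= b by lra.
    have bT : b < T by rewrite gt_max tT gtrBl divr_gt0.
    have /andP[h _] := yb _ _ t0 tb (fpos _ b0 bT).
    have := powR_ge0 (f b) e.
    have : k1 * (T - b) <= eps.
      by rewrite mulrC -ler_pdivlMr// lerBlDr addrC -lerBlDr le_max lexx orbT.
    by move: h; rewrite !mulrBr; lra.
  apply/ler_addgt0Pr => eps eps0.
  pose E := eps `^ e^-1.
  have E0 : 0 < E by rewrite powR_gt0.
  have [b' /andP[b'0 b'T] hb] := small _ E0.
  pose b := Num.max t b'.
  have tb : t <= b by rewrite le_max lexx.
  have b0 : 0 <= b by lra.
  have bT : b < T by rewrite gt_max tT.
  have b'b : b' <= b by rewrite le_max lexx orbT.
  have fb := fpos _ b0 bT.
  have /andP[_ h] := yb _ _ t0 tb fb.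
  have : f b `^ e <= eps.
    have -> : eps = E `^ e by rewrite /E -powRrM mulVf// powRr1// ltW.
    by rewrite ge0_ler_powR ?nnegrE ?(ltW fb) ?(ltW E0) ?(ltW ep)//; exact: hb.
  have : k2 * (b - t) <= k2 * (T - t) by rewrite ler_pM2l//; lra.
  lra.
Qed.

End decay.

(** * Smooth bump functions *)

Section smooth1.
Context {R : realType}.
Implicit Types f g : R -> R.

(** Infinite differentiability in the form in which closure under products is
    an induction. *)
Fixpoint Ck (n : nat) (f : R -> R) : Prop :=
  if n is m.+1 then (forall t, derivable f t 1) /\ Ck m (derive1 f) else True.

Definition Csmooth f := forall n, Ck n f.

Lemma CkS n f : Ck n.+1 f -> Ck n f.
Proof. by elim: n f => [//|n IH] f [df /IH Cf]; split. Qed.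

Lemma Ck_add n f g : Ck n f -> Ck n g -> Ck n (f \+ g).
Proof.
elim: n f g => [//|n IH] f g [df Cf] [dg Cg]; split=> [t|]; first exact: derivableD.
rewrite (_ : derive1 _ = (derive1 f) \+ (derive1 g)); first exact: IH.
by apply/funext => t; rewrite /= !derive1E deriveD.
Qed.

Lemma Ck_mul n f g : Ck n f -> Ck n g -> Ck n (f \* g).
Proof.
elim: n f g => [//|n IH] f g Cf Cg; have [df Cf'] := Cf; have [dg Cg'] := Cg.
split=> [t|]; first exact: derivableM.
rewrite (_ : derive1 _ = (f \* (derive1 g)) \+ (g \* (derive1 f))).
  by apply: Ck_add; apply: IH => //; exact: CkS.
by apply/funext => t; rewrite /= !derive1E deriveM.
Qed.

Lemma Ck_cst n (c : R) : Ck n (cst c).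
Proof.
elim: n c => [//|n IH] c; split=> [t|]; first exact: derivable_cst.
by rewrite (_ : derive1 _ = cst 0)//; apply/funext => t; rewrite derive1_cst.
Qed.

Lemma derivable_affine f (k a t : R) : derivable f (k * t + a) 1 ->
  is_derive t 1 (fun x => f (k * x + a)) (k * (derive1 f) (k * t + a)).
Proof.
move=> df.
have h : is_derive t 1 (fun x : R => k * x + a) k.
  have h0 : is_derive t 1 ((k \*: id) \+ cst a : R -> R) (k *: 1 + 0) by apply: is_deriveD.
  by rewrite addr0 [_ *: _]mulr1 in h0.
rewrite mulrC.
have df' : is_derive (k * t + a) 1 f ((derive1 f) (k * t + a)).
  by rewrite derive1E; apply: DeriveDef.
exact: (@is_derive1_comp _ f (fun x : R => k * x + a) t _ _ df' h).
Qed.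

Lemma Ck_affine n f (k a : R) : Ck n f -> Ck n (fun x => f (k * x + a)).
Proof.
elim: n f => [//|n IH] f [df Cf]; split=> [t|].
  by have [] := derivable_affine (df (k * t + a)).
rewrite (_ : derive1 _ = (cst k) \* (fun x => (derive1 f) (k * x + a))).
  by apply: Ck_mul; [exact: Ck_cst|exact: IH].
apply/funext => t; rewrite derive1E /=.
by have [_ ->] := derivable_affine (df (k * t + a)).
Qed.

Lemma Csmooth_derivable f : Csmooth f -> forall n t, derivable (derive1n n f) t 1.
Proof.
move=> Cf n; have := Cf n.+1; elim: n f {Cf} => [|n IH] f [df Cf] t; first exact: df.
by rewrite derive1Sn; apply: IH.
Qed.

Lemma Csmooth_derive1n f n : Csmooth f -> Csmooth (derive1n n f).
Proof.
elim: n f => [//|n IH] f Cf; rewrite derive1Sn; apply: IH => m.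
by have [] := Cf m.+1.
Qed.

Lemma Csmooth_continuous f : Csmooth f -> continuous f.
Proof.
move=> Cf t; have [df _] := Cf 1%N.
exact/differentiable_continuous/derivable1_diffP.
Qed.

End smooth1.

Section flat.
Context {R : realType}.
Variable c : R.
Hypothesis c0 : 0 < c.

(** The functions [p(1/x) exp(-c/x)], extended by zero to [x <= 0], are stable
    under differentiation; hence they are smooth. The parameter [c] tends to 0
    when indicator functions are approximated. *)
Definition flat (p : {poly R}) (x : R) : R :=
  if 0 < x then p.[x^-1] * expR (- (c / x)) else 0.

Definition flat_deriv (p : {poly R}) : {poly R} := 'X^2 * (c *: p - p^`()).

Lemma poly_bound (p : {poly R}) : exists2 K : R, 0 <= K &
  forall y, 1 <= y -> `|p.[y]| <= K * y ^+ size p.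
Proof.
exists (\sum_(i < size p) `|p`_i|); first exact: sumr_ge0.
move=> y y1; rewrite horner_coef mulr_suml (le_trans (ler_norm_sum _ _ _))//.
apply: ler_sum => i _; rewrite normrM ler_wpM2l// normrX ger0_norm; last by lra.
exact: ler_weXn2l (ltnW (ltn_ord i)).
Qed.

Lemma flat_bound (p : {poly R}) : exists2 K : R, 0 <= K &
  forall h, h <= 1 -> `|flat p h| <= K * h ^+ 2.
Proof.
have [K K0 pK] := poly_bound p; set n := size p in pK.
have M0 : 0 <= (n.+2)`!%:R / c ^+ n.+2 by rewrite divr_ge0// exprn_ge0// ltW.
exists (K * ((n.+2)`!%:R / c ^+ n.+2)); first exact: mulr_ge0.
move=> h h1; rewrite /flat; case: ifPn => h0; last by rewrite normr0 mulr_ge0 ?sqr_ge0// mulr_ge0.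
have y1 : 1 <= h^-1 by rewrite invf_ge1.
have ch : 0 <= c / h by rewrite divr_ge0// ltW.
have e1 : expR (- (c / h)) <= (n.+2)`!%:R / (c / h) ^+ n.+2.
  rewrite expRN -[leRHS]invf_div lef_pV2 ?posrE ?expR_gt0 ?divr_gt0 ?exprn_gt0 ?divr_gt0 ?ltr0n ?fact_gt0//.
  by have := expR_ge1Dxn n.+1 ch; lra.
rewrite normrM (ger0_norm (expR_ge0 _)).
apply: (@le_trans _ _ (K * h^-1 ^+ n * ((n.+2)`!%:R / (c / h) ^+ n.+2))).
  by apply: ler_pM => //; exact: pK.
rewrite le_eqVlt; apply/orP; left; apply/eqP.
rewrite expr_div_n exprVn -[in h ^+ n.+2]addn2 exprD.
by field; rewrite !expf_neq0 ?gt_eqF.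
Qed.

(** Away from 0 this is the chain rule; at 0 the difference quotient is bounded
    by a multiple of [h], since the exponential beats every power. *)
Lemma is_derive_flat (p : {poly R}) (x : R) :
  is_derive x 1 (flat p) (flat (flat_deriv p) x).
Proof.
have [x0|x0|->] := ltgtP x 0.
- rewrite [X in is_derive _ _ _ X]/flat ltNge (ltW x0)/=.
  apply: (@near_eq_is_derive _ _ _ (cst 0)) => //.
  near=> y; rewrite /flat ltNge ifF//; apply/negbF.
  by apply: ltW; near: y; exact: lt_nbhsl.
- rewrite [X in is_derive _ _ _ X]/flat x0.
  apply: (@near_eq_is_derive _ _ _ (fun y : R => p.[y^-1] * expR (- (c / y)))) => //.
  + by near=> y; rewrite /flat ifT//; near: y; apply: (cvgr_gt x) => //; exact: cvg_id.
  + have dV : is_derive x 1 (fun y : R => y^-1) (- x ^- 2).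
      have dV := @is_deriveV _ id x 1 1 (lt0r_neq0 x0) (is_derive_id x 1).
      by rewrite [_ *: 1]mulr1 in dV.
    have dp : is_derive x 1 (fun y : R => p.[y^-1]) (p^`().[x^-1] * (- x ^- 2)).
      exact: (is_derive1_comp (is_derive_poly p x^-1) dV).
    have de : is_derive x 1 (fun y : R => - (c / y)) (- (c *: - x ^- 2)).
      exact: is_deriveN (is_deriveZ c dV).
    have dE : is_derive x 1 (fun y : R => expR (- (c / y))) (expR (- (c / x)) * (- (c *: - x ^- 2))).
      exact: (is_derive1_comp (is_derive_expR _) de).
    apply: (is_derive_eq (is_deriveM dp dE)).
    rewrite /flat_deriv !hornerE /= /GRing.scale/= !exprVn.
    by field; rewrite gt_eqF.
- rewrite [X in is_derive _ _ _ X]/flat ltxx.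
  have [K K0 fK] := flat_bound p.
  apply/is_derive1_caratheodory; exists (fun z => flat p z / z); split.
  + move=> z; rewrite [flat p 0]/flat ltxx !subr0.
    have [->|z0] := eqVneq z 0; first by rewrite mulr0 /flat ltxx.
    by rewrite divfK.
  + rewrite /prop_for /continuous_at invr0 mulr0.
    apply/cvgr0Pnorm_le => e e0.
    near=> z; have [z0|z0] := leP z 0.
      by rewrite /flat ltNge z0/= mul0r normr0 ltW.
    have z1 : z <= 1 by near: z; apply: nbhs0_ltW; exact: ltr01.
    rewrite normrM normfV (gtr0_norm z0) ler_pdivrMr//.
    apply: le_trans (fK _ z1) _; rewrite expr2 mulrA ler_wpM2r ?(ltW z0)//.
    have ze : z <= e / (K + 1).
      by near: z; apply: nbhs0_ltW; rewrite divr_gt0// ltr_pwDr.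
    have K1 : 0 < K + 1 by rewrite ltr_pwDr.
    apply: (@le_trans _ _ ((K + 1) * z)); last by rewrite mulrC -ler_pdivlMr.
    by rewrite ler_wpM2r ?(ltW z0)// lerDl.
  + by rewrite invr0 mulr0.
Unshelve. all: by end_near. Qed.

Lemma Csmooth_flat (p : {poly R}) : Csmooth (flat p).
Proof.
move=> n; elim: n p => [//|n IH] p; split=> [t|].
  by have [] := is_derive_flat p t.
rewrite (_ : derive1 _ = flat (flat_deriv p)); first exact: IH.
by apply/funext => t; rewrite derive1E; have [_ ->] := is_derive_flat p t.
Qed.

End flat.

Section product_bump.
Context {R : realType} {n : nat}.
Implicit Types b : 'I_n -> R -> R.

(** Functions of product form; their iterated partial derivatives are again of
    product form, so only one-dimensional smoothness is at stake. *)
Definition tensor b (x : 'rV[R]_n) : R := \prod_i b i (x ord0 i).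

Lemma tensor_continuous b : (forall i, continuous (b i)) -> continuous (tensor b).
Proof.
move=> cb; have C (i : 'I_n) : predT i -> continuous (fun x : 'rV[R]_n => b i (x ord0 i)); last first.
  exact: (@continuous_big R 'I_n *%R 1 predT (@mul_continuous R) _ (index_enum _) _ C).
move=> _ x; apply: (@continuous_comp _ _ _ (fun v : 'rV[R]_n => v ord0 i) (b i)).
  exact: coord_continuous.
exact: cb.
Qed.

Lemma is_derive_tensor b (i : 'I_n) (x : 'rV[R]_n) :
  (forall t, derivable (b i) t 1) ->
  is_derive x (delta_mx ord0 i) (tensor b)
    (tensor (fun j => if j == i then derive1 (b j) else b j) x).
Proof.
move=> db; pose K := \prod_(j | j != i) b j (x ord0 j).
have E (h : R) : tensor b (h *: delta_mx ord0 i + x) = K * b i (h *: 1 + x ord0 i).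
  rewrite /tensor (bigD1 i)//= mulrC; congr (_ * b i _); last by rewrite !mxE !eqxx.
  by apply: eq_bigr => j ji; rewrite !mxE (negbTE ji) andbF mulr0 add0r.
have E0 : tensor b x = K * b i (x ord0 i).
  by have := E 0; rewrite !scale0r !add0r.
have -> : tensor (fun j => if j == i then derive1 (b j) else b j) x = K * derive1 (b i) (x ord0 i).
  rewrite /tensor (bigD1 i)//= eqxx mulrC; congr (_ * _).
  by apply: eq_bigr => j ji; rewrite (negbTE ji).
have H : h^-1 *: (tensor b (h *: delta_mx ord0 i + x) - tensor b x) @[h --> 0^'] -->
    K * derive1 (b i) (x ord0 i).
  rewrite (_ : (fun h => _) = fun h => K * (h^-1 *: (b i (h *: 1 + x ord0 i) - b i (x ord0 i)))); last first.
    by apply/funext => h; rewrite E E0 -mulrBr -scalerAr.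
  by apply: cvgMr; rewrite derive1E; exact: db.
by apply: DeriveDef; [apply/cvg_ex; eexists; exact: H|exact: cvg_lim H].
Qed.

Lemma iter_pderiv_tensor b (s : seq 'I_n) : (forall i, Csmooth (b i)) ->
  iter_pderiv s (tensor b) = tensor (fun i => derive1n (count_mem i s) (b i)).
Proof.
move=> sb; elim: s => [//|i s IH]; rewrite /= -/(iter_pderiv s _) IH.
apply/funext => x; rewrite /pderiv.
have := @is_derive_tensor (fun i => derive1n (count_mem i s) (b i)) i x.
move=> /(_ (fun t => @Csmooth_derivable _ _ (sb i) _ t)) [_ ->].
rewrite /tensor; apply: eq_bigr => j _; rewrite eq_sym.
by have [_|//] := eqVneq i j; rewrite add1n derive1nS.
Qed.

Lemma smooth_tensor b : (forall i, Csmooth (b i)) -> smooth (tensor b).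
Proof.
move=> sb s; rewrite iter_pderiv_tensor//; split=> [|i x].
  by apply: tensor_continuous => i; apply: Csmooth_continuous; exact: Csmooth_derive1n.
by have [] := @is_derive_tensor (fun i => derive1n (count_mem i s) (b i)) i x (fun t => @Csmooth_derivable _ _ (sb i) _ t).
Qed.

End product_bump.

Section smooth_bump.
Context {R : realType}.
Implicit Types a b c x : R.

(** A smooth approximation of the indicator function of the interval [(a, b)],
    which is reached pointwise as [c] tends to 0. *)
Definition smooth_bump (c a b : R) (x : R) : R := flat c 1 (x - a) * flat c 1 (b - x).

Lemma Csmooth_bump c a b : 0 < c -> Csmooth (smooth_bump c a b).
Proof.
move=> c0 m; have F := Csmooth_flat c0 1 m.
have F1 := Ck_affine 1 (- a) F; have F2 := Ck_affine (-1) b F.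
have := Ck_mul F1 F2; rewrite (_ : _ \* _ = smooth_bump c a b)//.
by apply/funext => x; rewrite /smooth_bump/= mul1r mulN1r (addrC (- x)).
Qed.

Lemma bump_ge0 c a b x : 0 <= smooth_bump c a b x.
Proof.
rewrite /smooth_bump /flat mulr_ge0//; case: ifP => // _; rewrite hornerC mul1r; exact: expR_ge0.
Qed.

Lemma bump_le1 c a b x : 0 < c -> smooth_bump c a b x <= 1.
Proof.
move=> c0; rewrite /smooth_bump mulr_ile1//.
- by rewrite /flat; case: ifP => // _; rewrite hornerC mul1r; exact: expR_ge0.
- by rewrite /flat; case: ifP => // _; rewrite hornerC mul1r; exact: expR_ge0.
- rewrite /flat; case: ifPn => // x0; rewrite hornerC mul1r -expR0 ler_expR oppr_le0.
  by rewrite divr_ge0// ltW.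
- rewrite /flat; case: ifPn => // x0; rewrite hornerC mul1r -expR0 ler_expR oppr_le0.
  by rewrite divr_ge0// ltW.
Qed.

Lemma bump_neq0 c a b x : (smooth_bump c a b x != 0) = (a < x < b).
Proof.
rewrite /smooth_bump /flat mulf_eq0 negb_or !subr_gt0.
case: ifP => [ax|]; last by rewrite eqxx.
by rewrite hornerC mul1r (gt_eqF (expR_gt0 _))/=; case: ifP; rewrite ?eqxx// hornerC mul1r (gt_eqF (expR_gt0 _)).
Qed.

Lemma cvg_bump a b x :
  smooth_bump (m.+1%:R^-1) a b x @[m --> \oo] --> (\1_(`]a, b[%classic) x : R).
Proof.
have [/andP[ax xb]|] := boolP (a < x < b); last first.
  move=> h; rewrite indicE memNset/=; last by rewrite in_itv/=; exact/negP.
  rewrite (_ : (fun m => _) = cst 0); first exact: cvg_cst.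
  by apply/funext => m; apply/eqP; apply: contraNT h; rewrite bump_neq0.
rewrite indicE mem_set/=; last by rewrite in_itv/= ax.
have -> : (fun m : nat => smooth_bump m.+1%:R^-1 a b x) =
    (fun m : nat => expR (- ((x - a)^-1 + (b - x)^-1) * m.+1%:R^-1)).
  apply/funext => m; rewrite /smooth_bump /flat !subr_gt0 ax xb !hornerC !mul1r -expRD.
  by congr expR; ring.
rewrite [X in _ --> X](_ : _ = expR (- ((x - a)^-1 + (b - x)^-1) * 0)); last by rewrite mulr0 expR0.
apply: (@cvg_comp _ _ _ _ expR); last exact: continuous_expR.
apply: cvgMr; exact: cvg_harmonic.
Qed.

End smooth_bump.

(** * Semi-inner products, boxes and square-integrable functions *)

Section semi_inner.
Context {R : realType} {T : Type}.
Variables (P : set (T -> R)) (B : (T -> R) -> (T -> R) -> R).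
Implicit Types u v w : T -> R.
Hypothesis Plin : forall a u v, P u -> P v -> P (fun x => a * u x + v x).
Hypothesis Blin : forall a u v w, P u -> P v -> P w ->
  B (fun x => a * u x + v x) w = a * B u w + B v w.
Hypothesis BC : forall u v, B u v = B v u.
Hypothesis B0 : forall u, 0 <= B u u.
Let N u := Num.sqrt (B u u).

Let B_expand a u v : P u -> P v ->
  B (fun x => a * u x + v x) (fun x => a * u x + v x) = a ^+ 2 * B u u + 2 * a * B u v + B v v.
Proof.
move=> Pu Pv; have Pw := Plin a Pu Pv.
by rewrite Blin// (BC u) (BC v) !Blin// (BC v u); ring.
Qed.

(** Only a semi-inner product on a class of functions is at hand: two functions
    may differ on a null set. The discriminant argument needs a separate case
    when [B u u = 0]. *)
Lemma semi_inner_cauchy_schwarz u v : P u -> P v -> `|B u v| <= N u * N v.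
Proof.
move=> Pu Pv; rewrite /N -sqrtrM// -sqrtr_sqr ler_wsqrtr//.
have Q t : 0 <= t ^+ 2 * B u u + 2 * t * B u v + B v v by rewrite -B_expand.
have [A0|An] := eqVneq (B u u) 0.
  rewrite A0 mul0r; have [->|Bn] := eqVneq (B u v) 0; first by rewrite expr0n.
  have := Q (- (B v v + 1) / (2 * B u v)); rewrite A0 mulr0 add0r.
  have -> : 2 * (- (B v v + 1) / (2 * B u v)) * B u v = - (B v v + 1) by field.
  lra.
have := ler_wpM2l (B0 u) (Q (- B u v / B u u)).
have -> : B u u * ((- B u v / B u u) ^+ 2 * B u u + 2 * (- B u v / B u u) * B u v + B v v) =
  B u u * B v v - B u v ^+ 2 by field.
by rewrite mulr0 subr_ge0.
Qed.

Lemma semi_inner_norm_lin a u v : P u -> P v ->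
  N (fun x => a * u x + v x) <= `|a| * N u + N v.
Proof.
move=> Pu Pv; have Nu := sqrtr_ge0 (B u u); have Nv := sqrtr_ge0 (B v v).
have S0 : 0 <= `|a| * N u + N v by rewrite addr_ge0// mulr_ge0.
rewrite -(ger0_norm S0) -sqrtr_sqr ler_wsqrtr// B_expand//.
rewrite sqrrD exprMn real_normK ?num_real// /N !sqr_sqrtr// lerD2r lerD2l.
rewrite -[leRHS]mulr_natl -!mulrA ler_pM2l//.
apply: le_trans (ler_norm _) _; rewrite normrM ler_wpM2l//.
exact: semi_inner_cauchy_schwarz.
Qed.

End semi_inner.

Section box_generation.
Context {R : realType} {n : nat}.
Local Notation leb := (lebesgue_rV R n).

Definition obox (a b : 'I_n -> R) : set 'rV[R]_n := box (fun i => `]a i, b i[%classic).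
Definition cbox (a b : 'I_n -> R) : set 'rV[R]_n := box (fun i => `[a i, b i]%classic).

Lemma measurable_obox a b : measurable (obox a b).
Proof. by apply: measurable_box => i; exact: measurable_itv. Qed.

Lemma measurable_cbox a b : measurable (cbox a b).
Proof. by apply: measurable_box => i; exact: measurable_itv. Qed.

Lemma obox_cbox a b : obox a b `<=` cbox a b.
Proof. by move=> x xab i; have := xab i; rewrite /= !in_itv/= => /andP[/ltW -> /ltW ->]. Qed.

Definition oboxes : set (set 'rV[R]_n) := [set A | exists a b, A = obox a b].

Lemma oboxI a b c d :
  obox a b `&` obox c d = obox (fun i => Num.max (a i) (c i)) (fun i => Num.min (b i) (d i)).
Proof.
apply/seteqP; split=> x.
  by move=> [xab xcd] i; have := xab i; have := xcd i; rewrite /= !in_itv/= gt_max lt_min => /andP[-> ->] /andP[-> ->].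
move=> h; split=> i; have := h i; rewrite /= !in_itv/= gt_max lt_min;
  by move=> /andP[/andP[h1 h2] /andP[h3 h4]]; apply/andP.
Qed.

Lemma oboxes_setI_closed : setI_closed oboxes.
Proof. by move=> _ _ [a [b ->]] [c [d ->]]; rewrite oboxI; do 2 eexists. Qed.

Lemma oboxes_cover : \bigcup_k obox (fun=> - k%:R) (fun=> k%:R) = setT.
Proof.
rewrite -subTset => x _; exists (Num.truncn `|x|).+1 => // i /=.
rewrite in_itv/= -ltr_norml (le_lt_trans (rV_norm_coord x i))//.
exact: truncnS_gt.
Qed.

Lemma rV_measurable_oboxes : @measurable _ 'rV[R]_n = <<s oboxes >>.
Proof.
apply/seteqP; split; last first.
  by apply: smallest_sub; [exact: sigma_algebra_measurable|move=> _ [a [b ->]]; exact: measurable_obox].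
have mc (i : 'I_n) : measurable_fun [set: g_sigma_algebraType oboxes]
    (fun v : g_sigma_algebraType oboxes => (v : 'rV[R]_n) ord0 i).
  apply: (measurability _ (RGenOpens.measurableE R)) => _ [_ [c [d ->]] <-].
  rewrite setTI.
  rewrite (_ : _ @^-1` _ = \bigcup_k (obox (fun j => if j == i then c else - k%:R)
                                           (fun j => if j == i then d else k%:R))).
    by apply: bigcupT_measurable => k; apply: sub_sigma_algebra; do 2 eexists.
  apply/seteqP; split=> [x /= xcd|x [k _ xk] /=]; last first.
    by have := xk i; rewrite eqxx.
  have : [set: 'rV[R]_n] x by [].
  rewrite -oboxes_cover => -[k _ xk]; exists k => // j.
  by case: ifPn => [/eqP->|_]; [exact: xcd|exact: xk].
move=> A mA.
suff : measurable_fun [set: g_sigma_algebraType oboxes] (fun v : g_sigma_algebraType oboxes => (v : 'rV[R]_n)).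
  by move=> /(_ measurableT A mA); rewrite setTI.
by apply/measurable_fun_rVP.
Qed.

Section mass.
Variable h : 'rV[R]_n -> \bar R.
Hypotheses (mh : measurable_fun setT h) (h0 : forall x, (0 <= h x)%E).

Definition mass (A : set 'rV[R]_n) : \bar R := (\int[leb]_(x in A) h x)%E.

Let mass0 : mass set0 = 0%E. Proof. exact: integral_set0. Qed.

Let mass_ge0 A : (0 <= mass A)%E.
Proof. by apply: integral_ge0 => x _. Qed.

Let mass_additive : semi_sigma_additive mass.
Proof.
move=> F mF tF mUF; apply: semi_sigma_additive_nng_induced => //.
Qed.

Definition mass_measure : {measure set 'rV[R]_n -> \bar R} :=
  HB.pack mass (isMeasure.Build _ _ _ mass mass0 mass_ge0 mass_additive).

End mass.

(** Open boxes form a pi-system generating the Borel sets, so an integrable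
    function is determined by its integrals over them. *)
Lemma integrable_ae0_of_obox (h : 'rV[R]_n -> R) :
  leb.-integrable setT (EFin \o h) ->
  (forall a b, \int[leb]_(x in obox a b) (h x)%:E = 0)%E ->
  {ae leb, forall x, h x = 0}.
Proof.
move=> ih h0; set H := EFin \o h.
have mH : measurable_fun setT H by exact: measurable_int ih.
have mp : measurable_fun setT (H^\+)%E by exact: measurable_funepos.
have mn : measurable_fun setT (H^\-)%E by exact: measurable_funeneg.
have fin A : measurable A -> (\int[leb]_(x in A) H^\- x < +oo)%E.
  move=> mA; have : leb.-integrable A (H^\-)%E by apply: integrable_funeneg => //; exact: integrableS ih.
  by move=> /integrable_lty; apply.
have finp A : measurable A -> (\int[leb]_(x in A) H^\+ x < +oo)%E.
  move=> mA; have : leb.-integrable A (H^\+)%E by apply: integrable_funepos => //; exact: integrableS ih.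
  by move=> /integrable_lty; apply.
have eqb A : oboxes A -> (\int[leb]_(x in A) H^\+ x = \int[leb]_(x in A) H^\- x)%E.
  move=> [a [b ->]]; have : (\int[leb]_(x in obox a b) H x = 0)%E by exact: h0.
  rewrite integralE => /eqP.
  rewrite sube_eq ?add0e; first by move/eqP.
    by rewrite ge0_fin_numE; [apply: finp; exact: measurable_obox|exact: integral_ge0].
  rewrite fin_num_adde_defl// ge0_fin_numE; [apply: fin; exact: measurable_obox|exact: integral_ge0].
pose mup := mass_measure mp (funepos_ge0 H).
pose mun := mass_measure mn (funeneg_ge0 H).
have eqm A : measurable A -> (\int[leb]_(x in A) H^\+ x = \int[leb]_(x in A) H^\- x)%E.
  move=> mA; apply: (@measure_unique _ _ _ oboxes (fun k : nat => obox (fun=> - k%:R) (fun=> k%:R))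
     rV_measurable_oboxes oboxes_setI_closed _ oboxes_cover mup mun) => //.
  - by move=> k; do 2 eexists.
  - by move=> k; apply: finp; exact: measurable_obox.
have := @integral_ae_eq _ _ _ leb setT measurableT (cst 0%E) H ih (measurable_cst _).
move=> /(_ _); case => [A _ mA|N [mN N0 NH]].
  rewrite integral0 integralE eqm// subee// ge0_fin_numE ?fin//.
  exact: integral_ge0.
exists N; split=> // x /= hx; apply: NH => /= hx0; apply: hx.
by have := hx0 I; rewrite /H /= => -[].
Qed.

End box_generation.

Section L2.
Context {R : realType} {d : nat}.
Local Notation E := 'rV[R]_d.
Local Notation leb := (lebesgue_rV R d).
Variable Omega : set E.
Hypothesis mO : measurable Omega.
Implicit Types f g h : E -> R.

Definition L2 f := fmem (Lq Omega 2) f.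

Lemma L2_measurable f : L2 f -> measurable_fun setT (f \_ Omega).
Proof. by rewrite /L2/= inE => /andP[]; rewrite inE. Qed.

Lemma L2P f : measurable_fun setT (f \_ Omega) ->
  (L2 f <-> (\int[leb]_(x in Omega) (f x ^+ 2)%:E < +oo)%E).
Proof.
move=> mf; have -> : (\int[leb]_(x in Omega) (f x ^+ 2)%:E =
    \int[leb]_x (((f \_ Omega) x) ^+ 2)%:E)%E.
  rewrite integral_mkcond; apply: eq_integral => x _.
  by rewrite !patchE; case: ifP => //; rewrite expr0n.
split=> [fL|fi].
  have := Lfun2_integrable_sqr fL; move=> /integrable_lty; exact.
rewrite /L2/= inE; apply/andP; split; rewrite inE//=.
rewrite /finite_norm unlock poweR_lty//.
move: fi; congr (_ < _)%E; apply: eq_integral => x _ /=.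
by rewrite powR_mulrn// real_normK// num_real.
Qed.

Lemma L2_lin a f g : L2 f -> L2 g -> L2 (fun x => a * f x + g x).
Proof.
move=> Lf Lg; rewrite /L2/=.
rewrite (_ : _ \_ Omega = a *: (f \_ Omega) + (g \_ Omega)).
  by apply: (@Lfun_submod_closed _ _ _ _ _ (lee1n 2)).2.
apply/funext => x; transitivity (a * (f \_ Omega) x + (g \_ Omega) x) => //.
by rewrite !patchE; case: ifP => // _; rewrite mulr0 addr0.
Qed.

Lemma L2_integrable_mul f g : L2 f -> L2 g -> leb.-integrable Omega (EFin \o (f \* g)).
Proof.
move=> Lf Lg; apply/(integrable_mkcond _ mO).
have := Lfun2_mul_Lfun1 Lf Lg => /Lfun1_integrable.
rewrite (_ : EFin \o _ = (EFin \o f \* g) \_ Omega)//.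
by apply/funext => x; rewrite !patchE /= !patchE; case: ifP => //; rewrite mulr0.
Qed.

Lemma L2_integrable_sqr f : L2 f -> leb.-integrable Omega (EFin \o (fun x => f x ^+ 2)).
Proof.
move=> Lf; have := L2_integrable_mul Lf Lf; apply: eq_integrable => // x _.
Qed.

Lemma Lq_norm2E f : L2 f -> Lq_norm Omega 2 f = Num.sqrt (\int[leb]_(x in Omega) (f x ^+ 2)).
Proof.
move=> Lf; rewrite /Lq_norm /Lq_norme unlock.
have -> : (\int[leb]_x (`|(EFin \o f \_ Omega) x| `^ 2) = \int[leb]_(x in Omega) (f x ^+ 2)%:E)%E.
  rewrite [RHS]integral_mkcond; apply: eq_integral => x _.
  rewrite !patchE /= !patchE; case: ifP => _.
    by rewrite powR_mulrn// real_normK// num_real.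
  by rewrite normr0 powR0.
rewrite /Rintegral.
have ge : (0 <= \int[leb]_(x in Omega) (f x ^+ 2)%:E)%E.
  by apply: integral_ge0 => x _; rewrite lee_fin sqr_ge0.
have fin : (\int[leb]_(x in Omega) (f x ^+ 2)%:E)%E \is a fin_num.
  by rewrite ge0_fin_numE//; exact: (L2P (L2_measurable Lf)).1 Lf.
rewrite -[in LHS](fineK fin) poweR_EFin/= -powR12_sqrt//.
by rewrite fine_ge0.
Qed.

Lemma Rintegral_sqr_ge0 f : 0 <= \int[leb]_(x in Omega) (f x ^+ 2).
Proof. by apply: Rintegral_ge0 => x _; exact: sqr_ge0. Qed.

Lemma L2_norm_sqr f : L2 f -> Lq_norm Omega 2 f ^+ 2 = \int[leb]_(x in Omega) (f x ^+ 2).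
Proof. by move=> Lf; rewrite Lq_norm2E// sqr_sqrtr// Rintegral_sqr_ge0. Qed.

Lemma L2_norm_ge0 f : L2 f -> 0 <= Lq_norm Omega 2 f.
Proof. by move=> Lf; rewrite Lq_norm2E// sqrtr_ge0. Qed.

Lemma L2_pair_lin a f g h : L2 f -> L2 g -> L2 h ->
  \int[leb]_(x in Omega) ((a * f x + g x) * h x) =
  a * \int[leb]_(x in Omega) (f x * h x) + \int[leb]_(x in Omega) (g x * h x).
Proof.
move=> Lf Lg Lh.
have i1 := L2_integrable_mul Lf Lh; have i2 := L2_integrable_mul Lg Lh.
rewrite -RintegralZl// -RintegralD//.
  by apply: eq_Rintegral => x _; rewrite mulrDl mulrA.
by have := integrableZl mO a i1; apply: eq_integrable.
Qed.

Lemma L2_norm_inner f : L2 f ->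
  Lq_norm Omega 2 f = Num.sqrt (\int[leb]_(x in Omega) (f x * f x)).
Proof. by move=> Lf; rewrite Lq_norm2E//; under eq_Rintegral do rewrite expr2. Qed.

Lemma L2_cauchy_schwarz f g : L2 f -> L2 g ->
  `|\int[leb]_(x in Omega) (f x * g x)| <= Lq_norm Omega 2 f * Lq_norm Omega 2 g.
Proof.
move=> Lf Lg.
rewrite !L2_norm_inner//.
apply: (semi_inner_cauchy_schwarz (P := L2) (B := fun f g => \int[leb]_(x in Omega) (f x * g x))) => //.
- exact: L2_lin.
- exact: L2_pair_lin.
- by move=> u v; apply: eq_Rintegral => x _; rewrite mulrC.
- by move=> u; have := Rintegral_sqr_ge0 u; under eq_Rintegral do rewrite expr2.
Qed.

Lemma L2_norm_lin a f g : L2 f -> L2 g ->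
  Lq_norm Omega 2 (fun x => a * f x + g x) <= `|a| * Lq_norm Omega 2 f + Lq_norm Omega 2 g.
Proof.
move=> Lf Lg; have Lh := L2_lin a Lf Lg; rewrite !L2_norm_inner//.
apply: (semi_inner_norm_lin (P := L2) (B := fun f g => \int[leb]_(x in Omega) (f x * g x))) => //.
- exact: L2_lin.
- exact: L2_pair_lin.
- by move=> u v; apply: eq_Rintegral => x _; rewrite mulrC.
- by move=> u; have := Rintegral_sqr_ge0 u; under eq_Rintegral do rewrite expr2.
Qed.

Lemma L2_pair_ae f g h : L2 f -> L2 g -> L2 h ->
  {ae leb, forall x, Omega x -> f x = g x} ->
  \int[leb]_(x in Omega) (f x * h x) = \int[leb]_(x in Omega) (g x * h x).
Proof.
move=> Lf Lg Lh fg; rewrite /Rintegral; congr fine; apply: ae_eq_integral => //.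
- exact: measurable_int (L2_integrable_mul Lf Lh).
- exact: measurable_int (L2_integrable_mul Lg Lh).
by apply: filterS fg => x fg Ox; rewrite fg.
Qed.

Lemma L2_norm_ae f g : L2 f -> L2 g ->
  {ae leb, forall x, Omega x -> f x = g x} -> Lq_norm Omega 2 f = Lq_norm Omega 2 g.
Proof.
move=> Lf Lg fg; rewrite !L2_norm_inner//; congr Num.sqrt.
rewrite (L2_pair_ae Lf Lg Lf fg); transitivity (\int[leb]_(x in Omega) (f x * g x)).
  by apply: eq_Rintegral => x _; rewrite mulrC.
exact: L2_pair_ae.
Qed.

End L2.

(** * Test functions and uniqueness of weak gradients *)

Section bounded_Lfun.
Context {R : realType} {d : nat}.
Local Notation E := 'rV[R]_d.
Local Notation leb := (lebesgue_rV R d).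

Lemma Lfun_bounded (p M : R) (A : set E) (f : E -> R) : 1 <= p ->
  measurable_fun setT f -> (forall x, `|f x| <= M) ->
  measurable A -> (leb A < +oo)%E -> (forall x, ~ A x -> f x = 0) ->
  f \in Lfun leb p%:E.
Proof.
move=> p1 mf fM mA Afin fA.
have p0 : 0 <= p by lra.
rewrite inE; apply/andP; split; rewrite inE//=.
rewrite /finite_norm unlock poweR_lty//.
have M0 : 0 <= M by apply: le_trans (fM 0).
apply: (@le_lt_trans _ _ (\int[leb]_x (M `^ p * \1_A x)%:E)%E).
  apply: ge0_le_integral => //=.
  - apply/measurable_EFinP; apply: (measurableT_comp (measurable_powR _)) => //.
    exact: measurableT_comp.
  - by apply/measurable_EFinP; apply: measurable_funM => //; exact: measurable_indic.
  - move=> x _; rewrite lee_fin indicE; case: (boolP (x \in A)) => xA /=.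
      by rewrite mulr1 ge0_ler_powR ?nnegrE.
    by rewrite fA ?normr0 ?powR0 ?mulr0//; [lra|move/negP : xA; rewrite inE].
under eq_integral do rewrite EFinM.
rewrite ge0_integralZl//; last 2 first.
- by apply/measurable_EFinP; exact: measurable_indic.
- by rewrite lee_fin powR_ge0.
rewrite integral_indic// setIT lte_mul_pinfty// lee_fin powR_ge0//.
Qed.

Lemma L2_indic (Omega A : set E) : measurable Omega -> measurable A ->
  (leb A < +oo)%E -> L2 Omega (\1_A : E -> R).
Proof.
move=> mO mA Afin; rewrite /L2/=; apply: (@Lfun_bounded 2 1 A) => //.
- by rewrite ler1n.
- by apply/(measurable_restrictT _ _).1 => //; apply: (measurable_funS measurableT) => //; exact: measurable_indic.
- move=> x; rewrite patchE; case: ifP => _; rewrite ?normr0//.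
  by rewrite indicE; case: (_ \in _); rewrite ?normr1 ?normr0.
- by move=> x Ax; rewrite patchE indicE (memNset Ax); case: ifP.
Qed.

End bounded_Lfun.

Section test_functions.
Context {R : realType} {d : nat}.
Local Notation E := 'rV[R]_d.
Local Notation leb := (lebesgue_rV R d).
Variable Omega : set E.
Implicit Types phi psi : E -> R.

Lemma test_fun_continuous phi : test_fun Omega phi -> continuous phi.
Proof. by move=> [s _ _]; have [] := s [::]. Qed.

Lemma test_fun_derivable phi i x : test_fun Omega phi ->
  derivable phi x (delta_mx ord0 i).
Proof. by move=> [s _ _]; have [_] := s [::]; apply. Qed.

Lemma test_fun_measurable phi : test_fun Omega phi -> measurable_fun setT phi.
Proof. by move=> /test_fun_continuous; exact: continuous_measurable_rV. Qed.

Lemma test_fun_supp phi x : test_fun Omega phi -> ~ Omega x -> phi x = 0.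
Proof.
move=> [_ _ KO] Ox; apply/eqP; apply: contra_notT Ox => px.
by apply: KO; exact: subset_closure.
Qed.

Lemma test_fun_patch phi : test_fun Omega phi -> phi \_ Omega = phi.
Proof.
move=> tp; apply/funext => x; rewrite patchE; case: ifPn => // /negP.
by rewrite inE => /(test_fun_supp tp) ->.
Qed.

Lemma test_fun_bounded phi : test_fun Omega phi -> exists M, forall x, `|phi x| <= M.
Proof.
move=> tp; have [_ cK _] := tp.
have : compact (phi @` closure [set x | phi x != 0]).
  by apply: continuous_compact => //; apply: continuous_subspaceT; exact: test_fun_continuous tp.
move=> /compact_bounded[M [_ bM]]; exists (`|M| + 1) => x.
have [->|px] := eqVneq (phi x) 0; first by rewrite normr0 addr_ge0.
apply: (bM (`|M| + 1)); first by rewrite (le_lt_trans (ler_norm M))// ltrDl.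
by exists x => //; exact: subset_closure.
Qed.

Lemma test_fun_Lfun p phi : 1 <= p -> test_fun Omega phi -> phi \in Lfun leb p%:E.
Proof.
move=> p1 tp; have [M pM] := test_fun_bounded tp; have [_ cK _] := tp.
have mK : measurable (closure [set x | phi x != 0]).
  by rewrite -[X in measurable X]setCK; apply: measurableC; apply: open_measurable_rV; rewrite openC; exact: closed_closure.
apply: (Lfun_bounded p1 (test_fun_measurable tp) pM mK).
  by apply: bounded_finite_measure => //; exact: compact_bounded.
move=> x Kx; apply/eqP; apply: contra_notT Kx => px; exact: subset_closure.
Qed.

Lemma test_fun_L2 phi : test_fun Omega phi -> L2 Omega phi.
Proof. by move=> tp; rewrite /L2/= (test_fun_patch tp); apply: test_fun_Lfun => //; rewrite ler1n. Qed.

Lemma test_fun_pderiv phi i : test_fun Omega phi -> test_fun Omega (pderiv i phi).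
Proof.
move=> [s cK KO]; pose K := closure [set x | phi x != 0].
have sK : closure [set x | pderiv i phi x != 0] `<=` K.
  apply: subset_trans (closureS _) (@closed_closure _ [set x | phi x != 0]) => x /= px.
  apply: contrapT => Kx.
  have oK : open (~` K) by rewrite openC; exact: closed_closure.
  have nz : \near x, phi x = cst 0 x.
    have : nbhs x (~` K) by exact: open_nbhs_nbhs.
    apply: filterS => y Ky; apply/eqP; apply: contra_notT Ky => py; exact: subset_closure.
  move: px; rewrite /pderiv (near_eq_derive _ nz) ?derive_cst ?eqxx//.
split.
- move=> r; have := s (rcons r i).
  by rewrite /iter_pderiv foldr_rcons.
- by apply: subclosed_compact cK _ => //; exact: closed_closure.
- exact: subset_trans KO.
Qed.

Lemma pderiv_lin a phi psi i x :
  derivable phi x (delta_mx ord0 i) -> derivable psi x (delta_mx ord0 i) ->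
  derivable (fun x => a * phi x + psi x) x (delta_mx ord0 i) /\
  pderiv i (fun x => a * phi x + psi x) x = a * pderiv i phi x + pderiv i psi x.
Proof.
move=> d1 d2; rewrite (_ : (fun x => _) = (a *: phi) + psi); last by [].
have dZ : derivable (a *: phi) x (delta_mx ord0 i) by exact: derivableZ.
by split; [exact: derivableD|rewrite /pderiv deriveD// deriveZ].
Qed.

Lemma smooth_lin a phi psi s : smooth phi -> smooth psi ->
  iter_pderiv s (fun x => a * phi x + psi x) =
  (fun x => a * iter_pderiv s phi x + iter_pderiv s psi x).
Proof.
move=> s1 s2; elim: s => [//|i s IH].
rewrite [iter_pderiv (i :: s) _]/= -/(iter_pderiv s _) IH.
apply/funext => x; have [_ d1] := s1 s; have [_ d2] := s2 s.
by have [_ ->] := pderiv_lin a (d1 i x) (d2 i x).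
Qed.

Lemma test_fun_lin a phi psi : test_fun Omega phi -> test_fun Omega psi ->
  test_fun Omega (fun x => a * phi x + psi x).
Proof.
move=> [s1 c1 O1] [s2 c2 O2].
set K1 := closure _ in c1 O1; set K2 := closure _ in c2 O2.
have sK : closure [set x | a * phi x + psi x != 0] `<=` K1 `|` K2.
  rewrite /K1 /K2 -closureU; apply: closureS => x /= h; apply: contrapT => /not_orP[/negP + /negP].
  by rewrite !negbK => /eqP p0 /eqP q0; move: h; rewrite p0 q0 mulr0 addr0 eqxx.
split.
- move=> s; rewrite smooth_lin//; have [k1 d1] := s1 s; have [k2 d2] := s2 s; split.
    by move=> x; exact: (continuousD (continuousM (@cst_continuous _ _ a x) (k1 x)) (k2 x)).
  by move=> i x; have [] := pderiv_lin a (d1 i x) (d2 i x).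
- by apply: subclosed_compact (compactU c1 c2) _ => //; exact: closed_closure.
- by apply: subset_trans sK _; rewrite subUset.
Qed.

End test_functions.

Section fundamental_lemma.
Context {R : realType} {d : nat}.
Local Notation E := 'rV[R]_d.
Local Notation leb := (lebesgue_rV R d).
Variable Omega : set E.
Hypothesis oO : open Omega.
Let mO : measurable Omega := open_measurable_rV oO.

Lemma cbox_finite (a b : 'I_d -> R) : (leb (cbox a b) < +oo)%E.
Proof.
apply: bounded_finite_measure; first exact: measurable_cbox.
apply: compact_bounded; apply: rV_compact => i; exact: segment_compact.
Qed.

Lemma test_fun_bump (c : R) (a b : 'I_d -> R) : 0 < c -> cbox a b `<=` Omega ->
  test_fun Omega (tensor (fun i => smooth_bump c (a i) (b i))).
Proof.
move=> c0 abO.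
have sK : closure [set x : E | tensor (fun i => smooth_bump c (a i) (b i)) x != 0] `<=` cbox a b.
  have cc : closed (cbox a b).
    apply: compact_closed; first exact: norm_hausdorff.
    by apply: rV_compact => i; exact: segment_compact.
  apply: subset_trans (closureS _) cc => x /= /prodf_neq0 h i.
  by have := h i isT; rewrite bump_neq0 /= in_itv/= => /andP[/ltW -> /ltW ->].
split.
- by apply: smooth_tensor => i; exact: Csmooth_bump.
- apply: subclosed_compact sK => //; first exact: closed_closure.
  by apply: rV_compact => i; exact: segment_compact.
- exact: subset_trans abO.
Qed.

(** Dominated convergence along the smooth bumps tending to the indicator
    function of the box. *)
Lemma integral_obox_eq0 (k : E -> R) (a b : 'I_d -> R) : L2 Omega k ->
  (forall phi, test_fun Omega phi -> \int[leb]_(x in Omega) (k x * phi x) = 0) ->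
  cbox a b `<=` Omega -> (\int[leb]_(x in obox a b) (k x)%:E = 0)%E.
Proof.
move=> Lk k0 abO.
have mob : measurable (obox a b) by exact: measurable_obox.
have obO : obox a b `<=` Omega by apply: subset_trans abO; exact: obox_cbox.
pose f_ (m : nat) x := (k x * tensor (fun i => smooth_bump m.+1%:R^-1 (a i) (b i)) x)%:E.
have c0 (m : nat) : 0 < m.+1%:R^-1 :> R by rewrite invr_gt0.
have if_ m : leb.-integrable Omega (f_ m).
  by apply: (L2_integrable_mul mO Lk); apply: test_fun_L2; exact: test_fun_bump.
have z m : (\int[leb]_(x in Omega) f_ m x = 0)%E.
  have := k0 _ (test_fun_bump (c0 m) abO); rewrite /Rintegral => h.
  by rewrite -[LHS]fineK ?h//; exact: integrable_fin_num.
have L1 : L2 Omega (\1_(cbox a b) : E -> R).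
  by apply: L2_indic => //; [exact: measurable_cbox|exact: cbox_finite].
have mk : measurable_fun Omega (EFin \o k).
  by apply/measurable_EFinP; apply/measurable_restrictT => //; exact: L2_measurable Lk.
have mlim : measurable_fun Omega (fun x => (k x * \1_(obox a b) x)%:E).
  apply/measurable_EFinP; apply: measurable_funM; first exact/measurable_EFinP.
  exact: measurable_indic.
have ig : leb.-integrable Omega (abse \o (EFin \o (k \* \1_(cbox a b)))).
  by apply: integrable_abse => //; exact: L2_integrable_mul.
have cv x : f_^~ x @ \oo --> (k x * \1_(obox a b) x)%:E.
  apply: cvg_EFin; first by near=> m.
  apply: cvgMr.
  rewrite (_ : \1_(obox a b) x = \prod_i (\1_(`]a i, b i[%classic) (x ord0 i) : R)).
    apply: (@cvg_big R 'I_d *%R 1 predT (@mul_continuous R) _ \oo (index_enum _)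
      (fun i (m : nat) => smooth_bump m.+1%:R^-1 (a i) (b i) (x ord0 i))) => i _.
    exact: cvg_bump.
  rewrite indicE; case: (boolP (x \in _)) => [|]; rewrite ?inE ?notin_setE => h.
    rewrite big1// => i _; rewrite indicE mem_set//; exact: h.
  have [i hi] : exists i, ~ `]a i, b i[%classic (x ord0 i).
    by apply/existsNP.
  by rewrite (bigD1 i)//= indicE memNset// mul0r.
have bd x m : (`|f_ m x| <= (abse \o (EFin \o (k \* \1_(cbox a b))%R)) x)%E.
  rewrite /f_ /= lee_fin !normrM ler_wpM2l// indicE.
  have t0 : 0 <= tensor (fun i => smooth_bump m.+1%:R^-1 (a i) (b i)) x.
    by apply: prodr_ge0 => i _; exact: bump_ge0.
  rewrite ger0_norm//; case: (boolP (x \in cbox a b)) => xab /=.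
    rewrite normr1 /tensor -[leRHS](@big1_eq R 1 *%R 'I_d (index_enum _) predT).
    by apply: ler_prod => i _; rewrite bump_ge0 bump_le1.
  move: xab; rewrite notin_setE => xab; rewrite normr0.
  have [i hi] : exists i, ~ `[a i, b i]%classic (x ord0 i) by apply/existsNP.
  rewrite /tensor (bigD1 i)//= (_ : smooth_bump _ _ _ _ = 0) ?mul0r//.
  apply/eqP; apply: contra_notT hi; rewrite bump_neq0 /= in_itv/= => /andP[/ltW -> /ltW ->]//.
have [_ _] := @dominated_convergence _ _ _ leb Omega mO f_ (fun x => (k x * \1_(obox a b) x)%:E) _
  (fun m => measurable_int _ (if_ m)) mlim (aeW _ (fun x _ => cv x)) ig (aeW _ (fun x m _ => bd x m)).
rewrite (_ : [sequence _]_n = cst 0%E); last by apply/funext => m; rewrite /= z.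
move=> C; have {C} -> : (0 = \int[leb]_(x in Omega) (k x * \1_(obox a b) x)%:E)%E.
  by apply: cvg_unique C => //; exact: cvg_cst.
rewrite [LHS]integral_mkcond [RHS]integral_mkcond.
apply: eq_integral => x _; rewrite !patchE indicE.
case: (boolP (x \in obox a b)) => xab.
  by rewrite (_ : x \in Omega) ?mulr1//; move: xab; rewrite !inE; exact: obO.
by case: ifP; rewrite ?mulr0.
Unshelve. all: by end_near. Qed.

(** The fundamental lemma of the calculus of variations: integrals over boxes
    compactly contained in [Omega] vanish, and countably many of these boxes
    cover [Omega]. *)
Lemma ae0_of_test_fun (k : E -> R) : L2 Omega k ->
  (forall phi, test_fun Omega phi -> \int[leb]_(x in Omega) (k x * phi x) = 0) ->
  {ae leb, forall x, Omega x -> k x = 0}.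
Proof.
move=> Lk k0.
have local a b : cbox a b `<=` Omega -> {ae leb, forall x, obox a b x -> k x = 0}.
  move=> abO; have mab := measurable_obox a b.
  have obO : obox a b `<=` Omega by apply: subset_trans abO; exact: obox_cbox.
  have ih : leb.-integrable setT (EFin \o (k \* \1_(obox a b))).
    have L1 : L2 Omega (\1_(obox a b) : E -> R).
      apply: L2_indic => //; apply: le_lt_trans (cbox_finite a b).
      by rewrite le_measure ?inE//; [exact: measurable_cbox|exact: obox_cbox].
    have := L2_integrable_mul mO Lk L1 => /(integrable_mkcond _ mO).
    apply: eq_integrable => // x _; rewrite patchE /= indicE; case: ifPn => // xO.
    by rewrite memNset ?mulr0// => /obO Ox; move: xO; rewrite (mem_set Ox).
  have := integrable_ae0_of_obox ih.
  move=> /(_ _)[u v|N [mN N0 NH]].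
    rewrite -[RHS](@integral_obox_eq0 k (fun i => Num.max (a i) (u i)) (fun i => Num.min (b i) (v i)))//.
      rewrite -oboxI [LHS]integral_mkcond [RHS]integral_mkcond; apply: eq_integral => x _.
      rewrite !patchE in_setI /= indicE.
      by case: (x \in obox a b); case: (x \in obox u v); rewrite /= ?mulr1 ?mulr0.
    move=> x h; apply: abO => i; have := h i; rewrite /= !in_itv/= ge_max le_min.
    by move=> /andP[/andP[-> _] /andP[-> _]].
  exists N; split=> // x /= hx; apply: NH => /= h; apply: hx => xab.
  by move: h; rewrite /= indicE mem_set// mulr1.
pose F (m : nat) : set E := if (unpickle m : option ('rV[rat]_d * 'rV[rat]_d)) is Some c then
  (if `[< cbox (fun i => ratr (c.1 ord0 i)) (fun i => ratr (c.2 ord0 i)) `<=` Omega >] then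
    [set x | obox (fun i => ratr (c.1 ord0 i)) (fun i => ratr (c.2 ord0 i)) x /\ k x != 0] else set0) else set0.
have nF m : leb.-negligible (F m).
  rewrite /F; case: unpickle => [c|]; last exact: negligible_set0.
  case: asboolP => [cO|_]; last exact: negligible_set0.
  have := local _ _ cO; apply: negligibleS => x /= [xc kx] h.
  by move: kx; rewrite h// eqxx.
have := negligible_bigcup nF; apply: negligibleS => x /= /not_implyP[Ox kx].
have [a [b [xab abO]]] := open_rational_box oO Ox.
exists (pickle (a, b)) => //; rewrite /F pickleK /=; case: asboolP => // _.
by split => //; apply/eqP.
Qed.

Lemma weak_gradient_unique (w : E -> R) (g1 g2 : 'I_d -> E -> R) :
  weak_gradient Omega w g1 -> weak_gradient Omega w g2 ->
  forall i, {ae leb, forall x, Omega x -> g1 i x = g2 i x}.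
Proof.
move=> G1 G2 i; have [L1 e1] := G1 i; have [L2' e2] := G2 i.
have Lk : L2 Omega (fun x => -1 * g2 i x + g1 i x) by apply: L2_lin.
have := ae0_of_test_fun Lk _; case=> [phi tp|N [mN N0 NH]].
  rewrite L2_pair_lin//; last exact: test_fun_L2.
  by have := e1 _ tp; rewrite (e2 _ tp); lra.
exists N; split=> // x /= hx; apply: NH => /= h; apply: hx => Ox.
by have := h Ox; lra.
Qed.

End fundamental_lemma.

(** * The energy space *)

Section square_integrable.
Context {dT : measure_display} {T : measurableType dT} {R : realType}.
Variable mu : {measure set T -> \bar R}.

(** Products of square-integrable functions, with a common nonnegative
    weight [p], are integrable because [2|fg| <= f^2 + g^2]. *)
Lemma integrable_weighted_mul (f g p : T -> R) : (forall z, 0 <= p z) ->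
  measurable_fun setT f -> measurable_fun setT g -> measurable_fun setT p ->
  mu.-integrable setT (EFin \o (fun z => f z * f z * p z)) ->
  mu.-integrable setT (EFin \o (fun z => g z * g z * p z)) ->
  mu.-integrable setT (EFin \o (fun z => f z * g z * p z)).
Proof.
move=> p0 mf mg mp fi gi; have S := integrableD measurableT fi gi.
apply: le_integrable S => //.
  by apply/measurable_EFinP; apply: measurable_funM => //; exact: measurable_funM.
move=> z _; rewrite /= lee_fin -mulrDl !normrM.
rewrite (ger0_norm (p0 z)) ler_wpM2r//.
have h : 0 <= f z * f z + g z * g z by rewrite addr_ge0// -expr2 sqr_ge0.
rewrite (ger0_norm h) -normrM.
have := sqr_ge0 (f z - g z); have := sqr_ge0 (f z + g z).
by rewrite !expr2 ler_norml => h1 h2; apply/andP; split; nra.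
Qed.

Lemma integrable_weighted_lin (a : R) (f g p : T -> R) : (forall z, 0 <= p z) ->
  measurable_fun setT f -> measurable_fun setT g -> measurable_fun setT p ->
  mu.-integrable setT (EFin \o (fun z => f z * f z * p z)) ->
  mu.-integrable setT (EFin \o (fun z => g z * g z * p z)) ->
  mu.-integrable setT (EFin \o (fun z => (a * f z + g z) * (a * f z + g z) * p z)).
Proof.
move=> p0 mf mg mp fi gi; have fgi := integrable_weighted_mul p0 mf mg mp fi gi.
have i1 := integrableZl measurableT (a ^+ 2) fi.
have i2 := integrableZl measurableT (2 * a) fgi.
have := integrableD measurableT (integrableD measurableT i1 i2) gi.
apply: eq_integrable => // z _.
by rewrite /= -!EFinM -!EFinD; congr EFin; ring.
Qed.

End square_integrable.

Section X_space.
Context {R : realType} {d : nat}.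
Local Notation E := 'rV[R]_d.
Local Notation leb := (lebesgue_rV R d).
Variables (Omega : set E) (theta : R).
Hypothesis bO : bounded_domain Omega.
Implicit Types u v w : E -> R.

Let oO : open Omega. Proof. by case: bO. Qed.
Let mO : measurable Omega. Proof. exact: open_measurable_rV. Qed.

Lemma domain_measurable : measurable Omega. Proof. exact: mO. Qed.

Lemma domain_finite : (leb Omega < +oo)%E.
Proof. by apply: bounded_finite_measure => //; case: bO. Qed.

Lemma Lfun2_measurable w : w \in Lfun leb 2%:E -> measurable_fun setT w.
Proof. by rewrite inE => /andP[]; rewrite inE. Qed.

Lemma Lfun2_lin a v w : v \in Lfun leb 2%:E -> w \in Lfun leb 2%:E ->
  (fun x => a * v x + w x) \in Lfun leb 2%:E.
Proof. by move=> Lv Lw; apply: (@Lfun_submod_closed _ _ _ _ _ (lee1n 2)).2. Qed.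

(** ** The fractional seminorm *)

Let weight (z : E * E) : R := (enorm (z.1 - z.2) `^ (d%:R + 2 * theta))^-1.

Let weight_ge0 z : 0 <= weight z.
Proof. by rewrite invr_ge0 powR_ge0. Qed.

Lemma measurable_enorm_sub :
  measurable_fun setT (fun z : E * E => enorm (z.1 - z.2)).
Proof.
rewrite (_ : (fun z : E * E => _) = fun z => (\sum_i (z.1 ord0 i - z.2 ord0 i) ^+ 2) `^ 2^-1); last first.
  apply/funext => z; rewrite /enorm powR12_sqrt; last by apply: sumr_ge0 => i _; exact: sqr_ge0.
  by congr Num.sqrt; apply: eq_bigr => i _; rewrite !mxE.
apply: (measurableT_comp (measurable_powR _)).
apply: measurable_sum => i; apply: measurable_funX; apply: measurable_funB.
- exact: (measurableT_comp (measurable_coord i) measurable_fst).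
- exact: (measurableT_comp (measurable_coord i) measurable_snd).
Qed.

Let measurable_weight : measurable_fun setT weight.
Proof.
rewrite (_ : weight = fun z => enorm (z.1 - z.2) `^ (- (d%:R + 2 * theta))); last first.
  by apply/funext => z; rewrite powRN.
by apply: (measurableT_comp (measurable_powR _)); exact: measurable_enorm_sub.
Qed.

Let diff w (z : E * E) := w z.1 - w z.2.

Let measurable_diff w : measurable_fun setT w -> measurable_fun setT (diff w).
Proof.
move=> mw; apply: measurable_funB.
- exact: (measurableT_comp mw measurable_fst).
- exact: (measurableT_comp mw measurable_snd).
Qed.

Lemma fractional_integrable w : w \in Lfun leb 2%:E ->
  (\int[(leb \x leb)%E]_z (gagliardo_integrand theta w w z)%:E < +oo)%E ->
  (leb \x leb)%E.-integrable setT (EFin \o (fun z => diff w z * diff w z * weight z)).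
Proof.
move=> /Lfun2_measurable mw fi; apply/integrableP; split.
  apply/measurable_EFinP; apply: measurable_funM => //.
  by apply: measurable_funM; exact: measurable_diff.
apply: le_lt_trans fi; rewrite le_eqVlt; apply/orP; left; apply/eqP.
apply: eq_integral => z _; rewrite /= ger0_norm// mulr_ge0//.
by rewrite -expr2 sqr_ge0.
Qed.

Let fractional_lin a v w : fractional_sobolev theta v -> fractional_sobolev theta w ->
  fractional_sobolev theta (fun x => a * v x + w x).
Proof.
move=> [Lv iv] [Lw iw]; have Lz := Lfun2_lin a Lv Lw; split=> //.
have mv := measurable_diff (Lfun2_measurable Lv).
have mw := measurable_diff (Lfun2_measurable Lw).
have := integrable_weighted_lin a weight_ge0 mv mw measurable_weight
  (fractional_integrable Lv iv) (fractional_integrable Lw iw).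
move=> /integrable_lty => /(_ measurableT); apply: le_lt_trans.
rewrite le_eqVlt; apply/orP; left; apply/eqP.
apply: eq_integral => z _; rewrite /= /gagliardo_integrand /diff /weight; congr EFin.
by congr (_ * _); ring.
Qed.

(** ** The first-order seminorm *)

Lemma gradP w : H1 Omega w -> weak_gradient Omega w (grad Omega w).
Proof. by move=> [_ [g gw]]; rewrite /grad; apply: xgetPex; exists g. Qed.

Lemma grad_L2 w i : H1 Omega w -> L2 Omega (grad Omega w i).
Proof. by move=> /gradP /(_ i)[]. Qed.

Lemma weak_gradient_lin a v w g h : L2 Omega v -> L2 Omega w ->
  weak_gradient Omega v g -> weak_gradient Omega w h ->
  weak_gradient Omega (fun x => a * v x + w x) (fun i x => a * g i x + h i x).
Proof.
move=> Lv Lw gv hw i; have [Lg eg] := gv i; have [Lh eh] := hw i.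
split; first exact: L2_lin.
move=> phi tp; have Lp := test_fun_L2 tp; have Ld := test_fun_L2 (test_fun_pderiv i tp).
by rewrite !L2_pair_lin// eg// eh//; ring.
Qed.

Lemma H1_lin a v w : H1 Omega v -> H1 Omega w -> H1 Omega (fun x => a * v x + w x).
Proof.
move=> Hv Hw; have [Lv _] := Hv; have [Lw _] := Hw; split; first exact: L2_lin.
by eexists; exact: weak_gradient_lin (gradP Hv) (gradP Hw).
Qed.

Lemma grad_lin a v w i : H1 Omega v -> H1 Omega w ->
  {ae leb, forall x, Omega x -> grad Omega (fun x => a * v x + w x) i x =
     a * grad Omega v i x + grad Omega w i x}.
Proof.
move=> Hv Hw; have [Lv _] := Hv; have [Lw _] := Hw.
have := weak_gradient_unique oO (gradP (H1_lin a Hv Hw))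
  (weak_gradient_lin a Lv Lw (gradP Hv) (gradP Hw)); exact.
Qed.

Lemma H1_0_lin a v w : H1_0 Omega v -> H1_0 Omega w -> H1_0 Omega (fun x => a * v x + w x).
Proof.
move=> [Hv [p [tp pv pgv]]] [Hw [q [tq qw qgw]]]; have Hz := H1_lin a Hv Hw.
have [Lv _] := Hv; have [Lw _] := Hw; split => //.
have sq (f1 f2 g1 g2 h : nat -> E -> R) : (forall n, L2 Omega (f1 n)) -> (forall n, L2 Omega (f2 n)) ->
    (forall n, L2 Omega (h n)) ->
    (forall n, {ae leb, forall x, Omega x -> h n x = a * f1 n x + f2 n x}) ->
    Lq_norm Omega 2 (f1 n) @[n --> \oo] --> (0 : R) ->
    Lq_norm Omega 2 (f2 n) @[n --> \oo] --> (0 : R) ->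
    Lq_norm Omega 2 (h n) @[n --> \oo] --> (0 : R).
  move=> L1 L2' Lh hE c1 c2.
  apply: (squeeze_cvgr (f := cst 0)
    (h := fun n => `|a| * Lq_norm Omega 2 (f1 n) + Lq_norm Omega 2 (f2 n))).
  - apply: nearW => n; rewrite L2_norm_ge0//= (L2_norm_ae mO (Lh n) (L2_lin a (L1 n) (L2' n)) (hE n)).
    exact: L2_norm_lin.
  - exact: cvg_cst.
  - rewrite -[X in _ --> X](addr0 0) -{1}(mulr0 `|a|).
    by apply: cvgD => //; apply: cvgMr.
have L2B f g : L2 Omega f -> L2 Omega g -> L2 Omega (f \- g).
  move=> Lf Lg; have := L2_lin (-1) Lg Lf; congr (L2 _ _).
  by apply/funext => x /=; lra.
exists (fun n x => a * p n x + q n x); split.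
- by move=> n; exact: test_fun_lin.
- apply: (sq (fun n => p n \- v) (fun n => q n \- w)) => //.
  + by move=> n; apply: L2B => //; exact: test_fun_L2.
  + by move=> n; apply: L2B => //; exact: test_fun_L2.
  + by move=> n; apply: L2B; [apply: test_fun_L2; exact: test_fun_lin|exact: L2_lin].
  + by move=> n; apply: aeW => x _ /=; lra.
- move=> i; have tl n := test_fun_lin a (tp n) (tq n).
  apply: (sq (fun n => pderiv i (p n) \- grad Omega v i) (fun n => pderiv i (q n) \- grad Omega w i)) => //.
  + by move=> n; apply: L2B; [apply: test_fun_L2; exact: test_fun_pderiv|exact: grad_L2].
  + by move=> n; apply: L2B; [apply: test_fun_L2; exact: test_fun_pderiv|exact: grad_L2].
  + by move=> n; apply: L2B; [apply: test_fun_L2; apply: test_fun_pderiv|exact: grad_L2].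
  + move=> n; apply: filterS (grad_lin a i Hv Hw) => x gx Ox /=.
    rewrite gx//; have [_ ->] := pderiv_lin a (@test_fun_derivable _ _ Omega (p n) i x (tp n)) (@test_fun_derivable _ _ Omega (q n) i x (tq n)).
    by lra.
Qed.

(** ** The semi-inner product *)

Lemma Xmem_lin a v w : Xmem Omega theta v -> Xmem Omega theta w ->
  Xmem Omega theta (fun x => a * v x + w x).
Proof.
move=> [Lv zv Hv] [Lw zw Hw]; split; first exact: Lfun2_lin.
- apply: filterS2 zv zw => x zv zw Ox; by rewrite zv// zw// mulr0 addr0.
- by move: Hv Hw; case: ifP => _; [exact: H1_0_lin|exact: fractional_lin].
Qed.

Lemma Xmem_L2 v : Xmem Omega theta v -> L2 Omega v.
Proof.
move=> [Lv _ _]; have mv := Lfun2_measurable Lv; apply/L2P => //.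
  by apply/(measurable_restrictT _ _).1 => //; exact: measurable_funS mv.
have := Lfun2_integrable_sqr Lv => /integrable_lty => /(_ measurableT).
apply: le_lt_trans; apply: ge0_subset_integral => //.
- by apply/measurable_EFinP; exact: measurable_funX.
- by move=> x _; rewrite lee_fin sqr_ge0.
Qed.

Lemma Xmem_H1 v : theta = 1 -> Xmem Omega theta v -> H1 Omega v.
Proof. by move=> t1 [_ _]; rewrite t1 eqxx => -[]. Qed.

Lemma XinnerC v w : Xinner Omega theta v w = Xinner Omega theta w v.
Proof.
rewrite /Xinner; case: ifP => _.
  by apply: eq_Rintegral => x _; apply: eq_bigr => i _; rewrite mulrC.
congr (_ * _); apply: eq_Rintegral => z _.
by rewrite /gagliardo_integrand (mulrC (v _ - _)).
Qed.

Lemma Xinner_ge0 v : 0 <= Xinner Omega theta v v.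
Proof.
rewrite /Xinner; case: ifP => _.
  by apply: Rintegral_ge0 => x _; apply: sumr_ge0 => i _; rewrite -expr2 sqr_ge0.
rewrite mulr_ge0//; apply: Rintegral_ge0 => z _.
by rewrite /gagliardo_integrand divr_ge0 ?powR_ge0// -expr2 sqr_ge0.
Qed.

Let Rintegral_sum (F : 'I_d -> E -> R) : (forall i, leb.-integrable Omega (EFin \o F i)) ->
  \int[leb]_(x in Omega) (\sum_i F i x) = \sum_i \int[leb]_(x in Omega) F i x.
Proof.
move=> iF; rewrite /Rintegral; under eq_integral do rewrite -sumEFin.
by rewrite integral_sum// sum_fine// => i _; exact: (integrable_fin_num mO (iF i)).
Qed.

Lemma Xinner1E v w : H1 Omega v -> H1 Omega w ->
  \int[leb]_(x in Omega) (\sum_i grad Omega v i x * grad Omega w i x) =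
  \sum_i \int[leb]_(x in Omega) (grad Omega v i x * grad Omega w i x).
Proof.
by move=> Hv Hw; rewrite Rintegral_sum// => i; apply: L2_integrable_mul => //; exact: grad_L2.
Qed.

Lemma Xinner_lin a u v w : Xmem Omega theta u -> Xmem Omega theta v -> Xmem Omega theta w ->
  Xinner Omega theta (fun x => a * u x + v x) w =
  a * Xinner Omega theta u w + Xinner Omega theta v w.
Proof.
move=> Xu Xv Xw; rewrite /Xinner; case: ifPn => [/eqP t1|t1].
  have Hu := Xmem_H1 t1 Xu; have Hv := Xmem_H1 t1 Xv; have Hw := Xmem_H1 t1 Xw.
  have Hz := H1_lin a Hu Hv.
  rewrite !Xinner1E// mulr_sumr -big_split/=; apply: eq_bigr => i _.
  have Gu := grad_L2 i Hu; have Gv := grad_L2 i Hv; have Gw := grad_L2 i Hw.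
  have Gz := grad_L2 i Hz; rewrite -L2_pair_lin//.
  apply: L2_pair_ae => //; first exact: L2_lin.
  exact: grad_lin.
move: Xu Xv Xw => [Lu _ + ] [Lv _ +] [Lw _ +]; rewrite (negbTE t1) => -[_ fu] [_ fv] [_ fw].
have mu := measurable_diff (Lfun2_measurable Lu).
have mv := measurable_diff (Lfun2_measurable Lv).
have mw := measurable_diff (Lfun2_measurable Lw).
have i1 := integrable_weighted_mul weight_ge0 mu mw measurable_weight
  (fractional_integrable Lu fu) (fractional_integrable Lw fw).
have i2 := integrable_weighted_mul weight_ge0 mv mw measurable_weight
  (fractional_integrable Lv fv) (fractional_integrable Lw fw).
rewrite mulrCA -mulrDr; congr (_ * _).
rewrite -[X in a * X]/(\int[(leb \x leb)%E]_z (diff u z * diff w z * weight z)).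
rewrite -[X in _ + X]/(\int[(leb \x leb)%E]_z (diff v z * diff w z * weight z)).
rewrite -RintegralZl// -RintegralD//.
  by apply: eq_Rintegral => z _; rewrite /gagliardo_integrand /diff /weight; ring.
by have := integrableZl measurableT a i1; apply: eq_integrable.
Qed.

Lemma Xnorm_sqr v : Xnorm Omega theta v ^+ 2 = Xinner Omega theta v v.
Proof. by rewrite sqr_sqrtr// Xinner_ge0. Qed.

Lemma Xnorm_ge0 v : 0 <= Xnorm Omega theta v. Proof. exact: sqrtr_ge0. Qed.

Lemma Xinner_cauchy_schwarz v w : Xmem Omega theta v -> Xmem Omega theta w ->
  `|Xinner Omega theta v w| <= Xnorm Omega theta v * Xnorm Omega theta w.
Proof.
exact: (semi_inner_cauchy_schwarz (P := Xmem Omega theta) Xmem_lin Xinner_lin XinnerC Xinner_ge0).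
Qed.

Lemma Xmem0 v : Xmem Omega theta v -> Xmem Omega theta (fun=> 0).
Proof.
move=> Xv; have := Xmem_lin (-1) Xv Xv; congr (Xmem _ _ _).
by apply/funext => x; lra.
Qed.

Lemma XmemZ a v : Xmem Omega theta v -> Xmem Omega theta (fun x => a * v x).
Proof.
move=> Xv; have := Xmem_lin a Xv (Xmem0 Xv); congr (Xmem _ _ _).
by apply/funext => x; rewrite addr0.
Qed.

Lemma Xinner0 v w : Xmem Omega theta v -> Xmem Omega theta w ->
  Xinner Omega theta (fun=> 0) w = 0.
Proof.
move=> Xv Xw; have := Xinner_lin (-1) Xv Xv Xw.
rewrite (_ : (fun x => _) = fun=> 0); last by apply/funext => x; lra.
by move=> ->; lra.
Qed.

Lemma XinnerZ a v w : Xmem Omega theta v -> Xmem Omega theta w ->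
  Xinner Omega theta (fun x => a * v x) w = a * Xinner Omega theta v w.
Proof.
move=> Xv Xw; have := Xinner_lin a Xv (Xmem0 Xv) Xw.
rewrite (Xinner0 Xv)// addr0; congr (Xinner _ _ _ _ = _).
by apply/funext => x; rewrite addr0.
Qed.

Lemma XnormZ a v : Xmem Omega theta v ->
  Xnorm Omega theta (fun x => a * v x) = `|a| * Xnorm Omega theta v.
Proof.
move=> Xv; rewrite /Xnorm XinnerZ//; last exact: XmemZ.
by rewrite XinnerC XinnerZ// mulrA -expr2 sqrtrM ?sqr_ge0// sqrtr_sqr.
Qed.

End X_space.

(** * The fractional Sobolev estimate *)

Section product_ae.
Context {R : realType} {d : nat}.
Local Notation E := 'rV[R]_d.
Local Notation leb := (lebesgue_rV R d).

Lemma ae_product (P : E -> Prop) : {ae leb, forall x, P x} ->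
  {ae (leb \x leb)%E, forall z : E * E, P z.1 /\ P z.2}.
Proof.
move=> [N [mN N0 NP]]; exists ((N `*` setT) `|` (setT `*` N)); split.
- by apply: measurableU; exact: measurableX.
- apply/eqP; rewrite eq_le measure_ge0 andbT.
  apply: (@le_trans _ _ ((leb \x leb)%E (N `*` setT) + (leb \x leb)%E (setT `*` N))%E).
    by apply: measureU2; exact: measurableX.
  have [-> ->] : (leb \x leb)%E (N `*` setT) = 0%E /\ (leb \x leb)%E (setT `*` N) = 0%E.
    split.
      by transitivity (leb N * leb setT)%E; [exact: product_measure1E|rewrite N0 mul0e].
    by transitivity (leb setT * leb N)%E; [exact: product_measure1E|rewrite N0 mule0].
  by rewrite adde0.
- move=> z /= /not_andP[h|h]; [left|right]; split=> //; exact: NP.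
Qed.

Lemma measurable_gagliardo (theta : R) (v w : E -> R) :
  measurable_fun setT v -> measurable_fun setT w ->
  measurable_fun setT (gagliardo_integrand theta v w).
Proof.
move=> mv mw.
have mdiff (f : E -> R) : measurable_fun setT f -> measurable_fun setT (fun z : E * E => f z.1 - f z.2).
  move=> mf; apply: measurable_funB.
  - exact: (measurableT_comp mf measurable_fst).
  - exact: (measurableT_comp mf measurable_snd).
rewrite (_ : gagliardo_integrand theta v w = fun z => (v z.1 - v z.2) * (w z.1 - w z.2) * enorm (z.1 - z.2) `^ (- (d%:R + 2 * theta))); last first.
  by apply/funext => z; rewrite /gagliardo_integrand powRN.
apply: measurable_funM; first by apply: measurable_funM; exact: mdiff.
by apply: (measurableT_comp (measurable_powR _)); exact: measurable_enorm_sub.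
Qed.

Lemma gagliardo_ge0 (theta : R) (v : E -> R) z : 0 <= gagliardo_integrand theta v v z.
Proof. by rewrite /gagliardo_integrand divr_ge0 ?powR_ge0// -expr2 sqr_ge0. Qed.

End product_ae.

Section hedberg.
Context {R : realType} {d : nat}.
Local Notation E := 'rV[R]_d.
Local Notation leb := (lebesgue_rV R d).
Hypothesis d0 : (0 < d)%N.
Variables (v : E -> R) (q K p theta : R).
Hypotheses (mv : measurable_fun setT v) (q2 : 2 <= q) (K0 : 0 < K) (p0 : 0 <= p).
Hypotheses (theta0 : 0 < theta) (scaling : 2 * theta * p = d%:R * (q - 2)).

(** [level_volume l] bounds the measure of the set where [|v| > l/2], and
    [level_radius l] is the half side of a cube of twice that volume: in at
    least half of such a cube, wherever its centre, [|v| <= l/2]. *)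
Definition level_volume (l : R) := K * l `^ (- p).
Definition level_radius (l : R) := (2 * level_volume l) `^ (d%:R^-1) / 2.
Definition sublevel (l : R) : set E := [set y | `|v y| <= l / 2].
Definition superlevel (l : R) : set E := [set y | l / 2 < `|v y|].
Hypothesis cheb : forall l : R, 0 < l -> (leb (superlevel l) <= (level_volume l)%:E)%E.

Let dR0 : 0 < d%:R :> R. Proof. by rewrite ltr0n. Qed.

Lemma level_volume_gt0 l : 0 < l -> 0 < level_volume l.
Proof. by move=> l0; rewrite mulr_gt0// powR_gt0. Qed.

Lemma level_radius_gt0 l : 0 < l -> 0 < level_radius l.
Proof. by move=> l0; rewrite divr_gt0// powR_gt0// mulr_gt0// level_volume_gt0. Qed.

Lemma level_radius_volume l : 0 < l -> (2 * level_radius l) ^+ d = 2 * level_volume l.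
Proof.
move=> l0; rewrite /level_radius mulrCA mulfV// mulr1 -powR_mulrn ?powR_ge0// -powRrM mulVf ?gt_eqF// powRr1//.
by rewrite mulr_ge0// ltW// level_volume_gt0.
Qed.

Let Lam := 2 `^ (- (2 * theta)) * (2 * K) `^ (2 * theta / d%:R).

(** The scaling relation between the exponents makes this product constant. *)
Lemma level_radius_scaling l : 0 < l -> l `^ (q - 2) * level_radius l `^ (2 * theta) = Lam.
Proof.
move=> l0; have P : 0 <= (2 * level_volume l) `^ (d%:R^-1) by exact: powR_ge0.
have K20 : 0 <= 2 * K by rewrite mulr_ge0// ltW.
rewrite /level_radius powRM ?invr_ge0// -powRrM /level_volume [2 * (K * _)]mulrA (powRM _ K20) ?powR_ge0//.
rewrite -powRrM -[2^-1]powR_inv1// -powRrM mulN1r /Lam.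
have -> : d%:R^-1 * (2 * theta) = 2 * theta / d%:R by rewrite mulrC.
have -> : - p * (2 * theta / d%:R) = - (q - 2).
  have -> : - p * (2 * theta / d%:R) = - (2 * theta * p / d%:R) by field; rewrite gt_eqF.
  by rewrite scaling mulrAC mulfV ?gt_eqF// mul1r.
have -> : l `^ (q - 2) * ((2 * K) `^ (2 * theta / d%:R) * l `^ (- (q - 2)) * 2 `^ (- (2 * theta))) =
  (l `^ (q - 2) * l `^ (- (q - 2))) * (2 `^ (- (2 * theta)) * (2 * K) `^ (2 * theta / d%:R)).
  by ring.
by rewrite powRN mulfV ?mul1r// gt_eqF// powR_gt0.
Qed.

Definition cube (x : E) (r : R) : set E := box (fun i => `[x ord0 i - r, x ord0 i + r]%classic).

Let mlow (l : R) : measurable (sublevel l).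
Proof.
have m : measurable_fun setT (fun x => `|v x|) by exact: measurableT_comp.
have := m measurableT `]-oo, (l / 2)]%classic (measurable_itv _); rewrite setTI.
by congr measurable; apply/seteqP; split=> x /=; rewrite in_itv.
Qed.

Lemma half_cube x l : 0 < l ->
  ((level_volume l)%:E <= leb (cube x (level_radius l) `&` sublevel l))%E.
Proof.
move=> l0; have mc : measurable (cube x (level_radius l)) by exact: measurable_ball_box.
have mh : measurable (superlevel l).
  have := measurableC (mlow l); congr measurable; apply/seteqP; split=> y /=.
    by move=> /negP; rewrite -ltNge.
  by rewrite /superlevel /= ltNge => /negP.
have vol : leb (cube x (level_radius l)) = (2 * level_volume l)%:E by rewrite lebesgue_cube ?level_radius_volume// ltW// level_radius_gt0.
have : ((2 * level_volume l)%:E <= leb (cube x (level_radius l) `&` sublevel l) + (level_volume l)%:E)%E.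
  rewrite -vol; apply: (@le_trans _ _ (leb ((cube x (level_radius l) `&` sublevel l) `|` superlevel l))).
    apply: le_measure; rewrite ?inE//.
      by apply: measurableU => //; exact: measurableI.
    by move=> y cy; case: (lerP `|v y| (l / 2)) => h; [left|right].
  apply: (@le_trans _ _ (leb (cube x (level_radius l) `&` sublevel l) + leb (superlevel l))%E).
    by apply: measureU2 => //; exact: measurableI.
  by rewrite leeD2l// cheb.
have -> : (2 * level_volume l)%:E = ((level_volume l)%:E + (level_volume l)%:E)%E by rewrite -EFinD; congr EFin; ring.
by rewrite leeD2rE.
Qed.

Lemma enorm_le_cube (x y : E) r : 0 <= r -> cube x r y -> enorm (x - y) <= Num.sqrt d%:R * r.
Proof.
move=> r0 cy; rewrite -(ger0_norm r0) -sqrtr_sqr -sqrtrM// ler_wsqrtr//.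
have -> : d%:R * r ^+ 2 = \sum_(i < d) r ^+ 2 by rewrite sumr_const card_ord mulr_natl.
apply: ler_sum => i _; rewrite !mxE -real_normK ?num_real// ler_sqr ?nnegrE//.
have := cy i; rewrite /= in_itv/= => /andP[h1 h2].
by rewrite ler_norml; apply/andP; split; lra.
Qed.

Lemma enorm_gt0 (x : E) : x != 0 -> 0 < enorm x.
Proof.
move=> x0; rewrite sqrtr_gt0 lt_def sumr_ge0 ?andbT; last by move=> i _; exact: sqr_ge0.
apply: contra x0; rewrite psumr_eq0; last by move=> i _; exact: sqr_ge0.
move=> /allP h; apply/eqP/rowP => i; rewrite mxE; apply/eqP.
by have := h i (mem_index_enum _); rewrite sqrf_eq0.
Qed.

Let C1 := 8 / 2 ^+ d * Num.sqrt d%:R `^ (d%:R + 2 * theta).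

(** With [l = |v x|], half of the cube around [x] of half side
    [level_radius l] consists of points [y] where [|v x - v y| >= l/2]; these
    alone contribute [l ^ 2 * level_radius l ^ (- 2 theta)], up to a constant,
    to the energy at [x]. *)
Lemma fractional_pointwise x :
  ((`|v x| `^ q)%:E <= (C1 * Lam)%:E * \int[leb]_y (gagliardo_integrand theta v v (x, y))%:E)%E.
Proof.
have Lam0 : 0 <= Lam by rewrite mulr_ge0 ?powR_ge0.
have C10 : 0 <= C1 by rewrite mulr_ge0 ?powR_ge0// divr_ge0// exprn_ge0.
have I0 : (0 <= \int[leb]_y (gagliardo_integrand theta v v (x, y))%:E)%E.
  by apply: integral_ge0 => y _; rewrite lee_fin gagliardo_ge0.
have [->|vx] := eqVneq (v x) 0.
  rewrite normr0 powR0; last by rewrite gt_eqF// (lt_le_trans _ q2).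
  by rewrite mule_ge0// lee_fin mulr_ge0.
pose l : R := `|v x|; have l0 : 0 < l by rewrite normr_gt0.
rewrite -/l; have r0 := level_radius_gt0 l0; have b0 := level_volume_gt0 l0.
set A := cube x (level_radius l) `&` sublevel l.
have mA : measurable A by apply: measurableI => //; exact: measurable_ball_box.
have sd : 0 < Num.sqrt d%:R :> R by rewrite sqrtr_gt0.
pose D := (Num.sqrt d%:R * level_radius l) `^ (d%:R + 2 * theta).
have D0 : 0 < D by rewrite powR_gt0// mulr_gt0.
have e0 : 0 <= d%:R + 2 * theta by rewrite addr_ge0// mulr_ge0// ltW.
have mg : measurable_fun setT (fun y => (gagliardo_integrand theta v v (x, y))%:E).
  apply/measurable_EFinP; apply: (measurableT_comp (measurable_gagliardo theta mv mv)).
  exact: measurable_pair1.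
have low_ : (((l / 2) ^+ 2 / D)%:E * (level_volume l)%:E <= \int[leb]_y (gagliardo_integrand theta v v (x, y))%:E)%E.
  apply: (@le_trans _ _ (\int[leb]_(y in A) (gagliardo_integrand theta v v (x, y))%:E)%E); last first.
    by apply: ge0_subset_integral => // y _; rewrite lee_fin gagliardo_ge0.
  apply: (@le_trans _ _ (\int[leb]_(y in A) ((l / 2) ^+ 2 / D)%:E)%E).
    rewrite integral_cst// lee_wpmul2l ?half_cube//.
    by rewrite lee_fin divr_ge0 ?sqr_ge0 ?(ltW D0).
  apply: ge0_le_integral => //.
  - by move=> y _; rewrite lee_fin divr_ge0 ?sqr_ge0// ltW.
  - exact: measurable_funS mg.
  - move=> y [cy vy]; rewrite lee_fin /gagliardo_integrand/= -expr2.
    have dv : l / 2 <= `|v x - v y|.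
      apply: le_trans (lerB_dist _ _); rewrite -/l; have : `|v y| <= l / 2 by []; lra.
    have xy : x - y != 0.
      apply/eqP => xy; have : x = y by apply/eqP; rewrite -subr_eq0 xy.
      move=> exy; move: dv; rewrite exy subrr normr0; lra.
    rewrite ler_pM ?sqr_ge0 ?invr_ge0 ?(ltW D0)//.
      by rewrite -(real_normK (num_real (v x - v y))) ler_sqr ?nnegrE//; lra.
    rewrite lef_pV2 ?posrE ?powR_gt0 ?enorm_gt0 ?(mulr_gt0 sd r0)//.
    rewrite ge0_ler_powR ?nnegrE ?(mulr_ge0 (sqrtr_ge0 _) (ltW r0)) ?sqrtr_ge0//.
    by apply: enorm_le_cube => //; exact: ltW.
apply: le_trans (lee_wpmul2l _ low_); last by rewrite lee_fin mulr_ge0.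
rewrite -!EFinM lee_fin le_eqVlt; apply/orP; left; apply/eqP.
have -> : l `^ q = l ^+ 2 * l `^ (q - 2).
  rewrite -powR_mulrn ?(ltW l0)// -powRD; last by rewrite (gt_eqF l0) implybT.
  by congr (_ `^ _); lra.
have DE : D = Num.sqrt d%:R `^ (d%:R + 2 * theta) * (level_radius l ^+ d * level_radius l `^ (2 * theta)).
  rewrite /D powRM ?(ltW sd) ?(ltW r0)//; congr (_ * _).
  by rewrite powRD ?powR_mulrn ?(ltW r0)//; rewrite (gt_eqF r0) implybT.
have bE : level_volume l = 2 ^+ d * level_radius l ^+ d / 2.
  by rewrite -exprMn level_radius_volume// mulrAC mulfV// mul1r.
rewrite DE bE /C1 -(level_radius_scaling l0).
field; rewrite ?gt_eqF ?powR_gt0 ?exprn_gt0//.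
Qed.

Lemma fractional_core :
  (\int[leb]_x (`|v x| `^ q)%:E <=
   (C1 * Lam)%:E * \int[(leb \x leb)%E]_z (gagliardo_integrand theta v v z)%:E)%E.
Proof.
have Lam0 : 0 <= Lam by rewrite mulr_ge0 ?powR_ge0.
have C10 : 0 <= C1 by rewrite mulr_ge0 ?powR_ge0// divr_ge0// exprn_ge0.
have mg : measurable_fun setT (EFin \o gagliardo_integrand theta v v).
  by apply/measurable_EFinP; exact: measurable_gagliardo.
have g0 z : (0 <= (EFin \o gagliardo_integrand theta v v) z)%E by rewrite lee_fin gagliardo_ge0.
have mF : measurable_fun setT (fubini_F leb (EFin \o gagliardo_integrand theta v v)).
  by apply: measurable_fun_fubini_tonelli_F.
rewrite (fubini_tonelli1 _ mg g0) -ge0_integralZl//; last 2 first.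
- by move=> x _; apply: integral_ge0 => y _; exact: g0.
- by rewrite lee_fin mulr_ge0.
apply: ge0_le_integral => //.
- apply/measurable_EFinP; apply: (measurableT_comp (measurable_powR _)).
  exact: measurableT_comp.
- apply: measurable_funeM; exact: mF.
- by move=> x _; exact: fractional_pointwise.
Qed.

End hedberg.

(** * The first-order Sobolev estimate *)

Section cut_off.
Context {R : realType}.

(** A first-order expansion with quadratic remainder; it handles the corners of
    the square of the positive part without case distinction on limits. *)
Lemma is_derive_quadratic (f : R -> R) (x l C : R) :
  (forall h, `|f (x + h) - f x - l * h| <= C * h ^+ 2) -> is_derive x 1 f l.
Proof.
move=> H.
have C0 : 0 <= C by have := le_trans (normr_ge0 _) (H 1); rewrite expr1n mulr1.
suff cv : h^-1 *: ((f \o shift x) (h *: (1 : R)) - f x) @[h --> 0^'] --> l.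
  by split; [apply/cvg_ex; exists l|apply: cvg_lim].
apply/cvgrPdist_le => /= e e0; near=> h.
have h0 : h != 0 by near: h; exact: nbhs_dnbhs_neq.
have -> : l - h^-1 *: (f (h *: (1 : R) + x) - f x) = - (h^-1 * (f (x + h) - f x - l * h)).
  rewrite /GRing.scale/= mulr1 [h + x]addrC; field.
  exact: h0.
rewrite normrN normrM normfV ler_pdivrMl ?normr_gt0//.
apply: (le_trans (H h)); rewrite -[h ^+ 2]ger0_norm ?sqr_ge0// normrX expr2 mulrCA.
rewrite ler_wpM2l//.
have : `|h| <= e / (C + 1).
  near: h; apply: dnbhs0_le; rewrite divr_gt0//; lra.
rewrite ler_pdivlMr; last lra.
have := normr_ge0 h; nra.
Unshelve. all: by end_near. Qed.

Lemma is_derive_pos_part_sqr (a x : R) :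
  is_derive x 1 (fun y : R => Num.max (y - a) 0 ^+ 2) (2 * Num.max (x - a) 0).
Proof.
apply: (@is_derive_quadratic _ _ _ 1) => h; rewrite mul1r.
rewrite [x + h - a]addrAC; move: (x - a) => y.
case: (lerP y 0) => y0; case: (lerP (y + h) 0) => yh.
- by rewrite expr0n/= mulr0 mul0r !subrr normr0 sqr_ge0.
- rewrite expr0n/= mulr0 mul0r !subr0 ger0_norm ?sqr_ge0// ler_sqr ?nnegrE; lra.
- rewrite ler_norml; apply/andP; split; nra.
- have -> : (y + h) ^+ 2 - y ^+ 2 - 2 * y * h = h ^+ 2 by ring.
  by rewrite ger0_norm ?sqr_ge0.
Qed.

(** Composed with [phi ^ 2], a [C^1] step whose derivative, a tent, only sees
    the points where [phi ^ 2] lies in [[a, b]]. *)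
Definition step (a b y : R) := Num.max (y - a) 0 ^+ 2
  - 2 * Num.max (y - (a + b) / 2) 0 ^+ 2 + Num.max (y - b) 0 ^+ 2.

Definition tent (a b y : R) := 2 * Num.max (y - a) 0
  - 4 * Num.max (y - (a + b) / 2) 0 + 2 * Num.max (y - b) 0.

Lemma is_derive_step (a b x : R) : is_derive x 1 (step a b) (tent a b x).
Proof.
have H1 := is_derive_pos_part_sqr a x.
have H2 := is_derive_pos_part_sqr ((a + b) / 2) x.
have H3 := is_derive_pos_part_sqr b x.
have H := is_deriveD (is_deriveB H1 (is_deriveZ 2 H2)) H3.
apply: (is_derive_eq H); rewrite /tent /GRing.scale/=; ring.
Qed.

Lemma step_low (a b y : R) : a <= b -> y <= a -> step a b y = 0.
Proof.
move=> ab ya; rewrite /step !max_r ?subr_le0//; [by rewrite expr0n/= mulr0 subrr addr0|..]; lra.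
Qed.

Lemma step_high (a b : R) : a <= b -> step a b b = (b - a) ^+ 2 / 2.
Proof.
move=> ab; rewrite /step [Num.max (b - b) 0]max_r ?subrr// max_l ?subr_ge0// max_l ?subr_ge0; last lra.
by field.
Qed.

Lemma tent_ge0 (a b y : R) : a <= b -> 0 <= tent a b y.
Proof.
move=> ab; rewrite /tent.
case: (lerP (y - a) 0) => h1; case: (lerP (y - (a + b) / 2) 0) => h2; case: (lerP (y - b) 0) => h3; lra.
Qed.

Lemma tent_le (a b y : R) : a <= b -> tent a b y <= if a <= y <= b then b - a else 0.
Proof.
move=> ab; rewrite /tent; case: ifPn => [/andP[h1 h2]|].
  by case: (lerP (y - a) 0) => ?; case: (lerP (y - (a + b) / 2) 0) => ?; case: (lerP (y - b) 0) => ?; lra.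
rewrite negb_and -!ltNge => /orP[h|h];
by case: (lerP (y - a) 0) => ?; case: (lerP (y - (a + b) / 2) 0) => ?; case: (lerP (y - b) 0) => ?; lra.
Qed.

Lemma continuous_tent (a b : R) : continuous (tent a b).
Proof.
have c e : continuous (fun y : R => Num.max (y - e) 0).
  move=> y; apply: (@continuous_max _ _ (fun y : R => y - e) (fun=> 0)); last exact: cvg_cst.
  by apply: cvgB; [exact: cvg_id|exact: cvg_cst].
move=> y; apply: cvgD; last by apply: cvgM; [exact: cvg_cst|exact: c].
by apply: cvgB; apply: cvgM; by [exact: cvg_cst|exact: c].
Qed.

End cut_off.

Section staircase.
Context {R : realType} {d : nat}.
Local Notation E := 'rV[R]_d.
Local Notation e_ i := (delta_mx ord0 i : E).

(** The staircase path from [0] to [h], one coordinate direction at a time;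
    it only involves partial derivatives. *)
Definition stair (k : nat) (h : E) : E := \row_j (if (j < k)%N then h ord0 j else 0).

Definition stair_path (i : 'I_d) (h : E) (s : R) : E := stair i h + (s * h ord0 i) *: e_ i.

Lemma stair0 h : stair 0 h = 0.
Proof. by apply/rowP => j; rewrite !mxE. Qed.

Lemma staird h : stair d h = h.
Proof. by apply/rowP => j; rewrite !mxE ltn_ord. Qed.

Lemma stair_path1 (i : 'I_d) h : stair_path i h 1 = stair i.+1 h.
Proof.
apply/rowP => j; rewrite !mxE mul1r eqxx/= ltnS.
case: (ltngtP j i) => [ji|ij|/val_inj ->]; rewrite ?eqxx ?mulr1 ?add0r//.
- by rewrite (_ : (j == i) = false) ?mulr0 ?addr0//; apply/eqP => E0; move: ji; rewrite E0 ltnn.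
- by rewrite (_ : (j == i) = false) ?mulr0 ?addr0//; apply/eqP => E0; move: ij; rewrite E0 ltnn.
Qed.

Lemma is_derive_line (phi : E -> R) (y : E) (i : 'I_d) (c s : R) :
  derivable phi (y + (s * c) *: e_ i) (e_ i) ->
  is_derive s 1 (fun t : R => phi (y + (t * c) *: e_ i)) (c * pderiv i phi (y + (s * c) *: e_ i)).
Proof.
move=> D; pose g (t : R) := phi (y + t *: e_ i).
have dg : is_derive (s * c) 1 g (pderiv i phi (y + (s * c) *: e_ i)).
  have E0 : (fun h : R => h^-1 *: ((g \o shift (s * c)) (h *: (1 : R)) - g (s * c))) =
     fun h : R => h^-1 *: ((phi \o shift (y + (s * c) *: e_ i)) (h *: e_ i) - phi (y + (s * c) *: e_ i)).
    by apply/funext => h; rewrite /g /= /shift/= [h *: 1]mulr1 scalerDl addrCA.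
  by split; [rewrite /derivable E0|rewrite /derive E0].
have dl : is_derive s 1 (fun t : R => t * c) c.
  have H := is_deriveM (is_derive_id s (1 : R)) (is_derive_cst c s (1 : R)).
  by apply: (is_derive_eq H); rewrite /GRing.scale/= mulr0 add0r mulr1.
have H := is_derive1_comp (g := fun t : R => t * c) (x := s) dg dl.
by apply: (is_derive_eq H); rewrite mulrC.
Qed.

Lemma continuous_line (f : E -> R) (y : E) (i : 'I_d) (c : R) : continuous f ->
  continuous (fun t : R => f (y + (t * c) *: e_ i)).
Proof.
move=> cf t; apply: continuous_comp; last exact: cf.
apply: cvgD; first exact: cvg_cst.
apply: cvgZr_tmp; apply: cvgM; [exact: cvg_id|exact: cvg_cst].
Qed.

End staircase.

Lemma unit_itv_measure {R : realType} : lebesgue_measure `[0%R : R, 1%R] = 1%E.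
Proof. by rewrite lebesgue_measure_itv/= lte_fin ltr01 oppr0 adde0. Qed.

Section gradient_core.
Context {R : realType} {d : nat}.
Local Notation E := 'rV[R]_d.
Local Notation leb := (lebesgue_rV R d).
Local Notation leb1 := (@lebesgue_measure R).
Local Notation e_ i := (delta_mx ord0 i : E).
Hypothesis d0 : (0 < d)%N.
Variables (Omega : set E) (phi : E -> R) (q K p : R).
Hypotheses (tphi : test_fun Omega phi) (q2 : 2 <= q) (K0 : 0 < K) (p0 : 0 <= p).
Hypothesis scaling : 2 * 1 * p = d%:R * (q - 2).
Hypothesis cheb : forall l : R, 0 < l -> (leb (superlevel phi l) <= (level_volume K p l)%:E)%E.
Local Notation r := (@level_radius _ d K p).
Local Notation b := (level_volume K p).

Let dR0 : 0 < d%:R :> R. Proof. by rewrite ltr0n. Qed.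

(** A path from a point where [|phi| = l] to one where [|phi| <= l/2] loses
    height inside this window; only the gradient there is charged. This keeps
    the estimate local in the values of [phi]. *)
Definition window (l : R) (i : 'I_d) (z : E) : R :=
  if l / 2 <= `|phi z| <= l then pderiv i phi z ^+ 2 else 0.

Lemma window_ge0 l i z : 0 <= window l i z.
Proof. by rewrite /window; case: ifP => // _; exact: sqr_ge0. Qed.

Lemma measurable_window l i : measurable_fun setT (window l i).
Proof.
have mphi := test_fun_measurable tphi.
have mn : measurable_fun setT (fun z => `|phi z|) by exact: measurableT_comp.
apply: measurable_fun_ifT => //.
- by apply: measurable_and; apply: measurable_fun_ler.
- exact: measurable_funX (test_fun_measurable (test_fun_pderiv i tphi)).
Qed.

Lemma measurable_line (y : E) (i : 'I_d) (c : R) :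
  measurable_fun [set: R] (fun s : R => y + (s * c) *: e_ i).
Proof.
apply/measurable_fun_rVP => j.
rewrite (_ : (fun s => _) = fun s : R => y ord0 j + s * c * (e_ i) ord0 j); last first.
  by apply/funext => s; rewrite !mxE.
apply: measurable_funD => //; apply: measurable_funM => //.
exact: measurable_funM.
Qed.

(** The fundamental theorem of calculus along a segment in a coordinate
    direction, then Young's inequality; the weights are chosen so that the sum
    over the [d] segments of a staircase absorbs the first term. *)
Lemma segment_bound (l rho : R) (y : E) (i : 'I_d) (c : R) : 0 < l -> `|c| <= rho ->
  ((step (l ^+ 2 / 4) (l ^+ 2) (phi y ^+ 2)
    - step (l ^+ 2 / 4) (l ^+ 2) (phi (y + c *: e_ i) ^+ 2))%:E
  <= (9 / (64 * d%:R) * l ^+ 4)%:E + (4 * d%:R * l ^+ 2 * rho ^+ 2)%:E *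
    \int[leb1]_(s in `[0%R, 1%R]) (window l i (y + (s * c) *: e_ i))%:E)%E.
Proof.
move=> l0 crho.
have rho0 : 0 <= rho by exact: le_trans (normr_ge0 c) crho.
have ab : l ^+ 2 / 4 <= l ^+ 2 by have := sqr_ge0 l; lra.
pose z (s : R) := y + (s * c) *: e_ i.
pose F (s : R) := - step (l ^+ 2 / 4) (l ^+ 2) (phi (z s) ^+ 2).
pose f (s : R) := - (tent (l ^+ 2 / 4) (l ^+ 2) (phi (z s) ^+ 2) * (2 * phi (z s) * (c * pderiv i phi (z s)))).
have dF (s : R) : is_derive s 1 F (f s).
  have dp : is_derive s 1 (fun t => phi (z t)) (c * pderiv i phi (z s)).
    by apply: is_derive_line; exact: test_fun_derivable tphi.
  have dq : is_derive s 1 (fun t => phi (z t) ^+ 2) (2 * phi (z s) * (c * pderiv i phi (z s))).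
    have H := is_deriveM dp dp; apply: (is_derive_eq H).
    by rewrite /GRing.scale/=; ring.
  apply: is_deriveN.
  exact: (is_derive1_comp (g := fun t => phi (z t) ^+ 2) (x := s) (is_derive_step _ _ _) dq).
have cphi := test_fun_continuous tphi.
have cz : continuous (fun t => phi (z t)) by exact: continuous_line.
have cd : continuous (fun t => pderiv i phi (z t)).
  by apply: continuous_line; exact: test_fun_continuous (test_fun_pderiv i tphi).
have cf : continuous f.
  move=> s; apply: cvgN; apply: cvgM.
    apply: (@continuous_comp _ _ _ (fun t => phi (z t) ^+ 2) (tent _ _)); last exact: continuous_tent.
    exact: (cvgM (cz s) (cz s)).
  apply: cvgM; first by apply: cvgM; [exact: cvg_cst|exact: cz].
  by apply: cvgM; [exact: cvg_cst|exact: cd].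
have ftc : (\int[leb1]_(s in `[0%R, 1%R]) (f s)%:E = (F 1)%:E - (F 0)%:E)%E.
  apply: continuous_FTC2 => //.
  - exact: continuous_subspaceT.
  - have cF (s : R) : {for s, continuous F}.
      by apply: differentiable_continuous; apply/derivable1_diffP; have [] := dF s.
    split.
    + by move=> s _; have [] := dF s.
    + exact/cvg_at_right_filter/cF.
    + exact/cvg_at_left_filter/cF.
  - by move=> s _; rewrite derive1E; case: (dF s) => _ ->.
have -> : (step (l ^+ 2 / 4) (l ^+ 2) (phi y ^+ 2)
    - step (l ^+ 2 / 4) (l ^+ 2) (phi (y + c *: e_ i) ^+ 2))%:E = (\int[leb1]_(s in `[0%R, 1%R]) (f s)%:E)%E.
  rewrite ftc -EFinB /F /z mul0r scale0r addr0 mul1r; congr EFin; ring.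
have mw : measurable_fun [set: R] (fun s : R => window l i (z s)).
  exact: (measurableT_comp (measurable_window l i) (measurable_line y i c)).
have c40 : 0 <= 4 * d%:R * l ^+ 2 * rho ^+ 2 by rewrite !mulr_ge0 ?sqr_ge0// ltW.
have c90 : 0 <= 9 / (64 * d%:R) * l ^+ 4.
  by rewrite mulr_ge0 ?exprn_ge0 ?divr_ge0 ?mulr_ge0 ?(ltW l0) ?(ltW dR0).
have mI : measurable `[0%R : R, 1%R] by exact: measurable_itv.
have -> : ((9 / (64 * d%:R) * l ^+ 4)%:E + (4 * d%:R * l ^+ 2 * rho ^+ 2)%:E *
    \int[leb1]_(s in `[0%R, 1%R]) (window l i (y + (s * c) *: e_ i))%:E =
  \int[leb1]_(s in `[0%R, 1%R]) (9 / (64 * d%:R) * l ^+ 4 + 4 * d%:R * l ^+ 2 * rho ^+ 2 * window l i (z s))%:E)%E.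
  move: c40 c90; move: (4 * d%:R * l ^+ 2 * rho ^+ 2) (9 / (64 * d%:R) * l ^+ 4) => B A B0 A0.
  have mwI : measurable_fun `[0%R : R, 1%R] (fun s : R => (window l i (z s))%:E).
    by apply/measurable_EFinP; exact: measurable_funS mw.
  transitivity (\int[leb1]_(s in `[0%R, 1%R]) (A%:E + B%:E * (window l i (z s))%:E))%E; last first.
    by apply: eq_integral.
  rewrite ge0_integralD//.
  - congr (_ + _)%E.
      by rewrite integral_cst// -[LHS]mule1; congr (_ * _)%E; exact/esym/unit_itv_measure.
    rewrite ge0_integralZl//.
    by move=> s _; rewrite lee_fin window_ge0.
  - by move=> s _; rewrite mule_ge0// lee_fin window_ge0.
  - exact: measurable_funeM.
have mfI : measurable_fun `[0%R : R, 1%R] f.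
  by apply: measurable_funS (continuous_measurable_fun cf).
apply: le_trans (lee_abs _) _; apply: le_trans (le_abse_integral _ _ _) _ => //.
  exact/measurable_EFinP.
apply: ge0_le_integral => //.
- by apply: measurableT_comp => //; exact/measurable_EFinP.
- apply/measurable_EFinP; apply: measurable_funD => //; apply: measurable_funM => //.
  exact: measurable_funS mw.
move=> s _; rewrite abse_EFin lee_fin.
have t0 := tent_ge0 (phi (z s) ^+ 2) ab.
have t1 := tent_le (phi (z s) ^+ 2) ab.
have W : (l ^+ 2 / 4 <= phi (z s) ^+ 2 <= l ^+ 2) = (l / 2 <= `|phi (z s)| <= l).
  rewrite -(real_normK (num_real (phi (z s)))).
  have -> : l ^+ 2 / 4 = (l / 2) ^+ 2 by field.
  by rewrite !ler_sqr ?nnegrE ?divr_ge0 ?(ltW l0).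
rewrite /window; move: t1; rewrite W; case: ifPn => [/andP[w1 w2] t1|_ t1]; last first.
  have -> : `|f s| = 0 by rewrite /f (_ : tent _ _ _ = 0) ?mul0r ?oppr0 ?normr0//; apply/eqP; rewrite eq_le t1 t0.
  by rewrite mulr0 addr0.
rewrite /f normrN !normrM (ger0_norm t0) (@ger0_norm _ 2)//.
have -> : pderiv i phi (z s) ^+ 2 = `|pderiv i phi (z s)| ^+ 2 by rewrite real_normK ?num_real.
move: (normr_ge0 (pderiv i phi (z s))) (normr_ge0 c); move: (`|pderiv i phi (z s)|) => D D0 cc0.
apply: (@le_trans _ _ (3 / 4 * l ^+ 2 * (2 * l * (rho * D)))).
  apply: ler_pM => //; first by rewrite !mulr_ge0.
    by lra.
  by apply: ler_pM; rewrite ?mulr_ge0// ?ler_wpM2r//; lra.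
(* Young's inequality, as a square. *)
have H : 0 <= d%:R^-1 * (3 / 8 * l ^+ 2 - 2 * d%:R * l * (rho * D)) ^+ 2.
  by rewrite mulr_ge0 ?sqr_ge0 ?invr_ge0 ?ltW.
rewrite -subr_ge0; apply: le_trans H _; rewrite le_eqVlt; apply/orP; left; apply/eqP.
by field; rewrite gt_eqF.
Qed.

Definition window_integral (l : R) (i : 'I_d) (x h : E) : \bar R :=
  (\int[leb1]_(s in `[0%R, 1%R]) (window l i (x + stair_path i h s))%:E)%E.

(** The step falls from [9/32 l^4] to 0 along the staircase; half of this is
    absorbed by the first terms of [segment_bound]. *)
Lemma path_bound (l rho : R) (x h : E) : 0 < l -> 0 <= rho -> `|phi x| = l -> `|phi (x + h)| <= l / 2 ->
  (forall j, `|h ord0 j| <= rho) ->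
  ((l ^+ 2)%:E <= (32 * d%:R * rho ^+ 2)%:E * \sum_(i < d) window_integral l i x h)%E.
Proof.
move=> l0 rho0 phix phih hrho.
have ab : l ^+ 2 / 4 <= l ^+ 2 by have := sqr_ge0 l; lra.
pose St y := step (l ^+ 2 / 4) (l ^+ 2) (phi y ^+ 2).
have start : St (x + stair 0 h) = 9 / 32 * l ^+ 4.
  by rewrite stair0 addr0 /St -(real_normK (num_real (phi x))) phix (step_high ab); field.
have stop : St (x + stair d h) = 0.
  rewrite staird /St step_low// -(real_normK (num_real (phi _))).
  have -> : l ^+ 2 / 4 = (l / 2) ^+ 2 by field.
  by rewrite ler_sqr ?nnegrE ?divr_ge0 ?(ltW l0).
have tele : 9 / 32 * l ^+ 4 = \sum_(i < d) (St (x + stair i h) - St (x + stair i.+1 h)).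
  rewrite -(big_mkord xpredT (fun i => St (x + stair i h) - St (x + stair i.+1 h))).
  rewrite (@telescope_sumr_eq _ 0%N d (fun i => - St (x + stair i h)))//; last first.
    by move=> i _; rewrite opprK addrC.
  by rewrite start stop oppr0 add0r opprK.
have I0 i : (0 <= window_integral l i x h)%E.
  by apply: integral_ge0 => s _; rewrite lee_fin window_ge0.
have main : ((9 / 32 * l ^+ 4)%:E <= (9 / 64 * l ^+ 4)%:E + (4 * d%:R * l ^+ 2 * rho ^+ 2)%:E *
    \sum_(i < d) window_integral l i x h)%E.
  rewrite tele -sumEFin ge0_sume_distrr//.
  have -> : 9 / 64 * l ^+ 4 = \sum_(i < d) (9 / (64 * d%:R) * l ^+ 4).
    by rewrite sumr_const card_ord -mulr_natl; field; rewrite gt_eqF.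
  rewrite -sumEFin -big_split/=; apply: lee_sum => i _.
  have := @segment_bound l rho (x + stair i h) i (h ord0 i) l0 (hrho i).
  have -> : x + stair i h + h ord0 i *: e_ i = x + stair i.+1 h.
    by rewrite -stair_path1 /stair_path mul1r addrA.
  have -> : (\int[leb1]_(s in `[0%R, 1%R]) (window l i (x + stair i h + (s * h ord0 i) *: e_ i))%:E =
    window_integral l i x h)%E.
    by apply: eq_integral => s _; rewrite /stair_path addrA.
  by [].
have : ((9 / 64 * l ^+ 4)%:E <= (4 * d%:R * l ^+ 2 * rho ^+ 2)%:E *
    \sum_(i < d) window_integral l i x h)%E.
  move: main; have -> : 9 / 32 * l ^+ 4 = 9 / 64 * l ^+ 4 + 9 / 64 * l ^+ 4 by field.
  by rewrite EFinD leeD2lE.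
have c0 : 0 <= 64 / (9 * l ^+ 2) by rewrite divr_ge0// mulr_ge0// sqr_ge0.
have c0' : (0 <= (64 / (9 * l ^+ 2))%:E)%E by rewrite lee_fin.
move=> /(lee_wpmul2l c0'); rewrite muleA -!EFinM.
have -> : 64 / (9 * l ^+ 2) * (9 / 64 * l ^+ 4) = l ^+ 2 by field; rewrite gt_eqF.
move=> /le_trans; apply; rewrite lee_wpmul2r ?sume_ge0// lee_fin.
have -> : 64 / (9 * l ^+ 2) * (4 * d%:R * l ^+ 2 * rho ^+ 2) = 256 / 9 * (d%:R * rho ^+ 2).
  by field; rewrite gt_eqF.
have : 0 <= d%:R * rho ^+ 2 by rewrite mulr_ge0 ?sqr_ge0 ?(ltW dR0).
by rewrite -[32 * _ * _]mulrA; move: (d%:R * rho ^+ 2) => u u0; lra.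
Qed.

Let invb (l : R) := K^-1 * l `^ p.

(** The window, rewritten in terms of the running point [z] of the path only:
    [|phi z|] is comparable to [l], so the volume and the radius of the cube
    can be taken at [|phi z|]. After the translation [z = x + path] the
    integration in [x] becomes one in [z], and the one in [h] is over a cube
    whose volume cancels the weight. *)
Definition window_density (i : 'I_d) (z h : E) : R :=
  if (phi z != 0) && [forall j, `|h ord0 j| <= r `|phi z|]
  then invb `|phi z| * pderiv i phi z ^+ 2 else 0.

Lemma window_density_ge0 i z h : 0 <= window_density i z h.
Proof.
rewrite /window_density; case: ifP => // _; rewrite mulr_ge0 ?sqr_ge0//.
by rewrite /invb mulr_ge0 ?powR_ge0// invr_ge0 ltW.
Qed.

Lemma level_radius_noninc (l m : R) : 0 < l -> l <= m -> r m <= r l.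
Proof.
move=> l0 lm; have m0 := lt_le_trans l0 lm.
have bl := level_volume_gt0 p K0 l0; have bm := level_volume_gt0 p K0 m0.
have bml : b m <= b l.
  rewrite /level_volume; apply: ler_wpM2l; first exact: ltW.
  rewrite !powRN lef_pV2 ?posrE ?powR_gt0//.
  by apply: ge0_ler_powR => //; rewrite nnegrE ltW.
rewrite /level_radius; apply: ler_wpM2r; first by rewrite invr_ge0.
apply: ge0_ler_powR; first by rewrite invr_ge0 ltW.
- by rewrite nnegrE mulr_ge0// ltW.
- by rewrite nnegrE mulr_ge0// ltW.
- by rewrite ler_pM2l.
Qed.

Lemma window_le_density (l : R) i z (h : E) : 0 < l -> (forall j, `|h ord0 j| <= r l) ->
  window l i z <= 2 `^ p * b l * window_density i z h.
Proof.
move=> l0 hh; have b0 := level_volume_gt0 p K0 l0.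
rewrite /window; case: ifPn => [/andP[w1 w2]|_]; last first.
  apply: mulr_ge0 (window_density_ge0 _ _ _); apply: mulr_ge0 (ltW b0); exact: powR_ge0.
have n0 : 0 < `|phi z| by apply: lt_le_trans w1; rewrite divr_gt0.
rewrite /window_density -normr_gt0 n0/=; have -> : [forall j, `|h ord0 j| <= r `|phi z|].
  by apply/forallP => j; apply: le_trans (hh j) _; exact: level_radius_noninc.
rewrite mulrA ler_peMl ?sqr_ge0// /invb /level_volume.
have -> : 2 `^ p * (K * l `^ (- p)) * (K^-1 * `|phi z| `^ p) = (2 * `|phi z|) `^ p / l `^ p.
  rewrite powRN powRM ?normr_ge0//; field.
  by rewrite (gt_eqF K0) (gt_eqF (powR_gt0 p l0)).
rewrite ler_pdivlMr ?powR_gt0// mul1r ge0_ler_powR ?nnegrE ?mulr_ge0 ?(ltW l0)//; lra.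
Qed.

Let Lam := 2 `^ (- (2 * 1)) * (2 * K) `^ (2 * 1 / d%:R) : R.

Definition density_path (i : 'I_d) (xh : E * E) (s : R) : R :=
  if (0 <= s) && (s <= 1) then window_density i (xh.1 + stair_path i xh.2 s) xh.2 else 0.

Definition density_integral (i : 'I_d) (xh : E * E) : \bar R :=
  (\int[leb1]_s (density_path i xh s)%:E)%E.

Lemma density_path_ge0 i xh s : (0 <= (density_path i xh s)%:E)%E.
Proof. by rewrite lee_fin /density_path; case: ifP => // _; exact: window_density_ge0. Qed.

Lemma measurable_window_density i : measurable_fun setT (fun zh : E * E => window_density i zh.1 zh.2).
Proof.
have mphi := test_fun_measurable tphi.
have mz : measurable_fun setT (fun zh : E * E => phi zh.1) by exact: measurableT_comp mphi measurable_fst.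
have mn : measurable_fun setT (fun zh : E * E => `|phi zh.1|) by exact: measurableT_comp.
have mpow (s : R) : measurable_fun setT (fun zh : E * E => `|phi zh.1| `^ s).
  exact: (measurableT_comp (measurable_powR s) mn).
have mr : measurable_fun setT (fun zh : E * E => r `|phi zh.1|).
  apply: measurable_funM => //; apply: (measurableT_comp (measurable_powR _)).
  by apply: measurable_funM => //; apply: measurable_funM => //; exact: mpow.
apply: measurable_fun_ifT => //.
- apply: measurable_and.
    by apply: measurable_neg; apply: measurable_fun_eqr.
  apply: (measurable_fun_bool true); rewrite setTI.
  rewrite (_ : _ @^-1` _ = \bigcap_(j in [set: 'I_d]) [set zh : E * E | `|zh.2 ord0 j| <= r `|phi zh.1|]).
    apply: fin_bigcap_measurable => // j _.
    have mj : measurable_fun setT (fun zh : E * E => `|zh.2 ord0 j|).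
      apply: measurableT_comp => //; exact: (measurableT_comp (measurable_coord j) measurable_snd).
    have := measurable_fun_ler mj mr; move=> /(_ measurableT [set true]); rewrite setTI; exact.
  apply/seteqP; split=> zh /=.
    by move=> /forallP H j _; exact: H.
  by move=> H; apply/forallP => j; exact: H.
- apply: measurable_funM; first by apply: measurable_funM => //; exact: mpow.
  apply: measurable_funX.
  exact: (measurableT_comp (test_fun_measurable (test_fun_pderiv i tphi)) measurable_fst).
Qed.

Lemma measurable_stair_path (i : 'I_d) : measurable_fun setT (fun hs : E * R => stair_path i hs.1 hs.2).
Proof.
have mc (j : 'I_d) : measurable_fun setT (fun hs : E * R => hs.1 ord0 j).
  exact: (measurableT_comp (measurable_coord j) measurable_fst).
apply/measurable_fun_rVP => j.
rewrite (_ : (fun hs => _) = fun hs : E * R => (if (j < i)%N then hs.1 ord0 j else 0) + hs.2 * hs.1 ord0 i * (e_ i) ord0 j).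
  apply: measurable_funD; first by case: (j < i)%N.
  by apply: measurable_funM => //; apply: measurable_funM.
by apply/funext => hs; rewrite !mxE.
Qed.

Lemma measurable_density_path i :
  measurable_fun setT (fun w : (E * E) * R => (density_path i w.1 w.2)%:E).
Proof.
apply/measurable_EFinP; apply: measurable_fun_ifT => //.
  by apply: measurable_and; apply: measurable_fun_ler => //; exact: measurable_snd.
have m11 : measurable_fun setT (fun w : (E * E) * R => w.1.1) by exact: (measurableT_comp measurable_fst measurable_fst).
have m12 : measurable_fun setT (fun w : (E * E) * R => w.1.2) by exact: (measurableT_comp measurable_snd measurable_fst).
have mp : measurable_fun setT (fun w : (E * E) * R => stair_path i w.1.2 w.2).
  have mpair : measurable_fun setT (fun w : (E * E) * R => (w.1.2, w.2)).
    by apply/measurable_fun_pairP; split; [exact: m12|exact: measurable_snd].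
  exact: (measurableT_comp (measurable_stair_path i) mpair).
have ms : measurable_fun setT (fun w : (E * E) * R => w.1.1 + stair_path i w.1.2 w.2).
  apply/measurable_fun_rVP => j.
  rewrite (_ : (fun w => _) = fun w : (E * E) * R => w.1.1 ord0 j + stair_path i w.1.2 w.2 ord0 j); last first.
    by apply/funext => w; rewrite !mxE.
  apply: measurable_funD.
  - exact: (measurableT_comp (measurable_coord j) m11).
  - exact: (measurableT_comp (measurable_coord j) mp).
have mpair : measurable_fun setT (fun w : (E * E) * R => (w.1.1 + stair_path i w.1.2 w.2, w.1.2)).
  by apply/measurable_fun_pairP; split.
exact: (measurableT_comp (measurable_window_density i) mpair).
Qed.

Lemma measurable_density_integral i : measurable_fun setT (density_integral i).
Proof.
have H := measurable_fun_fubini_tonelli_F (m2 := lebesgue_measure) _ (measurable_density_path i).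
by apply: H => w; exact: density_path_ge0.
Qed.

Lemma measurable_density_integral_r i x : measurable_fun setT (fun h => density_integral i (x, h)).
Proof. exact: (measurableT_comp (measurable_density_integral i) (measurable_pair1 x)). Qed.

Lemma density_integral_ge0 i xh : (0 <= density_integral i xh)%E.
Proof. by apply: integral_ge0 => s _; exact: density_path_ge0. Qed.

Lemma window_integral_le (l : R) i (x h : E) : 0 < l -> (forall j, `|h ord0 j| <= r l) ->
  (window_integral l i x h <= (2 `^ p * b l)%:E * density_integral i (x, h))%E.
Proof.
move=> l0 hh; have c0 : 0 <= 2 `^ p * b l by apply: mulr_ge0 (ltW (level_volume_gt0 p K0 l0)); exact: powR_ge0.
have md : measurable_fun setT (fun s => (density_path i (x, h) s)%:E).
  exact: (measurableT_comp (measurable_density_path i) (measurable_pair1 (x, h))).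
rewrite /density_integral -ge0_integralZl//; last by move=> s _; exact: density_path_ge0.
rewrite /window_integral [leLHS]integral_mkcond.
apply: ge0_le_integral => //.
- by move=> s _; rewrite patchE; case: ifP => // _; rewrite lee_fin window_ge0.
- apply/(measurable_restrictT _ _).1 => //; apply/measurable_EFinP.
  apply: measurable_funS measurableT _ _ => //.
  apply: (measurableT_comp (measurable_window l i)).
  have mp := measurable_line (x + stair i h) i (h ord0 i).
  rewrite (_ : (fun s : R => x + stair_path i h s) = (fun s : R => x + stair i h + (s * h ord0 i) *: e_ i))//.
  by apply/funext => s; rewrite /stair_path addrA.
- exact: measurable_funeM.
- move=> s _; rewrite patchE mem_setE in_itv/= /density_path/=; case: ifP => _.
    by rewrite -EFinM lee_fin window_le_density.
  by rewrite mule0.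
Qed.

Let Ccore := 32 * d%:R * Lam * 2 `^ p.

(** [path_bound] averaged over the displacements [h] for which [x + h] lies in
    the half of the cube where [|phi| <= l/2]. *)
Lemma gradient_pointwise x :
  ((`|phi x| `^ q)%:E <= Ccore%:E * \sum_(i < d) \int[leb]_h density_integral i (x, h))%E.
Proof.
have Lam0 : 0 <= Lam by rewrite mulr_ge0 ?powR_ge0.
have C0 : 0 <= Ccore by rewrite !mulr_ge0 ?powR_ge0.
have S0 : (0 <= \sum_(i < d) \int[leb]_h density_integral i (x, h))%E.
  by apply: sume_ge0 => i _; apply: integral_ge0 => h _; exact: density_integral_ge0.
have [->|px] := eqVneq (phi x) 0.
  rewrite normr0 powR0; last by rewrite gt_eqF// (lt_le_trans _ q2).
  by rewrite mule_ge0// lee_fin.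
pose l : R := `|phi x|; have l0 : 0 < l by rewrite normr_gt0.
rewrite -/l; have r0 : 0 < r l by exact: level_radius_gt0.
have b0 := level_volume_gt0 p K0 l0.
pose A : set E := cube x (r l) `&` sublevel phi l.
pose H : set E := [set h | A (h + x)].
have mphi := test_fun_measurable tphi.
have mA : measurable A.
  apply: measurableI; first exact: measurable_ball_box.
  have mn : measurable_fun setT (fun z => `|phi z|) by exact: measurableT_comp.
  have := measurable_fun_ler mn (measurable_cst (l / 2)) => /(_ measurableT [set true]); rewrite setTI; exact.
have mH : measurable H.
  by have := measurable_addr_rV x measurableT mA; rewrite setTI.
have lebH : leb H = leb A.
  transitivity (\int[leb]_h (\1_H h)%:E)%E; first by rewrite integral_indic// setIT.
  transitivity (\int[leb]_h (\1_A h)%:E)%E; last by rewrite integral_indic// setIT.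
  rewrite -(@ge0_integral_rV_shift _ _ x (fun z => (\1_A z)%:E))//.
  by apply/measurable_EFinP; exact: measurable_indic.
have C'0 : 0 <= Ccore / l `^ q * b l by rewrite mulr_ge0 ?divr_ge0 ?powR_ge0 ?(ltW b0).
have key h : H h -> ((l `^ q / b l)%:E <= \sum_(i < d) Ccore%:E * density_integral i (x, h))%E.
  move=> [ch vh].
  have hh j : `|h ord0 j| <= r l.
    by have := ch j; rewrite /= in_itv/= mxE => /andP[h1 h2]; rewrite ler_norml; apply/andP; split; lra.
  have := path_bound l0 (ltW r0) (erefl : `|phi x| = l) _ hh.
  rewrite addrC => /(_ vh) /le_trans pb.
  have pb2 : ((l ^+ 2)%:E <= (32 * d%:R * r l ^+ 2)%:E * \sum_(i < d) (2 `^ p * b l)%:E * density_integral i (x, h))%E.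
    apply: pb; apply: lee_wpmul2l.
      by rewrite lee_fin; apply: mulr_ge0 (sqr_ge0 _); exact: mulr_ge0.
    by apply: lee_sum => i _; exact: window_integral_le.
  rewrite -ge0_sume_distrr; last by move=> i _; exact: density_integral_ge0.
  move: pb2; rewrite -ge0_sume_distrr; last by move=> i _; exact: density_integral_ge0.
  move: (\sum_(i < d) density_integral i (x, h))%E => S pb2.
  have k0 : 0 <= l `^ (q - 2) / b l by rewrite divr_ge0 ?powR_ge0 ?(ltW b0).
  have k0' : (0 <= (l `^ (q - 2) / b l)%:E)%E by rewrite lee_fin.
  have := lee_wpmul2l k0' pb2; rewrite !muleA -!EFinM.
  have -> : l `^ (q - 2) / b l * l ^+ 2 = l `^ q / b l.
    rewrite mulrAC -powR_mulrn ?(ltW l0)// -powRD; last by rewrite (gt_eqF l0) implybT.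
    by congr (_ `^ _ / _); lra.
  have -> : l `^ (q - 2) / b l * (32 * d%:R * r l ^+ 2) * (2 `^ p * b l) = Ccore.
    rewrite /Ccore /Lam -(level_radius_scaling d0 K0 scaling l0).
    have -> : r l `^ (2 * 1) = r l ^+ 2 by rewrite mulr1 powR_mulrn// ltW.
    by field; rewrite gt_eqF.
  by [].
have mS : measurable_fun setT (fun h => \sum_(i < d) Ccore%:E * density_integral i (x, h))%E.
  by apply: emeasurable_sum => i; apply: measurable_funeM; exact: measurable_density_integral_r.
have S'0 h : (0 <= \sum_(i < d) Ccore%:E * density_integral i (x, h))%E.
  by apply: sume_ge0 => i _; rewrite mule_ge0 ?density_integral_ge0// lee_fin.
have -> : (Ccore%:E * (\sum_(i < d) \int[leb]_h density_integral i (x, h)) =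
  \int[leb]_h (\sum_(i < d) Ccore%:E * density_integral i (x, h)))%E.
  rewrite ge0_integral_sum//.
  - rewrite ge0_sume_distrr; last by move=> i _; apply: integral_ge0 => h _; exact: density_integral_ge0.
    apply: eq_bigr => i _; rewrite ge0_integralZl//.
    + exact: measurable_density_integral_r.
    + by move=> h _; exact: density_integral_ge0.
  - by move=> i; apply: measurable_funeM; exact: measurable_density_integral_r.
  - by move=> i h _; rewrite mule_ge0 ?density_integral_ge0// lee_fin.
have hbH : ((b l)%:E <= leb H)%E by rewrite lebH; exact: half_cube.
apply: (@le_trans _ _ (\int[leb]_(h in H) (l `^ q / b l)%:E)%E).
  rewrite integral_cst//.
  apply: (@le_trans _ _ ((l `^ q / b l)%:E * (b l)%:E)%E).
    by rewrite -EFinM lee_fin divfK// gt_eqF.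
  by rewrite lee_wpmul2l// lee_fin divr_ge0 ?powR_ge0 ?(ltW b0).
apply: (@le_trans _ _ (\int[leb]_(h in H) (\sum_(i < d) Ccore%:E * density_integral i (x, h)))%E).
  apply: ge0_le_integral => //.
  - by move=> h _; rewrite lee_fin divr_ge0 ?powR_ge0 ?(ltW b0).
  - exact: measurable_funS mS.
by apply: ge0_subset_integral.
Qed.

(** Tonelli's theorem and the translation invariance of the measure, for each
    fixed position on the path. *)
Lemma integral_density i : (\int[leb]_x \int[leb]_h density_integral i (x, h) =
  \int[leb]_h \int[leb]_z (window_density i z h)%:E)%E.
Proof.
rewrite (fubini_tonelli _ (measurable_density_integral i) (density_integral_ge0 i)).
apply: eq_integral => h _; rewrite /density_integral.
have md : measurable_fun setT (fun w : E * R => (density_path i (w.1, h) w.2)%:E).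
  have mp : measurable_fun setT (fun w : E * R => ((w.1, h), w.2)).
    apply/measurable_fun_pairP; split; last exact: measurable_snd.
    by apply/measurable_fun_pairP; split; [exact: measurable_fst|exact: measurable_cst].
  exact: (measurableT_comp (measurable_density_path i) mp).
rewrite (fubini_tonelli (m2 := lebesgue_measure) _ md); last by move=> w; exact: density_path_ge0.
have mdz : measurable_fun setT (fun z => (window_density i z h)%:E).
  by apply/measurable_EFinP; exact: (measurableT_comp (measurable_window_density i) (measurable_pair2 h)).
have -> : (\int[leb]_z (window_density i z h)%:E = \int[leb1]_(s in `[0%R, 1%R]) \int[leb]_z (window_density i z h)%:E)%E.
  rewrite integral_cst//.
    by rewrite -[LHS]mule1; congr (_ * _)%E; exact/esym/unit_itv_measure.
rewrite [RHS]integral_mkcond; apply: eq_integral => s _.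
rewrite patchE mem_setE in_itv/= /density_path/=; case: ifP => _; last first.
  by rewrite integral0.
rewrite -(ge0_integral_rV_shift (stair_path i h s) mdz)// => z.
by rewrite lee_fin window_density_ge0.
Qed.

Lemma integral_density_le i : (\int[leb]_h \int[leb]_z (window_density i z h)%:E <=
  2%:E * \int[leb]_z (pderiv i phi z ^+ 2)%:E)%E.
Proof.
have md : measurable_fun setT (fun w : E * E => (window_density i w.1 w.2)%:E).
  by apply/measurable_EFinP; exact: measurable_window_density.
rewrite -(fubini_tonelli _ md); last by move=> w; rewrite lee_fin window_density_ge0.
have mp : measurable_fun setT (fun z => (pderiv i phi z ^+ 2)%:E).
  apply/measurable_EFinP; apply: measurable_funX.
  exact: test_fun_measurable (test_fun_pderiv i tphi).
rewrite -ge0_integralZl//; last by move=> z _; rewrite lee_fin sqr_ge0.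
apply: ge0_le_integral => //.
- by move=> z _; apply: integral_ge0 => h _; rewrite lee_fin window_density_ge0.
- by apply: (measurable_fun_fubini_tonelli_F (m2 := leb) _ md) => w; rewrite lee_fin window_density_ge0.
- exact: measurable_funeM.
move=> z _.
have [pz|pz] := eqVneq (phi z) 0.
  rewrite integral0_eq; first by rewrite -EFinM lee_fin mulr_ge0 ?sqr_ge0.
  by move=> h _; rewrite /window_density pz eqxx.
have n0 : 0 < `|phi z| by rewrite normr_gt0.
have b0 := level_volume_gt0 p K0 n0.
have r0 : 0 < r `|phi z| by exact: level_radius_gt0.
have -> : (\int[leb]_h (window_density i z h)%:E = \int[leb]_h ((invb `|phi z| * pderiv i phi z ^+ 2)%:E * (\1_(cube 0 (r `|phi z|)) h)%:E))%E.
  apply: eq_integral => h _; rewrite /window_density pz/= indicE -EFinM; congr EFin.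
  have -> : [forall j, `|h ord0 j| <= r `|phi z|] = (h \in cube 0 (r `|phi z|)).
    apply/forallP/idP => [H|].
      rewrite inE => j /=; rewrite mxE in_itv/= !add0r -ler_norml; exact: H.
    rewrite inE => H j; have := H j; rewrite /= mxE in_itv/= !add0r -ler_norml; exact.
  by case: (h \in _); rewrite ?mulr1 ?mulr0.
have i0 : 0 <= invb `|phi z| by rewrite mulr_ge0 ?powR_ge0// invr_ge0 ltW.
rewrite ge0_integralZl//; first last.
- by rewrite lee_fin mulr_ge0 ?sqr_ge0.
- apply/measurable_EFinP; apply: measurable_indic; exact: measurable_ball_box.
have -> : (\int[leb]_h (\1_(cube 0 (r `|phi z|)) h)%:E = (2 * b `|phi z|)%:E)%E.
  rewrite integral_indic//; last exact: measurable_ball_box.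
  by rewrite setIT -(level_radius_volume d0 p K0 n0); exact: lebesgue_cube (ltW r0).
rewrite -!EFinM lee_fin.
rewrite mulrAC ler_wpM2r ?sqr_ge0// /invb /level_volume powRN.
rewrite le_eqVlt; apply/orP; left; apply/eqP; field.
by rewrite (gt_eqF K0) (gt_eqF (powR_gt0 p n0)).
Qed.

Lemma gradient_core :
  (\int[leb]_x (`|phi x| `^ q)%:E <=
   (Ccore * 2)%:E * \sum_(i < d) \int[leb]_z (pderiv i phi z ^+ 2)%:E)%E.
Proof.
have Lam0 : 0 <= Lam by rewrite mulr_ge0 ?powR_ge0.
have C0 : 0 <= Ccore by rewrite !mulr_ge0 ?powR_ge0.
have D0 i x : (0 <= \int[leb]_h density_integral i (x, h))%E.
  by apply: integral_ge0 => h _; exact: density_integral_ge0.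
have mD i : measurable_fun setT (fun x => \int[leb]_h density_integral i (x, h))%E.
  apply: (measurable_fun_fubini_tonelli_F (m2 := leb) _ (measurable_density_integral i)).
  exact: density_integral_ge0.
have mphi := test_fun_measurable tphi.
apply: (@le_trans _ _ (\int[leb]_x (Ccore%:E * \sum_(i < d) \int[leb]_h density_integral i (x, h)))%E).
  apply: ge0_le_integral => //.
  - apply/measurable_EFinP; apply: (measurableT_comp (measurable_powR _)).
    exact: measurableT_comp.
  - by apply: measurable_funeM; exact: emeasurable_sum.
  - by move=> x _; exact: gradient_pointwise.
rewrite ge0_integralZl//; last 2 first.
- exact: emeasurable_sum.
- by move=> x _; exact: sume_ge0.
rewrite ge0_integral_sum// (EFinM Ccore 2) -muleA lee_wpmul2l// ?lee_fin//.
rewrite ge0_sume_distrr; last by move=> i _; apply: integral_ge0 => z _; rewrite lee_fin sqr_ge0.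
by apply: lee_sum => i _; rewrite integral_density integral_density_le.
Qed.

End gradient_core.

(** * The Sobolev-Poincare inequality *)

Section sobolev_inequality.
Context {R : realType} {d : nat}.
Local Notation E := 'rV[R]_d.
Local Notation leb := (lebesgue_rV R d).

Lemma powR_integral_measurable (q : R) (v : E -> R) : measurable_fun setT v ->
  measurable_fun setT (fun x => (`|v x| `^ q)%:E).
Proof.
move=> mv; apply/measurable_EFinP; apply: (measurableT_comp (measurable_powR q)).
exact: measurableT_comp.
Qed.

Lemma measurable_superlevel (v : E -> R) (l : R) : measurable_fun setT v ->
  measurable (superlevel v l).
Proof.
move=> mv; have mn : measurable_fun setT (fun z => `|v z|) by exact: measurableT_comp.
by have := measurable_fun_ltr (measurable_cst (l / 2)) mn => /(_ measurableT [set true]); rewrite setTI; exact.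
Qed.

(** Chebyshev's inequality interpolated with the bound [V] on the measure of the
    support; the interpolation lets the exponent [q * a] take the value required
    by the scaling of the energy, also below the critical exponent. *)
Lemma chebyshev_interpolated (v : E -> R) (q V S a : R) : measurable_fun setT v ->
  0 < q -> 0 < V -> 0 < S -> 0 <= a <= 1 ->
  (leb [set x | v x != 0%R] <= V%:E)%E -> (\int[leb]_x (`|v x| `^ q)%:E = S%:E)%E ->
  forall l, 0 < l ->
  (leb (superlevel v l) <= (level_volume (V `^ (1 - a) * (2 `^ q * S) `^ a) (q * a) l)%:E)%E.
Proof.
move=> mv q0 V0 S0 /andP[a0 a1] suppV IS l l0.
have mA := measurable_superlevel l mv.
have m0 : measurable [set x | v x != 0%R].
  have := measurable_neg (measurable_fun_eqr mv (measurable_cst (0 : R))) => /(_ measurableT [set true]).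
  by rewrite setTI; exact.
have AV : (leb (superlevel v l) <= V%:E)%E.
  apply: le_trans suppV; apply: le_measure; rewrite ?inE// => x; rewrite /superlevel /= => h.
  by rewrite -normr_gt0; apply: le_lt_trans h; rewrite divr_ge0// ltW.
have l20 : 0 < l / 2 by rewrite divr_gt0.
have AS : (((l / 2) `^ q)%:E * leb (superlevel v l) <= S%:E)%E.
  rewrite -IS -integral_cst//.
  apply: (@le_trans _ _ (\int[leb]_(x in superlevel v l) (`|v x| `^ q)%:E)%E).
    apply: ge0_le_integral => //.
    - by move=> x _; rewrite lee_fin powR_ge0.
    - by apply: measurable_funS (powR_integral_measurable q mv).
    - by move=> x h; rewrite lee_fin ge0_ler_powR ?nnegrE ?(ltW q0) ?(ltW l20)// ltW.
  apply: ge0_subset_integral => //; first exact: powR_integral_measurable.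
have fA : leb (superlevel v l) \is a fin_num.
  by rewrite ge0_fin_numE// (le_lt_trans AV)// ltry.
move: AV AS; rewrite -(fineK fA) -EFinM !lee_fin.
have mge : 0 <= fine (leb (superlevel v l)) by rewrite fine_ge0.
move: (fine _) mge => m mge mV mS.
have mX : m <= 2 `^ q * S * l `^ (- q).
  have : m <= S / (l / 2) `^ q by rewrite ler_pdivlMr ?powR_gt0// mulrC.
  rewrite powRM ?invr_ge0 ?(ltW l0)// -[2^-1]powR_inv1// -powRrM mulN1r !powRN invfM invrK.
  by move=> /le_trans; apply; rewrite le_eqVlt; apply/orP; left; apply/eqP; ring.
have X0 : 0 <= 2 `^ q * S by rewrite mulr_ge0 ?powR_ge0 ?ltW.
have -> : level_volume (V `^ (1 - a) * (2 `^ q * S) `^ a) (q * a) l = V `^ (1 - a) * (2 `^ q * S * l `^ (- q)) `^ a.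
  by rewrite /level_volume (powRM _ X0) ?powR_ge0// -powRrM mulrA mulNr.
move: mge; rewrite le_eqVlt => /orP[/eqP <-|m0'].
  by rewrite mulr_ge0 ?powR_ge0.
have {1}-> : m = m `^ (1 - a) * m `^ a.
  by rewrite -powRD ?subrK ?powRr1 ?(ltW m0')// (gt_eqF m0') implybT.
by apply: ler_pM; rewrite ?powR_ge0// ge0_ler_powR ?nnegrE ?subr_ge0 ?(ltW m0') ?(ltW V0)// (le_trans (ltW m0')).
Qed.

Definition sobolev_factor (q theta V c : R) : R :=
  let a := d%:R * (q - 2) / (2 * theta * q) in
  c * (2 `^ (- (2 * theta)) * (2 * (V `^ (1 - a) * 2 `^ (q * a))) `^ (2 * theta / d%:R)).

(** The core estimates bound [S = \int |v|^q] by [S ^ (1 - 2 / q)] times the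
    energy; dividing requires [S] to be finite. *)
Lemma sobolev_of_core (v : E -> R) (q theta V c S : R) (En : \bar R) :
  (0 < d)%N -> measurable_fun setT v -> 2 <= q -> 0 < theta -> d%:R * (q - 2) <= 2 * theta * q ->
  0 < V -> 0 <= c -> (0 <= En)%E ->
  (leb [set x | v x != 0%R] <= V%:E)%E -> (\int[leb]_x (`|v x| `^ q)%:E = S%:E)%E ->
  (forall K p, 0 < K -> p = d%:R * (q - 2) / (2 * theta) ->
     (forall l, 0 < l -> (leb (superlevel v l) <= (level_volume K p l)%:E)%E) ->
     (S%:E <= (c * (2 `^ (- (2 * theta)) * (2 * K) `^ (2 * theta / d%:R)))%:E * En)%E) ->
  ((S `^ (2 / q))%:E <= (sobolev_factor q theta V c)%:E * En)%E.
Proof.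
move=> d0 mv q2 t0 crit V0 c0 En0 suppV IS core.
have q0 : 0 < q by lra.
have dR0 : 0 < d%:R :> R by rewrite ltr0n.
have F0 : 0 <= sobolev_factor q theta V c by rewrite mulr_ge0// mulr_ge0 ?powR_ge0.
have S0 : 0 <= S.
  by rewrite -lee_fin -IS; apply: integral_ge0 => x _; rewrite lee_fin powR_ge0.
move: S0; rewrite le_eqVlt => /orP[/eqP S0|S0].
  by rewrite -S0 powR0 ?mule_ge0 ?lee_fin// mulf_neq0 ?invr_neq0// gt_eqF.
pose a := d%:R * (q - 2) / (2 * theta * q).
have tq0 : 0 < 2 * theta * q by rewrite !mulr_gt0.
have a0 : 0 <= a by rewrite divr_ge0 ?(ltW tq0)// mulr_ge0 ?(ltW dR0)// subr_ge0.
have a1 : a <= 1 by rewrite ler_pdivrMr// mul1r.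
have aI : 0 <= a <= 1 by rewrite a0.
have := chebyshev_interpolated mv q0 V0 S0 aI suppV IS.
have K0 : 0 < V `^ (1 - a) * (2 `^ q * S) `^ a by rewrite mulr_gt0 ?powR_gt0// mulr_gt0// powR_gt0.
have pE : q * a = d%:R * (q - 2) / (2 * theta) by rewrite /a; field; rewrite !gt_eqF.
move=> /(core _ _ K0 pE) {core}.
have -> : c * (2 `^ (- (2 * theta)) * (2 * (V `^ (1 - a) * (2 `^ q * S) `^ a)) `^ (2 * theta / d%:R)) =
   sobolev_factor q theta V c * S `^ (1 - 2 / q).
  rewrite /sobolev_factor -/a (powRM _ (powR_ge0 _ _) (ltW S0)) -powRrM.
  have -> : 2 * (V `^ (1 - a) * (2 `^ (q * a) * S `^ a)) = 2 * (V `^ (1 - a) * 2 `^ (q * a)) * S `^ a by ring.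
  rewrite [X in c * (_ * X)]powRM ?powR_ge0 ?mulr_ge0 ?powR_ge0// -powRrM.
  have -> : a * (2 * theta / d%:R) = 1 - 2 / q by rewrite /a; field; rewrite !gt_eqF.
  by rewrite !mulrA.
move=> H.
have k0 : (0 <= (S `^ (2 / q - 1))%:E)%E by rewrite lee_fin powR_ge0.
have := lee_wpmul2l k0 H; rewrite muleA -!EFinM.
have -> : S `^ (2 / q - 1) * S = S `^ (2 / q).
  by rewrite -{2}(powRr1 (ltW S0)) -powRD ?subrK// (gt_eqF S0) implybT.
have -> : S `^ (2 / q - 1) * (sobolev_factor q theta V c * S `^ (1 - 2 / q)) = sobolev_factor q theta V c.
  rewrite mulrCA -powRD; last by rewrite (gt_eqF S0) implybT.
  by rewrite [2 / q - 1 + _]addrC subrKA subrr powRr0 mulr1.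
by [].
Qed.

Lemma Lq_norme_le (Omega : set E) (q B : R) (w : E -> R) : 0 < q -> 0 <= B ->
  (\int[leb]_x (`|(w \_ Omega) x| `^ q)%:E <= (B `^ q)%:E)%E -> (Lq_norme Omega q w <= B%:E)%E.
Proof.
move=> q0 B0 H; rewrite /Lq_norme unlock /Lnorm.
have -> : B%:E = ((B `^ q)%:E `^ q^-1)%E by rewrite poweR_EFin -powRrM mulfV ?gt_eqF// powRr1.
have I0 : (0 <= \int[leb]_x `|(EFin \o w \_ Omega) x| `^ q)%E.
  by apply: integral_ge0 => x _; exact: poweR_ge0.
apply: gt0_ler_poweR; first by rewrite invr_ge0 ltW.
- by rewrite in_itv/= I0 leey.
- by rewrite in_itv/= lee_fin powR_ge0 leey.
- exact: H.
Qed.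

(** Truncated functions have finite power integrals, and truncation does not
    increase differences; so the constant survives the limit. *)
Definition clamp (N y : R) := Num.max (- N) (Num.min N y).

Lemma clamp_norm (N y : R) : 0 <= N -> `|clamp N y| = Num.min N `|y|.
Proof.
move=> N0; rewrite /clamp /Num.min /Num.max.
case: (ltrP N y) => h; case: (ltrP (- N) _) => h'; case: (ltrP N `|y|) => h2;
  case: (lerP 0 y) h2 => y0; rewrite ?(ger0_norm y0) ?(ltr0_norm y0) => h2;
  rewrite ?normrN ?(ger0_norm N0) ?(ger0_norm y0) ?(ltr0_norm y0)//; try lra.
Qed.

Lemma clamp0 (N : R) : 0 <= N -> clamp N 0 = 0.
Proof. by move=> N0; apply/normr0_eq0; rewrite clamp_norm// normr0 min_r. Qed.

Lemma clamp_lip (N x y : R) : 0 <= N -> `|clamp N x - clamp N y| <= `|x - y|.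
Proof.
move=> N0; have mono (a b : R) : a <= b -> 0 <= clamp N b - clamp N a <= b - a.
  move=> ab; rewrite /clamp /Num.min /Num.max; apply/andP.
  by case: (ltrP N a) => h1; case: (ltrP N b) => h2;
    (case: (ltrP (- N) N) => h3 || idtac); (case: (ltrP (- N) a) => h4 || idtac);
    (case: (ltrP (- N) b) => h5 || idtac); split; lra.
case: (lerP x y) => [/mono|/ltW/mono] /andP[h1 h2].
- by rewrite distrC (ger0_norm h1).
- by rewrite (ger0_norm h1).
Qed.

Lemma measurable_clamp (N : R) (v : E -> R) : measurable_fun setT v ->
  measurable_fun setT (fun x => clamp N (v x)).
Proof.
move=> mv; apply: (measurable_maxr (measurable_cst (- N))).
exact: (measurable_minr (measurable_cst N) mv).
Qed.

Lemma clamp_integral_le (q B : R) (v : E -> R) : measurable_fun setT v -> 0 < q ->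
  (forall N : nat, (\int[leb]_x (`|clamp N%:R (v x)| `^ q)%:E <= B%:E)%E) ->
  (\int[leb]_x (`|v x| `^ q)%:E <= B%:E)%E.
Proof.
move=> mv q0 H.
pose g (N : nat) (x : E) : \bar R := (`|clamp N%:R (v x)| `^ q)%:E.
have mg N : measurable_fun setT (g N).
  apply: powR_integral_measurable; exact: measurable_clamp.
have g0 N x : setT x -> (0 <= g N x)%E by rewrite lee_fin powR_ge0.
have gmon x : setT x -> {homo g^~ x : n m / (n <= m)%N >-> (n <= m)%E}.
  move=> _ n m nm; rewrite lee_fin ge0_ler_powR ?nnegrE ?(ltW q0)// !clamp_norm//.
  by rewrite le_min ge_min ler_nat nm/= ge_min lexx orbT.
have := monotone_convergence leb measurableT mg g0 gmon.
have -> : (\int[leb]_x limn (g^~ x) = \int[leb]_x (`|v x| `^ q)%:E)%E.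
  apply: eq_integral => x _; apply/lim_near_cst => //.
  have [n vn] : exists n : nat, `|v x| <= n%:R.
    by exists (Num.bound `|v x|); exact/ltW/archi_boundP.
  exists n => // m /= nm; rewrite /g clamp_norm// min_r//.
  by apply: le_trans vn _; rewrite ler_nat.
move=> ->; apply: lime_le; last by near=> N; exact: H.
apply: ereal_nondecreasing_is_cvgn => n m nm.
by apply: ge0_le_integral => // x _; [exact: g0|exact: gmon].
Unshelve. all: by end_near. Qed.

Section bounded_support.
Variables (Omega : set E) (q N : R) (v : E -> R).
Hypotheses (mO : measurable Omega) (fO : (leb Omega < +oo)%E) (q0 : 0 < q).
Hypotheses (mv : measurable_fun setT v) (vN : forall x, `|v x| <= N).
Hypothesis vO : forall x, ~ Omega x -> v x = 0.

Lemma bounded_power_integral : exists S : R, (\int[leb]_x (`|v x| `^ q)%:E = S%:E)%E.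
Proof.
have N0 : 0 <= N by exact: le_trans (normr_ge0 _) (vN 0).
have fin : (\int[leb]_x (`|v x| `^ q)%:E)%E \is a fin_num.
  rewrite ge0_fin_numE; last by apply: integral_ge0 => x _; rewrite lee_fin powR_ge0.
  apply: (@le_lt_trans _ _ (\int[leb]_(x in Omega) (N `^ q)%:E)%E); last first.
    by rewrite integral_cst// lte_mul_pinfty// lee_fin powR_ge0.
  rewrite [leRHS]integral_mkcond; apply: ge0_le_integral => //.
  - exact: powR_integral_measurable.
  - by apply/(measurable_restrictT _ _).1.
  - move=> x _; rewrite patchE; case: ifPn => [_|].
      by rewrite lee_fin ge0_ler_powR ?nnegrE ?(ltW q0).
    by move=> /negP h; rewrite vO ?normr0 ?powR0 ?gt_eqF// => Ox; apply: h; rewrite inE.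
by exists (fine (\int[leb]_x (`|v x| `^ q)%:E)); rewrite fineK.
Qed.

Lemma support_measure_le : (leb [set x | v x != 0%R] <= leb Omega)%E.
Proof.
have := measurable_neg (measurable_fun_eqr mv (measurable_cst (0 : R))) => /(_ measurableT [set true]).
rewrite setTI => m0; apply: le_measure; rewrite ?inE//; first exact: m0.
by move=> x /=; apply: contra_neqP => /vO.
Qed.
End bounded_support.

Lemma powR_root_le (S G q : R) : 0 < q -> 0 <= S -> 0 <= G -> S `^ (2 / q) <= G -> S <= Num.sqrt G `^ q.
Proof.
move=> q0 S0 G0 H.
have -> : Num.sqrt G `^ q = G `^ (q / 2).
  rewrite -{2}(sqr_sqrtr G0) -powR_mulrn ?sqrtr_ge0// -powRrM; congr (_ `^ _); by field.
have -> : S = (S `^ (2 / q)) `^ (q / 2).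
  by rewrite -powRrM (_ : 2 / q * (q / 2) = 1) ?powRr1//; field; rewrite gt_eqF.
by rewrite ge0_ler_powR ?nnegrE ?powR_ge0// divr_ge0// ltW.
Qed.

(** The tangent-line inequality of the convex function [x ^ q]. *)
Lemma powR_sub_le (q a b : R) : 1 < q -> 0 <= a -> 0 <= b ->
  a `^ q - b `^ q <= q * a `^ (q - 1) * (a - b).
Proof.
move=> q1 a0 b0; have q0 : 0 < q by lra.
move: a0; rewrite le_eqVlt => /orP[/eqP <-|a0].
  rewrite !powR0 ?gt_eqF ?subr_gt0// mulr0 mul0r sub0r oppr_le0; exact: powR_ge0.
have aq : a `^ q = a * a `^ (q - 1).
  rewrite -{2}(powRr1 (ltW a0)) -powRD; last by rewrite (gt_eqF a0) implybT.
  by congr (_ `^ _); lra.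
have P := powR_gt0 (q - 1) a0.
move: b0; rewrite le_eqVlt => /orP[/eqP <-|b0].
  rewrite [0 `^ q]powR0 ?gt_eqF// !subr0 aq mulrAC -mulrA ler_peMl ?(ltW q1)//.
  by rewrite mulr_ge0 ?powR_ge0 ?ltW.
have t0 : 0 < (b / a) `^ q by rewrite powR_gt0// divr_gt0.
have qi : q^-1 < 1 by rewrite invf_lt1.
have qn : q^-1 != 0 by rewrite invr_eq0 gt_eqF.
have := powR_bernoulli t0 qi qn.
rewrite -powRrM mulfV ?gt_eqF// powRr1; last by rewrite divr_ge0 ?(ltW a0) ?(ltW b0).
rewrite invrK.
have -> : (b / a) `^ q = b `^ q / a `^ q.
  by rewrite powRM ?invr_ge0 ?(ltW a0) ?(ltW b0)// -(powR_inv1 (ltW a0)) -!powRrM mulN1r powRN.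
have A : 0 < a `^ q by exact: powR_gt0.
rewrite -(ler_pM2r A) !mulrBl divfK ?gt_eqF// mul1r.
have -> : b / a * q * a `^ q = q * a `^ (q - 1) * b by rewrite aq; field; rewrite gt_eqF.
by rewrite aq; lra.
Qed.

Lemma cvg_powR1 (q : R) (u : nat -> R) (a : R) : 1 < q -> u n @[n --> \oo] --> a ->
  (forall n, 0 <= u n) -> u n `^ q @[n --> \oo] --> a `^ q.
Proof.
move=> q1 ua u0; have q0 : 0 < q by lra.
have a0 : 0 <= a by apply: (cvgr_to_ge ua); near=> n; exact: u0.
apply: (@squeeze_cvgr _ _ _ _ (fun n => a `^ q - q * a `^ (q - 1) * `|a - u n|)
   (fun n => a `^ q + q * (a + 1) `^ (q - 1) * `|u n - a|)).
- near=> n; apply/andP; split.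
    have := powR_sub_le q1 a0 (u0 n).
    have : q * a `^ (q - 1) * (a - u n) <= q * a `^ (q - 1) * `|a - u n|.
      by rewrite ler_wpM2l ?ler_norm// mulr_ge0 ?powR_ge0 ?ltW.
    lra.
  have := powR_sub_le q1 (u0 n) a0.
  have : q * u n `^ (q - 1) * (u n - a) <= q * (a + 1) `^ (q - 1) * `|u n - a|.
    apply: (@le_trans _ _ (q * u n `^ (q - 1) * `|u n - a|)).
      by rewrite ler_wpM2l ?ler_norm// mulr_ge0 ?powR_ge0 ?ltW.
    rewrite ler_wpM2r// ler_pM2l// ge0_ler_powR ?nnegrE ?subr_ge0 ?(ltW q1) ?u0 ?addr_ge0//.
    by near: n; apply: (cvgr_le a) => //; lra.
  lra.
- have ca : `|a - u n| @[n --> \oo] --> (0 : R).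
    by rewrite -(normr0 R) -(subrr a); apply: cvg_norm; apply: cvgB => //; exact: cvg_cst.
  rewrite -[X in _ --> X]subr0 -[X in _ --> _ - X](mulr0 (q * a `^ (q - 1))).
  by apply: cvgB; [exact: cvg_cst|apply: cvgM => //; exact: cvg_cst].
- have ca : `|u n - a| @[n --> \oo] --> (0 : R).
    by rewrite -(normr0 R) -(subrr a); apply: cvg_norm; apply: cvgB => //; exact: cvg_cst.
  rewrite -[X in _ --> X]addr0 -[X in _ --> _ + X](mulr0 (q * (a + 1) `^ (q - 1))).
  by apply: cvgD; [exact: cvg_cst|apply: cvgM => //; exact: cvg_cst].
Unshelve. all: by end_near. Qed.

Section on_domain.
Variables (Omega : set E) (q theta : R).
Hypotheses (d0 : (0 < d)%N) (bO : bounded_domain Omega).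
Let mO : measurable Omega := domain_measurable bO.
Let V : R := fine (leb Omega) + 1.

Let V0 : 0 < V. Proof. by rewrite ltr_wpDl// fine_ge0. Qed.

Let OV : (leb Omega <= V%:E)%E.
Proof.
have fO := domain_finite bO.
by rewrite -(@fineK _ (leb Omega)) ?ge0_fin_numE// lee_fin /V lerDl.
Qed.

Lemma sobolev_fractional : 2 <= q -> 0 < theta -> theta != 1 -> d%:R * (q - 2) <= 2 * theta * q ->
  exists2 C, 0 <= C & forall w, Xmem Omega theta w -> (Lq_norme Omega q w <= (C * Xnorm Omega theta w)%:E)%E.
Proof.
move=> q2 t0 t1 crit; have q0 : 0 < q by lra.
pose c : R := 8 / 2 ^+ d * Num.sqrt d%:R `^ (d%:R + 2 * theta).
have c0 : 0 <= c by rewrite mulr_ge0 ?powR_ge0// divr_ge0// exprn_ge0.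
pose F := sobolev_factor q theta V c.
have F0 : 0 <= F by rewrite mulr_ge0// mulr_ge0 ?powR_ge0.
exists (Num.sqrt (F * 2)); first exact: sqrtr_ge0.
move=> w Xw; have [Lw w0] := Xw; rewrite (negbTE t1) => -[_ Ew].
have mw : measurable_fun setT w by exact: Lfun2_measurable.
have mwO : measurable_fun setT (w \_ Omega).
  by apply/(measurable_restrictT _ _).1 => //; exact: measurable_funS mw.
pose En := (\int[(leb \x leb)%E]_z (gagliardo_integrand theta w w z)%:E)%E.
have En0 : (0 <= En)%E by apply: integral_ge0 => z _; rewrite lee_fin gagliardo_ge0.
have EnE : En = (2 * Xnorm Omega theta w ^+ 2)%:E.
  rewrite Xnorm_sqr /Xinner (negbTE t1) mulrA mulfV// mul1r /Rintegral fineK//.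
  by rewrite ge0_fin_numE.
apply: Lq_norme_le => //; first by rewrite mulr_ge0 ?sqrtr_ge0 ?Xnorm_ge0.
apply: clamp_integral_le => // N.
pose v x := clamp N%:R ((w \_ Omega) x).
have mv : measurable_fun setT v by exact: measurable_clamp.
have vN x : `|v x| <= N%:R by rewrite clamp_norm// ge_min lexx.
have vO x : ~ Omega x -> v x = 0.
  by move=> Ox; rewrite /v patchE memNset//; exact: clamp0.
have [S IS] := bounded_power_integral mO (domain_finite bO) q0 mv vN vO.
have suppV := le_trans (support_measure_le mO mv vO) OV.
have S0 : 0 <= S.
  by rewrite -lee_fin -IS; apply: integral_ge0 => x _; rewrite lee_fin powR_ge0.
have H : ((S `^ (2 / q))%:E <= F%:E * En)%E.
  apply: (sobolev_of_core d0 mv q2 t0 crit V0 c0 En0 suppV IS) => K p K0 pE cheb.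
  have sc : 2 * theta * p = d%:R * (q - 2) by rewrite pE; field; rewrite gt_eqF.
  rewrite -IS; apply: le_trans (fractional_core d0 mv q2 K0 t0 sc cheb) _.
  apply: lee_wpmul2l; first by rewrite lee_fin mulr_ge0// mulr_ge0 ?powR_ge0.
  have mg u : measurable_fun setT u -> measurable_fun setT (fun z => (gagliardo_integrand theta u u z)%:E).
    by move=> mu; apply/measurable_EFinP; exact: measurable_gagliardo.
  have weq : {ae leb, forall x, w x = (w \_ Omega) x}.
    apply: filterS w0 => x h; rewrite patchE; case: ifPn => // /negP Ox.
    by rewrite h// => Ox'; apply: Ox; rewrite inE.
  apply: ae_ge0_le_integral => //.
  - by move=> z _; rewrite lee_fin gagliardo_ge0.
  - exact: mg.
  - by move=> z _; rewrite lee_fin gagliardo_ge0.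
  - exact: mg.
  apply: filterS (ae_product weq) => z [h1 h2] _.
  rewrite lee_fin /gagliardo_integrand -!expr2 ler_wpM2r ?invr_ge0 ?powR_ge0//.
  rewrite h1 h2 -(real_normK (num_real (v _ - v _))) -[leRHS](real_normK (num_real _)).
  by rewrite ler_sqr ?nnegrE// clamp_lip.
rewrite -/(v _) IS lee_fin.
have -> : Num.sqrt (F * 2) * Xnorm Omega theta w = Num.sqrt (F * (2 * Xnorm Omega theta w ^+ 2)).
  have -> : F * (2 * Xnorm Omega theta w ^+ 2) = (F * 2) * Xnorm Omega theta w ^+ 2 by ring.
  by rewrite -{1}(ger0_norm (Xnorm_ge0 _ _ _)) -sqrtr_sqr -sqrtrM// mulr_ge0.
apply: powR_root_le => //; first exact: mulr_ge0 F0 (mulr_ge0 (ler0n _ 2) (sqr_ge0 _)).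
by move: H; rewrite EnE -EFinM lee_fin.
Qed.

Lemma L2_norm_cvg (f : nat -> E -> R) (g : E -> R) : (forall n, L2 Omega (f n)) -> L2 Omega g ->
  Lq_norm Omega 2 (f n \- g) @[n --> \oo] --> (0 : R) ->
  Lq_norm Omega 2 (f n) @[n --> \oo] --> Lq_norm Omega 2 g.
Proof.
move=> Lf Lg H; apply/cvgrPdist_le => e e0; near=> n.
have Lfg (u v : E -> R) : L2 Omega u -> L2 Omega v -> L2 Omega (u \- v).
  move=> Lu Lv; have := L2_lin (-1) Lv Lu; congr (L2 Omega _); apply/funext => x /=; lra.
have h : Lq_norm Omega 2 (f n \- g) <= e.
  by near: n; apply: (cvgr_le 0) => //.
have tri (u v : E -> R) : L2 Omega u -> L2 Omega v -> Lq_norm Omega 2 u <= Lq_norm Omega 2 (u \- v) + Lq_norm Omega 2 v.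
  move=> Lu Lv; have := L2_norm_lin mO 1 (Lfg _ _ Lu Lv) Lv; rewrite normr1 mul1r.
  by congr (Lq_norm _ _ _ <= _); apply/funext => x /=; lra.
have sym : Lq_norm Omega 2 (g \- f n) <= Lq_norm Omega 2 (f n \- g).
  have := L2_norm_lin mO (-1) (Lfg _ _ (Lf n) Lg) (Lfg _ _ Lg Lg).
  have -> : Lq_norm Omega 2 (g \- g) = 0.
    rewrite Lq_norm2E; last exact: Lfg.
    rewrite (_ : (fun x => _) = fun=> 0); last by apply/funext => x /=; rewrite subrr expr0n.
    by rewrite /Rintegral integral0_eq//= sqrtr0.
  rewrite normrN normr1 mul1r addr0.
  by congr (Lq_norm _ _ _ <= _); apply/funext => x /=; lra.
have h1 := tri _ _ (Lf n) Lg; have h2 := tri _ _ Lg (Lf n).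
rewrite ler_norml; apply/andP; split; lra.
Unshelve. all: by end_near. Qed.

(** The estimate for test functions passes to their limits [w]. As convergence
    is known in [L2] only, it is done for the truncations of [w], on which the
    power [q] is Lipschitz. *)
Lemma sobolev_gradient : 2 <= q -> d%:R * (q - 2) <= 2 * 1 * q ->
  exists2 C, 0 <= C & forall w, Xmem Omega 1 w -> (Lq_norme Omega q w <= (C * Xnorm Omega 1 w)%:E)%E.
Proof.
move=> q2 crit; have q0 : 0 < q by lra.
have q1 : 1 < q by lra.
have t1 : 0 < (1 : R) by [].
pose c : R := 32 * d%:R * 2 `^ (d%:R * (q - 2) / (2 * 1)) * 2.
have c0 : 0 <= c by rewrite !mulr_ge0// powR_ge0.
pose F := sobolev_factor q 1 V c.
have F0 : 0 <= F by rewrite mulr_ge0// mulr_ge0 ?powR_ge0.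
exists (Num.sqrt F); first exact: sqrtr_ge0.
move=> w Xw; have [Lw w0] := Xw; rewrite eqxx => -[H1w [phi [tphi phiw dphiw]]].
have L2w : L2 Omega w by case: H1w.
have mwO : measurable_fun setT (w \_ Omega) by exact: L2_measurable.
pose G n : R := \sum_i Lq_norm Omega 2 (pderiv i (phi n)) ^+ 2.
have Gcvg : G n @[n --> \oo] --> Xnorm Omega 1 w ^+ 2.
  rewrite Xnorm_sqr /Xinner eqxx Xinner1E//.
  rewrite (_ : \sum_i _ = \sum_i Lq_norm Omega 2 (grad Omega w i) ^+ 2); last first.
    apply: eq_bigr => i _; rewrite L2_norm_sqr//; exact: grad_L2.
  apply: cvg_big; [exact: add_continuous|move=> i _].
  have cv := L2_norm_cvg (fun n => test_fun_L2 (test_fun_pderiv i (tphi n))) (grad_L2 i H1w) (dphiw i).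
  exact: (cvgM cv cv).
have G0 n : 0 <= G n by apply: sumr_ge0 => i _; exact: sqr_ge0.
have GE n : (\sum_(i < d) \int[leb]_z (pderiv i (phi n) z ^+ 2)%:E = (G n)%:E)%E.
  rewrite -sumEFin; apply: eq_bigr => i _.
  have td := test_fun_pderiv i (tphi n).
  have Ld := test_fun_L2 td.
  rewrite L2_norm_sqr// /Rintegral fineK; last first.
    by have := integrable_fin_num mO (L2_integrable_sqr mO Ld).
  rewrite integral_mkcond [RHS]integral_mkcond; apply: eq_integral => z _.
  rewrite !patchE in_setT; case: ifPn => // /negP h.
  by rewrite (test_fun_supp td) ?expr0n// => Oz; apply: h; rewrite inE.
have /choice[S IS] : forall n, exists S : R, (\int[leb]_x (`|phi n x| `^ q)%:E = S%:E)%E.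
  move=> n.
  have [M HM] := test_fun_bounded (tphi n).
  apply: (bounded_power_integral mO (domain_finite bO) q0 (test_fun_measurable (tphi n)) HM).
  by move=> x Ox; exact: test_fun_supp (tphi n) Ox.
have S0 n : 0 <= S n.
  by rewrite -lee_fin -IS; apply: integral_ge0 => x _; rewrite lee_fin powR_ge0.
have SG n : S n <= Num.sqrt (F * G n) `^ q.
  apply: powR_root_le => //; first exact: mulr_ge0.
  rewrite -lee_fin EFinM.
  have mphi := test_fun_measurable (tphi n).
  have GE0 : (0 <= (G n)%:E)%E by rewrite lee_fin.
  have suppV := le_trans (support_measure_le mO mphi (fun x => test_fun_supp (tphi n))) OV.
  apply: (sobolev_of_core d0 mphi q2 t1 crit V0 c0 GE0 suppV (IS n)) => K p K0 pE cheb.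
  have p0 : 0 <= p by rewrite pE divr_ge0 ?mulr_ge0// subr_ge0.
  have sc : 2 * 1 * p = d%:R * (q - 2) by rewrite pE; field.
  rewrite -IS; apply: le_trans (gradient_core d0 (tphi n) q2 K0 p0 sc cheb) _.
  rewrite GE; apply: lee_wpmul2r => //; rewrite lee_fin /c -pE le_eqVlt; apply/orP; left; apply/eqP; ring.
apply: Lq_norme_le => //; first by rewrite mulr_ge0 ?sqrtr_ge0 ?Xnorm_ge0.
apply: clamp_integral_le => // N.
pose D n := Lq_norm Omega 2 (phi n \- w).
pose k : R := q * N%:R `^ (q - 1) * Num.sqrt V.
have k0 : 0 <= q * N%:R `^ (q - 1) by rewrite mulr_ge0 ?powR_ge0// ltW.
have step n : (\int[leb]_x (`|clamp N%:R ((w \_ Omega) x)| `^ q)%:E <= (Num.sqrt (F * G n) `^ q + k * D n)%:E)%E.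
  have mphi := test_fun_measurable (tphi n).
  have Lphi := test_fun_L2 (tphi n).
  have Ldiff : L2 Omega (phi n \- w).
    have := L2_lin (-1) L2w Lphi; congr (L2 Omega _); apply/funext => x /=; lra.
  pose e x := `|(phi n \- w) x|.
  have me : measurable_fun setT (e \_ Omega).
    rewrite (_ : e \_ Omega = fun x => `|((phi n \- w) \_ Omega) x|).
      by apply: measurableT_comp => //; exact: L2_measurable.
    by apply/funext => x; rewrite !patchE; case: ifP => // _; rewrite normr0.
  have eO0 x : 0 <= (e \_ Omega) x.
    by rewrite patchE; case: ifP => // _; exact: normr_ge0.
  have Le : L2 Omega e.
    apply/L2P => //; have /L2P := Ldiff => /(_ (L2_measurable Ldiff)).
    by congr (_ < _)%E; apply: eq_integral => x _; rewrite /e real_normK ?num_real.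
  have eI : (\int[leb]_x ((e \_ Omega) x)%:E <= (Num.sqrt V * D n)%:E)%E.
    have L1 : L2 Omega (\1_Omega : E -> R) by apply: L2_indic => //; exact: domain_finite.
    have CS := L2_cauchy_schwarz mO Le L1.
    have I1 : \int[leb]_(x in Omega) (e x * \1_Omega x) = \int[leb]_(x in Omega) e x.
      by apply: eq_Rintegral => x Ox; rewrite indicE Ox mulr1.
    have De : Lq_norm Omega 2 e = D n.
      rewrite /D !Lq_norm2E//; congr (Num.sqrt _); apply: eq_Rintegral => x _.
      by rewrite /e real_normK ?num_real.
    have N1 : Lq_norm Omega 2 (\1_Omega : E -> R) <= Num.sqrt V.
      rewrite Lq_norm2E// ler_wsqrtr//.
      rewrite (_ : \int[leb]_(x in Omega) _ = fine (leb Omega)); first by rewrite /V lerDl.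
      rewrite (@eq_Rintegral _ _ _ _ _ (cst 1)); last by move=> x Ox; rewrite indicE Ox expr1n.
      by rewrite Rintegral_cst// mul1r.
    have Ie : leb.-integrable Omega (EFin \o e).
      have := L2_integrable_mul mO Le L1; apply: eq_integrable => // x Ox.
      by rewrite /= indicE Ox mulr1.
    have -> : (\int[leb]_x ((e \_ Omega) x)%:E = (\int[leb]_(x in Omega) e x)%:E)%E.
      rewrite /Rintegral fineK; last exact: integrable_fin_num.
      rewrite [RHS]integral_mkcond; apply: eq_integral => x _.
      by rewrite !patchE; case: ifP.
    rewrite lee_fin -I1; apply: le_trans (ler_norm _) (le_trans CS _).
    rewrite De mulrC ler_wpM2r//; exact: L2_norm_ge0.
  apply: (@le_trans _ _ (\int[leb]_x ((`|phi n x| `^ q)%:E + (q * N%:R `^ (q - 1))%:E * ((e \_ Omega) x)%:E))%E).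
    apply: ge0_le_integral => //.
    - by apply: powR_integral_measurable; exact: measurable_clamp.
    - apply: emeasurable_funD; first exact: powR_integral_measurable.
      by apply: measurable_funeM; exact/measurable_EFinP.
    move=> x _; rewrite -EFinM -EFinD lee_fin.
    rewrite clamp_norm// !patchE; case: ifPn => [_|_]; last first.
      by rewrite normr0 min_r// powR0 ?gt_eqF// mulr0 addr0 powR_ge0.
    set a := Num.min N%:R `|w x|; set b := Num.min N%:R `|phi n x|.
    have a0 : 0 <= a by rewrite le_min ler0n/=.
    have b0 : 0 <= b by rewrite le_min ler0n/=.
    have bq : b `^ q <= `|phi n x| `^ q by rewrite ge0_ler_powR ?nnegrE ?(ltW q0)// ge_min lexx orbT.
    have H := powR_sub_le q1 a0 b0.
    suff : q * a `^ (q - 1) * (a - b) <= q * N%:R `^ (q - 1) * e x by lra.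
    have ab : `|a - b| <= e x.
      rewrite /a /b -!clamp_norm//; apply: le_trans (ler_dist_dist _ _) _.
      by apply: le_trans (clamp_lip _ _ (ler0n _ _)) _; rewrite /e /= distrC.
    apply: (@le_trans _ _ (q * a `^ (q - 1) * `|a - b|)).
      by rewrite ler_wpM2l ?ler_norm// mulr_ge0 ?powR_ge0// ltW.
    apply: ler_pM => //; first by rewrite mulr_ge0 ?powR_ge0// ltW.
    rewrite ler_pM2l// ge0_ler_powR ?nnegrE ?subr_ge0 ?(ltW q1)// /a ge_min lexx//.
  rewrite ge0_integralD//; last 3 first.
  - exact: powR_integral_measurable.
  - by move=> x _; rewrite mule_ge0// lee_fin.
  - by apply: measurable_funeM; exact/measurable_EFinP.
  rewrite ge0_integralZl//; last 2 first.
  - exact/measurable_EFinP.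
  - by move=> x _; rewrite lee_fin.
  rewrite IS EFinD; apply: leeD; first by rewrite lee_fin SG.
  have -> : k * D n = (q * N%:R `^ (q - 1)) * (Num.sqrt V * D n) by rewrite /k mulrA.
  by rewrite [leRHS]EFinM; apply: lee_wpmul2l.
have lim : Num.sqrt (F * G n) `^ q + k * D n @[n --> \oo] --> (Num.sqrt F * Xnorm Omega 1 w) `^ q.
  rewrite -[X in _ --> X]addr0 -[X in _ --> _ + X](mulr0 k); apply: cvgD; last first.
    by apply: cvgM; [exact: cvg_cst|exact: phiw].
  have -> : Num.sqrt F * Xnorm Omega 1 w = Num.sqrt (F * Xnorm Omega 1 w ^+ 2).
    by rewrite -{1}(ger0_norm (Xnorm_ge0 _ _ _)) -sqrtr_sqr -sqrtrM.
  apply: cvg_powR1 => //.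
    apply: (@continuous_cvg _ _ _ _ _ _ Num.sqrt); first exact: sqrt_continuous.
    by apply: cvgM; [exact: cvg_cst|exact: Gcvg].
have IN : (\int[leb]_x (`|clamp N%:R ((w \_ Omega) x)| `^ q)%:E)%E \is a fin_num.
  rewrite ge0_fin_numE; last by apply: integral_ge0 => x _; rewrite lee_fin powR_ge0.
  exact: le_lt_trans (step 0%N) (ltry _).
rewrite -(fineK IN) lee_fin -(cvg_lim _ lim)//; apply: limr_ge; first by apply/cvg_ex; eexists; exact: lim.
by near=> n; rewrite -lee_fin fineK.
Unshelve. all: by end_near. Qed.

Lemma critical_scaling : 0 < theta -> 1 < q -> (q%:E <= critical_exponent d theta)%E ->
  d%:R * (q - 2) <= 2 * theta * q.
Proof.
move=> t0 q1; have dR0 : 0 < d%:R :> R by rewrite ltr0n.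
rewrite /critical_exponent; case: ltrP => [h|h _]; last by nra.
by rewrite lee_fin ler_pdivlMr ?subr_gt0//; nra.
Qed.

End on_domain.

Lemma sobolev_ge2 (Omega : set E) (q theta : R) : (0 < d)%N -> bounded_domain Omega ->
  0 < theta -> 2 <= q -> d%:R * (q - 2) <= 2 * theta * q ->
  exists2 C, 0 <= C & forall w, Xmem Omega theta w -> (Lq_norme Omega q w <= (C * Xnorm Omega theta w)%:E)%E.
Proof.
move=> d0 bO t0 q2 crit; have [t1|t1] := eqVneq theta 1.
  by rewrite t1 in crit *; exact: sobolev_gradient.
exact: sobolev_fractional.
Qed.

(** Below exponent 2 the bound follows from the one at 2, since
    [|y|^q <= m^q + m^(q-2) y^2] for every [m > 0] and [Omega] has finite measure. *)
Lemma sobolev_lt2 (Omega : set E) (q theta : R) : (0 < d)%N -> bounded_domain Omega ->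
  0 < theta -> 1 < q -> q < 2 ->
  exists2 C, 0 <= C & forall w, Xmem Omega theta w -> (Lq_norme Omega q w <= (C * Xnorm Omega theta w)%:E)%E.
Proof.
move=> d0 bO t0 q1 q2; have q0 : 0 < q by lra.
have mO := domain_measurable bO.
have fO : leb Omega \is a fin_num by rewrite ge0_fin_numE// domain_finite.
have [C2 C20 H2] : exists2 C, 0 <= C & forall w, Xmem Omega theta w -> (Lq_norme Omega 2 w <= (C * Xnorm Omega theta w)%:E)%E.
  by apply: sobolev_ge2 => //; rewrite subrr mulr0 !mulr_ge0// ltW.
pose V := fine (leb Omega); have V0 : 0 <= V by rewrite fine_ge0.
pose A := V + C2 ^+ 2; have A0 : 0 <= A by rewrite addr_ge0// sqr_ge0.
exists (A `^ q^-1); first exact: powR_ge0.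
move=> w Xw; set X := Xnorm Omega theta w; have X0 : 0 <= X by exact: Xnorm_ge0.
have Lw : L2 Omega w by exact: (Xmem_L2 bO Xw).
have mwO : measurable_fun setT (w \_ Omega) by exact: L2_measurable.
have w2 : \int[leb]_(x in Omega) (w x ^+ 2) <= (C2 * X) ^+ 2.
  rewrite -L2_norm_sqr// ler_sqr ?nnegrE ?mulr_ge0 ?L2_norm_ge0//.
  have L := H2 w Xw; rewrite /Lq_norm -lee_fin fineK// ge0_fin_numE ?Lnorm_ge0//.
  exact: le_lt_trans L (ltry _).
have key (e : R) : 0 < e -> (Lq_norme Omega q w <= (A `^ q^-1 * (X + e))%:E)%E.
  move=> e0; have m0 : 0 < X + e by rewrite ltr_wpDl.
  apply: Lq_norme_le => //; first by rewrite mulr_ge0 ?powR_ge0// ltW.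
  have -> : (A `^ q^-1 * (X + e)) `^ q = A * (X + e) `^ q.
    by rewrite powRM ?powR_ge0 ?(ltW m0)// -powRrM mulVf ?gt_eqF// powRr1.
  set m := X + e in m0 *.
  have pt y : `|y| `^ q <= m `^ q + m `^ (q - 2) * y ^+ 2.
    have mq : m `^ q = m `^ (q - 2) * m ^+ 2.
      rewrite -powR_mulrn ?(ltW m0)// -powRD; last by rewrite (gt_eqF m0) implybT.
      by congr (_ `^ _); lra.
    have P0 : 0 <= m `^ (q - 2) by exact: powR_ge0.
    case: (lerP `|y| m) => ym.
      have : `|y| `^ q <= m `^ q by rewrite ge0_ler_powR ?nnegrE ?(ltW q0)// ltW.
      by move=> /le_trans; apply; rewrite lerDl mulr_ge0// sqr_ge0.
    have y0 : 0 < `|y| by exact: lt_trans ym.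
    have yq : `|y| `^ q = `|y| `^ (q - 2) * y ^+ 2.
      rewrite -(real_normK (num_real y)) -powR_mulrn ?(ltW y0)// -powRD; last by rewrite (gt_eqF y0) implybT.
      by congr (_ `^ _); lra.
    rewrite yq; apply: (@le_trans _ _ (m `^ (q - 2) * y ^+ 2)); last by rewrite lerDr powR_ge0.
    rewrite ler_wpM2r ?sqr_ge0//.
    have -> : q - 2 = - (2 - q) by lra.
    rewrite !powRN lef_pV2 ?posrE ?powR_gt0// ge0_ler_powR ?nnegrE ?(ltW y0) ?(ltW m0) ?(ltW ym)//; lra.
  have -> : (\int[leb]_x (`|(w \_ Omega) x| `^ q)%:E = \int[leb]_(x in Omega) (`|w x| `^ q)%:E)%E.
    rewrite [RHS]integral_mkcond; apply: eq_integral => x _; rewrite !patchE; case: ifP => // _.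
    by rewrite normr0 powR0// gt_eqF.
  have mwq : measurable_fun Omega (fun x => (`|w x| `^ q)%:E).
    have mw : measurable_fun Omega w by apply/(measurable_restrictT _ _).2.
    apply/measurable_EFinP; apply: (measurableT_comp (measurable_powR q)).
    exact: measurableT_comp.
  have Ig := L2_integrable_sqr mO Lw.
  apply: (@le_trans _ _ (\int[leb]_(x in Omega) ((m `^ q)%:E + (m `^ (q - 2))%:E * (w x ^+ 2)%:E))%E).
    apply: ge0_le_integral => //.
    - by apply: emeasurable_funD => //; apply: measurable_funeM; exact: measurable_int Ig.
    - by move=> x _; rewrite -EFinM -EFinD lee_fin pt.
  rewrite ge0_integralD//; last 3 first.
  - by move=> x _; rewrite lee_fin powR_ge0.
  - by move=> x _; rewrite mule_ge0// lee_fin ?powR_ge0 ?sqr_ge0.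
  - by apply: measurable_funeM; exact: measurable_int Ig.
  have -> : (\int[leb]_(x in Omega) (m `^ q)%:E = (m `^ q * V)%:E)%E.
    by rewrite integral_cst// EFinM; congr (_ * _)%E; rewrite /V fineK.
  rewrite ge0_integralZl//; last 3 first.
  - exact: measurable_int Ig.
  - by move=> x _; rewrite lee_fin sqr_ge0.
  - by rewrite lee_fin powR_ge0.
  have -> : (\int[leb]_(x in Omega) (w x ^+ 2)%:E = (\int[leb]_(x in Omega) (w x ^+ 2))%:E)%E.
    by rewrite /Rintegral fineK//; exact: integrable_fin_num Ig.
  rewrite -!EFinM -EFinD lee_fin.
  apply: (@le_trans _ _ (m `^ q * V + m `^ (q - 2) * (C2 * m) ^+ 2)).
    rewrite lerD2l ler_wpM2l ?powR_ge0//; apply: le_trans w2 _.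
    by rewrite ler_sqr ?nnegrE ?mulr_ge0 ?(ltW m0)// ler_wpM2l// /m lerDl ltW.
  have mq : m `^ q = m `^ (q - 2) * m ^+ 2.
    rewrite -powR_mulrn ?(ltW m0)// -powRD; last by rewrite (gt_eqF m0) implybT.
    by congr (_ `^ _); lra.
  by rewrite mq /A le_eqVlt; apply/orP; left; apply/eqP; ring.
apply/lee_addgt0Pr => e e0.
have a1 : 0 < A `^ q^-1 + 1 by rewrite ltr_wpDl// powR_ge0.
apply: le_trans (key (e / (A `^ q^-1 + 1)) _) _; first exact: divr_gt0.
rewrite -EFinD lee_fin mulrDr lerD2l mulrA ler_pdivrMr// mulrC ler_wpM2l ?(ltW e0)//; lra.
Qed.

Theorem sobolev_poincare (Omega : set E) (q theta : R) : (0 < d)%N -> bounded_domain Omega ->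
  0 < theta -> 1 < q -> (q%:E <= critical_exponent d theta)%E ->
  exists2 C, 0 <= C & forall w, Xmem Omega theta w -> (Lq_norme Omega q w <= (C * Xnorm Omega theta w)%:E)%E.
Proof.
move=> d0 bO t0 q1 crit; case: (lerP 2 q) => q2; last exact: sobolev_lt2.
by apply: sobolev_ge2 => //; exact: critical_scaling.
Qed.

End sobolev_inequality.

(** * Integration without measurability and one-dimensional calculus *)

Section integral_without_measurability.
Context {dT : measure_display} {T : measurableType dT} {R : realType}.
Variable mu : {measure set T -> \bar R}.
Import HBNNSimple.

(** The integral of a nonnegative function is the supremum over the simple
    functions below it; so it is monotone, even almost everywhere, with no
    measurability. Strong measurability only yields almost everywhere limits
    of measurable functions, hence the interest of these statements. *)
Lemma ge0_ae_le_integral_gen (D : set T) (f g : T -> \bar R) :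
  (forall x, D x -> (0 <= f x)%E) -> (forall x, D x -> (0 <= g x)%E) ->
  {ae mu, forall x, D x -> (f x <= g x)%E} ->
  (\int[mu]_(x in D) f x <= \int[mu]_(x in D) g x)%E.
Proof.
move=> f0 g0 [N [mN N0 NP]]; rewrite !ge0_integralE//.
apply: ge_ereal_sup => _ /= [h hf <-].
have mNC := measurableC mN.
apply: (@le_trans _ _ (sintegral mu (proj_nnsfun h mNC))); last first.
  apply: ereal_sup_ubound => /=; exists (proj_nnsfun h mNC) => // x /=.
  have gx : (0 <= (g \_ D) x)%E by rewrite patchE; case: ifPn => // /set_mem; exact: g0.
  rewrite /proj_nnsfun /=; have -> : mindic R mNC x = \1_(~` N) x by [].
  rewrite indicE; case: (boolP (x \in ~` N)) => [/set_mem xN|_]; last by rewrite mulr0.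
  rewrite mulr1; apply: le_trans (hf x) _; rewrite !patchE; case: ifPn => // /set_mem Dx.
  by apply: contrapT => H; apply: xN; apply: NP => /= /(_ Dx).
have E (k : {nnsfun T >-> R}) : sintegral mu k = (\int[mu]_x (k x)%:E)%E.
  by rewrite integral_nnsfun// patch_setT.
rewrite !E le_eqVlt; apply/orP; left; apply/eqP.
apply: ae_eq_integral => //; [exact/measurable_EFinP|exact/measurable_EFinP|].
exists N; split=> // x /=; apply: contra_notP => xN _.
rewrite /proj_nnsfun /=; have -> : mindic R mNC x = \1_(~` N) x by [].
by rewrite indicE mem_set ?mulr1.
Qed.

Lemma ge0_le_integral_gen (D : set T) (f g : T -> \bar R) :
  (forall x, D x -> (0 <= f x)%E) -> (forall x, D x -> (f x <= g x)%E) ->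
  (\int[mu]_(x in D) f x <= \int[mu]_(x in D) g x)%E.
Proof.
move=> f0 fg; apply: ge0_ae_le_integral_gen => // [x Dx|]; first exact: le_trans (f0 _ Dx) (fg _ Dx).
exact: aeW.
Qed.

Lemma ae_eq_integral_gen (D : set T) (f g : T -> \bar R) :
  {ae mu, forall x, D x -> f x = g x} ->
  (\int[mu]_(x in D) f x = \int[mu]_(x in D) g x)%E.
Proof.
move=> fg; rewrite integralE [RHS]integralE; congr (_ - _)%E; apply/eqP; rewrite eq_le; apply/andP; split;
  apply: ge0_ae_le_integral_gen => // ; apply: filterS fg => x h /h; rewrite ?funeposE ?funenegE => ->; exact: lexx.
Qed.

Lemma ae_eq_Rintegral_gen (D : set T) (f g : T -> R) :
  {ae mu, forall x, D x -> f x = g x} ->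
  \int[mu]_(x in D) f x = \int[mu]_(x in D) g x.
Proof.
by move=> fg; congr fine; apply: ae_eq_integral_gen; apply: filterS fg => x h /h ->.
Qed.

End integral_without_measurability.

Section real_induction.
Context {R : realType}.

(** The supremum of the points up to which [P] holds can be neither less than
    [b] nor a point where [P] fails. *)
Lemma real_induction (a b : R) (P : R -> Prop) : P a ->
  (forall s, a <= s -> s < b -> P s -> exists2 delta, 0 < delta & forall t, s < t -> t <= s + delta -> P t) ->
  (forall t, a < t -> t <= b -> (forall s, a <= s -> s < t -> P s) -> P t) ->
  forall t, a <= t -> t <= b -> P t.
Proof.
move=> Pa right left t at_ tb.
have ab := le_trans at_ tb.
pose A := [set x | a <= x <= b /\ forall y, a <= y -> y <= x -> P y].
have Aa : A a by split; [rewrite lexx|move=> y ay ya; rewrite (_ : y = a)//; apply/le_anti; rewrite ya].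
have hA : has_sup A by split; [exists a|exists b => x [/andP[]]].
pose c := sup A.
have ac : a <= c by exact: sup_upper_bound hA _ Aa.
have cb : c <= b by apply: ge_sup => [|x [/andP[]]//]; exists a.
have below y : a <= y -> y < c -> P y.
  by move=> ay yc; have [x [_ Ax] yx] := sup_gt (ex_intro _ a Aa) yc; apply: Ax => //; exact: ltW.
have Pc : P c.
  move: ac; rewrite le_eqVlt => /orP[/eqP <-//|ac'].
  by apply: left => // s as_ sc; exact: below.
have upto y : a <= y -> y <= c -> P y.
  by move=> ay; rewrite le_eqVlt => /orP[/eqP ->//|]; exact: below.
have : ~ c < b.
  move=> cb'; have [delta d0 H] := right c ac cb' Pc.
  pose x := Num.min (c + delta) b.
  have cx : c < x by rewrite lt_min cb' ltrDl d0.
  have : A x.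
    split; first by rewrite (le_trans ac (ltW cx))/= ge_min lexx orbT.
    move=> y ay yx; case: (lerP y c) => yc; first exact: upto.
    by apply: H => //; apply: le_trans yx _; rewrite ge_min lexx.
  by move=> /(sup_upper_bound hA); rewrite leNgt cx.
move=> /negP; rewrite -leNgt => bc; apply: upto => //; exact: le_trans tb bc.
Qed.

End real_induction.

Section absolutely_continuous_monotone.
Context {R : realType}.
Local Notation leb := (@lebesgue_measure R).
Variables (F : R -> R) (s t e : R).
Hypotheses (st : s <= t) (e0 : 0 < e).

Lemma derive1_ge0_increment (x : R) : derivable F x 1 -> 0 <= derive1 F x ->
  exists2 delta, 0 < delta & forall y z, y <= z -> (y = x \/ z = x) -> z - y <= delta ->
    - e * (z - y) <= F z - F y.
Proof.
move=> dF F0.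
have cv : h^-1 *: ((F \o shift x) (h *: (1 : R)) - F x) @[h --> 0^'] --> derive1 F x.
  by rewrite derive1E; exact: dF.
have : \forall h \near 0^', - e < h^-1 *: ((F \o shift x) (h *: (1 : R)) - F x).
  by apply: (cvgr_gt (derive1 F x)) => //; apply: lt_le_trans F0; rewrite oppr_lt0.
rewrite near_withinE => /nbhs_ballP[r /= r0 H].
have incr h : h != 0 -> `|h| < r -> - e < (F (x + h) - F x) / h.
  move=> h0 hr; have := H h; rewrite /ball/= sub0r normrN => /(_ hr h0).
  by rewrite /GRing.scale/= mulr1 [h + x]addrC mulrC.
exists (r / 2); first exact: divr_gt0.
move=> y z yz xyz zy.
move: yz; rewrite le_eqVlt => /orP[/eqP <-|yz]; first by rewrite !subrr mulr0.
have d0 : 0 < z - y by rewrite subr_gt0.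
case: xyz => E0.
- have := incr (z - y); rewrite (gtr0_norm d0) E0 [x + _]addrC subrK => /(_ (lt0r_neq0 _)).
  rewrite -E0 => /(_ d0) K; have {}K := ltW (K ltac:(lra)).
  by rewrite -ler_pdivlMr.
- have n0 : y - z < 0 by rewrite subr_lt0.
  have := incr (y - z) (ltr0_neq0 n0); rewrite (ltr0_norm n0) E0 [x + _]addrC subrK -E0 opprB => K.
  have {}K := ltW (K ltac:(lra)).
  move: K; rewrite -[y - z]opprB invrN mulrN -mulNr opprB => K.
  by rewrite -ler_pdivlMr.
Qed.

Variable U : set R.
Hypothesis oU : open U.

(** Intervals inside the small open set [U] that contains the exceptional
    points, listed from right to left: real induction along [[s, t]] adds them
    at the head. *)
Fixpoint chain (x : R) (l : seq (R * R)) : Prop :=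
  if l is p :: l' then
    [/\ s <= p.1, p.1 <= p.2, p.2 <= x, `[p.1, p.2] `<=` U & chain p.1 l']
  else s <= x.

Definition chain_length (l : seq (R * R)) := \sum_(p <- l) (p.2 - p.1).
Definition chain_variation (l : seq (R * R)) := \sum_(p <- l) `|F p.2 - F p.1|.

Lemma chainW x y l : x <= y -> chain x l -> chain y l.
Proof. by case: l => /= [|p l] xy; [lra|case=> h1 h2 h3 h4 h5; split => //; lra]. Qed.

Lemma chain_measure x l : chain x l -> ((chain_length l)%:E <= leb (U `&` `[s, x[))%E.
Proof.
have mU : measurable U by exact: open_measurable.
elim: l x => [|p l IH] x /=; first by move=> _; rewrite /chain_length big_nil.
move=> [sp pq qx pU ch]; rewrite /chain_length big_cons addrC EFinD.
have mI (u v : R) : measurable (U `&` `[u, v[) by exact: measurableI.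
apply: (@le_trans _ _ (leb ((U `&` `[s, p.1[) `|` `[p.1, p.2[)))%E.
  have -> : leb ((U `&` `[s, p.1[) `|` `[p.1, p.2[) = (leb (U `&` `[s, p.1[) + leb `[p.1, p.2[)%E.
    apply: measureU => //; first exact: mI.
    apply/seteqP; split=> // y [[_ /=]]; rewrite !in_itv/= => /andP[_ h1] /andP[h2 _].
    by move: (lt_le_trans h1 h2); rewrite ltxx.
  apply: leeD; first exact: IH.
  rewrite lebesgue_measure_itv/= lte_fin; case: ltrP => // h.
  by rewrite lee_fin subr_le0.
apply: le_measure; rewrite ?inE; [by apply: measurableU => //; exact: mI|exact: mI|].
move=> y [[Uy]|]/=; rewrite in_itv/= => /andP[h1 h2].
  by split=> //=; rewrite in_itv/= h1/=; lra.
split; first by apply: pU; rewrite /= in_itv/= h1 ltW.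
by rewrite /= in_itv/=; apply/andP; split; lra.
Qed.

Lemma chain_in x l p : chain x l -> p \in l -> [/\ s <= p.1, p.1 <= p.2 & p.2 <= x].
Proof.
elim: l x => //= p0 l IH x [sp pq qx _ ch]; rewrite inE => /orP[/eqP ->//|/(IH _ ch)[h1 h2 h3]].
by split=> //; lra.
Qed.

Lemma chain_order x l i j : chain x l -> (i < j < size l)%N ->
  (nth (0, 0) l j).2 <= (nth (0, 0) l i).1.
Proof.
elim: l x i j => [|p l IH] x i j /=; first by rewrite andbF.
move=> [sp pq qx _ ch]; case: j => [|j]; first by rewrite ltn0.
case: i => [|i] /andP[ij jl] /=; last by apply: IH ch _; apply/andP.
by have [] := chain_in ch (mem_nth (0, 0) (jl : (j < size l)%N)).
Qed.

Lemma chain_absolutely_continuous (delta x : R) (l : seq (R * R)) (I : set R) :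
  (forall n (a b : 'I_n -> R),
      (forall i, [/\ I (a i), I (b i) & a i <= b i]) ->
      trivIset setT (fun i => `]a i, b i[%classic) ->
      \sum_(i < n) (b i - a i) < delta ->
      \sum_(i < n) `|F (b i) - F (a i)| < e) ->
  (forall y, s <= y -> y <= x -> I y) ->
  chain x l -> (leb U < delta%:E)%E -> chain_variation l < e.
Proof.
move=> H sI ch Ud.
rewrite /chain_variation (big_nth (0, 0)) big_mkord; apply: H.
- move=> i; have [h1 h2 h3] := chain_in ch (mem_nth (0, 0) (ltn_ord i)).
  by split=> //; apply: sI; lra.
- apply/trivIsetP => /= i j _ _; wlog ij : i j / (i < j)%N => [wl|] ne.
    case: (ltngtP i j) => [ij|ji|/val_inj ij]; [exact: wl|rewrite setIC; apply: wl => //; by rewrite eq_sym|].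
    by move: ne; rewrite ij eqxx.
  have ord : (i < j < size l)%N by rewrite ij ltn_ord.
  have := chain_order ch ord => h.
  apply/seteqP; split=> // y []; rewrite /= !in_itv/= => /andP[h1 h2] /andP[h3 h4].
  by have := lt_trans (lt_le_trans h4 h) h1; rewrite ltxx.
- rewrite -lte_fin; apply: le_lt_trans Ud.
  have := chain_measure ch; rewrite /chain_length (big_nth (0, 0)) big_mkord => /le_trans; apply.
  have mU : measurable U by exact: open_measurable.
  by apply: le_measure; rewrite ?inE//; exact: measurableI.
Qed.

Let P x := exists2 l, chain x l & - e * (x - s) - chain_variation l <= F x - F s.

Let P_in x y : s <= x -> x <= y -> `[x, y] `<=` U -> P x -> P y.
Proof.
move=> sx xy xyU [l ch H]; exists ((x, y) :: l); first by split.
rewrite /chain_variation big_cons /= -/(chain_variation l).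
have : - `|F y - F x| <= F y - F x by rewrite lerNl -normrN; exact: ler_norm.
have : 0 <= e * (y - x) by rewrite mulr_ge0 ?(ltW e0)// subr_ge0.
lra.
Qed.

Let P_deriv x y : x <= y -> - e * (y - x) <= F y - F x -> P x -> P y.
Proof.
move=> xy H [l ch K]; exists l; first exact: chainW ch.
nra.
Qed.

(** Real induction: a point outside [U] is passed by the sign of the derivative,
    with an error [e] times the length; a point of [U] by adding an interval to
    the chain. *)
Lemma chain_cover : (forall x, s <= x <= t -> ~ U x -> derivable F x 1 /\ 0 <= derive1 F x) ->
  exists2 l, chain t l & - e * (t - s) - chain_variation l <= F t - F s.
Proof.
move=> good.
have openP x : U x -> exists2 delta, 0 < delta & forall y, `|x - y| <= delta -> U y.
  move=> Ux; have /nbhs_ballP[r /= r0 H] := oU Ux.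
  exists (r / 2); first exact: divr_gt0.
  by move=> y xy; apply: H; rewrite /ball/=; lra.
apply: (real_induction (a := s) (b := t) (P := P)) => //.
- by exists [::] => //=; rewrite /chain_variation big_nil !subrr mulr0 subr0.
- move=> x sx xt Px; case: (pselect (U x)) => [/openP[delta d0 H]|Ux].
    exists delta => // y xy yd; apply: P_in (ltW xy) _ Px => // z; rewrite /= in_itv/= => /andP[h1 h2].
    by apply: H; rewrite ler_norml; apply/andP; split; lra.
  have [|dF F0] := good x _ Ux; first by rewrite sx ltW.
  have [delta d0 H] := derive1_ge0_increment dF F0.
  exists delta => // y xy yd; apply: P_deriv (ltW xy) _ Px.
  by apply: H; [exact: ltW|left|lra].
- move=> x sx xt Ps; case: (pselect (U x)) => [/openP[delta d0 H]|Ux].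
    pose y := Num.max s (x - delta).
    have sy : s <= y by rewrite le_max lexx.
    have yx : y < x by rewrite gt_max sx; lra.
    have yd : x - delta <= y by rewrite le_max lexx orbT.
    apply: P_in sy (ltW yx) _ (Ps _ sy yx) => z; rewrite /= in_itv/= => /andP[h1 h2].
    by apply: H; rewrite ler_norml; apply/andP; split; lra.
  have [|dF F0] := good x _ Ux; first by rewrite xt ltW.
  have [delta d0 H] := derive1_ge0_increment dF F0.
  pose y := Num.max s (x - delta).
  have sy : s <= y by rewrite le_max lexx.
  have yx : y < x by rewrite gt_max sx; lra.
  have yd : x - delta <= y by rewrite le_max lexx orbT.
  apply: P_deriv (ltW yx) _ (Ps _ sy yx).
  by apply: H; [exact: ltW|right|lra].
Qed.

End absolutely_continuous_monotone.

(** Cover the exceptional null set by a small open set: there the increments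
    are controlled by absolute continuity, elsewhere by the sign of the
    derivative. *)
Lemma absolutely_continuous_nondecreasing {R : realType} (F : R -> R) (I : set R) (s t : R) :
  s <= t -> `[s, t] `<=` I -> absolutely_continuous I F ->
  {ae lebesgue_measure, forall x, s < x < t -> derivable F x 1 /\ 0 <= derive1 F x} ->
  F s <= F t.
Proof.
move=> st stI ac [N [mN N0 NP]].
suff main e : 0 < e -> - e * (t - s) - e <= F t - F s.
  rewrite -subr_ge0; apply/ler_addgt0Pr => e e0.
  have k0 : 0 < t - s + 1 by lra.
  have := main (e / (t - s + 1)) (divr_gt0 e0 k0).
  have : e / (t - s + 1) * (t - s + 1) = e by rewrite divfK// gt_eqF.
  lra.
move=> e0; have [delta d0 H] := ac e e0.
pose M := N `|` [set s] `|` [set t].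
have mM : measurable M by apply: measurableU => //; exact: measurableU.
have M0 : lebesgue_measure M = 0.
  apply/eqP; rewrite eq_le measure_ge0 andbT.
  apply: (@le_trans _ _ (lebesgue_measure (N `|` [set s]) + lebesgue_measure [set t])%E).
    by apply: measureU2 => //; exact: measurableU.
  rewrite lebesgue_measure_set1 adde0.
  apply: (@le_trans _ _ (lebesgue_measure N + lebesgue_measure [set s])%E).
    by apply: measureU2.
  by rewrite lebesgue_measure_set1 adde0 N0.
have Mfin : (lebesgue_measure M < +oo)%E by rewrite M0.
have [U [oU MU Ud]] := @lebesgue_regularity_outer R M delta mM Mfin d0.
have Ud' : (lebesgue_measure U < delta%:E)%E.
  have mU : measurable U by exact: open_measurable.
  apply: le_lt_trans Ud; apply: (@le_trans _ _ (lebesgue_measure (U `\` M) + lebesgue_measure M)%E).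
    rewrite -measureU//; [|exact: measurableD|by rewrite setDKI].
    apply: le_measure; rewrite ?inE//; first by apply: measurableU => //; exact: measurableD.
    by move=> y Uy; case: (pselect (M y)) => My; [right|left].
  by rewrite M0 adde0.
have good x : s <= x <= t -> ~ U x -> derivable F x 1 /\ 0 <= derive1 F x.
  move=> /andP[sx xt] Ux; apply: contrapT => bad; apply/Ux/MU.
  move: sx; rewrite le_eqVlt => /orP[/eqP <-|sx]; first by left; right.
  move: xt; rewrite le_eqVlt => /orP[/eqP ->|xt]; first by right.
  by left; left; apply: NP => /= /(_ ltac:(by rewrite sx xt)).
have [l ch K] := chain_cover st e0 oU good.
have sI y : s <= y -> y <= t -> I y by move=> sy yt; apply: stI; rewrite /= in_itv/= sy yt.
have := chain_absolutely_continuous oU H sI ch Ud'.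
lra.
Qed.

Section du_bois_reymond.
Context {R : realType}.
Local Notation leb := (@lebesgue_measure R).

Lemma supported_integrable (a b : R) (rho : R -> R) : continuous rho ->
  (forall x, ~ (a < x < b) -> rho x = 0) ->
  leb.-integrable setT (EFin \o rho) /\
  forall D : set R, measurable D -> `]a, b[ `<=` D ->
    (\int[leb]_x (rho x)%:E = \int[leb]_(x in D) (rho x)%:E)%E.
Proof.
move=> crho supp.
have rest (D : set R) : `]a, b[ `<=` D -> (EFin \o rho) \_ D = EFin \o rho.
  move=> abD; apply/funext => x; rewrite patchE; case: ifPn => // /negP xD.
  rewrite /= supp// => axb; apply: xD; rewrite inE; apply: abD; by rewrite /= in_itv.
split; last by move=> D mD abD; rewrite [RHS]integral_mkcond rest.
have -> : EFin \o rho = (EFin \o rho) \_ `[a, b].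
  by rewrite rest// => x /=; rewrite !in_itv/= => /andP[h1 h2]; rewrite !ltW.
apply/(integrable_mkcond _ _).1 => //.
by apply: continuous_compact_integrable; [exact: segment_compact|exact: continuous_subspaceT].
Qed.

(** The normalized primitive of a smooth bump. *)
Lemma smooth_step (a b : R) : a < b -> exists Phi rho : R -> R,
  [/\ Csmooth Phi, derive1 Phi = rho,
      forall x, 0 <= rho x, forall x, ~ (a < x < b) -> rho x = 0 &
      [/\ (\int[leb]_x (rho x)%:E = 1)%E, forall x, x <= a -> Phi x = 0,
          forall x, b <= x -> Phi x = 1 & forall x, 0 <= Phi x <= 1]].
Proof.
move=> ab; pose k := smooth_bump 1 a b.
have Ck_ : Csmooth k by apply: Csmooth_bump.
have ck := Csmooth_continuous Ck_.
have k0 x : 0 <= k x by exact: bump_ge0.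
have ksupp x : ~ (a < x < b) -> k x = 0 by move=> /negP; rewrite -(bump_neq0 1) negbK => /eqP.
have [ik _] := supported_integrable ck ksupp.
pose c := \int[leb]_x k x.
have cE : (\int[leb]_x (k x)%:E = c%:E)%E by rewrite /c /Rintegral fineK//; exact: integrable_fin_num ik.
have c0 : 0 < c.
  have c_ge0 : 0 <= c by apply: Rintegral_ge0.
  rewrite lt_neqAle c_ge0 andbT; apply/eqP => c0.
  have mid : a < (a + b) / 2 < b by apply/andP; split; lra.
  have km : 0 < k ((a + b) / 2) by rewrite lt_def k0 bump_neq0 mid.
  have : \forall x \near nbhs ((a + b) / 2), k ((a + b) / 2) / 2 < k x.
    by apply: (cvgr_gt (k ((a + b) / 2)) (ck _)); lra.
  move=> /nbhs_ballP[r /= r0 H].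
  set m := (a + b) / 2 in mid km H; pose h := k m / 2; have h0 : 0 < h by rewrite divr_gt0.
  pose J : set R := `[m, m + r / 2]%classic.
  have mJ : measurable J by exact: measurable_itv.
  have : (\int[leb]_(x in J) (h%:E) <= \int[leb]_x (k x)%:E)%E.
    rewrite [leLHS]integral_mkcond; apply: ge0_le_integral => //.
    - by move=> x _; rewrite patchE; case: ifP => // _; rewrite lee_fin ltW.
    - by apply/(measurable_restrictT _ _).1.
    - exact: measurable_int ik.
    move=> x _; rewrite patchE; case: ifPn => [|_]; last by rewrite lee_fin.
    rewrite mem_setE in_itv/= => /andP[h1 h2]; rewrite lee_fin; apply/ltW/H.
    by rewrite /ball/= ltr_norml; apply/andP; split; lra.
  rewrite integral_cst// cE -c0.
  have -> : (h%:E * leb J = (h * (r / 2))%:E)%E.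
    rewrite EFinM; have -> : leb J = (r / 2)%:E; last by [].
    by rewrite /J lebesgue_measure_itv/= lte_fin ltrDl divr_gt0// -EFinB; congr EFin; lra.
  by rewrite lee_fin leNgt mulr_gt0// divr_gt0.
pose rho x := c^-1 * k x.
have Crho : Csmooth rho by move=> n; apply: (Ck_mul (Ck_cst n c^-1)); exact: Ck_.
have crho := Csmooth_continuous Crho.
have rho0 x : 0 <= rho x by rewrite mulr_ge0// invr_ge0 ltW.
have rsupp x : ~ (a < x < b) -> rho x = 0 by move=> /ksupp; rewrite /rho => ->; rewrite mulr0.
have [irho rhoD] := supported_integrable crho rsupp.
have rho1 : (\int[leb]_x (rho x)%:E = 1)%E.
  rewrite /rho; under eq_integral do rewrite EFinM.
  by rewrite integralZl// cE -EFinM mulVf ?gt_eqF.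
pose Phi x := \int[leb]_(y in [set` Interval -oo%O (BRight x)]) rho y.
have iD (D : set R) : measurable D -> leb.-integrable D (EFin \o rho).
  by move=> mD; apply: integrableS irho.
have PhiE x : (Phi x)%:E = (\int[leb]_(y in [set` Interval -oo%O (BRight x)]) (rho y)%:E)%E.
  by rewrite /Phi /Rintegral fineK//; apply: integrable_fin_num => //; exact: iD.
have dPhi x : derivable Phi x 1 /\ derive1 Phi x = rho x.
  have xx : x < x + 1 by rewrite ltrDl.
  apply: (@continuous_FTC1 R rho -oo%O x (x + 1) xx); first exact: iD.
    by rewrite /Order.lt /=.
  exact: crho.
have dP : derive1 Phi = rho by apply/funext => x; have [] := dPhi x.
exists Phi, rho; split=> //.
- case=> // n; split; first by move=> x; have [] := dPhi x.
  by rewrite dP; exact: Crho.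
split=> //.
- move=> x xa; apply/EFin_inj; rewrite PhiE integral0_eq// => y /=; rewrite in_itv/= => yx.
  by rewrite rsupp//; lra.
- move=> x bx; apply/EFin_inj; rewrite PhiE -rho1; apply/esym/rhoD => //.
  by move=> y /=; rewrite !in_itv/= => /andP[_ h]; exact: le_trans (ltW h) bx.
- move=> x; rewrite -!lee_fin PhiE; apply/andP; split.
    by apply: integral_ge0 => y _; rewrite lee_fin.
  rewrite -rho1; apply: ge0_subset_integral => //; first exact: measurable_int irho.
  by move=> y _; rewrite lee_fin.
Qed.

(** A continuous function with a weak derivative is its primitive: test with
    smooth approximations of the indicator function of [[s, t]]. *)
Lemma weak_derivative_increment (I : set R) (a m : R -> R) (s t : R) :
  measurable I -> s < t -> `[s, t] `<=` I ->
  (forall x, s <= x <= t -> {for x, continuous a}) ->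
  leb.-integrable `[s, t] (EFin \o m) ->
  (forall phi, time_test_fun I phi ->
    \int[leb]_(x in I) (derive1 phi x * a x) = - \int[leb]_(x in I) (phi x * m x)) ->
  a t - a s = \int[leb]_(x in `[s, t]) m x.
Proof.
move=> mI st stI ca im H.
pose h (k : nat) : R := (t - s) / 2 * k.+1%:R^-1.
have h0 k : 0 < h k by rewrite mulr_gt0 ?invr_gt0// divr_gt0// subr_gt0.
have hle k : h k <= (t - s) / 2.
  by rewrite ler_piMr ?invf_le1 ?ler1n// divr_ge0// subr_ge0 ltW.
have hcvg : h k @[k --> \oo] --> (0 : R).
  rewrite -(mulr0 ((t - s) / 2)); apply: cvgM; first exact: cvg_cst.
  exact: cvg_harmonic.
have step1 k : s < s + h k by rewrite ltrDl.
have step2 k : t - h k < t by rewrite ltrBlDr ltrDl.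
have /choice[Phi1 /choice[rho1 H1]] := fun k => smooth_step (step1 k).
have /choice[Phi2 /choice[rho2 H2]] := fun k => smooth_step (step2 k).
pose phi k := Phi1 k \- Phi2 k.
have Cphi k : Csmooth (phi k).
  have [C1 _ _ _ _] := H1 k; have [C2 _ _ _ _] := H2 k.
  have -> : phi k = Phi1 k \+ (cst (-1) \* Phi2 k).
    by apply/funext => x; rewrite /phi /= mulN1r.
  by move=> n; apply: Ck_add (C1 n) _; apply: Ck_mul (Ck_cst n _) (C2 n).
have dphi k x : derive1 (phi k) x = rho1 k x - rho2 k x.
  have [C1 <- _ _ _] := H1 k; have [C2 <- _ _ _] := H2 k.
  have d1 : derivable (Phi1 k) x 1 by case: (C1 1%N).
  have d2 : derivable (Phi2 k) x 1 by case: (C2 1%N).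
  by rewrite !derive1E /phi deriveB.
have phi_out k x : ~ (s < x < t) -> phi k x = 0.
  have [_ _ _ _ [_ L1 R1 _]] := H1 k; have [_ _ _ _ [_ L2 R2 _]] := H2 k.
  have := hle k; have := h0 k => hk0 hk.
  move=> nst; rewrite /phi /=; case: (lerP x s) => xs; first by rewrite L1// L2 ?subrr//; lra.
  have tx : t <= x by rewrite leNgt; apply/negP => xt; apply: nst; rewrite xs.
  by rewrite R1 ?R2 ?subrr//; lra.
have test k : time_test_fun I (phi k).
  have sub : closure [set x | phi k x != 0] `<=` `[s, t].
    rewrite [X in _ `<=` X](closure_id _).1; last exact: itv_closed.
    apply: closure_subset => x /=; rewrite in_itv/= => /eqP nz.
    by apply: contrapT => h'; apply: nz; apply: phi_out => /andP[u v]; apply: h'; rewrite !ltW.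
  split; first exact: Csmooth_derivable (Cphi k).
  - apply: subclosed_compact sub; [exact: closed_closure|exact: segment_compact].
  - exact: subset_trans sub stI.
have mst : measurable `[s, t] by exact: measurable_itv.
have restr (g : R -> R) : (forall x, ~ (s < x < t) -> g x = 0) ->
    \int[leb]_(x in I) g x = \int[leb]_(x in `[s, t]) g x.
  move=> g0; congr fine; rewrite [LHS]integral_mkcond [RHS]integral_mkcond.
  apply: eq_integral => x _; rewrite !patchE; case: (boolP (x \in `[s, t]%classic)) => xst.
    by rewrite mem_set//; apply: stI; exact: set_mem.
  case: ifP => // _; rewrite g0// => /andP[u v]; move: xst; rewrite mem_setE in_itv/= !ltW//.
have ia : leb.-integrable `[s, t] (EFin \o a).
  apply: continuous_compact_integrable; first exact: segment_compact.
  apply: continuous_in_subspaceT => x; rewrite inE/= in_itv/=; exact: ca.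
have rho_out k x : ~ (s < x < t) -> rho1 k x = 0 /\ rho2 k x = 0.
  have [_ _ _ O1 _] := H1 k; have [_ _ _ O2 _] := H2 k.
  have := hle k; have := h0 k => hk0 hk.
  move=> nst; split; [rewrite O1//|rewrite O2//] => /andP[u v]; apply: nst; apply/andP; split; lra.
have ma := measurable_int _ ia.
(* Averages of [a] against a density concentrated near s or t. *)
have average (rho : R -> R) (y e : R) : continuous rho -> (forall x, 0 <= rho x) ->
    (forall x, ~ (s < x < t) -> rho x = 0) -> (\int[leb]_x (rho x)%:E = 1)%E ->
    (forall x, s <= x <= t -> rho x != 0 -> `|a x - y| <= e) ->
    leb.-integrable `[s, t] (EFin \o (rho \* a)) /\
    `|\int[leb]_(x in `[s, t]) (rho x * a x) - y| <= e.
  move=> crho r0 rout r1 ae.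
  have [ir rD] := supported_integrable crho rout.
  have ir' : leb.-integrable `[s, t] (EFin \o rho) by exact: integrableS ir.
  have r1' : \int[leb]_(x in `[s, t]) rho x = 1.
    rewrite /Rintegral -rD ?r1// => x /=; rewrite !in_itv/= => /andP[u v]; by rewrite !ltW.
  have ira : leb.-integrable `[s, t] (EFin \o (rho \* a)).
    apply: continuous_compact_integrable; first exact: segment_compact.
    apply: continuous_in_subspaceT => x; rewrite inE/= in_itv/= => xst.
    by apply: cvgM; [exact: crho|exact: ca].
  have iz (z : R) : leb.-integrable `[s, t] (EFin \o (fun x => z * rho x)).
    rewrite (_ : EFin \o _ = (fun x => z%:E * (EFin \o rho) x)%E); last by apply/funext => x; rewrite /= EFinM.
    exact: integrableZl.
  have zE (z : R) : \int[leb]_(x in `[s, t]) (z * rho x) = z by rewrite RintegralZl// r1' mulr1.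
  split=> //; rewrite ler_norml; apply/andP; split.
    rewrite lerBrDl -[X in X <= _]zE; apply: le_Rintegral => // x; rewrite /= in_itv/= => xst.
    have [->|rx] := eqVneq (rho x) 0; first by rewrite mulr0 mul0r.
    by rewrite mulrC ler_wpM2l//; have := ae x xst rx; rewrite ler_norml => /andP[]; lra.
  rewrite lerBlDl -[X in _ <= X]zE; apply: le_Rintegral => // x; rewrite /= in_itv/= => xst.
  have [->|rx] := eqVneq (rho x) 0; first by rewrite mulr0 mul0r.
  by rewrite [X in _ <= X]mulrC ler_wpM2l//; have := ae x xst rx; rewrite ler_norml => /andP[]; lra.
have lim1 : \int[leb]_(x in I) (derive1 (phi k) x * a x) @[k --> \oo] --> a s - a t.
  apply/cvgrPdist_le => e e0.
  have e20 : 0 < e / 2 by rewrite divr_gt0.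
  have near_a y : s <= y <= t -> exists2 r, 0 < r & forall x, `|y - x| < r -> `|a x - a y| <= e / 2.
    move=> yst; have := ca y yst => /cvgrPdist_le/(_ _ e20)/nbhs_ballP[r /= r0 Hr].
    by exists r => // x xy; rewrite distrC; apply: Hr.
  have [rs rs0 Hs] := near_a s ltac:(by rewrite lexx ltW).
  have [rt rt0 Ht] := near_a t ltac:(by rewrite lexx ltW).
  near=> k.
  have hs : h k < rs by near: k; apply: (cvgr_lt 0).
  have ht : h k < rt by near: k; apply: (cvgr_lt 0).
  have [C1 d1 r10 O1 [I1 _ _ _]] := H1 k; have [C2 d2 r20 O2 [I2 _ _ _]] := H2 k.
  have c1 : continuous (rho1 k) by rewrite -d1; exact: Csmooth_continuous (Csmooth_derive1n 1 C1).
  have c2 : continuous (rho2 k) by rewrite -d2; exact: Csmooth_continuous (Csmooth_derive1n 1 C2).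
  have hk0 := h0 k; have hk := hle k.
  have B1 x : s <= x <= t -> rho1 k x != 0 -> `|a x - a s| <= e / 2.
    move=> xst nz; apply: Hs; have : s < x < s + h k.
      by apply: contraNT nz => /negP /O1 ->; exact: eqxx.
    by move=> /andP[u v]; rewrite ltr_norml; apply/andP; split; lra.
  have B2 x : s <= x <= t -> rho2 k x != 0 -> `|a x - a t| <= e / 2.
    move=> xst nz; apply: Ht; have : t - h k < x < t.
      by apply: contraNT nz => /negP /O2 ->; exact: eqxx.
    by move=> /andP[u v]; rewrite ltr_norml; apply/andP; split; lra.
  have [i1 A1] := average _ (a s) (e / 2) c1 r10 (fun x nst => (rho_out k x nst).1) I1 B1.
  have [i2 A2] := average _ (a t) (e / 2) c2 r20 (fun x nst => (rho_out k x nst).2) I2 B2.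
  rewrite restr; last by move=> x nst; have [E1 E2] := rho_out k x nst; rewrite dphi E1 E2 subrr mul0r.
  have -> : \int[leb]_(x in `[s, t]) (derive1 (phi k) x * a x) =
      \int[leb]_(x in `[s, t]) (rho1 k x * a x) - \int[leb]_(x in `[s, t]) (rho2 k x * a x).
    rewrite -RintegralB//; apply: eq_Rintegral => x _; rewrite dphi mulrBl//.
  move: A1 A2; rewrite !ler_norml.
  move: (\int[leb]_(x in `[s, t]) (rho1 k x * a x)) (\int[leb]_(x in `[s, t]) (rho2 k x * a x)) => u v.
  clear; move=> /andP[? ?] /andP[? ?]; apply/andP; split; lra.
have lim2 : \int[leb]_(x in I) (phi k x * m x) @[k --> \oo] --> \int[leb]_(x in `[s, t]) m x.
  have -> : (fun k => \int[leb]_(x in I) (phi k x * m x)) = (fun k => \int[leb]_(x in `[s, t]) (phi k x * m x)).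
    by apply/funext => k; apply: restr => x nst; rewrite phi_out ?mul0r.
  have phi1 k x : `|phi k x| <= 1.
    have [_ _ _ _ [_ _ _ B1]] := H1 k; have [_ _ _ _ [_ _ _ B2]] := H2 k.
    have := B1 x; have := B2 x; rewrite /phi /= => /andP[? ?] /andP[? ?].
    by rewrite ler_norml; apply/andP; split; lra.
  have mm := measurable_int _ im.
  have mphi k : measurable_fun `[s, t] (EFin \o (phi k \* m)).
    apply/measurable_EFinP; apply: measurable_funM; last exact/measurable_EFinP.
    exact: measurable_funS (continuous_measurable_fun (Csmooth_continuous (Cphi k))).
  have := @dominated_convergence _ _ _ leb _ mst (fun k => EFin \o (phi k \* m)) (EFin \o m) (fun x => `|(m x)%:E|)%E mphi mm.
  case.
  - exists [set s; t]; split => //.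
      by apply: measurableU.
    + apply/eqP; rewrite eq_le measure_ge0 andbT.
      apply: (@le_trans _ _ (leb [set s] + leb [set t])%E); first exact: measureU2.
      by rewrite !lebesgue_measure_set1 adde0.
    + move=> x /=; apply: contra_notP => /not_orP[xs xt]; rewrite in_itv/= => /andP[sx tx].
      have {}sx : s < x by rewrite lt_neqAle sx andbT; apply/eqP => E0; exact: xs.
      have {}tx : x < t by rewrite lt_neqAle tx andbT; apply/eqP => E0; exact: xt.
      apply: cvg_near_cst; near=> k.
      have [_ _ _ _ [_ _ R1 _]] := H1 k; have [_ _ _ _ [_ L2 _ _]] := H2 k.
      rewrite /= /phi /= R1 ?L2 ?subr0 ?mul1r//.
      * have : h k <= t - x by near: k; apply: (cvgr_le 0) => //; lra.
        lra.
      * have : h k <= x - s by near: k; apply: (cvgr_le 0) => //; lra.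
        lra.
  - exact: integrable_abse.
  - apply: aeW => x k _ /=; rewrite normrM lee_fin ler_piMl//.
  move=> _ _ C; apply: fine_cvg; rewrite fineK; first exact: C.
  exact: integrable_fin_num im.
have := cvg_unique (@Rhausdorff R) lim1.
rewrite (_ : (fun k => _) = fun k => - \int[leb]_(x in I) (phi k x * m x)); last by apply/funext => k; exact: H.
move=> /(_ _ _ (cvgN lim2)) => U.
by rewrite -[RHS]opprK -U opprB.
Unshelve. all: by end_near. Qed.

End du_bois_reymond.

(** * Duality and Hoelder's inequality on a domain *)

Section duality.
Context {R : realType}.
Local Notation leb1 := (@lebesgue_measure R).
Variable S : fspace R.
Hypothesis Slin : forall a v w, fmem S v -> fmem S w -> fmem S (fun x => a * v x + w x).

Lemma fspaceZ a v : fmem S v -> fmem S (fun x => a * v x).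
Proof.
move=> Sv; have := Slin (a - 1) Sv Sv; congr (fmem S _).
by apply/funext => x; rewrite mulrBl mul1r subrK.
Qed.

Lemma dualZ l a v : fmem (dual S) l -> fmem S v -> l (fun x => a * v x) = a * l v.
Proof.
move=> [lin _] Sv; have := lin (a - 1) v v Sv Sv.
rewrite mulrBl mul1r subrK => <-; congr l; apply/funext => x; by rewrite mulrBl mul1r subrK.
Qed.

Lemma dualB l v w : fmem (dual S) l -> fmem S v -> fmem S w -> l (v \- w) = l v - l w.
Proof.
move=> [lin _] Sv Sw; have := lin (-1) w v Sw Sv; rewrite mulN1r addrC => <-.
by congr l; apply/funext => x /=; rewrite mulN1r addrC.
Qed.

Lemma fspaceB v w : fmem S v -> fmem S w -> fmem S (v \- w).
Proof.
move=> Sv Sw; have := Slin (-1) Sw Sv; congr (fmem S _).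
by apply/funext => x /=; rewrite mulN1r addrC.
Qed.

Lemma dual_cvg l (f : R -> fdom S -> R) (F : set_system R) (g : fdom S -> R) : Filter F ->
  fmem (dual S) l -> (\forall t \near F, fmem S (f t)) -> fmem S g ->
  fnorm S (f t \- g) @[t --> F] --> (0 : R) -> l (f t) @[t --> F] --> l g.
Proof.
move=> FF dl Sf Sg C; have [_ [K HK]] := dl.
apply/cvgrPdist_le => e e0; near=> t.
have Sft : fmem S (f t) by near: t.
rewrite distrC -dualB//.
apply: le_trans (HK _ (fspaceB Sft Sg)) _.
have : `|fnorm S (f t \- g)| <= e / (`|K| + 1).
  near: t; move/cvgrPdist_le : C => /(_ (e / (`|K| + 1))).
  rewrite divr_gt0 ?ltr_wpDl// => /(_ isT); apply: filterS => t.
  by rewrite sub0r normrN.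
rewrite ler_pdivlMr ?ltr_wpDl// => h.
apply: le_trans (ler_norm _) _; rewrite normrM.
apply: le_trans h; rewrite mulrC ler_wpM2l//; lra.
Unshelve. all: by end_near. Qed.

(** A Bochner-measurable curve is only an almost everywhere limit of simple
    curves, so its image under a functional agrees with a Borel function up to a
    null set, on which the latter is set to 0. *)
Lemma scalar_measurable (I : set R) l (f : R -> fdom S -> R) : measurable I ->
  fmem S (fun=> 0) -> fmem (dual S) l -> strongly_measurable I f ->
  {ae leb1, forall t, I t -> fmem S (f t)} ->
  exists2 m : R -> R, measurable_fun setT m & {ae leb1, forall t, I t -> l (f t) = m t}.
Proof.
move=> mI S0 dl [s sv sf] Sf.
have lin0 : l (fun=> 0) = 0.
  by have := dualZ 0 dl S0; rewrite !mul0r.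
have simple n : (forall t, fmem S (s n t)) /\ measurable_fun setT (fun t => l (s n t)).
  have [k [A [v [mA Sv sE]]]] := sv n.
  have sumP (c : R -> 'I_k -> R) (r : seq 'I_k) t :
      fmem S (fun x => \sum_(i <- r) c t i * v i x) /\
      l (fun x => \sum_(i <- r) c t i * v i x) = \sum_(i <- r) c t i * l (v i).
    elim: r => [|i r [IH1 IH2]].
      rewrite big_nil -[RHS]lin0; split; first by move: S0; congr (fmem S _); apply/funext => x; rewrite big_nil.
      by congr l; apply/funext => x; rewrite big_nil.
    have E0 : (fun x => \sum_(j <- i :: r) c t j * v j x) = (fun x => c t i * v i x + \sum_(j <- r) c t j * v j x).
      by apply/funext => x; rewrite big_cons.
    rewrite E0 big_cons -IH2; split; first exact: Slin.
    by have [lin _] := dl; exact: lin.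
  have sE' t : s n t = fun x => \sum_(i <- index_enum 'I_k) \1_(A i) t * v i x.
    by apply/funext => x; rewrite sE.
  split; first by move=> t; rewrite sE'; have [] := sumP (fun t i => \1_(A i) t) (index_enum 'I_k) t.
  rewrite (_ : (fun t => _) = fun t => \sum_(i < k) \1_(A i) t * l (v i)).
    by apply: measurable_sum => i; apply: measurable_funM => //; exact: measurable_indic.
  by apply/funext => t; rewrite sE'; have [] := sumP (fun t i => \1_(A i) t) (index_enum 'I_k) t.
have both : {ae leb1, forall t, I t -> fmem S (f t) /\ fnorm S (s n t \- f t) @[n --> \oo] --> (0 : R)}.
  have [N1 [mN1 N10 NP1]] := Sf; have [N2 [mN2 N20 NP2]] := sf.
  exists (N1 `|` N2); split; [exact: measurableU|by rewrite measureU0|].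
  move=> t; apply: contra_notP => tN It; split.
  - by apply: contrapT => H; apply: tN; left; apply: NP1 => /= /(_ It).
  - by apply: contrapT => H; apply: tN; right; apply: NP2 => /= /(_ It).
have [N [mN N0 NP]] := both.
pose D := I `\` N; have mD : measurable D by exact: measurableD.
pose m t := \1_D t * l (f t).
exists m; last first.
  exists N; split=> // t /=; apply: contra_notP => tN It.
  by rewrite /m indicE mem_set ?mul1r.
apply: (@measurable_fun_cvg _ _ _ setT (fun n t => \1_D t * l (s n t))) => //.
  by move=> n; apply: measurable_funM; [exact: measurable_indic|exact: (simple n).2].
move=> t _; rewrite /m indicE; case: (boolP (t \in D)) => [/set_mem[It tN]|_]; last first.
  by under eq_fun do rewrite mul0r; rewrite mul0r; exact: cvg_cst.
have [Sft C] : fmem S (f t) /\ fnorm S (s n t \- f t) @[n --> \oo] --> (0 : R).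
  by apply: contrapT => H; apply: tN; apply: NP => /= /(_ It).
under eq_fun do rewrite mul1r; rewrite mul1r.
have [_ [K HK]] := dl.
apply/cvgrPdist_le => e e0; near=> n.
have Ssn := (simple n).1 t.
rewrite distrC -dualB//.
apply: le_trans (HK _ (fspaceB Ssn Sft)) _.
have : `|fnorm S (s n t \- f t)| <= e / (`|K| + 1).
  near: n; move/cvgrPdist_le : C => /(_ (e / (`|K| + 1))).
  rewrite divr_gt0 ?ltr_wpDl// => /(_ isT); apply: filterS => k.
  by rewrite sub0r normrN.
rewrite ler_pdivlMr ?ltr_wpDl// => h.
apply: le_trans (ler_norm _) _; rewrite normrM.
apply: le_trans h; rewrite mulrC ler_wpM2l//; lra.
Unshelve. all: by end_near. Qed.

Hypothesis norm_ge0 : forall v, fmem S v -> 0 <= fnorm S v.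
Hypothesis normZ : forall a v, fmem S v -> fnorm S (fun x => a * v x) = `|a| * fnorm S v.

Lemma dual_norm_bound l v : fmem (dual S) l -> fmem S v -> `|l v| <= fnorm (dual S) l * fnorm S v.
Proof.
move=> dl Sv; have [_ [K HK]] := dl.
have := norm_ge0 Sv; rewrite le_eqVlt => /orP[/eqP v0|v0].
  by rewrite -v0 mulr0; have := HK _ Sv; rewrite -v0 mulr0.
pose v' x := (fnorm S v)^-1 * v x.
have Sv' : fmem S v' by exact: fspaceZ.
have n1 : fnorm S v' = 1 by rewrite normZ// gtr0_norm ?invr_gt0// mulVf// gt_eqF.
have : `|l v'| <= fnorm (dual S) l.
  apply: sup_upper_bound; last by exists v' => //; split; rewrite ?n1.
  split; first by exists `|l v'|, v' => //; split; rewrite ?n1.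
  exists `|K| => _ [w [Sw w1] <-]; apply: le_trans (HK _ Sw) _.
  apply: le_trans (ler_norm _) _; rewrite normrM (ger0_norm (norm_ge0 Sw)).
  by rewrite ler_piMr.
rewrite /v' dualZ// normrM gtr0_norm ?invr_gt0// mulrC ler_pdivrMr//.
Qed.

(** The equation is an identity in the dual space; evaluation at [w] turns it
    into real identities. *)
Lemma dual_eval w : fmem S w -> fmem (dual (dual S)) (fun l => l w).
Proof.
move=> Sw; split=> //; exists (fnorm S w) => l dl.
by rewrite mulrC; exact: dual_norm_bound.
Qed.

End duality.

Section hoelder_domain.
Context {R : realType} {d : nat}.
Local Notation E := 'rV[R]_d.
Local Notation leb := (lebesgue_rV R d).
Variables (Omega : set E) (q : R).
Hypotheses (mO : measurable Omega) (q1 : 1 < q).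
Let q0 : 0 < q. Proof. exact: lt_trans ltr01 q1. Qed.

Lemma Lq_measurable p w : fmem (Lq Omega p) w -> measurable_fun setT (w \_ Omega).
Proof. by rewrite /= inE => /andP[]; rewrite inE. Qed.

Lemma Lq_norme_lty p w : fmem (Lq Omega p) w -> (Lq_norme Omega p w < +oo)%E.
Proof. by rewrite /= inE => /andP[_]; rewrite inE. Qed.

Lemma Lq_mem p w : measurable_fun setT (w \_ Omega) -> (Lq_norme Omega p w < +oo)%E -> fmem (Lq Omega p) w.
Proof. by move=> mw fw; rewrite /= inE; apply/andP; split; rewrite inE. Qed.

Lemma Lq_normE p w : fmem (Lq Omega p) w -> Lq_norme Omega p w = (Lq_norm Omega p w)%:E.
Proof. by move=> /Lq_norme_lty h; rewrite /Lq_norm fineK// ge0_fin_numE// Lnorm_ge0. Qed.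

Lemma Lq_norm_ge0 p w : 0 <= Lq_norm Omega p w.
Proof. by rewrite fine_ge0// Lnorm_ge0. Qed.

Lemma Lq_norme_powE (p : R) (w : E -> R) : 0 < p ->
  (\int[leb]_(x in Omega) (`|w x| `^ p)%:E = Lq_norme Omega p w `^ p)%E.
Proof.
move=> p0; rewrite /Lq_norme poweR_Lnorm; last by rewrite gt_eqF.
rewrite [LHS]integral_mkcond.
apply: eq_integral => x _.
by rewrite !patchE /= !patchE; case: ifP => // _; rewrite normr0 powR0// gt_eqF.
Qed.

Lemma Lq_norm_powE p w : 0 < p -> fmem (Lq Omega p) w ->
  (\int[leb]_(x in Omega) (`|w x| `^ p)%:E = (Lq_norm Omega p w `^ p)%:E)%E.
Proof. by move=> p0 Lw; rewrite Lq_norme_powE// Lq_normE. Qed.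

Lemma Lq_norm_ae (p : R) (f g : E -> R) : {ae leb, forall x, Omega x -> f x = g x} ->
  measurable_fun setT (f \_ Omega) -> measurable_fun setT (g \_ Omega) -> 0 < p ->
  Lq_norme Omega p f = Lq_norme Omega p g.
Proof.
move=> fg mf mg p0; rewrite /Lq_norme unlock.
congr (_ `^ _)%E.
have mp (h : E -> R) : measurable_fun setT h -> measurable_fun setT (fun x => (`|(EFin \o h) x| `^ p)%E).
  by move=> mh; rewrite (_ : (fun x => _) = fun x => (`|h x| `^ p)%:E)//; exact: powR_integral_measurable.
apply: ae_eq_integral => //; [exact: mp|exact: mp|].
apply: filterS fg => x h _ /=; rewrite !patchE; case: ifPn => // /set_mem /h -> //.
Qed.

Lemma conj_exp_gt0 : 0 < conj_exp q.
Proof. by rewrite /conj_exp divr_gt0 ?subr_gt0. Qed.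

Lemma hoelder_integral f g : fmem (Lq Omega q) f -> fmem (Lq Omega (conj_exp q)) g ->
  (\int[leb]_(x in Omega) (`|f x * g x|)%:E <= (Lq_norm Omega q f * Lq_norm Omega (conj_exp q) g)%:E)%E.
Proof.
move=> Lf Lg; rewrite EFinM -!Lq_normE//.
have conj1 : q^-1 + (conj_exp q)^-1 = 1.
  by rewrite /conj_exp; field; rewrite subr_eq0 !gt_eqF.
have := hoelder leb (Lq_measurable Lf) (Lq_measurable Lg) q0 conj_exp_gt0 conj1.
rewrite Lnorm1; apply: le_trans; rewrite le_eqVlt; apply/orP; left; apply/eqP.
rewrite [LHS]integral_mkcond.
apply: eq_integral => x _.
by rewrite !patchE /= !patchE; case: ifP => //=; rewrite mul0r normr0.
Qed.

Lemma hoelder_integrable f g : fmem (Lq Omega q) f -> fmem (Lq Omega (conj_exp q)) g ->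
  leb.-integrable Omega (EFin \o (f \* g)).
Proof.
move=> Lf Lg; apply/integrableP; split; last first.
  exact: le_lt_trans (hoelder_integral Lf Lg) (ltry _).
apply/measurable_EFinP; apply: measurable_funM.
- by apply/(measurable_restrictT _ _).2 => //; exact: Lq_measurable Lf.
- by apply/(measurable_restrictT _ _).2 => //; exact: Lq_measurable Lg.
Qed.

Lemma hoelder_pairing f g : fmem (Lq Omega q) f -> fmem (Lq Omega (conj_exp q)) g ->
  `|L2_pairing Omega g f| <= Lq_norm Omega q f * Lq_norm Omega (conj_exp q) g.
Proof.
move=> Lf Lg; rewrite -lee_fin; apply: le_trans (hoelder_integral Lf Lg).
have I := hoelder_integrable Lf Lg.
have -> : L2_pairing Omega g f = \int[leb]_(x in Omega) (f x * g x).
  by apply: eq_Rintegral => x _; rewrite mulrC.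
rewrite -abse_EFin /Rintegral fineK; last exact: integrable_fin_num.
by apply: le_trans (le_abse_integral _ _ _) _ => //; exact: measurable_int I.
Qed.

Lemma Lq_lin p a f g : 1 <= p -> fmem (Lq Omega p) f -> fmem (Lq Omega p) g ->
  fmem (Lq Omega p) (fun x => a * f x + g x).
Proof.
move=> p1 Lf Lg; rewrite /=.
rewrite (_ : _ \_ Omega = a *: (f \_ Omega) + (g \_ Omega)).
  have p1' : (1 <= p%:E)%E by rewrite lee_fin.
  by apply: (@Lfun_submod_closed _ _ _ _ _ p1').2.
apply/funext => x; transitivity (a * (f \_ Omega) x + (g \_ Omega) x) => //.
by rewrite !patchE; case: ifP => // _; rewrite mulr0 addr0.
Qed.

Lemma LqB p f g : 1 <= p -> fmem (Lq Omega p) f -> fmem (Lq Omega p) g ->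
  fmem (Lq Omega p) (f \- g).
Proof.
move=> p1 Lf Lg; have := Lq_lin (-1) p1 Lg Lf; congr (fmem _ _).
by apply/funext => x /=; rewrite mulN1r addrC.
Qed.

End hoelder_domain.

(** * Energy estimates *)

Lemma absolutely_continuous_affine {R : realType} (I : set R) (F : R -> R) (a c : R) :
  absolutely_continuous I F -> absolutely_continuous I (fun x => a * F x + c * x).
Proof.
move=> ac e e0; pose A := `|a| + 1; pose C := `|c| + 1.
have A0 : 0 < A by rewrite /A ltr_wpDl.
have C0 : 0 < C by rewrite /C ltr_wpDl.
have [d1 d10 H] := ac (e / 2 / A) (divr_gt0 (divr_gt0 e0 (ltr0n _ 2)) A0).
exists (Num.min d1 (e / 2 / C)); first by rewrite lt_min d10 !divr_gt0.
move=> n x y xy tI; rewrite lt_min => /andP[s1 s2].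
have := H n x y xy tI s1.
rewrite !ltr_pdivlMr// in s2 *.
set S1 := \sum_(i < n) `|F _ - F _| => h1.
have S10 : 0 <= S1 by apply: sumr_ge0.
have S20 : 0 <= \sum_(i < n) (y i - x i) by apply: sumr_ge0 => i _; rewrite subr_ge0; have [_ _] := xy i.
have : \sum_(i < n) `|a * F (y i) + c * y i - (a * F (x i) + c * x i)| <= `|a| * S1 + `|c| * \sum_(i < n) (y i - x i).
  rewrite !mulr_sumr -big_split/=; apply: ler_sum => i _.
  have [_ _ xyi] := xy i.
  rewrite (_ : _ - _ = a * (F (y i) - F (x i)) + c * (y i - x i)); last by ring.
  by apply: le_trans (ler_normD _ _) _; rewrite !normrM (ger0_norm (_ : 0 <= y i - x i))// subr_ge0.
move: s2 h1; rewrite /A /C; nra.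
Qed.

Lemma ae_imp {R : realType} (P Q : R -> Prop) : (forall t, P t -> Q t) ->
  {ae @lebesgue_measure R, forall t, P t} -> {ae @lebesgue_measure R, forall t, Q t}.
Proof.
move=> PQ [N [mN N0 NP]]; exists N; split=> // t /= nQ; apply: NP => /= Pt; exact/nQ/PQ.
Qed.

Lemma ae_and {R : realType} (P Q : R -> Prop) : {ae @lebesgue_measure R, forall t, P t} ->
  {ae @lebesgue_measure R, forall t, Q t} -> {ae @lebesgue_measure R, forall t, P t /\ Q t}.
Proof.
move=> [N1 [mN1 N10 NP1]] [N2 [mN2 N20 NP2]].
exists (N1 `|` N2); split; [exact: measurableU|by rewrite measureU0|].
move=> t; apply: contra_notP => tN; split.
- by apply: contrapT => H; apply: tN; left; exact: NP1.
- by apply: contrapT => H; apply: tN; right; exact: NP2.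
Qed.

Lemma ge0_subset_integral_gen {R : realType} (A B : set R) (f : R -> \bar R) : A `<=` B ->
  (forall x, B x -> (0 <= f x)%E) ->
  (\int[@lebesgue_measure R]_(x in A) f x <= \int[@lebesgue_measure R]_(x in B) f x)%E.
Proof.
move=> AB f0; rewrite integral_mkcond [leRHS]integral_mkcond.
apply: ge0_le_integral_gen => x _; rewrite !patchE.
  by case: ifPn => // /set_mem/AB/f0.
by case: ifPn => [/set_mem/AB h|_]; [rewrite mem_set|case: ifPn => // /set_mem/f0].
Qed.

(** Jensen's inequality for the square, from the nonnegativity of the variance. *)
Lemma sqr_Rintegral_le {dT} {T : measurableType dT} {R : realType} (mu : {measure set T -> \bar R})
    (J : set T) (m : T -> R) (L K : R) : measurable J -> mu J = L%:E -> 0 < L -> measurable_fun J m ->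
  (\int[mu]_(x in J) (m x ^+ 2)%:E <= K%:E)%E ->
  mu.-integrable J (EFin \o m) /\ (\int[mu]_(x in J) m x) ^+ 2 <= L * K.
Proof.
move=> mJ muJ L0 mm mK.
have mm2 : measurable_fun J (fun x => m x ^+ 2) by exact: measurable_funX.
have I2 : mu.-integrable J (EFin \o (fun x => m x ^+ 2)).
  apply/integrableP; split; first exact/measurable_EFinP.
  apply: le_lt_trans (ltry K); apply: le_trans mK.
  by rewrite le_eqVlt; apply/orP; left; apply/eqP; apply: eq_integral => x _ /=; rewrite ger0_norm ?sqr_ge0.
have Ic c : mu.-integrable J (EFin \o (fun=> c)).
  apply/integrableP; split; first exact: measurable_cst.
  rewrite (eq_integral (fun=> `|c|%:E))//= integral_cst// muJ.
  by rewrite -EFinM ltry.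
have I3 : mu.-integrable J (EFin \o (fun x => 1 + m x ^+ 2)).
  by have := integrableD mJ (Ic 1) I2; apply: eq_integrable => // x _.
have I1 : mu.-integrable J (EFin \o m).
  apply: (le_integrable mJ _ _ I3); first exact/measurable_EFinP.
  move=> x _ /=; rewrite lee_fin (ger0_norm (_ : 0 <= 1 + m x ^+ 2)); last by rewrite addr_ge0 ?sqr_ge0.
  by rewrite -(real_normK (num_real (m x))); have := sqr_ge0 (`|m x| - 1); have := normr_ge0 (m x); nra.
split=> //; set A := \int[_]_(x in _) m x.
have K2 : \int[mu]_(x in J) (m x ^+ 2) <= K.
  by rewrite -lee_fin /Rintegral fineK//; exact: integrable_fin_num.
pose c := A / L.
have I4 : mu.-integrable J (EFin \o (fun x => (- (2 * c)) * m x)).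
  by have := integrableZl mJ (- (2 * c)) I1; apply: eq_integrable => // x _.
have I5 : mu.-integrable J (EFin \o (fun x => m x ^+ 2 + (- (2 * c)) * m x)).
  by have := integrableD mJ I2 I4; apply: eq_integrable => // x _.
have : 0 <= \int[mu]_(x in J) (m x ^+ 2 + (- (2 * c)) * m x + c ^+ 2).
  apply: Rintegral_ge0 => x _; have := sqr_ge0 (m x - c); nra.
rewrite RintegralD// RintegralD// RintegralZl// Rintegral_cst// muJ -/A /= => h.
have cE : c * L = A by rewrite /c divfK// gt_eqF.
move: h K2; move: (\int[_]_(x in _) _) => X h K2.
have -> : A ^+ 2 = L * (c ^+ 2 * L) by rewrite -cE; ring.
rewrite ler_pM2l//.
rewrite -cE in h; nra.
Qed.

Section odd_power.
Context {R : realType}.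
Implicit Types a b r q : R.

Lemma odd_pow_measurable r : measurable_fun setT (@odd_pow R r).
Proof.
rewrite (_ : odd_pow r = fun a => (fun b => b `^ r) `|a| * a)//.
apply: measurable_funM => //.
exact: (measurableT_comp (measurable_powR r) (@normr_measurable R setT)).
Qed.

Lemma odd_pow_norm r a : 0 < r + 1 -> `|odd_pow r a| = `|a| `^ (r + 1).
Proof.
move=> r1; rewrite /odd_pow normrM ger0_norm ?powR_ge0//.
have [->|a0] := eqVneq a 0; first by rewrite normr0 mulr0 powR0// gt_eqF.
rewrite -{2}(@powRr1 _ `|a|)// -powRD//; apply/implyP => _; by rewrite normr_eq0.
Qed.

Lemma odd_pow_ge0 r a : 0 <= a -> 0 <= odd_pow r a.
Proof. by move=> a0; rewrite mulr_ge0// powR_ge0. Qed.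

Lemma odd_powN r a : odd_pow r (- a) = - odd_pow r a.
Proof. by rewrite /odd_pow normrN mulrN. Qed.

Lemma odd_pow_mul q a : 1 < q -> a * odd_pow (q - 2) a = `|a| `^ q.
Proof.
move=> q1; have aE : a * odd_pow (q - 2) a = `|a| * `|odd_pow (q - 2) a|.
  by rewrite /odd_pow normrM (ger0_norm (powR_ge0 _ _)) mulrCA [RHS]mulrCA -!expr2 real_normK ?num_real.
rewrite aE odd_pow_norm; last by lra.
have [->|a0] := eqVneq a 0; first by rewrite normr0 mul0r powR0// gt_eqF//; lra.
rewrite -{1}(@powRr1 _ `|a|)// -powRD; last by apply/implyP => _; rewrite normr_eq0.
by congr powR; lra.
Qed.

Lemma odd_pow_half_sqr q a : 1 < q -> odd_pow ((q - 2) / 2) a ^+ 2 = `|a| `^ q.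
Proof.
move=> q1; rewrite -real_normK ?num_real// odd_pow_norm; last by lra.
rewrite -powR_mulrn ?powR_ge0// -powRrM; congr powR; lra.
Qed.

Lemma odd_pow_nondecreasing r a b : 0 < r + 1 -> a <= b -> odd_pow r a <= odd_pow r b.
Proof.
move=> r1.
have mono x y : 0 <= x -> x <= y -> odd_pow r x <= odd_pow r y.
  move=> x0 xy; have y0 := le_trans x0 xy.
  rewrite -(ger0_norm (odd_pow_ge0 r x0)) -(ger0_norm (odd_pow_ge0 r y0)) !odd_pow_norm// !ger0_norm//.
  by rewrite ge0_ler_powR ?nnegrE// ltW.
move=> ab; have [a0|a0] := leP 0 a; first exact: mono.
have [b0|b0] := leP 0 b.
  apply: (@le_trans _ _ 0); last exact: odd_pow_ge0.
  by rewrite -oppr_ge0 -odd_powN odd_pow_ge0// oppr_ge0 ltW.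
by rewrite -lerN2 -!odd_powN mono ?lerN2// oppr_ge0 ltW.
Qed.

Lemma odd_pow_increasing r a b : 0 < r + 1 -> a < b -> odd_pow r a < odd_pow r b.
Proof.
move=> r1.
have mono x y : 0 <= x -> x < y -> odd_pow r x < odd_pow r y.
  move=> x0 xy; have y0 := ltW (le_lt_trans x0 xy).
  rewrite -(ger0_norm (odd_pow_ge0 r x0)) -(ger0_norm (odd_pow_ge0 r y0)) !odd_pow_norm// !ger0_norm//.
  by rewrite gt0_ltr_powR ?nnegrE.
move=> ab; have [a0|a0] := leP 0 a; first exact: mono.
have [b0|b0] := leP b 0.
  by rewrite -ltrN2 -!odd_powN mono ?ltrN2// oppr_ge0.
apply: (@le_lt_trans _ _ (odd_pow r 0)); first by apply: odd_pow_nondecreasing => //; exact: ltW.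
exact: mono.
Qed.

(** For values of the same sign, [|a|^(q/2)] and [|b|^(q/2)] satisfy
    [(x - y)^2 <= |x^2 - y^2|]; for opposite signs both terms on the right are
    at least [|a|^q], respectively [|b|^q]. The difference of [a ^ q] and
    [b ^ q] is split so that Hoelder's inequality bounds it by the distances of
    the solution in [L^q] and of its power in the dual space of [L^q]. *)
Lemma odd_pow_half_sub q a b : 1 < q ->
  (odd_pow ((q - 2) / 2) a - odd_pow ((q - 2) / 2) b) ^+ 2 <=
  2 * `|a * (odd_pow (q - 2) a - odd_pow (q - 2) b)| +
  2 * `|odd_pow (q - 2) b * (a - b)|.
Proof.
move=> q1; have r1 : 0 < (q - 2) + 1 by lra.
have r2 : 0 < (q - 2) / 2 + 1 by lra.
wlog a0 : a b / 0 <= a.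
  move=> H; have [/H//|a0] := leP 0 a.
  have := H (- a) (- b); rewrite oppr_ge0 (ltW a0) !odd_powN => /(_ isT).
  by rewrite -!opprD sqrrN mulrNN mulrNN.
have Ea := odd_pow_mul a q1; have Eb := odd_pow_mul b q1.
have Sa := odd_pow_half_sqr a q1; have Sb := odd_pow_half_sqr b q1.
have va := odd_pow_ge0 ((q - 2) / 2) a0; have ra := odd_pow_ge0 (q - 2) a0.
have n1 := ler_norm (a * (odd_pow (q - 2) a - odd_pow (q - 2) b)).
have n2 := ler_norm (odd_pow (q - 2) b * (a - b)).
have n3 := lerNnormlW (lexx `|a * (odd_pow (q - 2) a - odd_pow (q - 2) b)|).
have n4 := lerNnormlW (lexx `|odd_pow (q - 2) b * (a - b)|).
have X0 := normr_ge0 (a * (odd_pow (q - 2) a - odd_pow (q - 2) b)).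
have Y0 := normr_ge0 (odd_pow (q - 2) b * (a - b)).
rewrite -Ea in Sa; rewrite -Eb in Sb; clear Ea Eb.
have [b0|b0] := leP 0 b.
  have vb := odd_pow_ge0 ((q - 2) / 2) b0.
  have [ab|ba] := leP a b.
    have vab := odd_pow_nondecreasing r2 ab; clear - Sa Sb va vb n3 n4 X0 Y0 vab.
    rewrite mulrBr in n3 X0 *; rewrite mulrBr in n4 Y0 *.
    nra.
  have vab := odd_pow_nondecreasing r2 (ltW ba); clear - Sa Sb va vb n1 n2 X0 Y0 vab.
  rewrite mulrBr in n1 X0 *; rewrite mulrBr in n2 Y0 *.
  nra.
have rb : odd_pow (q - 2) b <= 0 by rewrite -oppr_ge0 -odd_powN odd_pow_ge0// oppr_ge0 ltW.
have p1 : a * odd_pow (q - 2) b <= 0 by rewrite mulr_ge0_le0.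
clear - Sa Sb p1 n1 n4 X0 Y0.
have : (odd_pow ((q - 2) / 2) a - odd_pow ((q - 2) / 2) b) ^+ 2 <= 2 * odd_pow ((q - 2) / 2) a ^+ 2 + 2 * odd_pow ((q - 2) / 2) b ^+ 2.
  have := sqr_ge0 (odd_pow ((q - 2) / 2) a + odd_pow ((q - 2) / 2) b); lra.
rewrite Sa Sb; rewrite mulrBr in n1 X0 *; rewrite mulrBr in n4 Y0 *.
lra.
Qed.

End odd_power.

Section energy_estimates.
Context {R : realType} {d : nat}.
Local Notation E := 'rV[R]_d.
Local Notation leb := (lebesgue_rV R d).
Local Notation leb1 := (@lebesgue_measure R).
Variables (Omega : set E) (theta q : R) (u0 : E -> R) (u : R -> E -> R).
Hypotheses (bO : bounded_domain Omega) (q1 : 1 < q).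
Hypothesis es : energy_solution Omega theta q u0 u.
Let mO : measurable Omega. Proof. exact: domain_measurable bO. Qed.
Let q0 : 0 < q. Proof. exact: lt_trans ltr01 q1. Qed.
Local Notation f := (fun t => Lq_norm Omega q (u t) `^ q).
Local Notation g := (fun t => Xnorm Omega theta (u t) ^+ 2).
Local Notation rho t := (odd_pow (q - 2) \o u t).
Local Notation v t := (odd_pow ((q - 2) / 2) \o u t).

Lemma energy_Xmem t : 0 <= t -> Xmem Omega theta (u t).
Proof. by move=> t0; have [+ _] := es_weakly_continuous es; apply; rewrite /= in_itv/= t0. Qed.

Lemma energy_Lq t : 0 <= t -> fmem (Lq Omega q) (u t).
Proof. by move=> t0; have [+ _] := es_Lq_continuous es; apply; rewrite /= in_itv/= t0. Qed.

Lemma energy_rho t : 0 <= t -> fmem (Lq Omega (conj_exp q)) (rho t).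
Proof. by move=> t0; have [+ _] := es_rho_continuous es; apply; rewrite /= in_itv/= t0. Qed.

Lemma energy_noninc s t : 0 <= s -> s < t -> g t <= g s.
Proof.
move=> s0 st; have [dv _ /(_ _ _ s0 st)] := es_energy es.
have : 0 <= 4 / (q * conj_exp q) * \int[leb1]_(r in `[s, t]) (Lq_norm Omega 2 (dv r) ^+ 2).
  apply: mulr_ge0; last by apply: Rintegral_ge0 => r _; exact: sqr_ge0.
  by rewrite divr_ge0// mulr_ge0// ltW// conj_exp_gt0.
lra.
Qed.

Let derivative_f : {ae leb1, forall t, 0 < t -> derivable f t 1 /\ derive1 f t = - (q / (q - 1) * g t)}.
Proof.
apply: ae_imp (es_Lq_identity es) => t H t0; have [df eq] := H t0; split=> //; move: eq.
have c0 := conj_exp_gt0 q1; rewrite -/(conj_exp q) => /eqP; rewrite addr_eq0 => /eqP.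
by move=> /(congr1 (fun x => conj_exp q * x)); rewrite mulVKf ?gt_eqF// mulrN.
Qed.

(** The identity [f' = - q' g] holds almost everywhere, and [g] is
    nonincreasing: adding the linear function of slope [q' g s], or [q' g t],
    gives a derivative of constant sign. *)
Lemma dissipation s t : 0 <= s -> s < t ->
  q / (q - 1) * g t * (t - s) <= f s - f t <= q / (q - 1) * g s * (t - s).
Proof.
move=> s0 st; have sub : `[s, t] `<=` `[(0 : R), +oo[.
  by move=> x; rewrite /= !in_itv/= andbT => /andP[sx _]; exact: le_trans sx.
have c0 := conj_exp_gt0 q1; rewrite /conj_exp in c0.
have mono a c : (forall x : R, s < x < t -> 0 <= a * - (q / (q - 1) * g x) + c) ->
    a * f s + c * s <= a * f t + c * t.
  move=> H; have ac := absolutely_continuous_affine a c (es_absolutely_continuous es).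
  apply: (absolutely_continuous_nondecreasing (ltW st) sub ac).
  apply: ae_imp derivative_f => x + xst; have x0 : 0 < x by case/andP: xst; lra.
  move=> /(_ x0)[df dfE].
  have D1 : is_derive x 1 (fun y => a * f y + c * y) (a * - (q / (q - 1) * g x) + c).
    have fd : is_derive x 1 f (- (q / (q - 1) * g x)) by rewrite -dfE derive1E; exact: derivableP.
    have := is_deriveD (is_deriveZ a fd) (is_deriveZ c (is_derive_id x (1 : R))).
    by rewrite scaler1.
  split; first by case: D1.
  by rewrite derive1E; case: D1 => _ ->; exact: H.
apply/andP; split.
  have := mono (-1) (- (q / (q - 1) * g t)) _.
  move=> /(_ _)/wrap[x /andP[sx xt]|].
    have := energy_noninc (ltW (le_lt_trans s0 sx)) xt.
    by rewrite mulN1r opprK subr_ge0 => ?; apply: ler_wpM2l => //; exact: ltW.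
  move: (f s) (f t) (g t) => A B C; lra.
have := mono 1 (q / (q - 1) * g s) _.
move=> /(_ _)/wrap[x /andP[sx xt]|].
  have := energy_noninc s0 sx.
  by rewrite mul1r addrC subr_ge0 => ?; apply: ler_wpM2l => //; exact: ltW.
move: (f s) (f t) (g s) => A B C; lra.
Qed.

Lemma Lq_norm_noninc t : 0 <= t -> Lq_norm Omega q (u t) <= Lq_norm Omega q (u 0).
Proof.
rewrite le_eqVlt => /predU1P[<-//|t0].
have /andP[+ _] := dissipation (lexx 0) t0.
have : 0 <= q / (q - 1) * g t * (t - 0).
  apply: mulr_ge0; last by rewrite subr0 ltW.
  by apply: mulr_ge0; [exact: ltW (conj_exp_gt0 q1)|exact: sqr_ge0].
move=> h1 h2; have : f t <= f 0 by lra.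
rewrite leNgt => h3; rewrite leNgt; apply: contra h3 => h3.
by rewrite gt0_ltr_powR ?nnegrE ?Lq_norm_ge0.
Qed.

Lemma half_power_L2 t : 0 <= t -> fmem (Lq Omega 2) (v t).
Proof.
move=> t0; have Lu := energy_Lq t0.
have mv : measurable_fun setT (v t \_ Omega).
  rewrite (_ : _ \_ _ = odd_pow ((q - 2) / 2) \o (u t \_ Omega)).
    by apply: measurableT_comp; [exact: odd_pow_measurable|exact: Lq_measurable Lu].
  by apply/funext => x; rewrite /= !patchE; case: ifP => // _; rewrite /odd_pow mulr0.
apply/L2P => //.
rewrite (_ : (\int[leb]_(x in Omega) _)%E = (\int[leb]_(x in Omega) (`|u t x| `^ q)%:E)%E).
  by rewrite Lq_norm_powE// ltry.
by apply: eq_integral => x _; rewrite /= odd_pow_half_sqr.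
Qed.

Lemma half_power_norm t : 0 <= t -> Lq_norm Omega 2 (v t) ^+ 2 = f t.
Proof.
move=> t0; rewrite L2_norm_sqr//; last exact: half_power_L2.
rewrite /Rintegral (_ : (\int[leb]_(x in Omega) _)%E = (\int[leb]_(x in Omega) (`|u t x| `^ q)%:E)%E).
  by rewrite Lq_norm_powE//; exact: energy_Lq.
by apply: eq_integral => x _; rewrite /= odd_pow_half_sqr.
Qed.

(** This gives the continuity in [L2] of [|u|^((q-2)/2) u], from that of [u] in
    [L^q] and of [|u|^(q-2) u] in the dual space. *)
Lemma half_power_sub r t : 0 <= r -> 0 <= t ->
  Lq_norm Omega 2 (v r \- v t) ^+ 2 <=
  2 * (Lq_norm Omega q (u 0) * Lq_norm Omega (conj_exp q) (rho r \- rho t)) +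
  2 * (Lq_norm Omega q (u r \- u t) * Lq_norm Omega (conj_exp q) (rho t)).
Proof.
move=> r0 t0; have c1 : 1 <= conj_exp q by rewrite /conj_exp ler_pdivlMr ?subr_gt0//; lra.
have Lv : fmem (Lq Omega 2) (v r \- v t).
  by apply: LqB; [exact: ler1n|exact: half_power_L2|exact: half_power_L2].
rewrite L2_norm_sqr// -lee_fin /Rintegral fineK; last first.
  by apply: integrable_fin_num => //; exact: L2_integrable_sqr.
have Lr : fmem (Lq Omega (conj_exp q)) (rho r \- rho t) by apply: LqB => //; exact: energy_rho.
have Lu : fmem (Lq Omega q) (u r \- u t) by apply: LqB; [exact: ltW|exact: energy_Lq|exact: energy_Lq].
pose F1 x := u r x * (rho r \- rho t) x; pose F2 x := (u r \- u t) x * rho t x.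
have H1 := hoelder_integral q1 (energy_Lq r0) Lr.
have H2 := hoelder_integral q1 Lu (energy_rho t0).
have I1 := hoelder_integrable mO q1 (energy_Lq r0) Lr.
have I2 := hoelder_integrable mO q1 Lu (energy_rho t0).
apply: (@le_trans _ _ (\int[leb]_(x in Omega) (2 * `|F1 x| + 2 * `|F2 x|)%:E)%E).
  apply: ge0_le_integral_gen => x _; rewrite lee_fin; first exact: sqr_ge0.
  by rewrite /F1 /F2 /= (mulrC (_ - _) (odd_pow _ _)); exact: odd_pow_half_sub.
have m1 : measurable_fun Omega (fun x => `|F1 x|%:E).
  by apply/measurable_EFinP; apply: measurableT_comp => //; apply/measurable_EFinP; exact: measurable_int I1.
have m2 : measurable_fun Omega (fun x => `|F2 x|%:E).
  by apply/measurable_EFinP; apply: measurableT_comp => //; apply/measurable_EFinP; exact: measurable_int I2.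
under eq_integral do rewrite EFinD (EFinM 2) (EFinM 2).
rewrite ge0_integralD//; last 2 first.
- by apply: emeasurable_funM.
- by apply: emeasurable_funM.
rewrite !ge0_integralZl// [leRHS]EFinD.
apply: leeD; rewrite (EFinM 2) lee_pmul2l//.
  apply: le_trans H1 _; rewrite lee_fin ler_wpM2r ?Lq_norm_ge0//.
  exact: Lq_norm_noninc.
Qed.

Lemma interior_cvg (F : R -> R) (t l : R) : 0 < t ->
  F r @[r --> within `[0, +oo[ (nbhs t)] --> l -> F r @[r --> t] --> l.
Proof.
move=> t0 C A /C h0; have {h0}h : nbhs t (fun r => `[(0 : R), +oo[%classic r -> A (F r)) := h0.
have h0 : \forall r \near t, (0 : R) < r by exact: lt_nbhsr.
have : nbhs t (fun r => A (F r)) by apply: filterS2 h h0 => r + r0; apply; rewrite /= in_itv/= andbT ltW.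
exact.
Qed.

Lemma half_power_cvg t : 0 < t -> Lq_norm Omega 2 (v r \- v t) @[r --> t] --> (0 : R).
Proof.
move=> t0; have It : `[(0 : R), +oo[%classic t by rewrite /= in_itv/= ltW.
have [_ /(_ _ It)/(interior_cvg t0) C1] := es_Lq_continuous es.
have [_ /(_ _ It)/(interior_cvg t0) C2] := es_rho_continuous es.
have C : 2 * (Lq_norm Omega q (u 0) * Lq_norm Omega (conj_exp q) (rho r \- rho t)) +
  2 * (Lq_norm Omega q (u r \- u t) * Lq_norm Omega (conj_exp q) (rho t)) @[r --> t] -->
  2 * (Lq_norm Omega q (u 0) * 0) + 2 * (0 * Lq_norm Omega (conj_exp q) (rho t)).
  apply: cvgD; first by apply: cvgMr; apply: cvgMr.
  by apply: cvgMr; apply: cvgMl.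
rewrite mulr0 mul0r !mulr0 addr0 in C.
apply/cvgrPdist_le => e e0; near=> r.
have r0 : 0 <= r by rewrite ltW//; near: r; exact: lt_nbhsr.
rewrite sub0r normrN ger0_norm ?Lq_norm_ge0// -(ler_pXn2r (ltn0Sn 1)) ?nnegrE ?Lq_norm_ge0// ?(ltW e0)//.
apply: le_trans (half_power_sub r0 (ltW t0)) _.
apply: le_trans (ler_norm _) _; rewrite -normrN -sub0r.
near: r; move/cvgrPdist_le : C; apply; exact: exprn_gt0.
Unshelve. all: by end_near. Qed.

Lemma L2_dual eta : fmem (Lq Omega 2) eta ->
  fmem (dual (Lq Omega 2)) (fun w => \int[leb]_(x in Omega) (w x * eta x)).
Proof.
move=> Le; split; first by move=> a w1 w2 L1 L2; exact: L2_pair_lin.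
by exists (Lq_norm Omega 2 eta) => w Lw; rewrite mulrC; exact: L2_cauchy_schwarz.
Qed.

Let L2_closed a w1 w2 : fmem (Lq Omega 2) w1 -> fmem (Lq Omega 2) w2 ->
  fmem (Lq Omega 2) (fun x => a * w1 x + w2 x).
Proof. by apply: Lq_lin; exact: ler1n. Qed.

(** [sqrt f] is the [L2] norm of [|u|^((q-2)/2) u]. Testing the increment of the
    latter against its own direction [eta1] makes it the integral of a real
    function [m] with [|m|] at most the norm of the time derivative; the square
    of this integral is bounded by Jensen's inequality, and the energy
    inequality bounds the integral of the square. *)
Lemma sqrt_increment_pos s t : 0 < s -> s < t ->
  (Num.sqrt (f s) - Num.sqrt (f t)) ^+ 2 <= (t - s) * (q * (q / (q - 1)) / 8) * (g s - g t).
Proof.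
move=> s0 st; have t0 := lt_trans s0 st.
have [dv [_ [dvm dvX dvfin] wd] /(_ s t (ltW s0) st) en] := es_energy es.
have Lvs := half_power_L2 (ltW s0); have Lvt := half_power_L2 (ltW t0).
pose eta := v t \- v s.
have Le : fmem (Lq Omega 2) eta by apply: LqB => //; exact: ler1n.
pose n := Lq_norm Omega 2 eta.
have n0 : 0 <= n by exact: Lq_norm_ge0.
have sub : (Num.sqrt (f s) - Num.sqrt (f t)) ^+ 2 <= n ^+ 2.
  rewrite -!half_power_norm ?(ltW s0) ?(ltW t0)// !sqrtr_sqr !ger0_norm ?Lq_norm_ge0//.
  have h1 := L2_norm_lin mO 1 Le Lvs.
  have h2 := L2_norm_lin mO (-1) Le Lvt.
  have E1 : (fun x => 1 * eta x + v s x) = v t by apply/funext => x; rewrite mul1r /eta/= subrK.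
  have E2 : (fun x => -1 * eta x + v t x) = v s by apply/funext => x; rewrite mulN1r /eta/= opprB subrK.
  move: h1 h2; rewrite E1 E2 normrN1 normr1 -/n.
  move: (Lq_norm _ _ (v t)) (Lq_norm _ _ (v s)) => X Y h1 h2; nra.
apply: le_trans sub _.
have gst := energy_noninc (ltW s0) st.
have K0 : 0 < q * (q / (q - 1)) / 8 by rewrite divr_gt0// mulr_gt0// conj_exp_gt0.
have [n00|n00] := eqVneq n 0.
  rewrite n00 expr0n/= mulr_ge0//; last by rewrite subr_ge0.
  by rewrite mulr_ge0 ?(ltW K0)// subr_ge0 ltW.
have {}n0 : 0 < n by rewrite lt0r n00.
(* Normalization spares pulling a constant out of an integral whose integrand
   is not known to be measurable. *)
pose eta1 x := n^-1 * eta x.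
have Le1 : fmem (Lq Omega 2) eta1 by apply: fspaceZ => //; exact: L2_closed.
have Z0 : fmem (Lq Omega 2) (fun=> 0).
  by have := fspaceZ L2_closed 0 Le; congr (fmem _ _); apply/funext => x; rewrite mul0r.
pose l w := \int[leb]_(x in Omega) (w x * eta1 x).
have lE w : fmem (Lq Omega 2) w -> l w = n^-1 * \int[leb]_(x in Omega) (w x * eta x).
  move=> Lw; rewrite /l -RintegralZl//; last exact: L2_integrable_mul.
  by apply: eq_Rintegral => x _; rewrite mulrCA.
have dl := L2_dual Le1.
have lb w : fmem (Lq Omega 2) w -> `|l w| <= Lq_norm Omega 2 w.
  move=> Lw; rewrite lE// normrM ger0_norm ?invr_ge0 ?(ltW n0)// mulrC ler_pdivrMr//.
  exact: L2_cauchy_schwarz.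
have mI : measurable (`]0, +oo[%classic : set R) by exact: measurable_itv.
have [m mm ml] := scalar_measurable L2_closed mI Z0 dl dvm dvX.
have stI : `[s, t] `<=` `](0 : R), +oo[.
  by move=> x; rewrite /= !in_itv/= andbT => /andP[sx _]; exact: lt_le_trans sx.
pose D2 r := Lq_norm Omega 2 (dv r) ^+ 2.
pose K := \int[leb1]_(r in `[s, t]) D2 r.
have D2fin : (\int[leb1]_(r in `[s, t]) (D2 r)%:E)%E = K%:E.
  rewrite /K /Rintegral fineK// ge0_fin_numE; last by apply: integral_ge0 => r _; rewrite lee_fin sqr_ge0.
  apply: le_lt_trans dvfin; apply: ge0_subset_integral_gen => // r _; by rewrite lee_fin sqr_ge0.
have mK : (\int[leb1]_(r in `[s, t]) (m r ^+ 2)%:E <= K%:E)%E.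
  rewrite -D2fin; apply: ge0_ae_le_integral_gen => [r _|r _|]; [by rewrite lee_fin sqr_ge0|by rewrite lee_fin sqr_ge0|].
  apply: ae_imp (ae_and ml dvX) => r [h1 h2] /stI Ir.
  rewrite lee_fin -h1// -real_normK ?num_real// /D2 ler_pXn2r ?nnegrE ?Lq_norm_ge0//.
  exact/lb/h2.
have [mi msq] : leb1.-integrable `[s, t] (EFin \o m) /\ (\int[leb1]_(x in `[s, t]) m x) ^+ 2 <= (t - s) * K.
  have Jst : leb1 `[s, t] = (t - s)%:E by rewrite lebesgue_measure_itv/= lte_fin st.
  apply: sqr_Rintegral_le => //; last 2 first.
  - by rewrite subr_gt0.
  - exact: measurable_funS measurableT _ mm.
have inc : l (v t) - l (v s) = \int[leb1]_(r in `[s, t]) m r.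
  apply: (weak_derivative_increment (a := fun r => l (v r)) mI st stI _ mi) => [r /andP[sr rt]|phi tphi].
    have r0 : 0 < r by lra.
    have Sf : \forall r' \near r, fmem (Lq Omega 2) (v r').
      have : \forall r' \near r, (0 : R) < r' by exact: lt_nbhsr.
      by apply: filterS => r' /ltW; exact: half_power_L2.
    exact: (dual_cvg (S := Lq Omega 2) (f := fun t => v t) L2_closed (nbhs_filter r) dl Sf
      (half_power_L2 (ltW r0)) (half_power_cvg r0)).
  rewrite (wd _ tphi _ dl); congr (- _); apply: ae_eq_Rintegral_gen.
  by apply: ae_imp ml => r h /h ->.
have nE : l (v t) - l (v s) = n.
  rewrite -(dualB (S := Lq Omega 2) (l := l) dl Lvt Lvs) lE// (_ : \int[leb]_(x in Omega) _ = n ^+ 2).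
    by rewrite expr2 mulrA mulVf ?mul1r.
  by rewrite /n L2_norm_sqr//; apply: eq_Rintegral => x _; rewrite expr2.
rewrite -nE inc; apply: le_trans msq _.
rewrite -mulrA ler_pM2l ?subr_gt0//.
have Kle : 4 / (q * conj_exp q) * K <= 2^-1 * (g s - g t) by move: en; rewrite -/K; move: (g s) (g t) => A B; lra.
have qc0 : 0 < q * conj_exp q by rewrite mulr_gt0// conj_exp_gt0.
rewrite mulrAC ler_pdivrMr// mulrC in Kle.
move: Kle; rewrite /conj_exp; move: (g s - g t) (q * (q / (q - 1))) => A B; lra.
Qed.

Lemma sqrt_increment s t : 0 <= s -> s < t ->
  (Num.sqrt (f s) - Num.sqrt (f t)) ^+ 2 <= (t - s) * (q * (q / (q - 1)) / 8) * (g s - g t).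
Proof.
rewrite le_eqVlt => /predU1P[<-|]; last exact: sqrt_increment_pos.
move=> t0.
have fc : f r @[r --> 0^'+] --> f 0.
  have C : f 0 - q / (q - 1) * g 0 * r @[r --> 0^'+] --> f 0 - q / (q - 1) * g 0 * 0.
    apply: cvgB; first exact: cvg_cst.
    by apply: cvgMr; apply: cvg_at_right_filter; exact: cvg_id.
  rewrite mulr0 subr0 in C.
  apply: (squeeze_cvgr _ C (cvg_cst (f 0))).
  near=> r; have r0 : 0 < r by near: r; exact: nbhs_right_gt.
  have /andP[h1 h2] := dissipation (lexx 0) r0.
  have : 0 <= q / (q - 1) * g r * (r - 0).
    apply: mulr_ge0; last by rewrite subr0 ltW.
    by apply: mulr_ge0; [exact: ltW (conj_exp_gt0 q1)|exact: sqr_ge0].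
  rewrite subr0 in h1 h2 *; move: h1 h2; move: (f 0) (f r) (g r) (g 0) => A B C' D h1 h2 h3.
  by apply/andP; split; lra.
have C1 : (Num.sqrt (f r) - Num.sqrt (f t)) ^+ 2 @[r --> 0^'+] --> (Num.sqrt (f 0) - Num.sqrt (f t)) ^+ 2.
  have C1 : Num.sqrt (f r) - Num.sqrt (f t) @[r --> 0^'+] --> Num.sqrt (f 0) - Num.sqrt (f t).
    apply: cvgB; last exact: cvg_cst.
    exact: continuous_cvg (@sqrt_continuous R (f 0)) fc.
  rewrite expr2; under eq_fun do rewrite expr2; exact: cvgM.
apply: (cvgr_to_le C1); near=> r.
have r0 : 0 < r by near: r; exact: nbhs_right_gt.
have rt : r < t by near: r; exact: nbhs_right_lt.
apply: le_trans (sqrt_increment_pos r0 rt) _.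
have K0 : 0 < q * (q / (q - 1)) / 8 by rewrite divr_gt0// mulr_gt0// conj_exp_gt0.
have h1 := energy_noninc (lexx 0) r0; have h2 := energy_noninc (ltW r0) rt.
apply: ler_pM; rewrite ?subr_ge0//.
- by apply: mulr_ge0; [lra|exact: ltW].
- by rewrite ler_pM2r//; lra.
- by lra.
Unshelve. all: by end_near. Qed.

End energy_estimates.

(** * Uniqueness of energy solutions *)

Lemma odd_exponent {R : realType} (q : R) : 1 < q -> 0 < (q - 2) + 1.
Proof. lra. Qed.

Lemma conj_exp_ge1 {R : realType} (q : R) : 1 < q -> 1 <= conj_exp q.
Proof. by move=> q1; rewrite /conj_exp ler_pdivlMr ?subr_gt0//; lra. Qed.

Lemma integrable_EFinB {dT} {T : measurableType dT} {R : realType} (mu : {measure set T -> \bar R})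
    (D : set T) (f g : T -> R) : measurable D ->
  mu.-integrable D (EFin \o f) -> mu.-integrable D (EFin \o g) ->
  mu.-integrable D (EFin \o (fun x => f x - g x)).
Proof. by move=> mD If Ig; have := integrableB mD If Ig; apply: eq_integrable => // x _. Qed.

(** The elementary estimates behind one time step [h] in the uniqueness proof. *)
Section time_step.
Context {R : realType}.
Implicit Types h m e k n A : R.

Lemma step_quadratic_term h m e : 0 < h -> 0 <= m -> h * (2 * (m + 1)) <= e -> h * m <= e / 2.
Proof. nra. Qed.

Lemma step_linear_term k n A e : 0 < k -> 0 <= A -> 0 <= n -> n < 2 * A ->
  k * (16 * (A + 1)) = e -> 4 * k * n <= e / 2.
Proof. nra. Qed.

Lemma step_combine h m e k n (Lt Ls Lz zw B es : R) : 0 <= h ->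
  Lt - Ls - h * zw <= 2 * h * k * n ->
  2 * (- h * Lz + Ls) - (h ^+ 2 * m - 2 * h * zw + n ^+ 2) <= B + es ->
  h * Lz <= 0 -> h * m <= e / 2 -> 4 * k * n <= e / 2 ->
  2 * Lt - n ^+ 2 <= B + (es + e * h).
Proof.
move=> h0 D P Lz0 /(ler_wpM2l h0) hm /(ler_wpM2l h0) hk.
by move: P; rewrite expr2; lra.
Qed.

End time_step.

Section integrated_equation.
Context {R : realType} {d : nat}.
Local Notation E := 'rV[R]_d.
Local Notation leb := (lebesgue_rV R d).
Local Notation leb1 := (@lebesgue_measure R).
Variables (Omega : set E) (theta q : R) (u0 : E -> R) (C : R).
Hypotheses (bO : bounded_domain Omega) (q1 : 1 < q) (C0 : 0 <= C).
Hypothesis sobolev : forall w, Xmem Omega theta w ->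
  (Lq_norme Omega q w <= (C * Xnorm Omega theta w)%:E)%E.
Let mO : measurable Omega. Proof. exact: domain_measurable bO. Qed.
Implicit Types (u : R -> E -> R) (w : E -> R).
Local Notation rho u t := (odd_pow (q - 2) \o u t).

Lemma Xmem_Lq w : Xmem Omega theta w -> fmem (Lq Omega q) w.
Proof.
move=> Xw; apply: Lq_mem; last exact: le_lt_trans (sobolev Xw) (ltry _).
have [Lw _ _] := Xw; have mw := Lfun2_measurable Lw.
by apply/(measurable_restrictT _ _).1 => //; exact: measurable_funS mw.
Qed.

Lemma Xmem_Lq_norm w : Xmem Omega theta w -> Lq_norm Omega q w <= C * Xnorm Omega theta w.
Proof. by move=> Xw; rewrite -lee_fin -Lq_normE ?sobolev//; exact: Xmem_Lq. Qed.

Lemma XB v w : Xmem Omega theta v -> Xmem Omega theta w -> Xmem Omega theta (v \- w).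
Proof. by apply: (fspaceB (S := Xspace Omega theta)) => a x y; exact: (Xmem_lin bO). Qed.

Lemma Xinner_dual w : Xmem Omega theta w ->
  fmem (dual (Xspace Omega theta)) (fun v => Xinner Omega theta v w).
Proof.
move=> Xw; split; first by move=> a v1 v2 X1 X2; exact: (Xinner_lin bO).
by exists (Xnorm Omega theta w) => v Xv; rewrite mulrC; exact: (Xinner_cauchy_schwarz bO).
Qed.

Lemma pairing_bound (r w : E -> R) : fmem (Lq Omega (conj_exp q)) r -> Xmem Omega theta w ->
  `|L2_pairing Omega r w| <= C * Lq_norm Omega (conj_exp q) r * Xnorm Omega theta w.
Proof.
move=> Lr Xw; apply: le_trans (hoelder_pairing mO q1 (Xmem_Lq Xw) Lr) _.
by rewrite mulrAC ler_wpM2r ?Lq_norm_ge0// Xmem_Lq_norm.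
Qed.

Lemma pairingB (r1 r2 w : E -> R) : fmem (Lq Omega (conj_exp q)) r1 ->
  fmem (Lq Omega (conj_exp q)) r2 -> Xmem Omega theta w ->
  L2_pairing Omega r1 w - L2_pairing Omega r2 w = L2_pairing Omega (r1 \- r2) w.
Proof.
move=> L1 L2 Xw; have I r : fmem (Lq Omega (conj_exp q)) r -> leb.-integrable Omega (EFin \o (fun x => r x * w x)).
  move=> Lr; have := hoelder_integrable mO q1 (Xmem_Lq Xw) Lr.
  by apply: eq_integrable => // x _ /=; rewrite mulrC.
rewrite /L2_pairing -RintegralB//; [|exact: I|exact: I].
by apply: eq_Rintegral => x _ /=; rewrite mulrBl.
Qed.

Section one_solution.
Variable u : R -> E -> R.
Hypothesis es : energy_solution Omega theta q u0 u.

Lemma pairing_increment r t w : 0 <= r -> 0 <= t -> Xmem Omega theta w ->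
  `|L2_pairing Omega (rho u r) w - L2_pairing Omega (rho u t) w| <=
  C * Lq_norm Omega (conj_exp q) (rho u r \- rho u t) * Xnorm Omega theta w.
Proof.
move=> r0 t0 Xw; have Lr := energy_rho es r0; have Lt := energy_rho es t0.
rewrite pairingB//; apply: pairing_bound => //; apply: LqB => //; exact: conj_exp_ge1.
Qed.

Lemma pairing_continuous t w : 0 < t -> Xmem Omega theta w ->
  {for t, continuous (fun r => L2_pairing Omega (rho u r) w)}.
Proof.
move=> t0 Xw; have It : `[(0 : R), +oo[%classic t by rewrite /= in_itv/= ltW.
have [_ /(_ _ It)/(interior_cvg t0) Cv] := es_rho_continuous es.
have {}Cv : C * Lq_norm Omega (conj_exp q) (rho u r \- rho u t) * Xnorm Omega theta w @[r --> t] -->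
    C * 0 * Xnorm Omega theta w.
  by apply: cvgMl; apply: cvgMr.
rewrite mulr0 mul0r in Cv.
apply/cvgrPdist_le => e e0; near=> r.
have r0 : 0 <= r by rewrite ltW//; near: r; exact: lt_nbhsr.
rewrite distrC; apply: le_trans (pairing_increment r0 (ltW t0) Xw) _.
apply: le_trans (ler_norm _) _; rewrite -normrN -sub0r.
by near: r; move/cvgrPdist_le : Cv; exact.
Unshelve. all: by end_near. Qed.

Lemma Xinner_continuous t w : 0 < t -> Xmem Omega theta w ->
  {for t, continuous (fun r => Xinner Omega theta (u r) w)}.
Proof.
move=> t0 Xw; have It : `[(0 : R), +oo[%classic t by rewrite /= in_itv/= ltW.
have [_ /(_ _ (Xinner_dual Xw) _ It)] := es_weakly_continuous es.
exact: interior_cvg.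
Qed.

Lemma Xinner_integrable s t w : 0 < s -> Xmem Omega theta w ->
  leb1.-integrable `[s, t] (EFin \o (fun r => Xinner Omega theta (u r) w)).
Proof.
move=> s0 Xw; apply: continuous_compact_integrable; first exact: segment_compact.
apply: continuous_in_subspaceT => r /set_mem; rewrite /= in_itv/= => /andP[sr _].
by apply: Xinner_continuous => //; exact: lt_le_trans sr.
Qed.

(** The equation tested with [w] says that the pairing of [|u|^(q-2) u] with [w],
    which is continuous in time, has the weak derivative [- (u(t), w)], which is
    continuous as well. *)
Lemma integrated_equation s t w : 0 < s -> s < t -> Xmem Omega theta w ->
  L2_pairing Omega (rho u t) w - L2_pairing Omega (rho u s) w =
  - \int[leb1]_(r in `[s, t]) Xinner Omega theta (u r) w.
Proof.
move=> s0 st Xw; have T0 : 0 < t + 1 by lra.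
have [rh [drh W]] := es_weak_solution es T0.
have e0 : 0 < s / 2 < t + 1 by apply/andP; split; lra.
have [_ _ wd] := ws_rho_W12 W e0.
have mI : measurable (`]s / 2, t + 1[%classic : set R) by exact: measurable_itv.
have stI : `[s, t] `<=` `]s / 2, t + 1[.
  by move=> x; rewrite /= !in_itv/= => /andP[sx xt]; apply/andP; split; lra.
have I1 := Xinner_integrable t s0 Xw.
have I2 : leb1.-integrable `[s, t] (EFin \o (fun r => - Xinner Omega theta (u r) w)).
  have mJ : measurable (`[s, t]%classic : set R) by exact: measurable_itv.
  have := integrableN I1; apply: eq_integrable => // x _.
have ev : fmem (dual (dual (Xspace Omega theta))) (fun l => l w).
  apply: dual_eval => //.
  - by move=> a x y; exact: (Xmem_lin bO).
  - by move=> x _; exact: Xnorm_ge0.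
  - by move=> a x; exact: (XnormZ bO).
rewrite (weak_derivative_increment (a := fun r => L2_pairing Omega (rho u r) w) mI st stI _ I2).
- by rewrite -mulN1r -RintegralZl//; apply: eq_Rintegral => r _; rewrite mulN1r.
- by move=> r /andP[sr _]; apply: pairing_continuous => //; lra.
move=> phi tphi; have := wd phi tphi _ ev.
rewrite (_ : \int[leb1]_(r in _) (derive1 phi r * rh r w) =
  \int[leb1]_(r in `]s / 2, t + 1[) (derive1 phi r * L2_pairing Omega (rho u r) w)); last first.
  apply: ae_eq_Rintegral_gen; apply: ae_imp (ws_rho_rh W) => r H.
  rewrite /= in_itv/= => /andP[r1 r2]; rewrite H//; last exact: Xmem_Lq.
  by apply/andP; split; lra.
move=> ->; congr (- _); apply: ae_eq_Rintegral_gen; apply: ae_imp (ws_equation W) => r H.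
rewrite /= in_itv/= => /andP[r1 r2].
have /H /(_ w Xw) : 0 < r < t + 1 by apply/andP; split; lra.
by move/eqP; rewrite addr_eq0 => /eqP ->.
Qed.

(** Strong right continuity is used through this estimate: near [s] the integral
    is [t - s] times the value at [s], uniformly for [w] in a bounded set. *)
Lemma first_order_increment s t w k : 0 < s -> s < t -> Xmem Omega theta w ->
  (forall r, s <= r <= t -> Xnorm Omega theta (u r \- u s) <= k) ->
  `|L2_pairing Omega (rho u t) w - L2_pairing Omega (rho u s) w + (t - s) * Xinner Omega theta (u s) w|
  <= (t - s) * k * Xnorm Omega theta w.
Proof.
move=> s0 st Xw H; rewrite integrated_equation//.
have mJ : measurable (`[s, t]%classic : set R) by exact: measurable_itv.
have Jst : leb1 `[s, t] = (t - s)%:E by rewrite lebesgue_measure_itv/= lte_fin st.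
have Icst c : leb1.-integrable `[s, t] (EFin \o (fun=> c : R)).
  by apply: continuous_compact_integrable; [exact: segment_compact|move=> x; exact: cvg_cst].
have cstE (c : R) : \int[leb1]_(r in `[s, t]) c = (t - s) * c.
  by rewrite Rintegral_cst// mulrC; congr (_ * _); rewrite [X in fine X]Jst.
have I1 := Xinner_integrable t s0 Xw.
have Xs : Xmem Omega theta (u s) by exact: (energy_Xmem es (ltW s0)).
rewrite -cstE addrC -RintegralB// -mulrA -cstE.
apply: le_trans (le_normr_Rintegral _ _) _ => //.
  by apply: integrable_EFinB => //; exact: Icst.
apply: le_Rintegral => //.
  have I3 : leb1.-integrable `[s, t] (EFin \o (fun r => Xinner Omega theta (u s) w - Xinner Omega theta (u r) w)).
    by apply: integrable_EFinB => //; exact: Icst.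
  by have := integrable_abse I3; apply: eq_integrable => // x _.
move=> r; rewrite /= in_itv/= => srt; have r0 : 0 <= r by case/andP: srt; lra.
have Xr : Xmem Omega theta (u r) by exact: (energy_Xmem es r0).
rewrite distrC -(dualB (S := Xspace Omega theta) (Xinner_dual Xw))//.
apply: le_trans (Xinner_cauchy_schwarz bO (XB Xr Xs) Xw) _.
by rewrite ler_wpM2r ?Xnorm_ge0//; exact: H.
Qed.

End one_solution.

Lemma right_neighbourhood (F : R -> R) (I : set R) (s k : R) : (forall r, s <= r -> I r) -> 0 < k ->
  F r @[r --> within I (nbhs s)] --> (0 : R) ->
  exists2 delta, 0 < delta & forall r, s <= r <= s + delta -> F r <= k.
Proof.
move=> sI k0 /cvgrPdist_le/(_ _ k0) H.
have {}H : nbhs s (fun r => I r -> `|0 - F r| <= k) := H.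
have [e /= e0 He] := (nbhs_ballP _ _).1 H.
exists (e / 2); first exact: divr_gt0.
move=> r /andP[sr rs]; apply: le_trans (ler_norm _) _; rewrite -normrN -sub0r.
apply: He; last exact: sI.
by rewrite /ball/= ltr_norml; apply/andP; split; lra.
Qed.

Lemma pairing_lin (r : E -> R) (a : R) v w : fmem (Lq Omega (conj_exp q)) r -> Xmem Omega theta v ->
  Xmem Omega theta w ->
  L2_pairing Omega r (fun x => a * v x + w x) = a * L2_pairing Omega r v + L2_pairing Omega r w.
Proof.
move=> Lr Xv Xw; have I z : Xmem Omega theta z -> leb.-integrable Omega (EFin \o (fun x => r x * z x)).
  move=> Xz; have := hoelder_integrable mO q1 (Xmem_Lq Xz) Lr.
  by apply: eq_integrable => // x _ /=; rewrite mulrC.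
have Ia : leb.-integrable Omega (EFin \o (fun x => a * (r x * v x))).
  by have := integrableZl mO a (I _ Xv); apply: eq_integrable => // x _.
rewrite /L2_pairing -RintegralZl//; last exact: I.
rewrite -RintegralD//; last exact: I.
by apply: eq_Rintegral => x _; rewrite mulrDr mulrCA.
Qed.

Section uniqueness.
Variables u1 u2 : R -> E -> R.
Hypotheses (es1 : energy_solution Omega theta q u0 u1) (es2 : energy_solution Omega theta q u0 u2).
Local Notation z t := (u1 t \- u2 t).
Local Notation Xn := (Xnorm Omega theta).
(** Minus the difference of the two powers as a functional. By the equation its
    formal derivative is [(z(t), w)], and by monotonicity it is nonpositive at
    [z(t)]. *)
Let L t w : R := L2_pairing Omega (rho u2 t) w - L2_pairing Omega (rho u1 t) w.
Let eta s := Lq_norm Omega (conj_exp q) (rho u1 s \- rho u1 0) + Lq_norm Omega (conj_exp q) (rho u2 s \- rho u2 0).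

Let z_X t : 0 <= t -> Xmem Omega theta (z t).
Proof. by move=> t0; apply: XB; [exact: (energy_Xmem es1)|exact: (energy_Xmem es2)]. Qed.

Let monotone_pairing t : 0 <= t ->
  - L t (z t) = \int[leb]_(x in Omega) ((rho u1 t x - rho u2 t x) * (u1 t x - u2 t x)).
Proof.
by move=> t0; rewrite /L opprB (pairingB (energy_rho es1 t0) (energy_rho es2 t0) (z_X t0)).
Qed.

Let integrand_ge0 t x : 0 <= (rho u1 t x - rho u2 t x) * (u1 t x - u2 t x).
Proof.
have r1 := odd_exponent q1.
have [h|h] := leP (u2 t x) (u1 t x).
  by rewrite mulr_ge0 ?subr_ge0//; exact: odd_pow_nondecreasing.
by rewrite mulr_le0 ?subr_le0 ?(ltW h)//; apply: odd_pow_nondecreasing => //; exact: ltW.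
Qed.

Let L_diag t : 0 <= t -> L t (z t) <= 0.
Proof. by move=> t0; rewrite -oppr_ge0 monotone_pairing//; apply: Rintegral_ge0 => x _; exact: integrand_ge0. Qed.

Let L_initial w : L 0 w = 0.
Proof.
rewrite /L; apply/eqP; rewrite subr_eq0; apply/eqP; apply: ae_eq_Rintegral_gen.
by apply: filterS2 (es_initial es1) (es_initial es2) => x /= -> ->.
Qed.

Let L_start s w : 0 <= s -> Xmem Omega theta w -> `|L s w| <= C * eta s * Xn w.
Proof.
move=> s0 Xw; have := L_initial w; rewrite /L => h0.
have h1 := pairing_increment es1 s0 (lexx 0) Xw; have h2 := pairing_increment es2 s0 (lexx 0) Xw.
rewrite (_ : _ - _ = (L2_pairing Omega (rho u2 s) w - L2_pairing Omega (rho u2 0) w) -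
  (L2_pairing Omega (rho u1 s) w - L2_pairing Omega (rho u1 0) w)); last by lra.
apply: le_trans (ler_normB _ _) _; rewrite /eta mulrDr mulrDl; lra.
Qed.

(** Formally [sup_w (2 L t w - |w|^2)], the squared dual norm of [L t], has the
    derivative [2 L t (z t) <= 0]. The proof is by real induction with an error
    [e] per unit of time. A step from [s] to [t] compares [w] at [t] with
    [w - (t - s) z(s)] at [s]; this is uniform for bounded [w], while for large
    [w] the quadratic term dominates. Starting at [s0 > 0] avoids the equation
    at time 0, where only the continuity of the powers is used. *)
Let quadratic_bound s0 T e w : 0 < s0 -> s0 <= T -> 0 < e -> Xmem Omega theta w ->
  2 * L T w - Xn w ^+ 2 <= (C * eta s0) ^+ 2 + e * T.
Proof.
move=> s00 s0T e0; set B := (C * eta s0) ^+ 2; move: w.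
have B0 : 0 <= B by exact: sqr_ge0.
apply: (real_induction (a := s0) (b := T) (P := fun t => forall w, Xmem Omega theta w -> 2 * L t w - Xn w ^+ 2 <= B + e * t)) => //.
- move=> w Xw; have := L_start (ltW s00) Xw => h.
  have {h}: L s0 w <= C * eta s0 * Xn w by exact: le_trans (ler_norm _) h.
  rewrite /B; have := sqr_ge0 (C * eta s0 - Xn w); have := mulr_gt0 e0 s00.
  by move: (C * eta s0) (Xn w) (L s0 w) => X Y Z; nra.
- move=> s s0s sT Ps; have sp : 0 < s by exact: lt_le_trans s0s.
  have s0' := ltW sp.
  (* For t close to s, L t is bounded by A; so only |w| < 2 A matters. *)
  pose A := C * (2 + Lq_norm Omega (conj_exp q) (rho u1 s) + Lq_norm Omega (conj_exp q) (rho u2 s)).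
  have A0 : 0 <= A by rewrite mulr_ge0// !addr_ge0// Lq_norm_ge0.
  pose k := e / (16 * (A + 1)).
  have k0 : 0 < k by rewrite divr_gt0// mulr_gt0// ltr_wpDl.
  pose M := Xn (z s).
  have Is : `[(0 : R), +oo[%classic s by rewrite /= in_itv/= s0'.
  have sI1 r : s <= r -> (`[(0 : R), +oo[%classic `&` [set r | s <= r]) r.
    by move=> sr; split=> //; rewrite /= in_itv/= andbT (le_trans s0').
  have sI2 r : s <= r -> `[(0 : R), +oo[%classic r by move=> /sI1[].
  have [d1 d10 H1] := right_neighbourhood sI1 k0 ((es_right_continuous es1).2 _ Is).
  have [d2 d20 H2] := right_neighbourhood sI1 k0 ((es_right_continuous es2).2 _ Is).
  have [d3 d30 H3] := right_neighbourhood sI2 ltr01 ((es_rho_continuous es1).2 _ Is).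
  have [d4 d40 H4] := right_neighbourhood sI2 ltr01 ((es_rho_continuous es2).2 _ Is).
  pose d5 := e / (2 * (M ^+ 2 + 1)).
  have M0 : 0 <= M ^+ 2 by exact: sqr_ge0.
  have d50 : 0 < d5 by rewrite divr_gt0// mulr_gt0// ltr_wpDl.
  exists (Num.min (Num.min d1 d2) (Num.min (Num.min d3 d4) d5)).
    by rewrite !lt_min d10 d20 d30 d40 d50.
  move=> t st; rewrite -lerBlDl !le_min => /andP[/andP[t1 t2] /andP[/andP[t3 t4] t5]] w Xw.
  have t0 : 0 <= t by exact: le_trans (ltW st).
  set h := t - s in t1 t2 t3 t4 t5.
  have h0 : 0 < h by rewrite subr_gt0.
  have tE : t = s + h by rewrite /h addrC subrK.
  have n0 : 0 <= Xn w by exact: Xnorm_ge0.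
  have [nA|nA] := leP (2 * A) (Xn w).
    have : L t w <= A * Xn w.
      apply: le_trans (ler_norm _) _.
      have g1 := pairing_increment es1 t0 s0' Xw; have g2 := pairing_increment es2 t0 s0' Xw.
      have g3 := pairing_bound (energy_rho es1 s0') Xw; have g4 := pairing_bound (energy_rho es2 s0') Xw.
      have g5 : C * Lq_norm Omega (conj_exp q) (rho u1 t \- rho u1 s) * Xn w <= C * 1 * Xn w.
        by rewrite ler_wpM2r// ler_wpM2l// H3// tE lerDl lerD2l (ltW h0).
      have g6 : C * Lq_norm Omega (conj_exp q) (rho u2 t \- rho u2 s) * Xn w <= C * 1 * Xn w.
        by rewrite ler_wpM2r// ler_wpM2l// H4// tE lerDl lerD2l (ltW h0).
      rewrite (_ : L t w = ((L2_pairing Omega (rho u2 t) w - L2_pairing Omega (rho u2 s) w) +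
        L2_pairing Omega (rho u2 s) w) - ((L2_pairing Omega (rho u1 t) w - L2_pairing Omega (rho u1 s) w) +
        L2_pairing Omega (rho u1 s) w)); last by rewrite /L; lra.
      apply: le_trans (ler_normB _ _) _.
      apply: le_trans (lerD (ler_normD _ _) (ler_normD _ _)) _.
      rewrite /A !mulrDr !mulrDl; lra.
    have := mulr_ge0 (ltW e0) t0; have := mulr_ge0 n0 A0.
    move: nA n0 A0 B0; move: (Xn w) (L t w) (e * t) => n l et; nra.
  have Xz := z_X s0'.
  pose w' x := - h * z s x + w x.
  have Xw' : Xmem Omega theta w' by exact: (Xmem_lin bO).
  have Lw' : L s w' = - h * L s (z s) + L s w.
    rewrite /L !pairing_lin//; [|exact: (energy_rho es1)|exact: (energy_rho es2)].
    by rewrite mulrBr; lra.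
  have nw' : Xn w' ^+ 2 = h ^+ 2 * M ^+ 2 - 2 * h * Xinner Omega theta (z s) w + Xn w ^+ 2.
    rewrite !Xnorm_sqr /w' (Xinner_lin bO)// (XinnerC _ _ (z s)) (XinnerC _ _ w) !(Xinner_lin bO)// (XinnerC _ _ w (z s)).
    by ring.
  have Pw' := Ps _ Xw'; rewrite Lw' nw' in Pw'.
  have srE dl : h <= dl -> forall r, s <= r <= t -> s <= r <= s + dl.
    by move=> hd r /andP[-> rt]/=; apply: le_trans rt _; rewrite tE lerD2l.
  have D1 := first_order_increment es1 sp st Xw (fun r srt => H1 r (srE _ t1 _ srt)).
  have D2 := first_order_increment es2 sp st Xw (fun r srt => H2 r (srE _ t2 _ srt)).
  have zE : Xinner Omega theta (z s) w = Xinner Omega theta (u1 s) w - Xinner Omega theta (u2 s) w.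
    by rewrite -(dualB (S := Xspace Omega theta) (Xinner_dual Xw))//; [exact: (energy_Xmem es1)|exact: (energy_Xmem es2)].
  have {}D : L t w - L s w - h * Xinner Omega theta (z s) w <= 2 * h * k * Xn w.
    rewrite -/h in D1 D2; have {D1}[D1 _] := andP (etrans (esym (ler_norml _ _)) D1).
    have {D2}[_ D2] := andP (etrans (esym (ler_norml _ _)) D2).
    rewrite zE /L mulrBr; move: D1 D2; move: (L2_pairing _ _ _) (L2_pairing _ _ _) => p1 p2.
    by move: (L2_pairing _ _ _) (L2_pairing _ _ _) (Xn w) => p3 p4 n; lra.
  have hM : h * M ^+ 2 <= e / 2.
    have : h * (2 * (M ^+ 2 + 1)) <= e by rewrite -ler_pdivlMr// mulr_gt0// ltr_wpDl.
    exact: step_quadratic_term.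
  have kA : 4 * k * Xn w <= e / 2.
    have : k * (16 * (A + 1)) = e by rewrite /k divfK// gt_eqF// mulr_gt0// ltr_wpDl.
    by move=> kE; exact: step_linear_term kE.
  have Ld : h * L s (z s) <= 0 by rewrite mulr_ge0_le0// ?(ltW h0)// L_diag.
  have -> : e * t = e * s + e * h by rewrite tE mulrDr.
  exact: step_combine (ltW h0) D Pw' Ld hM kA.
- move=> t s0t tT Pt w Xw; have t0 : 0 < t by exact: lt_trans s0t.
  have Cv : 2 * L r w - Xn w ^+ 2 @[r --> t^'-] --> 2 * L t w - Xn w ^+ 2.
    apply: cvgB; last exact: cvg_cst.
    apply: cvgMr; apply: cvg_at_left_filter.
    by apply: cvgB; [exact: (pairing_continuous es2)|exact: (pairing_continuous es1)].
  apply: (cvgr_to_le Cv); near=> r.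
  have rt : r < t by near: r; exact: nbhs_left_lt.
  have sr : s0 < r by near: r; exact: nbhs_left_gt.
  apply: le_trans (Pt r (ltW sr) rt _ Xw) _.
  by rewrite lerD2l ler_wpM2l// ltW.
Unshelve. all: by end_near. Qed.

(** The bound lets [s0] and [e] tend to 0; a linear functional dominated by half
    of [|w|^2] vanishes. *)
Let L_eq0 t w : 0 < t -> Xmem Omega theta w -> L t w = 0.
Proof.
move=> t0; have neg v : Xmem Omega theta v -> 2 * L t v - Xn v ^+ 2 <= 0.
  move=> Xv; apply/ler_addgt0Pr => e e0; rewrite add0r.
  pose k := Num.min 1 (e / (8 * (C ^+ 2 + 1))).
  have D0 : 0 < 8 * (C ^+ 2 + 1) by rewrite mulr_gt0// ltr_wpDl// sqr_ge0.
  have k0 : 0 < k by rewrite lt_min ltr01 divr_gt0.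
  have I0 : `[(0 : R), +oo[%classic (0 : R) by rewrite /= in_itv/= lexx.
  have sI r : (0 : R) <= r -> `[(0 : R), +oo[%classic r by move=> r0; rewrite /= in_itv/= r0.
  have [d1 d10 H1] := right_neighbourhood sI k0 ((es_rho_continuous es1).2 _ I0).
  have [d2 d20 H2] := right_neighbourhood sI k0 ((es_rho_continuous es2).2 _ I0).
  pose s0 := Num.min t (Num.min d1 d2).
  have s00 : 0 < s0 by rewrite !lt_min t0 d10 d20.
  have s0t : s0 <= t by rewrite ge_min lexx.
  have eta_k : eta s0 <= 2 * k.
    have h1 : Lq_norm Omega (conj_exp q) (rho u1 s0 \- rho u1 0) <= k.
      by apply: H1; rewrite (ltW s00) add0r !ge_min lexx !orbT.
    have h2 : Lq_norm Omega (conj_exp q) (rho u2 s0 \- rho u2 0) <= k.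
      by apply: H2; rewrite (ltW s00) add0r !ge_min lexx !orbT.
    by rewrite /eta; move: h1 h2; move: (Lq_norm _ _ _) (Lq_norm _ _ _) => x y; lra.
  have e20 : 0 < e / 2 / t by rewrite !divr_gt0.
  apply: le_trans (quadratic_bound s00 s0t e20 Xv) _; rewrite divfK ?gt_eqF//.
  have eta0 : 0 <= eta s0 by rewrite addr_ge0// Lq_norm_ge0.
  have b1 : (C * eta s0) ^+ 2 <= (C * (2 * k)) ^+ 2.
    by rewrite ler_sqr ?nnegrE ?ler_wpM2l// mulr_ge0// mulr_ge0// ltW.
  have k1 : k <= 1 by rewrite ge_min lexx.
  have k2 : k * (8 * (C ^+ 2 + 1)) <= e by rewrite -ler_pdivlMr// ge_min lexx orbT.
  have b2 : (C * (2 * k)) ^+ 2 <= e / 2.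
    have k1' : 0 <= 1 - k by rewrite subr_ge0.
    have := mulr_ge0 (mulr_ge0 (sqr_ge0 C) (ltW k0)) k1'.
    by move: k2 k0; move: (k) => y; nra.
  by move: b1 b2; move: ((C * eta s0) ^+ 2) ((C * (2 * k)) ^+ 2) => x y; lra.
move=> Xw; pose N := Xn w ^+ 2; have N0 : 0 <= N by exact: sqr_ge0.
pose c := L t w / (N + 1).
have cE : L t w = c * (N + 1) by rewrite /c divfK// gt_eqF// ltr_wpDl.
have := neg _ (XmemZ bO c Xw); rewrite (XnormZ bO)// exprMn real_normK ?num_real// -/N.
rewrite (_ : L t _ = c * L t w); last first.
  have Z0 := Xmem0 bO Xw.
  have lin r : fmem (Lq Omega (conj_exp q)) r -> L2_pairing Omega r (fun x => c * w x) = c * L2_pairing Omega r w.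
    move=> Lr; have := pairing_lin c Lr Xw Z0.
    rewrite (_ : (fun x => _ + 0) = (fun x => c * w x)); last by apply/funext => x; rewrite addr0.
    move=> ->; rewrite (_ : L2_pairing Omega r (fun=> 0) = 0) ?addr0//.
    rewrite /L2_pairing (_ : (fun x => r x * 0) = (fun=> 0)); last by apply/funext => x; rewrite mulr0.
    by rewrite /Rintegral integral0.
  by rewrite /L !lin ?mulrBr//; [exact: (energy_rho es1 (ltW t0))|exact: (energy_rho es2 (ltW t0))].
rewrite cE => h; suff -> : c = 0 by rewrite mul0r.
apply/eqP; rewrite -sqrf_eq0 eq_le sqr_ge0 andbT.
have := mulr_ge0 (sqr_ge0 c) N0; move: h; nra.
Qed.

(** The pairing of the difference of the powers with the difference of the
    solutions vanishes, and its integrand is nonnegative, zero only where they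
    agree. *)
Lemma energy_solution_unique t : 0 < t -> {ae leb, forall x, Omega x -> u1 t x = u2 t x}.
Proof.
move=> t0; have t0' := ltW t0.
have := monotone_pairing t0'; rewrite L_eq0//; last exact: z_X.
rewrite oppr0 => I0.
have r1 := odd_exponent q1.
pose F x : R := (rho u1 t x - rho u2 t x) * (u1 t x - u2 t x).
have Ii : leb.-integrable Omega (EFin \o F).
  have Lr : fmem (Lq Omega (conj_exp q)) (rho u1 t \- rho u2 t).
    by apply: LqB; [exact: conj_exp_ge1|exact: (energy_rho es1)|exact: (energy_rho es2)].
  have := hoelder_integrable mO q1 (Xmem_Lq (z_X t0')) Lr.
  by apply: eq_integrable => // x _ /=; rewrite mulrC.
have A0 : (\int[leb]_(x in Omega) `|(EFin \o F) x| = 0)%E.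
  rewrite (eq_integral (EFin \o F)).
    by rewrite -(fineK (integrable_fin_num mO Ii)); congr EFin; exact: esym I0.
  by move=> x _; rewrite gee0_abs// lee_fin; exact: integrand_ge0.
have := (ae_eq_integral_abs leb mO (measurable_int _ Ii)).1 A0.
apply: filterS => x H Ox; have {H} := H Ox => -[] /eqP; rewrite mulf_eq0 => /orP[|]; last by rewrite subr_eq0 => /eqP.
rewrite subr_eq0 => /eqP/= e; have [h|h|//] := ltgtP (u1 t x) (u2 t x).
- by have := odd_pow_increasing r1 h; rewrite e ltxx.
- by have := odd_pow_increasing r1 h; rewrite e ltxx.
Qed.

End uniqueness.

End integrated_equation.

(** * Decay and extinction *)

Section two_sided_bounds.
Context {R : realType}.

Lemma two_sided (A B : R) (y h : R -> R) : 0 < A -> 0 < B -> (forall t : R, 0 <= t -> 0 <= h t) ->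
  (forall t : R, 0 <= t -> A * h t <= y t <= B * h t) ->
  exists2 c, 0 < c & forall t : R, 0 <= t -> c * h t <= y t <= c^-1 * h t.
Proof.
move=> A0 B0 h0 H; have m0 : 0 < Num.min A B^-1 by rewrite lt_min A0 invr_gt0.
exists (Num.min A B^-1) => // t t0; have /andP[h1 h2] := H t t0; apply/andP; split.
  by apply: le_trans h1; rewrite ler_wpM2r ?h0// ge_min lexx.
apply: le_trans h2 _; rewrite ler_wpM2r ?h0// -[leLHS]invrK lef_pV2 ?posrE ?invr_gt0//.
by rewrite ge_min lexx orbT.
Qed.

Variables (q C : R) (n x : R -> R).
Hypotheses (q1 : 1 < q) (C0 : 0 < C).
Hypothesis n_ge0 : forall t : R, 0 <= t -> 0 <= n t.
Hypothesis x_ge0 : forall t : R, 0 <= t -> 0 <= x t.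
Local Notation f := (fun t => n t `^ q).
Local Notation g := (fun t => x t ^+ 2).
Hypothesis x_noninc : forall s t : R, 0 <= s -> s < t -> g t <= g s.
Hypothesis dissip : forall s t : R, 0 <= s -> s < t ->
  q / (q - 1) * g t * (t - s) <= f s - f t <= q / (q - 1) * g s * (t - s).
Hypothesis sqrt_lip : forall s t : R, 0 <= s -> s < t ->
  (Num.sqrt (f s) - Num.sqrt (f t)) ^+ 2 <= (t - s) * (q * (q / (q - 1)) / 8) * (g s - g t).
Hypothesis sobolev : forall t : R, 0 <= t -> n t <= C * x t.
Hypothesis n0_gt0 : 0 < n 0.

Let q0 : 0 < q. Proof. exact: lt_trans ltr01 q1. Qed.
Let f_ge0 (t : R) : 0 <= t -> 0 <= f t. Proof. by move=> _; exact: powR_ge0. Qed.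
Let g_ge0 (t : R) : 0 <= t -> 0 <= g t. Proof. by move=> _; exact: sqr_ge0. Qed.
Let diss_ge (s t : R) : 0 <= s -> s < t -> q / (q - 1) * g t * (t - s) <= f s - f t.
Proof. by move=> s0 st; have /andP[] := dissip s0 st. Qed.
Let diss_le (s t : R) : 0 <= s -> s < t -> f s - f t <= q / (q - 1) * g s * (t - s).
Proof. by move=> s0 st; have /andP[] := dissip s0 st. Qed.

Let power (t : R) r : f t `^ r = n t `^ (q * r). Proof. by rewrite -powRrM. Qed.

Let sobolev2 (t : R) : 0 <= t -> f t `^ (2 / q) <= C ^+ 2 * g t.
Proof.
move=> t0; rewrite power mulrCA mulfV ?gt_eqF// mulr1 powR_mulrn ?n_ge0//.
by rewrite -exprMn ler_sqr ?nnegrE ?sobolev ?n_ge0// mulr_ge0 ?x_ge0// ltW.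
Qed.

Let f0_gt0 : 0 < f 0. Proof. exact: powR_gt0. Qed.

Let root (t : R) : 0 <= t -> f t `^ q^-1 = n t.
Proof. by move=> t0; rewrite power mulfV ?gt_eqF// powRr1 ?n_ge0. Qed.

Let f_gt0 (t : R) : 0 <= t -> (0 < f t) = (0 < n t).
Proof.
move=> t0; apply/idP/idP; last exact: powR_gt0.
apply: contraTT; rewrite -!leNgt => h; have -> : n t = 0 by apply/eqP; rewrite eq_le h n_ge0.
by rewrite powR0 ?gt_eqF.
Qed.

Let x_bounds : exists2 K, 0 < K & forall t : R, 0 <= t -> 0 < n t -> C^-1 * n t <= x t <= K * n t.
Proof.
exists (Num.sqrt (g 0 / f 0 `^ (2 / q)) + 1); first by rewrite ltr_wpDl.
move=> r r0; rewrite -f_gt0// => fr.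
have := g_bounds q1 C0 f_ge0 g_ge0 x_noninc diss_ge diss_le sqrt_lip sobolev2 r0 fr.
rewrite root// [Num.sqrt (x r ^+ 2)]sqrtr_sqr (ger0_norm (x_ge0 r0)) => /andP[-> h] /=.
by apply: le_trans h _; rewrite ler_wpM2r ?n_ge0// lerDl.
Qed.

Lemma slow_decay_norms : q < 2 ->
  (exists2 c, 0 < c & forall t : R, 0 <= t ->
     c * (t + 1) `^ (- (2 - q)^-1) <= n t <= c^-1 * (t + 1) `^ (- (2 - q)^-1)) /\
  (exists2 c, 0 < c & forall t : R, 0 <= t ->
     c * (t + 1) `^ (- (2 - q)^-1) <= x t <= c^-1 * (t + 1) `^ (- (2 - q)^-1)).
Proof.
move=> q2; have q2' : q != 2 by rewrite lt_eqF.
have [A [B [A0 B0 H]]] := slow_decay q1 C0 f_ge0 g_ge0 x_noninc diss_ge diss_le sqrt_lip sobolev2 f0_gt0 q2' q2.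
have [K K0 HK] := x_bounds.
split.
  apply: (two_sided A0 B0) => [t _|t t0]; first exact: powR_ge0.
  by have [_] := H t t0; rewrite root.
apply: (@two_sided (C^-1 * A) (K * B)) => [| |t _|t t0]; rewrite ?powR_ge0// ?mulr_gt0 ?invr_gt0//.
have [ft] := H t t0; rewrite root// => /andP[h1 h2].
have /andP[h3 h4] := HK t t0 (etrans (esym (f_gt0 t0)) ft).
apply/andP; split; [apply: le_trans h3|apply: le_trans h4 _]; rewrite -mulrA ler_wpM2l// ?(ltW K0)//.
by rewrite invr_ge0 ltW.
Qed.

Lemma extinction_norms : 2 < q -> exists T, [/\ 0 < T,
  forall t : R, 0 <= t -> (0 < n t) = (t < T),
  exists2 c, 0 < c & forall t : R, 0 <= t ->
    c * Num.max (T - t) 0 `^ (q - 2)^-1 <= n t <= c^-1 * Num.max (T - t) 0 `^ (q - 2)^-1,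
  exists2 c, 0 < c & forall t : R, 0 <= t ->
    c * Num.max (T - t) 0 `^ (q - 2)^-1 <= x t <= c^-1 * Num.max (T - t) 0 `^ (q - 2)^-1 &
  (q - 1) / (q - 2) * (n 0 `^ q / x 0 ^+ 2) <= T <= (q - 1) / (q - 2) * C ^+ 2 * n 0 `^ (q - 2)].
Proof.
move=> q2; have q2' : q != 2 by rewrite gt_eqF.
have [T [T0 pos gT H]] := extinction q1 C0 f_ge0 g_ge0 x_noninc diss_ge diss_le sqrt_lip sobolev2 f0_gt0 q2' q2.
have [K K0 HK] := x_bounds.
have q20 : 0 < q - 2 by rewrite subr_gt0.
have q10 : 0 < q - 1 by rewrite subr_gt0.
have x00 : 0 < x 0 by rewrite -(pmulr_rgt0 _ C0); exact: lt_le_trans (sobolev (lexx 0)).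
have eE (t : R) : f t `^ (1 - 2 / q) = n t `^ (q - 2).
  by rewrite power mulrBr mulr1 mulrCA mulfV ?gt_eqF// mulr1.
have r0E : x 0 ^+ 2 / f 0 `^ (2 / q) = x 0 ^+ 2 / n 0 ^+ 2.
  by rewrite power mulrCA mulfV ?gt_eqF// mulr1 powR_mulrn ?n_ge0.
pose k1 := (q - 2) / (q - 1) * (C ^+ 2)^-1.
pose k2 := (q - 2) / (q - 1) * (x 0 ^+ 2 / n 0 ^+ 2).
have k10 : 0 < k1 by rewrite mulr_gt0 ?divr_gt0// invr_gt0 exprn_gt0.
have k20 : 0 < k2 by rewrite mulr_gt0 ?divr_gt0// exprn_gt0.
have {}H (t : R) : 0 <= t -> k1 * Num.max (T - t) 0 <= n t `^ (q - 2) <= k2 * Num.max (T - t) 0.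
  by move=> t0; have := H t t0; rewrite eE r0E.
have posn (t : R) : 0 <= t -> (0 < n t) = (t < T) by move=> t0; rewrite -f_gt0// pos.
have m0 (t : R) : 0 <= Num.max (T - t) 0 by rewrite le_max lexx orbT.
have h0 (t : R) : 0 <= t -> 0 <= Num.max (T - t) 0 `^ (q - 2)^-1 by move=> _; exact: powR_ge0.
pose A := k1 `^ (q - 2)^-1; pose B := k2 `^ (q - 2)^-1.
have A0 : 0 < A by exact: powR_gt0.
have B0 : 0 < B by exact: powR_gt0.
have e0 : 0 <= (q - 2)^-1 by rewrite invr_ge0 ltW.
have nb (t : R) : 0 <= t -> A * Num.max (T - t) 0 `^ (q - 2)^-1 <= n t <= B * Num.max (T - t) 0 `^ (q - 2)^-1.
  move=> t0; have /andP[h1 h2] := H t t0.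
  have nE : n t = (n t `^ (q - 2)) `^ (q - 2)^-1 by rewrite -powRrM mulfV ?gt_eqF// powRr1 ?n_ge0.
  rewrite nE /A /B -!powRM ?(ltW k10) ?(ltW k20)//.
  have k1m : 0 <= k1 * Num.max (T - t) 0 by exact: mulr_ge0 (ltW k10) (m0 t).
  have k2m : 0 <= k2 * Num.max (T - t) 0 by exact: mulr_ge0 (ltW k20) (m0 t).
  by rewrite !ge0_ler_powR ?nnegrE ?powR_ge0.
exists T; split => //.
- exact: two_sided A0 B0 h0 nb.
- have CA0 : 0 < C^-1 * A by rewrite mulr_gt0// invr_gt0.
  apply: (two_sided CA0 (mulr_gt0 K0 B0) h0) => t t0; have /andP[h1 h2] := nb t t0.
  have [tT|Tt] := ltP t T.
    have /andP[h3 h4] : C^-1 * n t <= x t <= K * n t by apply: HK; rewrite ?posn.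
    apply/andP; split; [apply: le_trans h3|apply: le_trans h4 _]; rewrite -mulrA ler_wpM2l// ?(ltW K0)//.
    by rewrite invr_ge0 ltW.
  have -> : x t = 0 by apply/eqP; rewrite -sqrf_eq0 gT.
  have -> : Num.max (T - t) 0 = 0 by apply/max_idPr; rewrite subr_le0.
  by rewrite powR0 ?invr_eq0 ?gt_eqF// !mulr0 lexx.
- have /andP[h1 h2] := H 0 (lexx 0).
  have mT : Num.max (T - 0) 0 = T by rewrite subr0; apply/max_idPl; exact: ltW.
  rewrite mT /k1 /k2 in h1 h2.
  have nq : n 0 `^ q = n 0 `^ (q - 2) * n 0 ^+ 2.
    rewrite -(powR_mulrn 2 (n_ge0 (lexx 0))) -powRD; last by rewrite (gt_eqF n0_gt0) implybT.
    by congr powR; lra.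
  have n20 : 0 < n 0 ^+ 2 by rewrite exprn_gt0.
  have x20 : 0 < x 0 ^+ 2 by rewrite exprn_gt0.
  have C20 : 0 < C ^+ 2 by rewrite exprn_gt0.
  apply/andP; split.
    have := ler_wpM2l (ltW (divr_gt0 (mulr_gt0 q10 n20) (mulr_gt0 q20 x20))) h2.
    rewrite nq; congr (_ <= _); first by field; rewrite !gt_eqF.
    by field; rewrite !gt_eqF.
  have := ler_wpM2l (ltW (divr_gt0 (mulr_gt0 q10 C20) q20)) h1.
  congr (_ <= _); first by field; rewrite !gt_eqF.
  by field; rewrite !gt_eqF.
Qed.

End two_sided_bounds.

Lemma positivity_time_unique {R : realType} (n : R -> R) (s t : R) : 0 < s -> 0 < t ->
  (forall r : R, 0 <= r -> (0 < n r) = (r < s)) -> (forall r : R, 0 <= r -> (0 < n r) = (r < t)) -> s = t.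
Proof.
move=> s0 t0 Hs Ht; have [st|ts|//] := ltgtP s t.
- by have := Ht s (ltW s0); rewrite Hs ?(ltW s0)// ltxx st.
- by have := Hs t (ltW t0); rewrite Ht ?(ltW t0)// ltxx ts.
Qed.

Section initial_datum.
Context {R : realType} {d : nat}.
Local Notation E := 'rV[R]_d.
Local Notation leb := (lebesgue_rV R d).
Variables (Omega : set E) (theta q : R).
Hypotheses (bO : bounded_domain Omega) (q1 : 1 < q).
Let mO : measurable Omega. Proof. exact: domain_measurable bO. Qed.
Let q0 : 0 < q. Proof. exact: lt_trans ltr01 q1. Qed.
Implicit Types v w : E -> R.

Lemma Xnorm_ae v w : {ae leb, forall x, v x = w x} -> Xnorm Omega theta v = Xnorm Omega theta w.
Proof.
move=> vw; rewrite /Xnorm /Xinner; case: ifP => _; last first.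
  congr (Num.sqrt (_ * _)); apply: ae_eq_Rintegral_gen.
  apply: filterS (ae_product vw) => z [h1 h2] _.
  by rewrite /gagliardo_integrand h1 h2.
suff -> : grad Omega v = grad Omega w by [].
rewrite /grad; congr xget; apply/seteqP; split=> g H i; have [Lg Hg] := H i; split=> // phi tphi;
  rewrite -(Hg phi tphi); apply: ae_eq_Rintegral_gen; apply: filterS vw => x -> _ //.
Qed.

Lemma Xmem_restrict_measurable w : Xmem Omega theta w -> measurable_fun setT (w \_ Omega).
Proof.
move=> [Lw _ _]; have mw := Lfun2_measurable Lw.
by apply/(measurable_restrictT _ _).1 => //; exact: measurable_funS mw.
Qed.

Lemma Lq_norm_gt0 w : Xmem Omega theta w -> fmem (Lq Omega q) w ->
  ~ {ae leb, forall x, w x = 0} -> 0 < Lq_norm Omega q w.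
Proof.
move=> Xw Lw w0; rewrite lt_neqAle Lq_norm_ge0 andbT eq_sym; apply/negP => /eqP n0; apply: w0.
have [_ z _] := Xw.
have N0 : Lq_norme Omega q w = 0%E by rewrite Lq_normE// n0.
have m : measurable_fun setT (EFin \o (w \_ Omega)) by apply/measurable_EFinP; exact: Lq_measurable Lw.
have q0' : (0 < q%:E)%E by rewrite lte_fin.
have := Lnorm_eq0_eq0 m q0' N0; apply: filterS2 z => x zx /(_ I)/=.
rewrite patchE; case: ifPn => [_ []//|/negP nO _]; apply: zx => Ox; exact/nO/mem_set.
Qed.

(** The infimum need not be known to be attained: the bound holds for each
    admissible constant. *)
Lemma sobolev_constant_upper (K T : R) : 0 < K ->
  (exists2 C, 0 <= C & forall w, Xmem Omega theta w -> (Lq_norme Omega q w <= (C * Xnorm Omega theta w)%:E)%E) ->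
  (forall C, 0 <= C -> (forall w, Xmem Omega theta w -> (Lq_norme Omega q w <= (C * Xnorm Omega theta w)%:E)%E) ->
     T <= K * C ^+ 2) ->
  T <= K * sobolev_constant Omega theta q ^+ 2.
Proof.
move=> K0 [C C0 HC] H; have [T0|T0] := leP T 0.
  by apply: le_trans T0 _; apply: mulr_ge0 (ltW K0) (sqr_ge0 _).
have TK : 0 <= T / K by rewrite divr_ge0// ltW.
have le : Num.sqrt (T / K) <= sobolev_constant Omega theta q.
  apply: lb_le_inf; first by exists C.
  move=> C' [C'0 HC']; rewrite -(ger0_norm C'0) -sqrtr_sqr ler_wsqrtr// ler_pdivrMr// mulrC.
  exact: H.
rewrite -ler_pdivrMl// mulrC -[leLHS]sqr_sqrtr// ler_sqr ?nnegrE ?sqrtr_ge0//.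
exact: le_trans (sqrtr_ge0 _) le.
Qed.

End initial_datum.

Section energy_decay.
Context {R : realType} {d : nat}.
Local Notation E := 'rV[R]_d.
Local Notation leb := (lebesgue_rV R d).
Variables (Omega : set E) (theta q : R) (u0 : E -> R) (u : R -> E -> R).
Hypotheses (bO : bounded_domain Omega) (q1 : 1 < q) (Xu0 : Xmem Omega theta u0).
Hypothesis es : energy_solution Omega theta q u0 u.
Hypothesis u0_neq0 : ~ {ae leb, forall x, u0 x = 0}.
Let mO : measurable Omega. Proof. exact: domain_measurable bO. Qed.

Lemma initial_Lq_norm : Lq_norm Omega q (u 0) = Lq_norm Omega q u0.
Proof.
rewrite /Lq_norm; congr fine; apply: Lq_norm_ae => //.
- by apply: filterS (es_initial es) => x ->.
- exact: Lq_measurable (energy_Lq es (lexx 0)).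
- exact: Xmem_restrict_measurable Xu0.
- exact: lt_trans ltr01 q1.
Qed.

Lemma initial_Xnorm : Xnorm Omega theta (u 0) = Xnorm Omega theta u0.
Proof. exact: Xnorm_ae (es_initial es). Qed.

Variable C : R.
Hypotheses (C0 : 0 <= C).
Hypothesis sobolev : forall w, Xmem Omega theta w ->
  (Lq_norme Omega q w <= (C * Xnorm Omega theta w)%:E)%E.

Lemma u0_Lq_norm_gt0 : 0 < Lq_norm Omega q u0.
Proof. exact: (Lq_norm_gt0 q1 Xu0 (Xmem_Lq bO sobolev Xu0) u0_neq0). Qed.

Lemma admissible_constant_gt0 : 0 < C.
Proof.
rewrite lt_neqAle C0 andbT eq_sym; apply/negP => /eqP c0.
have := lt_le_trans u0_Lq_norm_gt0 (Xmem_Lq_norm bO sobolev Xu0).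
by rewrite c0 mul0r ltxx.
Qed.

Let n_ge0 (t : R) : 0 <= t -> 0 <= Lq_norm Omega q (u t).
Proof. by move=> _; exact: Lq_norm_ge0. Qed.
Let x_ge0 (t : R) : 0 <= t -> 0 <= Xnorm Omega theta (u t).
Proof. by move=> _; exact: Xnorm_ge0. Qed.
Let sob (t : R) : 0 <= t -> Lq_norm Omega q (u t) <= C * Xnorm Omega theta (u t).
Proof. by move=> t0; apply: (Xmem_Lq_norm bO sobolev); exact: (energy_Xmem es t0). Qed.
Let n0_gt0 : 0 < Lq_norm Omega q (u 0).
Proof. rewrite initial_Lq_norm; exact: u0_Lq_norm_gt0. Qed.

Lemma energy_slow_decay : q < 2 ->
  (exists2 c, 0 < c & forall t : R, 0 <= t ->
     c * (t + 1) `^ (- (2 - q)^-1) <= Lq_norm Omega q (u t)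
       <= c^-1 * (t + 1) `^ (- (2 - q)^-1)) /\
  (exists2 c, 0 < c & forall t : R, 0 <= t ->
     c * (t + 1) `^ (- (2 - q)^-1) <= Xnorm Omega theta (u t)
       <= c^-1 * (t + 1) `^ (- (2 - q)^-1)).
Proof.
exact: (slow_decay_norms q1 admissible_constant_gt0 n_ge0 x_ge0 (energy_noninc q1 es)
  (dissipation q1 es) (sqrt_increment bO q1 es) sob n0_gt0).
Qed.

(** [C] is any admissible constant of the Sobolev-Poincare inequality; the
    extinction time is the end of positivity, hence does not depend on it. *)
Lemma energy_extinction : 2 < q -> exists T, [/\ 0 < T,
  forall t : R, 0 <= t -> (0 < Lq_norm Omega q (u t)) = (t < T),
  exists2 c, 0 < c & forall t : R, 0 <= t ->
    c * Num.max (T - t) 0 `^ (q - 2)^-1 <= Lq_norm Omega q (u t)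
      <= c^-1 * Num.max (T - t) 0 `^ (q - 2)^-1,
  exists2 c, 0 < c & forall t : R, 0 <= t ->
    c * Num.max (T - t) 0 `^ (q - 2)^-1 <= Xnorm Omega theta (u t)
      <= c^-1 * Num.max (T - t) 0 `^ (q - 2)^-1 &
  (q - 1) / (q - 2) * (Lq_norm Omega q u0 `^ q / Xnorm Omega theta u0 ^+ 2) <= T
    <= (q - 1) / (q - 2) * C ^+ 2 * Lq_norm Omega q u0 `^ (q - 2)].
Proof.
rewrite -initial_Lq_norm -initial_Xnorm.
exact: (extinction_norms q1 admissible_constant_gt0 n_ge0 x_ge0 (energy_noninc q1 es)
  (dissipation q1 es) (sqrt_increment bO q1 es) sob n0_gt0).
Qed.

End energy_decay.

Theorem corollary3p7 (R : realType) (d : nat) (Omega : set 'rV[R]_d)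
    (theta q : R) (u0 : 'rV[R]_d -> R) :
  (0 < d)%N ->
  bounded_domain Omega ->
  0 < theta <= 1 ->
  1 < q -> (q%:E <= critical_exponent d theta)%E ->
  Xmem Omega theta u0 ->
  ~ {ae lebesgue_rV R d, forall x, u0 x = 0} ->
  (q < 2 -> forall u, energy_solution Omega theta q u0 u ->
    (exists2 c1, 0 < c1 & forall t, 0 <= t ->
       c1 * (t + 1) `^ (- (2 - q)^-1) <= Lq_norm Omega q (u t)
         <= c1^-1 * (t + 1) `^ (- (2 - q)^-1)) /\
    (exists2 c1, 0 < c1 & forall t, 0 <= t ->
       c1 * (t + 1) `^ (- (2 - q)^-1) <= Xnorm Omega theta (u t)
         <= c1^-1 * (t + 1) `^ (- (2 - q)^-1))) /\
  (2 < q -> exists tstar,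
    [/\ 0 < tstar,
        forall u, energy_solution Omega theta q u0 u ->
          [/\ exists2 c2, 0 < c2 & forall t, 0 <= t ->
                c2 * Num.max (tstar - t) 0 `^ (q - 2)^-1
                  <= Lq_norm Omega q (u t)
                  <= c2^-1 * Num.max (tstar - t) 0 `^ (q - 2)^-1,
              exists2 c2, 0 < c2 & forall t, 0 <= t ->
                c2 * Num.max (tstar - t) 0 `^ (q - 2)^-1
                  <= Xnorm Omega theta (u t)
                  <= c2^-1 * Num.max (tstar - t) 0 `^ (q - 2)^-1 &
              forall s, 0 < s ->
                (exists2 c2, 0 < c2 & forall t, 0 <= t ->
                  c2 * Num.max (s - t) 0 `^ (q - 2)^-1
                    <= Lq_norm Omega q (u t)
                    <= c2^-1 * Num.max (s - t) 0 `^ (q - 2)^-1) ->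
                s = tstar] &
        (q - 1) / (q - 2) * (Lq_norm Omega q u0 `^ q
            / Xnorm Omega theta u0 ^+ 2) <= tstar
          <= (q - 1) / (q - 2) * sobolev_constant Omega theta q ^+ 2
             * Lq_norm Omega q u0 `^ (q - 2)]).
Proof.
move=> d0 bO /andP[th0 _] q1 qc Xu0 u0n0.
have [C C0 HC] := sobolev_poincare d0 bO th0 q1 qc.
split=> [q2 u es|q2].
  exact: (energy_slow_decay bO q1 Xu0 es u0n0 C0 HC q2).
have q20 : 0 < q - 2 by rewrite subr_gt0.
have q10 : 0 < q - 1 by rewrite subr_gt0.
have K0 : 0 < (q - 1) / (q - 2) by exact: divr_gt0.
(* Without an energy solution the lower bound serves as t_*. *)
have [[ub esb]|none] := pselect (exists u, energy_solution Omega theta q u0 u); last first.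
  pose n0 := Lq_norm Omega q u0; pose x0 := Xnorm Omega theta u0.
  have n00 : 0 < n0 := u0_Lq_norm_gt0 bO q1 Xu0 u0n0 HC.
  have Cp (C' : R) : 0 <= C' -> (forall w, Xmem Omega theta w -> (Lq_norme Omega q w <= (C' * Xnorm Omega theta w)%:E)%E) ->
      n0 ^+ 2 / x0 ^+ 2 <= C' ^+ 2 /\ 0 < x0.
    move=> C'0 HC'; have le := Xmem_Lq_norm bO HC' Xu0; rewrite -/n0 -/x0 in le.
    have C'p : 0 < C' := admissible_constant_gt0 bO q1 Xu0 u0n0 C'0 HC'.
    have x0p : 0 < x0 by rewrite -(pmulr_rgt0 _ C'p); exact: lt_le_trans le.
    split=> //; rewrite ler_pdivrMr ?exprn_gt0// -exprMn ler_sqr ?nnegrE ?(ltW n00)//.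
    by rewrite mulr_ge0// ltW.
  have [_ x0p] := Cp C C0 HC.
  exists ((q - 1) / (q - 2) * (n0 `^ q / x0 ^+ 2)); split.
  - by rewrite mulr_gt0// divr_gt0 ?powR_gt0 ?exprn_gt0.
  - by move=> u es; case: none; exists u.
  - rewrite lexx/= [leRHS]mulrAC.
    have nq : n0 `^ q = n0 `^ (q - 2) * n0 ^+ 2.
      rewrite -(powR_mulrn 2 (ltW n00)) -powRD; last by rewrite (gt_eqF n00) implybT.
      by congr powR; lra.
    rewrite nq -(mulrA (n0 `^ _)) mulrA.
    apply: sobolev_constant_upper; first by rewrite mulr_gt0// powR_gt0.
      by exists C.
    move=> C' C'0 HC'; rewrite ler_pM2l; last by rewrite mulr_gt0// powR_gt0.
    exact: (Cp C' C'0 HC').1.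
have [T [T0 Tpos _ _ /andP[Tlow _]]] := energy_extinction bO q1 Xu0 esb u0n0 C0 HC q2.
exists T; split=> // [u es|]; last first.
  rewrite Tlow/= [leRHS]mulrAC.
  have n00 := u0_Lq_norm_gt0 bO q1 Xu0 u0n0 HC.
  apply: sobolev_constant_upper; first by rewrite mulr_gt0// powR_gt0.
    by exists C.
  move=> C' C'0 HC'.
  have [T' [T'0 T'pos _ _ /andP[_ +]]] := energy_extinction bO q1 Xu0 esb u0n0 C'0 HC' q2.
  by rewrite (positivity_time_unique T0 T'0 Tpos T'pos) mulrAC.
have [T' [T'0 T'pos nb xb _]] := energy_extinction bO q1 Xu0 es u0n0 C0 HC q2.
have mO := domain_measurable bO.
have TT' : T = T'.
  apply: (positivity_time_unique T0 T'0 _ T'pos) => r r0; rewrite -Tpos//; congr (0 < _).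
  move: r0; rewrite le_eqVlt => /predU1P[<-|r0].
    by rewrite (initial_Lq_norm bO q1 Xu0 es) (initial_Lq_norm bO q1 Xu0 esb).
  rewrite /Lq_norm; congr fine; apply: Lq_norm_ae.
  - exact: (energy_solution_unique bO q1 C0 HC es esb r0).
  - exact: Lq_measurable (energy_Lq es (ltW r0)).
  - exact: Lq_measurable (energy_Lq esb (ltW r0)).
  - exact: lt_trans ltr01 q1.
rewrite TT'; split=> // s s0 [c c0 H].
apply: (positivity_time_unique s0 T'0 _ T'pos) => r r0; have /andP[h1 h2] := H r r0.
have [rs|sr] := ltP r s.
  by apply: lt_le_trans h1; rewrite mulr_gt0// powR_gt0// lt_max subr_gt0 rs.
apply/negbTE; rewrite -leNgt; apply: le_trans h2 _.
have -> : Num.max (s - r) 0 = 0 by apply/max_idPr; rewrite subr_le0.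
by rewrite powR0 ?invr_eq0 ?gt_eqF// mulr0.
Qed.
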